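(* Assume the Riemann Hypothesis. Let $k\ge2$ be an integer, $1/2<\sigma_0<1$, $2\gamma_1\le t_1\le50$, $2\gamma_1\le t_2\le50$, $x_0\ge4\exp(2e^2)$, $x\ge x_0^{k+1}$, and suppose $\alpha=\alpha(\sigma_0,t_1,x_0)<1$. Then \[ \left|Q_k(x)-\frac{x}{\zeta(k)}\right|\le\mathcal{N}_2\,x^{\frac{1/2+\alpha}{k+1}+\omega_{0,2}}\log^2x, \] where $\omega_{0,2}=\omega_2\left(t_2;\log\log\left(\frac{3ex_0}{2}\right)\right)$ and, with $\mathcal{N}_1=\mathcal{N}_1(\sigma_0,t_1,x_0)$ and $\Phi=\Phi(k/2,\alpha,x_0)$, \[ \mathcal{N}_2=\frac{\mathcal{N}_1\Phi}{\pi(k+1)}\left(\frac{3e}{2}\right)^{\omega_{0,2}}\left(1+\frac{1}{\log x_0}+\frac{0.57}{\sqrt{x_0}\log^2x_0}\right)+\frac{1}{x_0^{\omega_{0,2}}\log x_0}\left(\frac{\mathcal{N}_1}{k+1}\left(\frac{56e^{e^2}\Phi}{\pi}+\frac{1}{2x_0^{\frac{1}{2(k+1)}}}\right)+\frac{27.7}{x_0^{\frac{\alpha-1/2}{k+1}}}\right). \]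
   Context: $Q_k(x)$ is the number of $k$-free positive integers $\le x$ (not divisible by $p^k$ for any prime $p$). $\zeta$ is the Riemann zeta-function; RH asserts all its nontrivial zeros have real part $1/2$. $\gamma_1\approx14.1347$ is the positive ordinate of the first nontrivial zero. $\delta(t_0)=(1+1/t_0)^2$; $\lambda(t_0)=(t_0/2)\log\log(3t_0/2)$; with $\delta=\delta(t_0)$: $a_1(t_0)=\delta\left(\frac{117}{4}+3\delta+(3+\delta)\left(\frac{t_0}{e^{e^2}}+\frac{3+e}{e}\right)\right)$, $a_2(t_0)=\frac{\delta}{75}\left(\frac{t_0}{2\gamma_1}+1+\frac1e\right)$, $a_4(t_0)=\frac{4\delta}{5e}\left(3+\frac{\delta}{4}\right)$. For $a,b,c>0$ let $\mathcal{M}(a,b,c;t)=a+\frac{b}{(\log t)^c\log\log t}$, $\mathcal{M}_1(t)=\mathcal{M}(0.759282,20.1911,0.285;t)$, $\mathcal{M}_2(t)=\mathcal{M}(0.653,60.12,0.2705;t)$. Define $\widehat\phi_1(u)=0.96$ for $\log\log2\pi\le u<\log\log10^{2465}$ and $\widehat\phi_1(u)=1.719282-\mathcal{M}_1(10^{2465})+\frac{20.1911}{ue^{0.285u}}$ for $u\ge\log\log10^{2465}$; $\widehat\phi_2(u)=2.491$ for $\log\log2\pi\le u<\log\log10^{208}$ and $\widehat\phi_2(u)=3.144-\mathcal{M}_2(10^{208})+\frac{60.12}{ue^{0.2705u}}$ for $u\ge\log\log10^{208}$. Define $\omega(t_0;u)=\frac{a_1(t_0)\widehat\phi_2(u)}{\lambda(t_0)u}+\frac{a_2(t_0)u}{\lambda(t_0)e^u}+\frac{15.83}{e^u}+\frac{12\lambda(t_0)}{ue^{e^u}}\left(\frac{3\widehat\phi_1(u)}{2u}+\frac{3}{100e^{u+e^u}}\right)+\frac{a_4(t_0)\widehat\phi_2(u)}{u^2e^u}$,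 $\omega_1(\sigma,t_0;u)=2\left(\frac{\widehat\phi_1(u)}{u}+\frac{1}{50e^{u+e^u}}\right)\log\left(1+\frac{2\lambda(t_0)}{(\sigma-\frac12)u}\right)+\omega(t_0;u)$, $\omega_2(t_0;u)=\frac{\lambda(t_0)}{\pi u}+\omega(t_0;u)$, $\omega_{0,1}(\sigma_0,t_0,x_0)=\omega_1\left(\sigma_0,t_0;\log\log\left(\frac{3e\sqrt{x_0}}{2}\right)\right)$, $\alpha(\sigma_0,t_0,x_0)=\sigma_0+\frac12\omega_{0,1}(\sigma_0,t_0,x_0)$, $\mathcal{N}_1(\sigma_0,t_0,x_0)=\frac1\pi\left(\frac{3e}{2}\right)^{\omega_{0,1}}\left(\frac12+\frac{1}{\log x_0}+\frac{1.1-\sigma_0}{x_0^{\sigma_0-\frac12}\log x_0}\right)+\frac{1}{x_0^{\frac12\omega_{0,1}}}\left(\frac{8e^{e^2}}{\pi\sigma_0(\sigma_0-\frac12)\log x_0}+\frac{23.6}{x_0^{\sigma_0-\frac12}}\right)$ with $\omega_{0,1}=\omega_{0,1}(\sigma_0,t_0,x_0)$, and $\Phi(\sigma,\alpha,x_0)=1+\frac{\sigma}{\sigma-\alpha}\left(1+\frac{1}{(\sigma-\alpha)\log x_0}\right)$. *)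

(* Defs.v *)
From Stdlib Require Import Reals ZArith Znumtheory ClassicalDescription.
From Coquelicot Require Import Coquelicot.
Open Scope R_scope.

Definition zeta_nat (k : nat) : R := Series (fun n => / (INR (S n)) ^ k).

Definition npow_neg (n : nat) (sigma t : R) : C :=
  (exp (- sigma * ln (INR n)) * cos (t * ln (INR n)),
   - (exp (- sigma * ln (INR n)) * sin (t * ln (INR n)))).

(* Dirichlet eta function eta(s) = sum_{n>=1} (-1)^{n-1} n^{-s},
   convergent for Re s > 0 (summed componentwise). *)
Definition eta (sigma t : R) : C :=
  (Series (fun n => (-1) ^ n * fst (npow_neg (S n) sigma t)),
   Series (fun n => (-1) ^ n * snd (npow_neg (S n) sigma t))).

(* zeta(s) = eta(s) / (1 - 2^{1-s}): the analytic continuation of zeta to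
   Re s > 0, s <> 1 (used here only in the critical strip 0 < Re s < 1). *)
Definition zeta (sigma t : R) : C :=
  Cdiv (eta sigma t)
       (Cminus (RtoC 1)
          (exp ((1 - sigma) * ln 2) * cos (- t * ln 2),
           exp ((1 - sigma) * ln 2) * sin (- t * ln 2))).

Definition RH : Prop :=
  forall sigma t : R, 0 < sigma < 1 -> zeta sigma t = RtoC 0 -> sigma = 1 / 2.

Definition gamma1 : R :=
  real (Glb_Rbar (fun t => 0 < t /\
          exists sigma, 0 < sigma < 1 /\ zeta sigma t = RtoC 0)).

Definition k_free (k n : nat) : Prop :=
  forall p : Z, prime p -> ~ (Z.divide (p ^ Z.of_nat k) (Z.of_nat n))%Z.

Fixpoint count_kfree (k N : nat) (x : R) : nat :=
  match N with
  | O => O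
  | S m => (count_kfree k m x +
            (if excluded_middle_informative (k_free k N /\ (INR N <= x)%R)
             then 1 else 0))%nat
  end.

Definition Qk (k : nat) (x : R) : R :=
  INR (count_kfree k (Z.to_nat (up x)) x).

Definition e : R := exp 1.

Definition delta (t0 : R) : R := (1 + 1 / t0) ^ 2.
Definition lambda (t0 : R) : R := (t0 / 2) * ln (ln (3 * t0 / 2)).

Definition a1 (t0 : R) : R :=
  let d := delta t0 in
  d * (117 / 4 + 3 * d + (3 + d) * (t0 / exp (exp 2) + (3 + e) / e)).
Definition a2 (t0 : R) : R :=
  delta t0 / 75 * (t0 / (2 * gamma1) + 1 + 1 / e).
Definition a4 (t0 : R) : R :=
  4 * delta t0 / (5 * e) * (3 + delta t0 / 4).

Definition MM (a b c t : R) : R := a + b / (Rpower (ln t) c * ln (ln t)).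
Definition M1 (t : R) : R := MM 0.759282 20.1911 0.285 t.
Definition M2 (t : R) : R := MM 0.653 60.12 0.2705 t.

(* defined for u >= log log (2 pi); the value below that is irrelevant *)
Definition phi1 (u : R) : R :=
  if Rlt_dec u (ln (ln (10 ^ 2465))) then 0.96
  else 1.719282 - M1 (10 ^ 2465) + 20.1911 / (u * exp (0.285 * u)).
Definition phi2 (u : R) : R :=
  if Rlt_dec u (ln (ln (10 ^ 208))) then 2.491
  else 3.144 - M2 (10 ^ 208) + 60.12 / (u * exp (0.2705 * u)).

Definition omega (t0 u : R) : R :=
  a1 t0 * phi2 u / (lambda t0 * u)
  + a2 t0 * u / (lambda t0 * exp u)
  + 15.83 / exp u
  + 12 * lambda t0 / (u * exp (exp u))
      * (3 * phi1 u / (2 * u) + 3 / (100 * exp (u + exp u)))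
  + a4 t0 * phi2 u / (u ^ 2 * exp u).

Definition omega1 (sigma t0 u : R) : R :=
  2 * (phi1 u / u + 1 / (50 * exp (u + exp u)))
    * ln (1 + 2 * lambda t0 / ((sigma - 1 / 2) * u))
  + omega t0 u.

Definition omega2 (t0 u : R) : R := lambda t0 / (PI * u) + omega t0 u.

Definition omega01 (sigma0 t0 x0 : R) : R :=
  omega1 sigma0 t0 (ln (ln (3 * e * sqrt x0 / 2))).

Definition alpha (sigma0 t0 x0 : R) : R := sigma0 + 1 / 2 * omega01 sigma0 t0 x0.

Definition N1 (sigma0 t0 x0 : R) : R :=
  let w := omega01 sigma0 t0 x0 in
  1 / PI * Rpower (3 * e / 2) w
    * (1 / 2 + 1 / ln x0 + (1.1 - sigma0) / (Rpower x0 (sigma0 - 1 / 2) * ln x0))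
  + 1 / Rpower x0 (1 / 2 * w)
    * (8 * exp (exp 2) / (PI * sigma0 * (sigma0 - 1 / 2) * ln x0)
       + 23.6 / Rpower x0 (sigma0 - 1 / 2)).

Definition Phi (sigma a x0 : R) : R :=
  1 + sigma / (sigma - a) * (1 + 1 / ((sigma - a) * ln x0)).

Definition omega02 (t2 x0 : R) : R := omega2 t2 (ln (ln (3 * e * x0 / 2))).

Definition N2 (k : nat) (sigma0 t1 t2 x0 : R) : R :=
  let n1 := N1 sigma0 t1 x0 in
  let al := alpha sigma0 t1 x0 in
  let ph := Phi (INR k / 2) al x0 in
  let w := omega02 t2 x0 in
  let K := INR k + 1 in
  n1 * ph / (PI * K) * Rpower (3 * e / 2) w
    * (1 + 1 / ln x0 + 0.57 / (sqrt x0 * (ln x0) ^ 2))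
  + 1 / (Rpower x0 w * ln x0)
    * (n1 / K * (56 * exp (exp 2) * ph / PI
                 + 1 / (2 * Rpower x0 (1 / (2 * K))))
       + 27.7 / Rpower x0 ((al - 1 / 2) / K)).

(* Main.v *)
(* Write E for the error, v = log log x and u = log log (3 e x0 / 2) <= v. AM-GM between the terms of omega2 in lambda / u and
   1 / (lambda u) gives omega02 u >= 5, once gamma1 is bounded below (the constants degenerate if zeta has no zero; that one exists
   near 1/2 + 14.13 i follows from Euler-Maclaurin at N = 10 and the minimum modulus principle). If omega02 >= 1/(k(k+1)), the
   elementary bound |E| <= 9 x^(1/k) suffices. Otherwise u > 5k(k+1), and it is enough that |E| <= x^(1/(k+1) + 5/v) / (20(k+1)).
   For this, Harnack's inequality and three lines bound zeta'/zeta, hence zeta and 1/zeta, on Re s = 1/2 + 6/v; Perron's formula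
   with a ramp on the logarithmic scale then bounds the sums of mu(d) d^(-z) and of mu(d) floor(x / d^k) over d > x^(1/(k+1)).
   Holomorphy is iterated complex differentiability, and contours are moved by comparing vertical integrals. *)
Require Import Defs.
From Stdlib Require Import Reals Lra Lia Psatz Classical ClassicalDescription IndefiniteDescription ZArith.
From Coquelicot Require Import Coquelicot.
Open Scope R_scope.

(** The proof lives on slack. As [omega02] is at least 5/u, the claimed bound exceeds x^(1/(k+1)) by
    a factor x^(5/v), which beats every power of log x and every numerical factor met on the way;
    the refined constants of the statement therefore enter only through crude lower bounds. In units
    of log x / v the exponent spends 12/(k+1) <= 4 for the distance 6/v of the line to the critical
    line and 0.64 for the growth of zeta and 1/zeta on it; the remaining 0.36 pays for constants and
    logarithms. The abscissa of that line depends on x alone, whereas the integrals run over all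
    heights t. Hence logarithms are measured by log(|t| + x), and the kernel decays like 1/w^2: the
    cut-off height can be sent to infinity and no truncation error has to be balanced. The pole of
    zeta is removed from the outset by working with (s - 1) zeta(s), which is also tied to the
    alternating series of the statement. *)

Ltac le_trans := eapply Rle_trans.
Tactic Notation "via" uconstr(t) := le_trans; [apply t|].
Tactic Notation "upto" uconstr(t) := le_trans; [|apply t].

Lemma two_le_INR (k : nat) : (2 <= k)%nat -> 2 <= INR k.
Proof. intros H. apply le_INR in H. simpl in H. lra. Qed.

Ltac mono := apply Rmult_le_compat.
Ltac mono_l := apply Rmult_le_compat_l.
Ltac mono_r := apply Rmult_le_compat_r.

Ltac mul_pos := apply Rmult_le_pos.
Ltac pos := solve [try left; first [apply exp_pos | apply Rinv_0_lt_compat; auto; lra | apply Rdiv_lt_0_compat; lra | apply Rmult_lt_0_compat; lra] | apply Cmod_ge_0].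

(** * Complex numbers: parts and modulus *)

Lemma C_eq (a b : C) : Re a = Re b -> Im a = Im b -> a = b.
Proof. destruct a, b; simpl; intros -> ->; reflexivity. Qed.

Lemma Re_plus (a b : C) : Re (a + b)%C = Re a + Re b. Proof. reflexivity. Qed.
Lemma Im_plus (a b : C) : Im (a + b)%C = Im a + Im b. Proof. reflexivity. Qed.
Lemma Re_minus (a b : C) : Re (a - b)%C = Re a - Re b. Proof. reflexivity. Qed.
Lemma Im_minus (a b : C) : Im (a - b)%C = Im a - Im b. Proof. reflexivity. Qed.
Lemma Re_opp (a : C) : Re (- a)%C = - Re a. Proof. reflexivity. Qed.
Lemma Im_opp (a : C) : Im (- a)%C = - Im a. Proof. reflexivity. Qed.
Lemma Re_mult (a b : C) : Re (a * b)%C = Re a * Re b - Im a * Im b. Proof. reflexivity. Qed.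
Lemma Im_mult (a b : C) : Im (a * b)%C = Re a * Im b + Im a * Re b. Proof. reflexivity. Qed.
Lemma Re_RtoC (a : R) : Re (RtoC a) = a. Proof. reflexivity. Qed.
Lemma Im_RtoC (a : R) : Im (RtoC a) = 0. Proof. reflexivity. Qed.
Lemma Re_pair (a b : R) : Re (a, b) = a. Proof. reflexivity. Qed.
Lemma Im_pair (a b : R) : Im (a, b) = b. Proof. reflexivity. Qed.
Lemma Re_conj (a : C) : Re (Cconj a) = Re a. Proof. reflexivity. Qed.
Lemma Im_conj (a : C) : Im (Cconj a) = - Im a. Proof. reflexivity. Qed.
Ltac csimp := repeat progress rewrite ?Re_plus, ?Im_plus, ?Re_minus, ?Im_minus, ?Re_opp, ?Im_opp,
 ?Re_mult, ?Im_mult, ?Re_RtoC, ?Im_RtoC, ?Re_pair, ?Im_pair, ?Re_conj, ?Im_conj in *.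

Ltac toR := match goal with |- @eq _ ?a ?b => change (@eq R a b) end.

Lemma exp_le (x y : R) : x <= y -> exp x <= exp y.
Proof. intros [H| ->]. left; now apply exp_increasing. lra. Qed.

Lemma Cmod_sq (z : C) : Cmod z ^ 2 = Re z ^ 2 + Im z ^ 2.
Proof. apply Cmod2_alt. Qed.

Lemma Im_le_Cmod (z : C) : Rabs (Im z) <= Cmod z.
Proof.
 apply Rle_trans with (2 := Rmax_Cmod z). apply Rmax_r.
Qed.

Lemma Re_le_mod (z : C) : Re z <= Cmod z.
Proof. apply Rle_trans with (1 := Rle_abs _). apply re_le_Cmod. Qed.

Lemma Cmod_le_abs (z : C) : Cmod z <= Rabs (Re z) + Rabs (Im z).
Proof.
 replace z with (RtoC (Re z) + Ci * (Im z))%C at 1.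
 - via Cmod_triangle.
  rewrite Cmod_mult, !Cmod_R, Cmod_Ci. lra.
 - destruct z; apply C_eq; simpl; ring.
Qed.

Lemma Cmod_minus_sym (a b : C) : Cmod (a - b) = Cmod (b - a).
Proof. rewrite <- Cmod_opp. f_equal. ring. Qed.

Lemma Cmod_triangle_minus (a b : C) : Cmod (a - b) <= Cmod a + Cmod b.
Proof. via Cmod_triangle. rewrite Cmod_opp. lra. Qed.

Lemma Cmod_triangle_inv (a b : C) : Cmod a - Cmod b <= Cmod (a + b).
Proof.
 assert (H := Cmod_triangle_minus (a + b) b).
 replace (a + b - b)%C with a in H by ring. lra.
Qed.

Lemma Cmod_triangle_inv' (a b : C) : Cmod a - Cmod b <= Cmod (a - b).
Proof.
 assert (H := Cmod_triangle_inv a (- b)). rewrite Cmod_opp in H. exact H.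
Qed.

(** * Continuity and complex differentiability *)

Definition ccont (f : C -> C) (z : C) : Prop :=
 forall eps, 0 < eps -> exists d, 0 < d /\
  forall w, Cmod (w - z) < d -> Cmod (f w - f z) < eps.

Lemma ccont_const (c z : C) : ccont (fun _ => c) z.
Proof.
 intros eps He. exists 1. split. lra. intros w _.
 replace (c - c)%C with (RtoC 0) by ring. rewrite Cmod_0; lra.
Qed.

Lemma ccont_id (z : C) : ccont (fun w => w) z.
Proof. intros eps He. exists eps. split; auto. Qed.

Lemma ccont_plus (f g : C -> C) (z : C) :
 ccont f z -> ccont g z -> ccont (fun w => f w + g w)%C z.
Proof.
 intros Hf Hg eps He.
 destruct (Hf (eps / 2)) as [d1 [Hd1 H1]]. lra.
 destruct (Hg (eps / 2)) as [d2 [Hd2 H2]]. lra.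
 exists (Rmin d1 d2). split. apply Rmin_pos; auto. intros w Hw.
 replace (f w + g w - (f z + g z))%C with ((f w - f z) + (g w - g z))%C by ring.
 eapply Rle_lt_trans. apply Cmod_triangle.
 assert (Cmod (f w - f z) < eps / 2) by (apply H1; eapply Rlt_le_trans; [exact Hw | apply Rmin_l]).
 assert (Cmod (g w - g z) < eps / 2) by (apply H2; eapply Rlt_le_trans; [exact Hw | apply Rmin_r]).
 lra.
Qed.

Lemma ccont_mult (f g : C -> C) (z : C) :
 ccont f z -> ccont g z -> ccont (fun w => f w * g w)%C z.
Proof.
 intros Hf Hg eps He.
 set (M := 1 + Cmod (f z) + Cmod (g z)).
 assert (HM : 1 <= M) by (unfold M; pose proof (Cmod_ge_0 (f z)); pose proof (Cmod_ge_0 (g z)); lra).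
 assert (He2 : 0 < Rmin 1 (eps / (2 * M))).
 { apply Rmin_pos. lra. pos. }
 destruct (Hf _ He2) as [d1 [Hd1 H1]].
 destruct (Hg _ He2) as [d2 [Hd2 H2]].
 exists (Rmin d1 d2). split. apply Rmin_pos; auto. intros w Hw.
 assert (A : Cmod (f w - f z) < Rmin 1 (eps / (2 * M))) by (apply H1; eapply Rlt_le_trans; [exact Hw | apply Rmin_l]).
 assert (B : Cmod (g w - g z) < Rmin 1 (eps / (2 * M))) by (apply H2; eapply Rlt_le_trans; [exact Hw | apply Rmin_r]).
 replace (f w * g w - f z * g z)%C with ((f w - f z) * (g w - g z) + (f w - f z) * g z + f z * (g w - g z))%C by ring.
 set (a := (f w - f z)%C) in *. set (b := (g w - g z)%C) in *.
 assert (E : eps / (2 * M) * M = eps / 2) by (field; lra).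
 assert (Rmin 1 (eps / (2 * M)) <= 1) by apply Rmin_l.
 assert (Rmin 1 (eps / (2 * M)) <= eps / (2 * M)) by apply Rmin_r.
 set (r := eps / (2 * M)) in *.
 eapply Rle_lt_trans. apply Cmod_triangle. rewrite Cmod_mult.
 eapply Rle_lt_trans. apply Rplus_le_compat_r, Cmod_triangle. rewrite !Cmod_mult.
 pose proof (Cmod_ge_0 a). pose proof (Cmod_ge_0 b).
 pose proof (Cmod_ge_0 (f z)). pose proof (Cmod_ge_0 (g z)).
 assert (Cmod a * Cmod b <= r * 1) by (mono; lra).
 assert (Cmod a * Cmod (g z) <= r * Cmod (g z)) by (mono_r; lra).
 assert (Cmod (f z) * Cmod b <= Cmod (f z) * r) by (mono_l; lra).
 unfold M in E. nra.
Qed.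

Lemma ccont_comp (f g : C -> C) (z : C) :
 ccont g z -> ccont f (g z) -> ccont (fun w => f (g w)) z.
Proof.
 intros Hg Hf eps He.
 destruct (Hf eps He) as [d [Hd H]]. destruct (Hg d Hd) as [d' [Hd' H']].
 exists d'. split; auto.
Qed.

Lemma ccont_inv (f : C -> C) (z : C) :
 f z <> RtoC 0 -> ccont f z -> ccont (fun w => / f w)%C z.
Proof.
 intros Hz Hf eps He.
 assert (Hp : 0 < Cmod (f z)) by (apply Cmod_gt_0; auto).
 set (m := Cmod (f z)) in *.
 assert (He2 : 0 < Rmin (m / 2) (eps * (m * m / 2))).
 { apply Rmin_pos; [lra|]. apply Rmult_lt_0_compat; nra. }
 destruct (Hf _ He2) as [d [Hd H]]. exists d. split; auto. intros w Hw.
 specialize (H w Hw).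
 assert (A1 : Cmod (f w - f z) < m / 2) by (eapply Rlt_le_trans; [exact H | apply Rmin_l]).
 assert (A2 : Cmod (f w - f z) < eps * (m * m / 2)) by (eapply Rlt_le_trans; [exact H | apply Rmin_r]).
 assert (B : m / 2 < Cmod (f w)).
 { assert (T := Cmod_triangle_inv (f z) (f w - f z)).
  replace (f z + (f w - f z))%C with (f w) in T by ring. unfold m in *; lra. }
 assert (Hw0 : f w <> RtoC 0) by (apply Cmod_gt_0; lra).
 replace (/ f w - / f z)%C with (- (f w - f z) * (/ f w * / f z))%C by (field; auto).
 rewrite Cmod_mult, Cmod_opp, Cmod_mult, !Cmod_inv; auto. fold m.
 assert (P : 0 < / Cmod (f w) * / m) by (apply Rmult_lt_0_compat; pos).
 apply Rlt_le_trans with (eps * (m * m / 2) * (/ Cmod (f w) * / m)).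
 - apply Rmult_lt_compat_r; auto.
 - replace (eps * (m * m / 2) * (/ Cmod (f w) * / m)) with (eps * ((m / 2) * / Cmod (f w))) by (field; lra).
  rewrite <- (Rmult_1_r eps) at 2. mono_l. lra.
  apply Rmult_le_reg_r with (Cmod (f w)). lra. rewrite Rmult_assoc, Rinv_l; lra.
Qed.

Lemma ccont_ext_loc (f g : C -> C) (z : C) (r : R) :
 0 < r -> (forall w, Cmod (w - z) < r -> f w = g w) -> ccont f z -> ccont g z.
Proof.
 intros Hr E Hf eps He. destruct (Hf eps He) as [d [Hd H]].
 exists (Rmin d r). split. apply Rmin_pos; auto. intros w Hw.
 rewrite <- (E w), <- (E z).
 - apply H. eapply Rlt_le_trans; [exact Hw | apply Rmin_l].
 - replace (z - z)%C with (RtoC 0) by ring. now rewrite Cmod_0.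
 - eapply Rlt_le_trans; [exact Hw | apply Rmin_r].
Qed.

(* Caratheodory's form of the derivative: the difference quotient is a factor continuous at [z]. *)
Definition cdiff (f : C -> C) (z l : C) : Prop :=
 exists phi : C -> C, phi z = l /\ ccont phi z /\
  forall w, f w = (f z + phi w * (w - z))%C.

Lemma cdiff_ext (f g : C -> C) (z l : C) :
 (forall w, f w = g w) -> cdiff f z l -> cdiff g z l.
Proof.
 intros E [p [H1 [H2 H3]]]. exists p. repeat split; auto. intros w. rewrite <- !E. auto.
Qed.

Lemma cdiff_eq (f : C -> C) (z l l' : C) : l = l' -> cdiff f z l -> cdiff f z l'.
Proof. now intros ->. Qed.

Lemma cdiff_cont (f : C -> C) (z l : C) : cdiff f z l -> ccont f z.
Proof.
 intros [p [H1 [H2 H3]]].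
 apply ccont_ext_loc with (fun w => f z + p w * (w - z))%C 1. lra. intros; now rewrite <- H3.
 apply ccont_plus. apply ccont_const. apply ccont_mult; auto.
 apply ccont_plus. apply ccont_id. apply ccont_const.
Qed.

Lemma cdiff_of_eps (f : C -> C) (z l : C) :
 (forall eps, 0 < eps -> exists d, 0 < d /\ forall h, Cmod h < d ->
   Cmod (f (z + h)%C - f z - l * h) <= eps * Cmod h) -> cdiff f z l.
Proof.
 intros H.
 exists (fun w => if excluded_middle_informative (w = z) then l else (f w - f z) / (w - z))%C.
 split; [|split].
 - destruct (excluded_middle_informative (z = z)); tauto.
 - intros eps He. destruct (H (eps / 2)) as [d [Hd Hh]]. lra.
  exists d. split; auto. intros w Hw.
  destruct (excluded_middle_informative (z = z)) as [_|]; [|tauto].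
  destruct (excluded_middle_informative (w = z)) as [->|n].
  + replace (l - l)%C with (RtoC 0) by ring. rewrite Cmod_0; lra.
  + assert (Hn : (w - z)%C <> RtoC 0).
   { intros E. apply n. replace w with (w - z + z)%C by ring. rewrite E; ring. }
   assert (P : 0 < Cmod (w - z)) by (apply Cmod_gt_0; auto).
   specialize (Hh (w - z)%C Hw). replace (z + (w - z))%C with w in Hh by ring.
   replace ((f w - f z) / (w - z) - l)%C with ((f w - f z - l * (w - z)) * / (w - z))%C by (field; auto).
   rewrite Cmod_mult, Cmod_inv; auto.
   apply Rmult_lt_reg_r with (Cmod (w - z)); auto. rewrite Rmult_assoc, Rinv_l; nra.
 - intros w. destruct (excluded_middle_informative (w = z)) as [->|n]. ring.
  field. intros E. apply n. replace w with (w - z + z)%C by ring. rewrite E; ring.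
Qed.

Lemma cdiff_eps (f : C -> C) (z l : C) : cdiff f z l ->
 forall eps, 0 < eps -> exists d, 0 < d /\ forall h, Cmod h < d ->
   Cmod (f (z + h)%C - f z - l * h) <= eps * Cmod h.
Proof.
 intros [p [H1 [H2 H3]]] eps He. destruct (H2 eps He) as [d [Hd H]].
 exists d. split; auto. intros h Hh.
 specialize (H (z + h)%C). rewrite (H3 (z + h)%C).
 replace (z + h - z)%C with h in * by ring.
 replace (f z + p (z + h) * h - f z - l * h)%C with ((p (z + h) - l) * h)%C by ring.
 rewrite Cmod_mult. mono_r. pos.
 rewrite <- H1. left; auto.
Qed.

(** A remainder of second order with any finite constant is enough; for the exponential and for
    Dirichlet series such a bound is easier to get than an interchange of limits. *)
Lemma cdiff_of_quad (f : C -> C) (z l : C) (r K : R) :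
 0 < r -> (forall h, Cmod h < r -> Cmod (f (z + h)%C - f z - l * h) <= K * Cmod h ^ 2) -> cdiff f z l.
Proof.
 intros Hr H. apply cdiff_of_eps. intros eps He.
 exists (Rmin r (eps / (1 + Rabs K))).
 pose proof (Rabs_pos K). split.
 - apply Rmin_pos; auto. pos.
 - intros h Hh. via H. eapply Rlt_le_trans; [exact Hh|apply Rmin_l].
  assert (A : Cmod h < eps / (1 + Rabs K)) by (eapply Rlt_le_trans; [exact Hh|apply Rmin_r]).
  pose proof (Cmod_ge_0 h). pose proof (Rle_abs K).
  apply Rmult_lt_compat_r with (r := 1 + Rabs K) in A; [|lra].
  unfold Rdiv in A. rewrite Rmult_assoc, Rinv_l in A by lra.
  replace (K * Cmod h ^ 2) with ((Cmod h * K) * Cmod h) by ring.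
  mono_r; nra.
Qed.

Lemma cdiff_ext_loc (f g : C -> C) (z l : C) (r : R) :
 0 < r -> (forall w, Cmod (w - z) < r -> f w = g w) -> cdiff f z l -> cdiff g z l.
Proof.
 intros Hr E Hf. apply cdiff_of_eps. intros eps He.
 destruct (cdiff_eps _ _ _ Hf eps He) as [d [Hd H]].
 exists (Rmin d r). split. apply Rmin_pos; auto. intros h Hh.
 rewrite <- (E (z + h)%C), <- (E z).
 - apply H. eapply Rlt_le_trans; [exact Hh | apply Rmin_l].
 - replace (z - z)%C with (RtoC 0) by ring. now rewrite Cmod_0.
 - replace (z + h - z)%C with h by ring. eapply Rlt_le_trans; [exact Hh | apply Rmin_r].
Qed.

Lemma cdiff_const (c z : C) : cdiff (fun _ => c) z 0.
Proof. exists (fun _ => RtoC 0). repeat split. apply ccont_const. intros; ring. Qed.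

Lemma cdiff_id (z : C) : cdiff (fun w => w) z 1.
Proof. exists (fun _ => RtoC 1). repeat split. apply ccont_const. intros; ring. Qed.

Lemma cdiff_plus (f g : C -> C) (z a b : C) :
 cdiff f z a -> cdiff g z b -> cdiff (fun w => f w + g w)%C z (a + b)%C.
Proof.
 intros [p [H1 [H2 H3]]] [q [K1 [K2 K3]]]. exists (fun w => p w + q w)%C.
 split; [|split]. now rewrite H1, K1. now apply ccont_plus.
 intros w. rewrite (H3 w), (K3 w). ring.
Qed.

Lemma cdiff_mult (f g : C -> C) (z a b : C) :
 cdiff f z a -> cdiff g z b -> cdiff (fun w => f w * g w)%C z (a * g z + f z * b)%C.
Proof.
 intros Hf Hg. assert (Cg := cdiff_cont _ _ _ Hg).
 destruct Hf as [p [H1 [H2 H3]]]. destruct Hg as [q [K1 [K2 K3]]].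
 exists (fun w => p w * g w + f z * q w)%C.
 split; [|split]. now rewrite H1, K1.
 apply ccont_plus; apply ccont_mult; auto. apply ccont_const.
 intros w. rewrite (H3 w) at 1. replace (g w) with (g z + q w * (w - z))%C at 1 by (symmetry; auto).
 rewrite (K3 w). ring.
Qed.

Lemma cdiff_inv (f : C -> C) (z a : C) :
 f z <> RtoC 0 -> cdiff f z a -> cdiff (fun w => / f w)%C z (- a * (/ f z * / f z))%C.
Proof.
 intros Hz Hf. assert (Cf := cdiff_cont _ _ _ Hf).
 destruct (Cf (Cmod (f z))) as [d [Hd Hn]]. now apply Cmod_gt_0.
 destruct Hf as [p [H1 [H2 H3]]].
 apply cdiff_ext_loc with (fun w => / f z + (- p w * (/ f w * / f z)) * (w - z))%C d; auto.
 - intros w Hw. assert (f w <> RtoC 0).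
  { intros E. specialize (Hn w Hw). rewrite E in Hn.
   replace (0 - f z)%C with (- f z)%C in Hn by ring. rewrite Cmod_opp in Hn. lra. }
  assert (E := H3 w). replace (- p w * (/ f w * / f z) * (w - z))%C with (- (p w * (w - z)) * (/ f w * / f z))%C by ring.
  replace (p w * (w - z))%C with (f w - f z)%C by (rewrite E at 1; ring). field; auto.
 - exists (fun w => - p w * (/ f w * / f z))%C. split; [|split].
  + now rewrite H1.
  + apply ccont_mult. apply ccont_ext_loc with (fun w => (-1) * p w)%C 1. lra. intros; ring.
   apply ccont_mult; auto. apply ccont_const.
   apply ccont_mult. apply ccont_inv; auto. apply ccont_const.
  + intros w. ring.
Qed.

(** In Caratheodory's form the chain rule is a product of two continuous factors, so the case g w =
    g z needs no separate treatment. *)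
Lemma cdiff_comp (f g : C -> C) (z a b : C) :
 cdiff g z b -> cdiff f (g z) a -> cdiff (fun w => f (g w)) z (a * b)%C.
Proof.
 intros Hg Hf. assert (Cg := cdiff_cont _ _ _ Hg).
 destruct Hf as [p [H1 [H2 H3]]]. destruct Hg as [q [K1 [K2 K3]]].
 exists (fun w => p (g w) * q w)%C.
 split; [|split]. now rewrite H1, K1.
 apply ccont_mult; auto. apply ccont_comp; auto.
 intros w. rewrite (H3 (g w)). rewrite (K3 w) at 2. ring.
Qed.

Lemma cdiff_unique (f : C -> C) (z a b : C) : cdiff f z a -> cdiff f z b -> a = b.
Proof.
 intros Ha Hb.
 destruct (Req_dec (Cmod (a - b)) 0) as [E|E].
 { apply Cmod_eq_0 in E. replace a with (a - b + b)%C by ring. rewrite E; ring. }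
 exfalso. pose proof (Cmod_ge_0 (a - b)).
 set (m := Cmod (a - b)) in *.
 destruct (cdiff_eps _ _ _ Ha (m / 4)) as [d1 [Hd1 H1]]. lra.
 destruct (cdiff_eps _ _ _ Hb (m / 4)) as [d2 [Hd2 H2]]. lra.
 set (h := Rmin d1 d2 / 2).
 assert (Hm : 0 < Rmin d1 d2) by (apply Rmin_pos; auto).
 pose proof (Rmin_l d1 d2). pose proof (Rmin_r d1 d2).
 assert (Ch : Cmod (RtoC h) = h) by (rewrite Cmod_R, Rabs_pos_eq; unfold h; lra).
 specialize (H1 (RtoC h)). specialize (H2 (RtoC h)). rewrite Ch in *.
 assert (A1 := H1 ltac:(unfold h; lra)). assert (A2 := H2 ltac:(unfold h; lra)).
 assert (T : Cmod ((a - b) * RtoC h) <= m / 4 * h + m / 4 * h).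
 { replace ((a - b) * RtoC h)%C with ((f (z + RtoC h) - f z - b * RtoC h) - (f (z + RtoC h) - f z - a * RtoC h))%C by ring.
  via Cmod_triangle_minus. lra. }
 rewrite Cmod_mult, Ch in T. fold m in T. assert (0 < h) by (unfold h; lra). nra.
Qed.

(** The number of derivatives is a parameter, so that no theorem producing higher derivatives from
    the first one is required: the maximum principle consumes two, and closure properties go by
    induction. The set [U] may be closed, since [cdiff] already refers to a full complex
    neighbourhood of each point. *)
Fixpoint hol (n : nat) (U : C -> Prop) (f : C -> C) : Prop :=
 match n with
 | O => True
 | S m => exists f', (forall z, U z -> cdiff f z (f' z)) /\ hol m U f'
 end.

Lemma hol_S (n : nat) (U : C -> Prop) (f : C -> C) : hol (S n) U f -> hol n U f.
Proof.
 revert f. induction n as [|n IH]; intros f H. exact I.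
 destruct H as [f' [H1 H2]]. exists f'. split; auto.
Qed.

Lemma hol_sub (n : nat) (U V : C -> Prop) (f : C -> C) :
 (forall z, V z -> U z) -> hol n U f -> hol n V f.
Proof.
 intros HV. revert f. induction n as [|n IH]; intros f H. exact I.
 destruct H as [f' [H1 H2]]. exists f'. split; auto.
Qed.

Lemma hol_cont (n : nat) (U : C -> Prop) (f : C -> C) (z : C) :
 hol (S n) U f -> U z -> ccont f z.
Proof. intros [f' [H _]] Hz. eapply cdiff_cont. apply H, Hz. Qed.

Lemma hol_ext (n : nat) (U : C -> Prop) (f g : C -> C) :
 (forall w, f w = g w) -> hol n U f -> hol n U g.
Proof.
 destruct n as [|n]; intros E H. exact I.
 destruct H as [f' [H1 H2]]. exists f'. split; auto. intros. eapply cdiff_ext; eauto.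
Qed.

Lemma hol_const (n : nat) (U : C -> Prop) (c : C) : hol n U (fun _ => c).
Proof.
 revert c. induction n as [|n IH]; intros c. exact I.
 exists (fun _ => RtoC 0). split. intros; apply cdiff_const. apply IH.
Qed.

Lemma hol_id (n : nat) (U : C -> Prop) : hol n U (fun w => w).
Proof.
 destruct n as [|n]. exact I.
 exists (fun _ => RtoC 1). split. intros; apply cdiff_id. apply hol_const.
Qed.

Lemma hol_plus (n : nat) (U : C -> Prop) (f g : C -> C) :
 hol n U f -> hol n U g -> hol n U (fun w => f w + g w)%C.
Proof.
 revert f g. induction n as [|n IH]; intros f g Hf Hg. exact I.
 destruct Hf as [f' [H1 H2]]. destruct Hg as [g' [K1 K2]].
 exists (fun w => f' w + g' w)%C. split. intros; apply cdiff_plus; auto. apply IH; auto.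
Qed.

Lemma hol_mult (n : nat) (U : C -> Prop) (f g : C -> C) :
 hol n U f -> hol n U g -> hol n U (fun w => f w * g w)%C.
Proof.
 revert f g. induction n as [|n IH]; intros f g Hf Hg. exact I.
 pose proof (hol_S _ _ _ Hf). pose proof (hol_S _ _ _ Hg).
 destruct Hf as [f' [H1 H2]]. destruct Hg as [g' [K1 K2]].
 exists (fun w => f' w * g w + f w * g' w)%C. split. intros; apply cdiff_mult; auto.
 apply hol_plus; apply IH; auto.
Qed.

Lemma hol_opp (n : nat) (U : C -> Prop) (f : C -> C) :
 hol n U f -> hol n U (fun w => - f w)%C.
Proof.
 intros H. apply hol_ext with (fun w => (-1) * f w)%C. intros; ring.
 apply hol_mult; auto. apply hol_const.
Qed.

Lemma hol_minus (n : nat) (U : C -> Prop) (f g : C -> C) :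
 hol n U f -> hol n U g -> hol n U (fun w => f w - g w)%C.
Proof. intros Hf Hg. apply hol_plus; auto. apply hol_opp; auto. Qed.

Lemma hol_inv (n : nat) (U : C -> Prop) (f : C -> C) :
 (forall z, U z -> f z <> RtoC 0) -> hol n U f -> hol n U (fun w => / f w)%C.
Proof.
 intros Hn. revert f Hn. induction n as [|n IH]; intros f Hn Hf. exact I.
 pose proof (hol_S _ _ _ Hf).
 destruct Hf as [f' [H1 H2]].
 exists (fun w => - f' w * (/ f w * / f w))%C. split. intros; apply cdiff_inv; auto.
 apply hol_mult. apply hol_opp; auto. apply hol_mult; apply IH; auto.
Qed.

Lemma hol_div (n : nat) (U : C -> Prop) (f g : C -> C) :
 (forall z, U z -> g z <> RtoC 0) -> hol n U f -> hol n U g -> hol n U (fun w => f w / g w)%C.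
Proof. intros Hn Hf Hg. apply hol_mult; auto. apply hol_inv; auto. Qed.

Lemma hol_comp (n : nat) (U V : C -> Prop) (f g : C -> C) :
 (forall z, V z -> U (g z)) -> hol n U f -> hol n V g -> hol n V (fun w => f (g w)).
Proof.
 intros HV. revert f g HV. induction n as [|n IH]; intros f g HV Hf Hg. exact I.
 pose proof (hol_S _ _ _ Hg).
 destruct Hf as [f' [H1 H2]]. destruct Hg as [g' [K1 K2]].
 exists (fun w => f' (g w) * g' w)%C. split. intros; apply cdiff_comp; auto.
 apply hol_mult; auto.
Qed.

(** * Derivatives along a real parameter and the mean value inequality *)

Definition rder (F : R -> C) (t : R) (l : C) : Prop :=
 is_derive (fun s => Re (F s)) t (Re l) /\ is_derive (fun s => Im (F s)) t (Im l).

Lemma is_derive_of_eps (f : R -> R) (x l : R) :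
 (forall eps, 0 < eps -> exists d, 0 < d /\ forall h, Rabs h < d ->
   Rabs (f (x + h) - f x - l * h) <= eps * Rabs h) -> is_derive f x l.
Proof.
 intros H. apply is_derive_Reals. intros eps He.
 destruct (H (eps / 2)) as [d [Hd Hh]]. lra.
 exists (mkposreal d Hd). intros h Hn Hl. simpl in Hl. specialize (Hh h Hl).
 assert (0 < Rabs h) by (apply Rabs_pos_lt; auto).
 replace ((f (x + h) - f x) / h - l) with ((f (x + h) - f x - l * h) / h) by (field; auto).
 unfold Rdiv. rewrite Rabs_mult, Rabs_inv.
 apply Rmult_lt_reg_r with (Rabs h); auto. rewrite Rmult_assoc, Rinv_l; nra.
Qed.

Lemma cdiff_line (f : C -> C) (z d l : C) (t : R) :
 cdiff f (z + RtoC t * d)%C l -> rder (fun s => f (z + RtoC s * d)%C) t (l * d)%C.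
Proof.
 intros Hf.
 assert (Hd0 : 0 <= Cmod d) by pos.
 assert (K : forall eps, 0 < eps -> exists del, 0 < del /\ forall h, Rabs h < del ->
   Cmod (f (z + RtoC (t + h) * d)%C - f (z + RtoC t * d)%C - (l * d) * RtoC h) <= eps * Rabs h).
 { intros eps He.
  destruct (cdiff_eps _ _ _ Hf (eps / (1 + Cmod d))) as [del [Hdel H]].
  { pos. }
  exists (del / (1 + Cmod d)). split. pos.
  intros h Hh. assert (A : Rabs h * (1 + Cmod d) < del).
  { apply Rmult_lt_compat_r with (r := 1 + Cmod d) in Hh; [|lra].
   unfold Rdiv in Hh. rewrite Rmult_assoc, Rinv_l in Hh; lra. }
  pose proof (Rabs_pos h).
  specialize (H (RtoC h * d)%C). rewrite Cmod_mult, Cmod_R in H.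
  replace (z + RtoC (t + h) * d)%C with (z + RtoC t * d + RtoC h * d)%C by (rewrite RtoC_plus; ring).
  replace (l * d * RtoC h)%C with (l * (RtoC h * d))%C by ring.
  via H. nra.
  assert (0 < eps / (1 + Cmod d)) by pos.
  replace (eps * Rabs h) with (eps / (1 + Cmod d) * (Rabs h * (1 + Cmod d))) by (field; lra).
  mono_l; nra. }
 split; apply is_derive_of_eps; intros eps He; destruct (K eps He) as [del [Hdel H]];
  exists del; split; auto; intros h Hh; specialize (H h Hh); (le_trans; [| exact H]).
 - le_trans; [|apply re_le_Cmod]. apply Req_le. f_equal.
  rewrite !Re_minus. rewrite (Re_mult (l * d)), Re_RtoC, Im_RtoC. ring.
 - le_trans; [|apply Im_le_Cmod]. apply Req_le. f_equal.
  rewrite !Im_minus. rewrite (Im_mult (l * d)), Re_RtoC, Im_RtoC. ring.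
Qed.

Lemma is_derive_lin2 (u v : R -> R) (t a b p q : R) :
 is_derive u t a -> is_derive v t b -> is_derive (fun s => p * u s + q * v s) t (p * a + q * b).
Proof.
 intros Hu Hv. apply (is_derive_plus (V := R_NormedModule)); now apply (is_derive_scal).
Qed.

(** The real mean value theorem is applied to the projection of F on the direction of the total
    increment Z; projecting, rather than treating the two components separately, keeps the constant
    sharp. *)
Lemma mean_value_C (F F' : R -> C) (a b M : R) :
 a <= b -> (forall t, a <= t <= b -> rder F t (F' t)) ->
 (forall t, a <= t <= b -> Cmod (F' t) <= M) -> Cmod (F b - F a) <= M * (b - a).
Proof.
 intros Hab HF HM. set (Z := (F b - F a)%C).
 destruct (Req_dec (Cmod Z) 0) as [E|E].
 { rewrite E. mul_pos; [|lra]. apply Rle_trans with (Cmod (F' a)). pos. apply HM; lra. }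
 assert (HZ : 0 < Cmod Z) by (pose proof (Cmod_ge_0 Z); lra).
 destruct (MVT_gen (fun s => Re Z * Re (F s) + Im Z * Im (F s)) a b
   (fun s => Re Z * Re (F' s) + Im Z * Im (F' s))) as [c [Hc E2]].
 - intros x Hx. rewrite Rmin_left, Rmax_right in Hx by lra.
  destruct (HF x) as [H1 H2]. lra. apply is_derive_lin2; auto.
 - intros x Hx. rewrite Rmin_left, Rmax_right in Hx by lra.
  destruct (HF x) as [H1 H2]. lra.
  apply derivable_continuous_pt. exists (Re Z * Re (F' x) + Im Z * Im (F' x)).
  apply is_derive_Reals. apply is_derive_lin2; auto.
 - rewrite Rmin_left, Rmax_right in Hc by lra.
  assert (B : Re Z * Re (F' c) + Im Z * Im (F' c) <= Cmod Z * M).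
  { replace (Re Z * Re (F' c) + Im Z * Im (F' c)) with (Re (Cconj Z * F' c)%C) by (csimp; ring).
   via Re_le_mod. rewrite Cmod_mult, Cmod_conj.
   mono_l. lra. apply HM; lra. }
  assert (S : Cmod Z ^ 2 = Re Z * Re (F b) + Im Z * Im (F b) - (Re Z * Re (F a) + Im Z * Im (F a))).
  { rewrite Cmod_sq. unfold Z. csimp. ring. }
  rewrite E2 in S. apply Rmult_le_reg_l with (Cmod Z); auto. 
  replace (Cmod Z * Cmod Z) with (Cmod Z ^ 2) by ring. rewrite S.
  rewrite <- Rmult_assoc. mono_r; lra.
Qed.

(** * The complex exponential *)

Definition cexp (z : C) : C := (exp (Re z) * cos (Im z), exp (Re z) * sin (Im z)).

Lemma cexp_plus (a b : C) : cexp (a + b) = (cexp a * cexp b)%C.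
Proof.
 unfold cexp. rewrite Re_plus, Im_plus, exp_plus, cos_plus, sin_plus.
 apply C_eq; csimp; ring.
Qed.

Lemma cexp_0 : cexp 0 = 1%C.
Proof. unfold cexp; simpl. rewrite exp_0, cos_0, sin_0. apply C_eq; simpl; ring. Qed.

Lemma Cmod_cexp (z : C) : Cmod (cexp z) = exp (Re z).
Proof.
 assert (H := Cmod_sq (cexp z)). unfold cexp in H at 2 3. csimp.
 assert (E : Cmod (cexp z) ^ 2 = exp (Re z) ^ 2).
 { rewrite H. assert (T := sin2_cos2 (Im z)). unfold Rsqr in T.
  transitivity (exp (Re z) ^ 2 * (sin (Im z) * sin (Im z) + cos (Im z) * cos (Im z))). ring. rewrite T; ring. }
 pose proof (exp_pos (Re z)). pose proof (Cmod_ge_0 (cexp z)).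
 assert (F : (Cmod (cexp z) - exp (Re z)) * (Cmod (cexp z) + exp (Re z)) = 0).
 { transitivity (Cmod (cexp z) ^ 2 - exp (Re z) ^ 2). ring. rewrite E; ring. }
 apply Rmult_integral in F. lra.
Qed.

Lemma cexp_neq_0 (z : C) : cexp z <> RtoC 0.
Proof. apply Cmod_gt_0. rewrite Cmod_cexp. pos. Qed.

Lemma cexp_opp (z : C) : cexp (- z) = (/ cexp z)%C.
Proof.
 assert (H : (cexp (- z) * cexp z)%C = 1%C).
 { rewrite <- cexp_plus, <- cexp_0. f_equal. ring. }
 pose proof (cexp_neq_0 z).
 transitivity (cexp (- z) * cexp z * / cexp z)%C. field; auto. rewrite H. ring.
Qed.

Lemma cexp_R (x : R) : cexp (RtoC x) = RtoC (exp x).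
Proof. unfold cexp. simpl. rewrite cos_0, sin_0. apply C_eq; simpl; ring. Qed.

Lemma cexp_conj (z : C) : cexp (Cconj z) = Cconj (cexp z).
Proof.
 unfold cexp. apply C_eq; csimp. now rewrite cos_neg. rewrite sin_neg. ring.
Qed.

Lemma rder_cexp_line (h : C) (t : R) : rder (fun s => cexp (RtoC s * h)) t (h * cexp (RtoC t * h))%C.
Proof.
 unfold cexp, rder. csimp.
 split.
 - apply is_derive_ext with (fun s => exp (s * Re h) * cos (s * Im h)).
  { intros s. csimp. f_equal; f_equal; ring. }
  auto_derive; auto. csimp. rewrite !Rmult_0_l, Rminus_0_r, Rplus_0_r. ring.
 - apply is_derive_ext with (fun s => exp (s * Re h) * sin (s * Im h)).
  { intros s. csimp. f_equal; f_equal; ring. }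
  auto_derive; auto. csimp. rewrite !Rmult_0_l, Rminus_0_r, Rplus_0_r. ring.
Qed.

(** Mean value inequality along the segment from 0 to h, where the modulus of the exponential is at
    most exp |h|. The second-order bound below repeats this with the present bound as input. *)
Lemma cexp_bound1 (h : C) : Cmod (cexp h - 1) <= Cmod h * exp (Cmod h).
Proof.
 assert (H := mean_value_C (fun s => cexp (RtoC s * h)) (fun s => h * cexp (RtoC s * h))%C 0 1 (Cmod h * exp (Cmod h))).
 cbv beta in H. replace (RtoC 1 * h)%C with h in H by ring. replace (RtoC 0 * h)%C with (RtoC 0) in H by ring.
 rewrite cexp_0, Rminus_0_r, Rmult_1_r in H. apply H. lra.
 - intros; apply rder_cexp_line.
 - intros t Ht. rewrite Cmod_mult, Cmod_cexp. mono_l. pos.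
  apply exp_le. csimp. pose proof (Re_le_mod h). pose proof (Cmod_ge_0 h).
  destruct (Rle_dec 0 (Re h)); nra.
Qed.

Lemma cexp_bound2 (h : C) : Cmod (cexp h - 1 - h) <= Cmod h ^ 2 * exp (Cmod h).
Proof.
 assert (H := mean_value_C (fun s => cexp (RtoC s * h) - RtoC s * h)%C (fun s => h * (cexp (RtoC s * h) - 1))%C 0 1
  (Cmod h ^ 2 * exp (Cmod h))).
 cbv beta in H.
 replace (cexp (RtoC 1 * h) - RtoC 1 * h - (cexp (RtoC 0 * h) - RtoC 0 * h))%C with (cexp h - 1 - h)%C in H.
 2:{ replace (RtoC 1 * h)%C with h by ring. replace (RtoC 0 * h)%C with (RtoC 0) by ring. rewrite cexp_0. ring. }
 rewrite Rminus_0_r, Rmult_1_r in H. apply H. lra.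
 - intros t Ht. destruct (rder_cexp_line h t) as [A B]. split.
  + apply is_derive_ext with (fun s => Re (cexp (RtoC s * h)) + (-1) * (s * Re h)).
   { intros s; csimp. toR. ring. }
   replace (Re (h * (cexp (RtoC t * h) - 1))%C) with (Re (h * cexp (RtoC t * h))%C + (-1) * Re h) by (csimp; ring).
   apply (is_derive_plus (V := R_NormedModule)); auto. apply is_derive_scal.
   auto_derive; [exact I | ring].
  + apply is_derive_ext with (fun s => Im (cexp (RtoC s * h)) + (-1) * (s * Im h)).
   { intros s; csimp. toR. ring. }
   replace (Im (h * (cexp (RtoC t * h) - 1))%C) with (Im (h * cexp (RtoC t * h))%C + (-1) * Im h) by (csimp; ring).
   apply (is_derive_plus (V := R_NormedModule)); auto. apply is_derive_scal.
   auto_derive; [exact I | ring].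
 - intros t Ht. rewrite Cmod_mult. pose proof (Cmod_ge_0 h).
  apply Rle_trans with (Cmod h * (Cmod h * exp (Cmod h))); [|right; ring].
  mono_l; auto. via cexp_bound1.
  rewrite Cmod_mult, Cmod_R, Rabs_pos_eq by lra.
  assert (t * Cmod h <= Cmod h) by nra.
  mono; auto. nra. pos. apply exp_le; lra.
Qed.

Lemma cdiff_cexp (z : C) : cdiff cexp z (cexp z).
Proof.
 apply cdiff_of_quad with 1 (Cmod (cexp z) * exp 1). lra. intros h Hh.
 rewrite cexp_plus. replace (cexp z * cexp h - cexp z - cexp z * h)%C with (cexp z * (cexp h - 1 - h))%C by ring.
 rewrite Cmod_mult, Rmult_assoc. mono_l. pos.
 via cexp_bound2. rewrite Rmult_comm. mono_r.
 apply pow_le, Cmod_ge_0. apply exp_le; lra.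
Qed.

Lemma hol_cexp (n : nat) (U : C -> Prop) : hol n U cexp.
Proof.
 induction n as [|n IH]. exact I. exists cexp. split; auto. intros; apply cdiff_cexp.
Qed.

Lemma hol_exp_comp (n : nat) (U : C -> Prop) (g : C -> C) :
 hol n U g -> hol n U (fun w => cexp (g w)).
Proof.
 intros H. apply hol_comp with (fun _ => True) ; auto. apply hol_cexp.
Qed.

(** * The maximum principle on rectangles *)

(** No critical point is assumed: if f'(0) >= 0 then f' > 0 just to the right of 0, and if f'(0) < 0
    then f' < 0 just to the left, so f exceeds f(0) on one side. *)
Lemma second_derivative_test (f f' : R -> R) (r c : R) :
 0 < r -> (forall s, Rabs s < r -> is_derive f s (f' s)) -> is_derive f' 0 c -> 0 < c ->
 ~ (forall s, Rabs s < r -> f s <= f 0).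
Proof.
 intros Hr Hf Hf' Hc Hm.
 apply is_derive_Reals in Hf'. destruct (Hf' (c / 2)) as [[d Hd] H]. lra. simpl in H.
 set (m := Rmin d r / 2).
 assert (P : 0 < Rmin d r) by (apply Rmin_pos; auto).
 pose proof (Rmin_l d r). pose proof (Rmin_r d r).
 assert (Q : forall s, s <> 0 -> Rabs s <= m -> Rabs (f' s - f' 0 - c * s) <= c / 2 * Rabs s).
 { intros s Hs Hsm. specialize (H s Hs). rewrite Rplus_0_l in H.
  assert (Rabs s < d) by (unfold m in *; lra). specialize (H H2).
  assert (0 < Rabs s) by (apply Rabs_pos_lt; auto).
  replace (f' s - f' 0 - c * s) with (((f' s - f' 0) / s - c) * s) by (field; auto).
  rewrite Rabs_mult. mono_r; lra. }
 assert (Hd' : forall x, Rabs x <= m -> is_derive f x (f' x)) by (intros; apply Hf; unfold m in *; lra).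
 destruct (Rle_dec 0 (f' 0)) as [C|C].
 - destruct (MVT_gen f 0 m f') as [y [Hy E]].
  + intros x Hx. rewrite Rmin_left, Rmax_right in Hx by (unfold m; lra). apply Hd'. rewrite Rabs_pos_eq; lra.
  + intros x Hx. rewrite Rmin_left, Rmax_right in Hx by (unfold m; lra).
   apply derivable_continuous_pt. exists (f' x). apply is_derive_Reals, Hd'. rewrite Rabs_pos_eq; lra.
  + rewrite Rmin_left, Rmax_right in Hy by (unfold m; lra).
   assert (f' y <= 0).
   { assert (f m <= f 0) by (apply Hm; rewrite Rabs_pos_eq; unfold m; lra).
    apply Rnot_lt_le. intros K. assert (0 < f' y * (m - 0)) by (apply Rmult_lt_0_compat; unfold m; lra). lra. }
   (* The mean value point lies in the closed interval, so it may be 0. Then f'(0) = 0 and f m = f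
      0, and splitting the interval at m/2 gives f m > f (m/2) >= f 0. *)
   destruct (Req_dec y 0) as [->|Hn].
   * assert (E0 : f' 0 = 0) by lra.
    assert (f m = f 0) by (rewrite E0 in E; lra).
    destruct (MVT_gen f (m / 2) m f') as [z [Hz E']].
    -- intros x Hx. rewrite Rmin_left, Rmax_right in Hx by (unfold m; lra). apply Hd'. rewrite Rabs_pos_eq; unfold m in *; lra.
    -- intros x Hx. rewrite Rmin_left, Rmax_right in Hx by (unfold m; lra).
      apply derivable_continuous_pt. exists (f' x). apply is_derive_Reals, Hd'. rewrite Rabs_pos_eq; unfold m in *; lra.
    -- rewrite Rmin_left, Rmax_right in Hz by (unfold m; lra).
      assert (Hz0 : 0 < z) by (unfold m in *; lra).
      assert (Qz := Q z ltac:(lra) ltac:(rewrite Rabs_pos_eq; lra)).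
      rewrite (Rabs_pos_eq z) in Qz by lra. apply Rabs_le_between in Qz.
      assert (0 < f' z) by nra.
      destruct (MVT_gen f 0 (m / 2) f') as [w [Hw Ew]].
      ++ intros x Hx. rewrite Rmin_left, Rmax_right in Hx by (unfold m; lra). apply Hd'. rewrite Rabs_pos_eq; unfold m in *; lra.
      ++ intros x Hx. rewrite Rmin_left, Rmax_right in Hx by (unfold m; lra).
       apply derivable_continuous_pt. exists (f' x). apply is_derive_Reals, Hd'. rewrite Rabs_pos_eq; unfold m in *; lra.
      ++ rewrite Rmin_left, Rmax_right in Hw by (unfold m; lra).
       assert (0 <= f' w).
       { destruct (Req_dec w 0) as [->|Hw0]. lra.
        assert (Qw := Q w Hw0 ltac:(rewrite Rabs_pos_eq; unfold m in *; lra)).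
        rewrite (Rabs_pos_eq w) in Qw by lra. apply Rabs_le_between in Qw. nra. }
       assert (0 <= f' w * (m / 2 - 0)) by (mul_pos; unfold m; lra).
       assert (0 < f' z * (m - m / 2)) by (apply Rmult_lt_0_compat; unfold m; lra). lra.
   * assert (Qy := Q y Hn ltac:(rewrite Rabs_pos_eq; lra)).
    rewrite (Rabs_pos_eq y) in Qy by lra. apply Rabs_le_between in Qy. nra.
 - destruct (MVT_gen f (-m) 0 f') as [y [Hy E]].
  + intros x Hx. rewrite Rmin_left, Rmax_right in Hx by (unfold m; lra). apply Hd'. rewrite Rabs_left; lra.
  + intros x Hx. rewrite Rmin_left, Rmax_right in Hx by (unfold m; lra).
   apply derivable_continuous_pt. exists (f' x). apply is_derive_Reals, Hd'. rewrite Rabs_left1; lra.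
  + rewrite Rmin_left, Rmax_right in Hy by (unfold m; lra).
   assert (f (-m) <= f 0) by (apply Hm; rewrite Rabs_left; unfold m; lra).
   assert (f' y < 0).
   { destruct (Req_dec y 0) as [->|Hn]. lra.
    assert (Qy := Q y Hn ltac:(rewrite Rabs_left1; lra)).
    rewrite (Rabs_left1 y) in Qy by lra. apply Rabs_le_between in Qy. nra. }
   assert (0 < - f' y * (0 - - m)) by (apply Rmult_lt_0_compat; unfold m; lra). lra.
Qed.

Lemma is_derive_sqmod (u v : R -> R) (t u' v' : R) :
 is_derive u t u' -> is_derive v t v' ->
 is_derive (fun s => u s ^ 2 + v s ^ 2) t (2 * (u t * u' + v t * v')).
Proof.
 intros Hu Hv.
 replace (2 * (u t * u' + v t * v')) with (2 * u' * u t ^ 1 + 2 * v' * v t ^ 1) by ring.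
 apply (is_derive_plus (V := R_NormedModule)).
 - replace 2 with (INR 2) at 1 by (simpl; ring). apply (is_derive_pow u 2 t u' Hu).
 - replace 2 with (INR 2) at 1 by (simpl; ring). apply (is_derive_pow v 2 t v' Hv).
Qed.

(** Strict subharmonicity. The second derivative in the direction d contains Re (conj G G'' d^2),
    which changes sign between d = 1 and d = i; adding the two directions leaves 4 |G'|^2 + 2 eta >
    0, while at a maximum neither can be positive. *)
Lemma no_interior_max (U : C -> Prop) (G : C -> C) (z0 : C) (r eta : R) :
 hol 2 U G -> 0 < r -> (forall w, Cmod (w - z0) < r -> U w) -> 0 < eta ->
 ~ (forall w, Cmod (w - z0) < r -> Cmod (G w) ^ 2 + eta * Re w ^ 2 <= Cmod (G z0) ^ 2 + eta * Re z0 ^ 2).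
Proof.
 intros [G1 [H1 [G2 [H2 _]]]] Hr HU He Hm.
 assert (HU0 : U z0) by (apply HU; replace (z0 - z0)%C with (RtoC 0) by ring; now rewrite Cmod_0).
 assert (line : forall d : C, Cmod d = 1 -> forall s, Rabs s < r -> Cmod (z0 + RtoC s * d - z0)%C < r).
 { intros d Hd s Hs. replace (z0 + RtoC s * d - z0)%C with (RtoC s * d)%C by ring.
  rewrite Cmod_mult, Cmod_R, Hd. lra. }
 assert (key : forall d : C, Cmod d = 1 ->
  2 * (Cmod (G1 z0 * d) ^ 2 + Re (Cconj (G z0) * (G2 z0 * d * d))%C) + 2 * eta * Re d ^ 2 <= 0).
 { intros d Hd. apply Rnot_lt_le. intros Hpos.
  apply (second_derivative_test
   (fun s => (Re (G (z0 + RtoC s * d)%C) ^ 2 + Im (G (z0 + RtoC s * d)%C) ^ 2) + eta * (Re z0 + s * Re d) ^ 2)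
   (fun s => 2 * (Re (G (z0 + RtoC s * d)%C) * Re (G1 (z0 + RtoC s * d) * d)%C
          + Im (G (z0 + RtoC s * d)%C) * Im (G1 (z0 + RtoC s * d) * d)%C)
        + 2 * eta * (Re z0 + s * Re d) * Re d) r _ Hr) with (3 := Hpos).
  - intros s Hs. destruct (cdiff_line G z0 d (G1 (z0 + RtoC s * d)%C) s) as [A B].
   apply H1, HU, line; auto.
   apply (is_derive_plus (V := R_NormedModule)). apply is_derive_sqmod; auto.
   auto_derive; [exact I|ring].
  - destruct (cdiff_line G z0 d (G1 (z0 + RtoC 0 * d)%C) 0) as [A B].
   { apply H1. replace (z0 + RtoC 0 * d)%C with z0 by ring. auto. }
   destruct (cdiff_line G1 z0 d (G2 (z0 + RtoC 0 * d)%C) 0) as [A' B'].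
   { apply H2. replace (z0 + RtoC 0 * d)%C with z0 by ring. auto. }
   replace (z0 + RtoC 0 * d)%C with z0 in * by ring.
   set (u := fun s => Re (G (z0 + RtoC s * d)%C)) in *.
   set (v := fun s => Im (G (z0 + RtoC s * d)%C)) in *.
   set (u1 := fun s => Re (G1 (z0 + RtoC s * d)%C)) in *.
   set (v1 := fun s => Im (G1 (z0 + RtoC s * d)%C)) in *.
   apply is_derive_ext with (fun s => 2 * (u s * (u1 s * Re d - v1 s * Im d) + v s * (u1 s * Im d + v1 s * Re d)) + 2 * eta * (Re z0 + s * Re d) * Re d).
   { intros s. unfold u, v, u1, v1. csimp. toR; ring. }
   assert (Eu : u 0 = Re (G z0)) by (unfold u; replace (z0 + RtoC 0 * d)%C with z0 by ring; reflexivity).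
   assert (Ev : v 0 = Im (G z0)) by (unfold v; replace (z0 + RtoC 0 * d)%C with z0 by ring; reflexivity).
   assert (Eu1 : u1 0 = Re (G1 z0)) by (unfold u1; replace (z0 + RtoC 0 * d)%C with z0 by ring; reflexivity).
   assert (Ev1 : v1 0 = Im (G1 z0)) by (unfold v1; replace (z0 + RtoC 0 * d)%C with z0 by ring; reflexivity).
   assert (Du : Derive u 0 = Re (G1 z0 * d)%C) by (now apply is_derive_unique).
   assert (Dv : Derive v 0 = Im (G1 z0 * d)%C) by (now apply is_derive_unique).
   assert (Du1 : Derive u1 0 = Re (G2 z0 * d)%C) by (now apply is_derive_unique).
   assert (Dv1 : Derive v1 0 = Im (G2 z0 * d)%C) by (now apply is_derive_unique).
   assert (exu : ex_derive u 0) by (eexists; eauto). assert (exv : ex_derive v 0) by (eexists; eauto).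
   assert (exu1 : ex_derive u1 0) by (eexists; eauto). assert (exv1 : ex_derive v1 0) by (eexists; eauto).
   clearbody u v u1 v1.
   auto_derive. repeat split; auto.
   change (fun x : R => u x) with u. change (fun x : R => v x) with v.
   change (fun x : R => u1 x) with u1. change (fun x : R => v1 x) with v1.
   rewrite Du, Dv, Du1, Dv1, Eu, Ev, Eu1, Ev1, Cmod_sq. csimp. ring.
  - intros s Hs. specialize (Hm _ (line d Hd s Hs)). rewrite !Cmod_sq in Hm.
   replace (z0 + RtoC 0 * d)%C with z0 by ring.
   replace (Re (z0 + RtoC s * d)%C) with (Re z0 + s * Re d) in Hm by (csimp; ring).
   rewrite Rmult_0_l, Rplus_0_r. lra. }
 assert (K1 := key 1%C ltac:(apply Cmod_1)).
 assert (K2 := key Ci ltac:(apply Cmod_Ci)).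
 rewrite !Cmod_sq in K1, K2.
 replace (Re Ci) with 0 in K2 by reflexivity.
 replace (G1 z0 * 1)%C with (G1 z0) in K1 by ring.
 replace (G2 z0 * 1 * 1)%C with (G2 z0) in K1 by ring.
 replace (G2 z0 * Ci * Ci)%C with (- G2 z0)%C in K2 by (unfold Ci; apply C_eq; csimp; ring).
 replace (Re 1%C) with 1 in K1 by reflexivity.
 replace (Re (G1 z0 * Ci)%C) with (- Im (G1 z0)) in K2 by (unfold Ci; csimp; ring).
 replace (Im (G1 z0 * Ci)%C) with (Re (G1 z0)) in K2 by (unfold Ci; csimp; ring).
 csimp. nra.
Qed.

Definition clamp (a b x : R) : R := Rmax a (Rmin b x).

Lemma clamp_in (a b x : R) : a <= b -> a <= clamp a b x <= b.
Proof. intros H. unfold clamp, Rmax, Rmin. repeat destruct Rle_dec; lra. Qed.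

Lemma clamp_id (a b x : R) : a <= x <= b -> clamp a b x = x.
Proof. intros H. unfold clamp, Rmax, Rmin. repeat destruct Rle_dec; lra. Qed.

Lemma clamp_lip (a b x y : R) : a <= b -> Rabs (clamp a b x - clamp a b y) <= Rabs (x - y).
Proof.
 intros H. unfold clamp, Rmax, Rmin.
 repeat destruct Rle_dec; unfold Rabs; repeat destruct Rcase_abs; lra.
Qed.

Lemma continuity_2d_pt_section (f : R -> R -> R) (x y : R) :
 continuity_2d_pt f x y -> continuity_pt (f x) y.
Proof.
 intros H eps He. destruct (H (mkposreal eps He)) as [d Hd].
 exists d. split. apply cond_pos. intros z [_ Hz].
 apply Hd. unfold Rminus; rewrite Rplus_opp_r, Rabs_R0. apply cond_pos. exact Hz.
Qed.

(** Maximise in y for each x, then in x; the partial maximum is continuous in x because f is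
    uniformly continuous near a vertical segment. [clamp] makes the choice of the partial maximiser
    total. *)
Lemma rectangle_max (f : R -> R -> R) (a b c d : R) :
 a <= b -> c <= d ->
 (forall x y, a <= x <= b -> c <= y <= d -> continuity_2d_pt f x y) ->
 exists x0 y0, a <= x0 <= b /\ c <= y0 <= d /\
  forall x y, a <= x <= b -> c <= y <= d -> f x y <= f x0 y0.
Proof.
 intros Hab Hcd Hc.
 assert (S : forall x, exists y0, c <= y0 <= d /\ forall y, c <= y <= d -> f (clamp a b x) y <= f (clamp a b x) y0).
 { intros x. destruct (continuity_ab_maj (f (clamp a b x)) c d Hcd) as [y0 [H1 H2]].
  - intros y Hy. apply continuity_2d_pt_section, Hc; auto. apply clamp_in; auto.
  - exists y0; auto. }
 set (g := fun x => proj1_sig (constructive_indefinite_description _ (S x))).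
 assert (Hg : forall x, c <= g x <= d /\ forall y, c <= y <= d -> f (clamp a b x) y <= f (clamp a b x) (g x)).
 { intros x. unfold g. destruct constructive_indefinite_description; auto. }
 destruct (continuity_ab_maj (fun x => f (clamp a b x) (g x)) a b Hab) as [x0 [H1 H2]].
 - intros x Hx eps He.
  destruct (uniform_continuity_2d_1d' f c d x) with (eps := mkposreal eps He) as [del Hdel].
  { intros y Hy. apply Hc; auto. }
  simpl in Hdel. exists del. split. apply cond_pos. intros z [_ Hz]. simpl in *. unfold R_dist in *.
  assert (E : clamp a b x = x) by (apply clamp_id; auto).
  assert (L := clamp_lip a b z x Hab). rewrite E in *.
  assert (Hz' : x - del <= clamp a b z <= x + del) by (apply Rabs_le_between'; lra).
  pose proof (cond_pos del).
  assert (T : forall y, c <= y <= d -> Rabs (f (clamp a b z) y - f x y) < eps).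
  { intros y Hy. apply Hdel; auto; try lra. replace (y - y) with 0 by ring. rewrite Rabs_R0; auto. }
  destruct (Hg x) as [Gx1 Gx2]. destruct (Hg z) as [Gz1 Gz2]. rewrite E in Gx2.
  assert (T1 := T _ Gx1). assert (T2 := T _ Gz1). assert (A := Gx2 _ Gz1). assert (B := Gz2 _ Gx1).
  apply Rabs_def2 in T1. apply Rabs_def2 in T2. apply Rabs_def1; lra.
 - exists x0, (g x0). destruct (Hg x0) as [A B]. repeat split; try apply H2; try apply A.
  intros x y Hx Hy. assert (E0 : clamp a b x0 = x0) by (apply clamp_id; auto).
  assert (E : clamp a b x = x) by (apply clamp_id; auto).
  specialize (H1 x Hx). rewrite E0, E in H1. destruct (Hg x) as [A' B']. rewrite E in B'.
  specialize (B' y Hy). lra.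
Qed.

Lemma continuity_2d_ccont (f : C -> C) (x y : R) : ccont f (x, y) ->
 continuity_2d_pt (fun u v => Re (f (u, v))) x y /\ continuity_2d_pt (fun u v => Im (f (u, v))) x y.
Proof.
 intros H. split; intros eps; destruct (H eps (cond_pos eps)) as [d [Hd Hf]];
  exists (mkposreal (d / 2) ltac:(lra)); simpl; intros u v Hu Hv.
 all: assert (A : Cmod ((u, v) - (x, y)) < d) by
  (eapply Rle_lt_trans; [apply Cmod_le_abs|]; csimp; lra).
 - eapply Rle_lt_trans; [|apply (Hf _ A)]. rewrite <- Re_minus. apply re_le_Cmod.
 - eapply Rle_lt_trans; [|apply (Hf _ A)]. rewrite <- Im_minus. apply Im_le_Cmod.
Qed.

Lemma rectangle_principle (U : C -> Prop) (G : C -> C) (a b c d M : R) : a < b -> c < d -> hol 2 U G -> 0 <= M ->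
 (forall x y, a <= x <= b -> c <= y <= d -> U (x, y)) ->
 (forall x y, a <= x <= b -> c <= y <= d -> x = a \/ x = b \/ y = c \/ y = d -> Cmod (G (x, y)) <= M) ->
 forall x y, a <= x <= b -> c <= y <= d -> Cmod (G (x, y)) <= M.
Proof.
 intros Hab Hcd HG HM HU HB x0 y0 Hx0 Hy0. apply Rnot_lt_le. intros Hlt.
 (* tilt by a small multiple of [x^2] to make the second derivative test strict *)
 set (q := a ^ 2 + b ^ 2 + 1).
 assert (Hq : forall x, a <= x <= b -> x ^ 2 <= q) by (intros x Hx; unfold q; destruct (Rle_dec 0 x); nra).
 assert (Hq1 : 1 <= q) by (unfold q; nra).
 set (D := Cmod (G (x0, y0)) ^ 2 - M ^ 2). assert (HD : 0 < D) by (unfold D; nra).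
 (* With this [eta] the tilt contributes at most half of the excess D of |G|^2 over M^2, so the
    tilted maximum cannot sit on the boundary. *)
 set (eta := D / (2 * q)). assert (Heta : 0 < eta) by pos.
 assert (Heq : eta * q = D / 2) by (unfold eta; field; lra).
 set (Psi := fun z => Cmod (G z) ^ 2 + eta * Re z ^ 2).
 destruct (rectangle_max (fun x y => Psi (x, y)) a b c d) as [x1 [y1 [Hx1 [Hy1 Hmax]]]]; try lra.
 { intros x y Hx Hy. unfold Psi. destruct (continuity_2d_ccont G x y) as [C1 C2].
  { eapply hol_cont. exact HG. auto. }
  apply continuity_2d_pt_ext with (fun u v => (Re (G (u, v)) * Re (G (u, v)) + Im (G (u, v)) * Im (G (u, v))) + eta * (u * u)).
  { intros u v. rewrite Cmod_sq. csimp. ring. }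
  apply continuity_2d_pt_plus. apply continuity_2d_pt_plus; apply continuity_2d_pt_mult; auto.
  apply continuity_2d_pt_mult. apply continuity_2d_pt_const.
  apply continuity_2d_pt_mult; apply continuity_2d_pt_id1. }
 assert (NB : ~ (x1 = a \/ x1 = b \/ y1 = c \/ y1 = d)).
 { intros Hb. assert (T := Hmax x0 y0 Hx0 Hy0). unfold Psi in T. rewrite !Re_pair in T.
  assert (B := HB x1 y1 Hx1 Hy1 Hb). assert (B0 := Cmod_ge_0 (G (x1, y1))).
  assert (x1 ^ 2 <= q) by auto. assert (0 <= eta * x0 ^ 2) by (mul_pos; [lra|apply pow2_ge_0]).
  assert (eta * x1 ^ 2 <= D / 2) by nra. assert (Cmod (G (x1, y1)) ^ 2 <= M ^ 2) by nra. unfold D in *. lra. }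
 assert (x1 <> a /\ x1 <> b /\ y1 <> c /\ y1 <> d) by tauto.
 set (r := Rmin (Rmin (x1 - a) (b - x1)) (Rmin (y1 - c) (d - y1))).
 assert (Hr : 0 < r) by (repeat apply Rmin_pos; lra).
 assert (Hr1 : r <= Rmin (x1 - a) (b - x1)) by apply Rmin_l. assert (Hr2 : r <= Rmin (y1 - c) (d - y1)) by apply Rmin_r.
 assert (Q1 := Rmin_l (x1 - a) (b - x1)). assert (Q2 := Rmin_r (x1 - a) (b - x1)).
 assert (Q3 := Rmin_l (y1 - c) (d - y1)). assert (Q4 := Rmin_r (y1 - c) (d - y1)).
 assert (Hw : forall w, Cmod (w - (x1, y1)) < r -> a <= Re w <= b /\ c <= Im w <= d).
 { intros w Hw. assert (A1 := re_le_Cmod (w - (x1, y1))%C). assert (A2 := Im_le_Cmod (w - (x1, y1))%C).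
  csimp. assert (A3 : Rabs (Re w - x1) < r) by lra. assert (A4 : Rabs (Im w - y1) < r) by lra.
  apply Rabs_def2 in A3. apply Rabs_def2 in A4. lra. }
 apply (no_interior_max U G (x1, y1) r eta HG Hr); auto.
 - intros w Hw'. destruct (Hw w Hw'), w. now apply HU.
 - intros w Hw'. destruct (Hw w Hw') as [A1 A2]. assert (T := Hmax (Re w) (Im w) A1 A2). destruct w; exact T.
Qed.

(** * Vertical strips and the three lines theorem *)

(** Phragmen-Lindelof for bounded functions: the damped function is small on distant horizontal
    sides, so the rectangle principle compares it with the vertical sides only. The bound K has to
    exist but leaves no trace in the conclusion. *)
Lemma strip_max (U : C -> Prop) (F : C -> C) (a b K M : R) :
 a < b -> 0 <= M -> hol 2 U F -> (forall z, a <= Re z <= b -> U z) ->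
 (forall z, a <= Re z <= b -> Cmod (F z) <= K) ->
 (forall z, Re z = a \/ Re z = b -> Cmod (F z) <= M) ->
 forall z, a <= Re z <= b -> Cmod (F z) <= M.
Proof.
 intros Hab HM HF HU HK HB z0 Hz0. apply Rnot_lt_le. intros Hlt.
 set (q := a ^ 2 + b ^ 2 + 1).
 assert (Hq : forall x, a <= x <= b -> x ^ 2 <= q) by (intros x Hx; unfold q; destruct (Rle_dec 0 x); nra).
 assert (Hq1 : 1 <= q) by (unfold q; nra).
 set (m := Cmod (F z0)) in *.
 (* Gaussian damping: for small [eps] the weight [exp (eps z^2)] still leaves [z0] above the boundary *)
 assert (Hm0 : 0 < m) by lra.
 assert (Heps : exists eps, 0 < eps /\ M * exp (eps * q) < m * exp (- eps * Im z0 ^ 2)).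
 { set (Q := q + Im z0 ^ 2). assert (HQ : 1 <= Q) by (unfold Q; nra).
  destruct (Req_dec M 0) as [E|E].
  - exists 1. split. lra. rewrite E, Rmult_0_l. apply Rmult_lt_0_compat; auto. pos.
  - assert (HM' : 0 < M) by lra.
   assert (1 < m / M) by (apply Rmult_lt_reg_r with M; auto; unfold Rdiv; rewrite Rmult_assoc, Rinv_l; lra).
   assert (HL : 0 < ln (m / M)) by (rewrite <- ln_1; apply ln_increasing; lra).
   exists (ln (m / M) / (2 * Q)). split. apply Rdiv_lt_0_compat; [exact HL | lra].
   set (eps := ln (m / M) / (2 * Q)).
   assert (E1 : eps * Q = ln (m / M) / 2) by (unfold eps; field; lra).
   apply Rmult_lt_reg_r with (exp (eps * Im z0 ^ 2)). pos.
   rewrite !Rmult_assoc, <- !exp_plus.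
   replace (eps * q + eps * Im z0 ^ 2) with (ln (m / M) / 2) by (rewrite <- E1; unfold Q; ring).
   replace (- eps * Im z0 ^ 2 + eps * Im z0 ^ 2) with 0 by ring. rewrite exp_0.
   apply Rlt_le_trans with (M * exp (ln (m / M))).
   apply Rmult_lt_compat_l; auto. apply exp_increasing; lra.
   rewrite exp_ln by lra. right; field; lra. }
 destruct Heps as [eps [He Hlt2]].
 set (G := fun z => (F z * cexp (RtoC eps * (z * z)))%C).
 assert (HG : hol 2 U G).
 { apply hol_mult; auto. apply hol_exp_comp. apply hol_mult. apply hol_const. apply hol_mult; apply hol_id. }
 assert (CG : forall z, Cmod (G z) = Cmod (F z) * exp (eps * (Re z ^ 2 - Im z ^ 2))).
 { intros z. unfold G. rewrite Cmod_mult, Cmod_cexp. do 2 f_equal. csimp. ring. }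
 set (B := M * exp (eps * q)).
 assert (HBp : 0 <= B) by (mul_pos; auto; pos).
 assert (HGz : B < Cmod (G z0)).
 { rewrite CG. eapply Rlt_le_trans. exact Hlt2. fold m. mono_l. lra. apply exp_le. assert (0 <= Re z0 ^ 2) by nra. nra. }
 assert (HGb : forall z, Re z = a \/ Re z = b -> Cmod (G z) <= B).
 { intros z Hz. rewrite CG. unfold B. mono. pos. pos. auto.
  apply exp_le. assert (Re z ^ 2 <= q) by (apply Hq; lra). nra. }
 assert (HY : exists Y, Rabs (Im z0) <= Y /\ 1 <= Y /\ forall z, a <= Re z <= b -> Rabs (Im z) = Y -> Cmod (G z) <= B \/ Cmod (G z) <= Cmod (G z0) / 2).
 { (* choose Y with K exp(eps q) exp(-eps Y) <= |G z0|/2 *)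
  set (A := Rabs K * exp (eps * q) + 1).
  assert (HA : 1 <= A) by (unfold A; pose proof (Rmult_le_pos _ _ (Rabs_pos K) (Rlt_le _ _ (exp_pos (eps * q)))); lra).
  assert (HGp : 0 < Cmod (G z0)) by lra.
  set (L := 2 * A / (Cmod (G z0) * eps)).
  assert (HL : 0 < L) by (unfold L; apply Rdiv_lt_0_compat; nra).
  exists (1 + Rabs (Im z0) + L). pose proof (Rabs_pos (Im z0)). split; [lra|split;[lra|]].
  intros z Hz HI. right. rewrite CG.
  set (Y := 1 + Rabs (Im z0) + L) in *.
  assert (HI2 : Im z ^ 2 = Y ^ 2) by (rewrite <- HI, <- Rsqr_pow2, <- (Rsqr_pow2 (Rabs _)); apply Rsqr_abs).
  rewrite HI2.
  assert (Hx : exp (eps * (Re z ^ 2 - Y ^ 2)) <= exp (eps * q) * exp (- (eps * Y))).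
  { rewrite <- exp_plus. apply exp_le. assert (Re z ^ 2 <= q) by auto. assert (Y <= Y ^ 2) by (unfold Y; nra). nra. }
  assert (Hy : exp (- (eps * Y)) <= / (eps * Y)).
  { rewrite exp_Ropp. apply Rinv_le_contravar. apply Rmult_lt_0_compat; unfold Y; lra.
   assert (HH := exp_ineq1_le (eps * Y)). lra. }
  assert (Hk : Cmod (F z) <= Rabs K) by (le_trans; [apply HK; auto|apply Rle_abs]).
  apply Rle_trans with (Rabs K * (exp (eps * q) * / (eps * Y))).
  { mono; auto. pos. pos. via Hx.
   mono_l; auto. pos. }
  rewrite <- Rmult_assoc. apply Rle_trans with (A * / (eps * L)).
  { mono. mul_pos; [apply Rabs_pos|pos].
   left; apply Rinv_0_lt_compat, Rmult_lt_0_compat; unfold Y; lra. unfold A; lra.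
   apply Rinv_le_contravar. nra. mono_l; unfold Y; lra. }
  right. unfold L. field. split; lra. }
 destruct HY as [Y [HY1 [HY2 HY3]]].
 assert (HGp : 0 < Cmod (G z0)) by lra.
 set (M' := Rmax B (Cmod (G z0) / 2)). assert (M1 : B <= M') by apply Rmax_l. assert (M2 : Cmod (G z0) / 2 <= M') by apply Rmax_r.
 assert (HM' : M' < Cmod (G z0)) by (unfold M'; apply Rmax_lub_lt; lra).
 assert (T : Cmod (G (Re z0, Im z0)) <= M').
 { apply (rectangle_principle U G a b (- Y) Y M'); auto; try lra.
  - intros x y Hx Hy Hb. destruct Hb as [E|[E|E]].
   + upto M1. apply HGb. left. exact E.
   + upto M1. apply HGb. right. exact E.
   + assert (E2 : Rabs y = Y) by (destruct E; subst y; [rewrite Rabs_Ropp|]; apply Rabs_pos_eq; lra).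
    destruct (HY3 (x, y) Hx E2); lra.
  - apply Rabs_le_between; auto. }
 destruct z0. simpl in T. lra.
Qed.

(** Multiplication by an exponential of a linear function turns both edge bounds into 1. Exponents
    m1, m2 in place of positive bounds avoid powers and logarithms in the statement. *)
Lemma three_lines (U : C -> Prop) (F : C -> C) (a b K m1 m2 : R) :
 a < b -> hol 2 U F -> (forall z, a <= Re z <= b -> U z) ->
 (forall z, a <= Re z <= b -> Cmod (F z) <= K) ->
 (forall z, Re z = a -> Cmod (F z) <= exp m1) ->
 (forall z, Re z = b -> Cmod (F z) <= exp m2) ->
 forall z, a <= Re z <= b -> Cmod (F z) <= exp (m1 + (m2 - m1) * ((Re z - a) / (b - a))).
Proof.
 intros Hab HF HU HK H1 H2 z Hz.
 set (c := (m2 - m1) / (b - a)).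
 set (G := fun w => (F w * cexp ((- c) * w + (c * a - m1)))%C).
 assert (CG : forall w, Cmod (G w) = Cmod (F w) * exp (- c * (Re w - a) - m1)).
 { intros w. unfold G. rewrite Cmod_mult, Cmod_cexp. do 2 f_equal. csimp. ring. }
 assert (H : Cmod (G z) <= 1).
 { apply (strip_max U G a b (Rabs K * exp (Rabs c * (b - a) + Rabs m1)) 1); auto; try lra.
  - apply hol_mult; auto. apply hol_exp_comp. apply hol_plus. apply hol_mult. apply hol_const. apply hol_id. apply hol_const.
  - intros w Hw. rewrite CG. mono. pos. pos.
   le_trans. apply HK; auto. apply Rle_abs.
   apply exp_le. pose proof (Rle_abs (- m1)). rewrite Rabs_Ropp in *. pose proof (Rle_abs (- c)). rewrite Rabs_Ropp in *.
   pose proof (Rabs_pos c). nra.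
  - intros w [Hw|Hw]; rewrite CG, Hw.
   + apply Rle_trans with (exp m1 * exp (- c * (a - a) - m1)). mono_r. pos. auto.
    rewrite <- exp_plus. replace (m1 + (- c * (a - a) - m1)) with 0 by ring. rewrite exp_0; lra.
   + apply Rle_trans with (exp m2 * exp (- c * (b - a) - m1)). mono_r. pos. auto.
    rewrite <- exp_plus. replace (m2 + (- c * (b - a) - m1)) with 0 by (unfold c; field; lra). rewrite exp_0; lra. }
 rewrite CG in H.
 replace (m1 + (m2 - m1) * ((Re z - a) / (b - a))) with (- (- c * (Re z - a) - m1)) by (unfold c; field; lra).
 rewrite exp_Ropp. apply Rmult_le_reg_r with (exp (- c * (Re z - a) - m1)). pos.
 rewrite Rinv_l; auto. apply Rgt_not_eq, exp_pos.
Qed.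

(** * Harnack's inequality by Schwarz's lemma *)

(** A point of the right half plane is nearer to b than to the mirror image - conj b of b in the
    imaginary axis. *)
Lemma Cmod_sub_conj_le (a b : C) : 0 < Re a -> 0 < Re b -> Cmod (a - b) <= Cmod (a + Cconj b).
Proof.
 intros Ha Hb. assert (A := Cmod_sq (a - b)). assert (B := Cmod_sq (a + Cconj b)). csimp.
 pose proof (Cmod_ge_0 (a - b)). pose proof (Cmod_ge_0 (a + Cconj b)). nra.
Qed.


Lemma Re_pos_neq_0 (z : C) : 0 < Re z -> z <> RtoC 0.
Proof. intros H ->. simpl in H. lra. Qed.

Lemma Re_div (a w : C) : w <> RtoC 0 -> Re (a / w)%C * Cmod w ^ 2 = Re (a * Cconj w)%C.
Proof.
 intros H. replace (a * Cconj w)%C with (a / w * (w * Cconj w))%C by (field; auto).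
 rewrite <- Cmod2_conj. rewrite (Re_mult (a / w)%C). csimp. ring.
Qed.

Definition cayley (z : C) : C := ((1 + z) / (1 - z))%C.

Lemma cayley_0 : cayley 0 = 1%C.
Proof. unfold cayley, Cdiv, Cinv. apply C_eq; simpl; field. Qed.

Lemma cayley_Re (z : C) : Cmod z < 1 -> 0 < Re (cayley z).
Proof.
 intros Hz. assert (S := Cmod_sq z). pose proof (Cmod_ge_0 z).
 assert (Hn : (1 - z)%C <> RtoC 0).
 { apply Re_pos_neq_0. csimp. pose proof (Re_le_mod z). lra. }
 assert (Hp : 0 < Cmod (1 - z)) by (apply Cmod_gt_0; auto).
 assert (E : Re (cayley z) * Cmod (1 - z) ^ 2 = 1 - Cmod z ^ 2).
 { unfold cayley. rewrite Re_div, S by auto. csimp. ring. }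
 assert (0 < 1 - Cmod z ^ 2) by nra. apply Rnot_le_lt. intros K. nra.
Qed.

Lemma cayley_Cmod (z : C) (r : R) : Cmod z <= r -> r < 1 -> Cmod (cayley z) <= (1 + r) / (1 - r).
Proof.
 intros Hz Hr. unfold cayley.
 assert (A := Cmod_triangle 1 z). assert (B := Cmod_triangle_inv' 1 z). rewrite Cmod_1 in *.
 rewrite Cmod_div. 2: apply Cmod_gt_0; lra.
 unfold Rdiv. mono. pos. left. pos. lra.
 apply Rinv_le_contravar; lra.
Qed.

Lemma exp_ln_cexp (x y : R) : 0 < x -> cexp (ln x, y) = (RtoC x * cexp (0, y))%C.
Proof. intros H. unfold cexp. simpl. rewrite exp_ln, exp_0 by auto. apply C_eq; simpl; ring. Qed.

(** The interpolation exponent when the left edge of a strip moves to -E: as E grows it approaches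
    q, and a loss [eta] is accepted instead of taking the limit. *)
Lemma large_ratio (c p q eta : R) : 0 < eta -> exists E0, forall E, E0 <= E ->
 0 < E + p -> q - eta <= (E - c) * q / (E + p).
Proof.
 intros He. exists ((c * q + (q - eta) * p) / eta). intros E HE HP.
 apply Rmult_le_reg_r with (E + p); auto. unfold Rdiv. rewrite Rmult_assoc, Rinv_l by lra.
 apply Rmult_le_compat_r with (r := eta) in HE; [|lra].
 unfold Rdiv in HE. rewrite Rmult_assoc, Rinv_l in HE by lra. lra.
Qed.

Lemma exp_small_ub (x : R) : 0 <= x < 1 -> exp x <= / (1 - x).
Proof.
 intros Hx. rewrite <- (Ropp_involutive x) at 1. rewrite exp_Ropp. apply Rinv_le_contravar. lra.
 assert (H := exp_ineq1_le (- x)). lra.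
Qed.

(* Schwarz's lemma for the Cayley transform of [H], obtained by applying the three lines theorem
  in the coordinate [w = log z]. *)
Lemma harnack_half (U : C -> Prop) (H : C -> C) (beta b tau : R) :
 0 < b -> hol 2 U H ->
 (forall s, beta < Re s -> Cmod (s - (beta, tau)) <= 19 * b -> U s /\ 0 < Re (H s)) ->
 Cmod (H (beta + b / 2, tau)) <= 2.25 * Cmod (H (beta + b, tau)).
Proof.
 intros Hb HH HP.
 set (S := fun z => ((beta, tau) + RtoC b * cayley z)%C).
 (* [S] maps the unit disc onto the half plane Re s > beta and 0 to beta + b + i tau. On |z| <= 0.9
    the Cayley transform is at most (1 + 0.9) / (1 - 0.9) = 19 in modulus, whence the radius 19
    b. *)
 assert (HS : forall z, Cmod z <= 0.9 -> beta < Re (S z) /\ Cmod (S z - (beta, tau)) <= 19 * b).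
 { intros z Hz. unfold S. split.
  - assert (A := cayley_Re z ltac:(lra)). csimp. nra.
  - replace ((beta, tau) + RtoC b * cayley z - (beta, tau))%C with (RtoC b * cayley z)%C by ring.
   rewrite Cmod_mult, Cmod_R, Rabs_pos_eq by lra.
   assert (A := cayley_Cmod z 0.9 Hz ltac:(lra)). replace ((1 + 0.9) / (1 - 0.9)) with 19 in A by (replace 0.9 with (9 / 10) by lra; field). nra. }
 set (s0 := (beta + b, tau) : C). set (H0 := H s0).
 assert (S0 : S 0 = s0).
 { unfold S, s0. rewrite cayley_0.
  apply C_eq; csimp; ring. }
 assert (P0 : U s0 /\ 0 < Re H0).
 { destruct (HS 0) as [A B]. rewrite Cmod_0; lra. rewrite S0 in *. apply HP; auto. }
 destruct P0 as [Us0 RH0].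
 (* Moebius transform of the right half plane onto the unit disc that sends the value H0 at the
    centre to 0. *)
 set (phi := fun s => ((H s - H0) / (H s + Cconj H0))%C).
 assert (Hden : forall s, 0 < Re (H s) -> (H s + Cconj H0)%C <> RtoC 0).
 { intros s Hs. apply Re_pos_neq_0. csimp. lra. }
 assert (Hphi1 : forall s, 0 < Re (H s) -> Cmod (phi s) <= 1).
 { intros s Hs. unfold phi. rewrite Cmod_div by auto.
  assert (A := Cmod_sub_conj_le (H s) H0 Hs RH0).
  assert (0 < Cmod (H s + Cconj H0)) by (apply Cmod_gt_0; auto).
  apply Rmult_le_reg_r with (Cmod (H s + Cconj H0)); auto. unfold Rdiv. rewrite Rmult_assoc, Rinv_l; lra. }
 (* First-order vanishing at the centre plays the part of dividing by z in Schwarz's lemma: on the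
    circle |z| = e^(-E) the modulus is at most K e^(-E), whatever the value of K. *)
 assert (Hlin : exists K d, 0 < K /\ 0 < d < 0.9 /\ forall z, Cmod z <= d -> Cmod (phi (S z)) <= K * Cmod z).
 { destruct HH as [H' [D _]]. specialize (D s0 Us0).
  destruct (cdiff_eps _ _ _ D 1 ltac:(lra)) as [d [Hd Hc]].
  set (l := Cmod (H' s0)). assert (Hl : 0 <= l) by pos.
  exists ((l + 1) * (20 * b) / Re H0), (Rmin 0.8 (d / (40 * b))).
  assert (Hm : 0 < Rmin 0.8 (d / (40 * b))) by (apply Rmin_pos; [lra|pos]).
  assert (Rmin 0.8 (d / (40 * b)) <= 0.8) by apply Rmin_l.
  split. apply Rdiv_lt_0_compat; auto. pos. split. lra.
  intros z Hz. pose proof (Cmod_ge_0 z).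
  assert (Hz9 : Cmod z <= 0.9) by lra.
  assert (Hzd : Cmod z <= d / (40 * b)) by (le_trans; [exact Hz|apply Rmin_r]).
  destruct (HS z Hz9) as [A B]. destruct (HP _ A B) as [UA RA].
  assert (Hn1 : (1 - z)%C <> RtoC 0) by (apply Re_pos_neq_0; csimp; pose proof (Re_le_mod z); lra).
  assert (E : S z = (s0 + RtoC b * (2 * z / (1 - z)))%C).
  { rewrite <- S0. unfold S. rewrite cayley_0. unfold cayley. field. auto. }
  assert (Ch : Cmod (RtoC b * (2 * z / (1 - z))) <= 20 * b * Cmod z).
  { rewrite Cmod_mult, Cmod_div, Cmod_mult, !Cmod_R, !Rabs_pos_eq by (auto; lra).
   assert (T := Cmod_triangle_inv' 1 z). rewrite Cmod_1 in T.
   assert (/ Cmod (1 - z) <= 10).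
   { replace 10 with (/ (1 / 10)) by field. apply Rinv_le_contravar; lra. }
   unfold Rdiv. assert (2 * Cmod z * / Cmod (1 - z) <= 2 * Cmod z * 10) by (mono_l; lra). nra. }
  assert (Hzd2 : 20 * b * Cmod z <= d / 2).
  { replace (d / 2) with (20 * b * (d / (40 * b))) by (field; lra). mono_l; lra. }
  specialize (Hc _ ltac:(eapply Rle_lt_trans; [exact Ch|lra])).
  rewrite <- E in Hc. fold H0 in Hc.
  set (h := (RtoC b * (2 * z / (1 - z)))%C) in *.
  assert (Hnum : Cmod (H (S z) - H0) <= (l + 1) * (20 * b) * Cmod z).
  { replace (H (S z) - H0)%C with ((H (S z) - H0 - H' s0 * h) + H' s0 * h)%C by ring.
   via Cmod_triangle. rewrite Cmod_mult. fold l.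
   pose proof (Cmod_ge_0 h). nra. }
  unfold phi. rewrite Cmod_div by (apply Hden; auto).
  assert (Hd2 : Re H0 <= Cmod (H (S z) + Cconj H0)).
  { le_trans; [|apply Re_le_mod]. csimp. lra. }
  unfold Rdiv. apply Rle_trans with ((l + 1) * (20 * b) * Cmod z * / Re H0).
  - mono; auto. pos. left. pos. apply Rinv_le_contravar; auto.
  - right; ring. }
 destruct Hlin as [K [d [HK [Hd Hlin]]]].
 set (q := ln 0.9 - ln (1 / 3)).
 destruct (large_ratio (ln K) (ln 0.9) q 0.01 ltac:(lra)) as [E0 HE0].
 assert (L9 : ln 0.9 < 0) by (rewrite <- ln_1; apply ln_increasing; lra).
 assert (L3 : ln (1 / 3) < ln 0.9) by (apply ln_increasing; lra).
 assert (Ld : ln d < ln 0.9) by (apply ln_increasing; lra).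
 (* The left edge Re w = -E is placed where e^(-E) <= d, to the left of log (1/3), and so far out
    that the exponent loses at most 0.01. *)
 set (E := Rmax E0 (Rmax (- ln d) (1 - ln (1 / 3)))).
 assert (HE1 : E0 <= E) by apply Rmax_l.
 assert (HE2 : - ln d <= E) by (le_trans; [apply Rmax_l|apply Rmax_r]).
 assert (HE3 : 1 - ln (1 / 3) <= E) by (le_trans; [apply Rmax_r|apply Rmax_r]).
 specialize (HE0 E HE1 ltac:(lra)).
 assert (cm : forall w, Re w <= ln 0.9 -> Cmod (cexp w) <= 0.9).
 { intros w Hw. rewrite Cmod_cexp. replace 0.9 with (exp (ln 0.9)) by (apply exp_ln; lra). now apply exp_le. }
 set (V := fun w => Re w <= ln 0.9).
 assert (Hpos : forall w, V w -> U (S (cexp w)) /\ 0 < Re (H (S (cexp w)))).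
 { intros w Hw. destruct (HS (cexp w) (cm w Hw)). apply HP; auto. }
 assert (TL := three_lines V (fun w => phi (S (cexp w))) (- E) (ln 0.9) 1 (ln K - E) 0).
 assert (Hw0 : (- E) <= Re (ln (1 / 3), PI) <= ln 0.9) by (simpl; lra).
 specialize (TL ltac:(lra)).
 assert (TL1 : hol 2 V (fun w => phi (S (cexp w)))).
 { assert (HSw : hol 2 V (fun w => S (cexp w))).
  { unfold S, cayley. apply hol_plus. apply hol_const. apply hol_mult. apply hol_const.
   apply hol_div.
   - intros w Hw. apply Re_pos_neq_0. csimp. pose proof (cm w Hw). pose proof (Re_le_mod (cexp w)). lra.
   - apply hol_plus. apply hol_const. apply hol_cexp.
   - apply hol_minus. apply hol_const. apply hol_cexp. }
  assert (HHw : hol 2 V (fun w => H (S (cexp w)))).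
  { apply hol_comp with U; auto. intros w Hw. apply Hpos; auto. }
  unfold phi. apply hol_div.
  - intros w Hw. apply Hden. apply Hpos; auto.
  - apply hol_minus; auto. apply hol_const.
  - apply hol_plus; auto. apply hol_const. }
 specialize (TL TL1). clear TL1.
 specialize (TL ltac:(intros z Hz; unfold V; lra)).
 specialize (TL ltac:(intros z Hz; apply Hphi1, Hpos; unfold V; lra)).
 assert (T1 : forall w, Re w = - E -> Cmod (phi (S (cexp w))) <= exp (ln K - E)).
 { intros w Hw. assert (Cw : Cmod (cexp w) = exp (- E)) by (rewrite Cmod_cexp, Hw; auto).
  via Hlin.
  - rewrite Cw. replace d with (exp (ln d)) by (apply exp_ln; lra). apply exp_le; lra.
  - rewrite Cw. unfold Rminus. rewrite exp_plus, exp_ln by auto. lra. }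
 specialize (TL T1).
 assert (T2 : forall w, Re w = ln 0.9 -> Cmod (phi (S (cexp w))) <= exp 0).
 { intros w Hw. rewrite exp_0. apply Hphi1, Hpos. unfold V; lra. }
 specialize (TL T2 _ Hw0).
 (* The point at distance b/2 from the line corresponds to z = -1/3, because (1 - 1/3) / (1 + 1/3) =
    1/2. *)
 assert (EW : S (cexp (ln (1 / 3), PI)) = (beta + b / 2, tau)).
 { rewrite exp_ln_cexp by lra. unfold cexp, S, cayley. simpl. rewrite exp_0, cos_PI, sin_PI.
  replace (RtoC (1 / 3) * ((1 * -1)%R, (1 * 0)%R))%C with (RtoC (-1 / 3)) by (apply C_eq; simpl; field).
  rewrite <- RtoC_plus, <- RtoC_minus, <- RtoC_div by lra.
  apply C_eq; csimp; simpl; field. }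
 cbv beta in TL. rewrite EW in TL. set (p := phi (beta + b / 2, tau)) in *.
 (* Schwarz's lemma on the disc of radius 0.9 would give (1/3) / 0.9 = 0.370...; the loss e^0.01
    still leaves 0.38, and (1 + 0.38) / (1 - 0.38) < 2.25. *)
 assert (Hp : Cmod p <= 0.38).
 { via TL. apply Rle_trans with (exp (- (q - 0.01))).
  - apply exp_le. simpl.
   replace (ln K - E + (0 - (ln K - E)) * ((ln (1 / 3) - - E) / (ln 0.9 - - E))) with (- ((E - ln K) * q / (E + ln 0.9))).
   lra. unfold q. field. lra.
  - replace (- (q - 0.01)) with (ln (1 / 3) + - ln 0.9 + 0.01) by (unfold q; ring).
   rewrite !exp_plus, exp_Ropp, !exp_ln by lra.
   assert (exp 0.01 <= / (1 - 0.01)) by (apply exp_small_ub; lra).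
   apply Rle_trans with (1 / 3 * / 0.9 * / (1 - 0.01)). mono_l; lra. lra. }
 set (h := H (beta + b / 2, tau)).
 assert (Rh : 0 < Re h).
 { unfold h. rewrite <- EW. apply Hpos. unfold V; simpl; lra. }
 assert (Eh : (h - p * h = H0 + p * Cconj H0)%C).
 { unfold p, phi. fold h. field. apply (Hden (beta + b / 2, tau)). exact Rh. }
 assert (I1 := Cmod_triangle_inv' h (p * h)%C). rewrite Eh in I1.
 assert (I2 := Cmod_triangle H0 (p * Cconj H0)%C). rewrite !Cmod_mult, Cmod_conj in *.
 fold s0. fold H0. pose proof (Cmod_ge_0 h). pose proof (Cmod_ge_0 H0). nra.
Qed.

(** * A one-sided bound for logarithmic derivatives *)

Lemma ln_mod_derive (f : C -> C) (z d l : C) (t : R) :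
 cdiff f (z + RtoC t * d)%C l -> f (z + RtoC t * d)%C <> RtoC 0 ->
 is_derive (fun s => ln (Cmod (f (z + RtoC s * d)%C))) t (Re (l * d / f (z + RtoC t * d))%C).
Proof.
 intros Hf Hn. destruct (cdiff_line f z d l t Hf) as [A B].
 set (u := fun s => Re (f (z + RtoC s * d)%C)) in *. set (v := fun s => Im (f (z + RtoC s * d)%C)) in *.
 assert (Hp : 0 < u t ^ 2 + v t ^ 2).
 { unfold u, v. rewrite <- Cmod_sq. apply Cmod_gt_0 in Hn. now apply pow_lt. }
 apply is_derive_ext with (fun s => / 2 * ln (u s ^ 2 + v s ^ 2)).
 { intros s. unfold u, v. rewrite <- Cmod_sq.
  (* The identity log |f| = (1/2) log |f|^2 is needed for every s; at zeros of f both sides are 0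
     because [ln 0] is 0. *)
  destruct (Req_dec (Cmod (f (z + RtoC s * d)%C)) 0) as [E|E].
  - rewrite E. unfold ln at 1 2. simpl. destruct (Rlt_dec 0 (0 * (0 * 1))). exfalso; lra.
   destruct (Rlt_dec 0 0). exfalso; lra. toR; ring.
  - pose proof (Cmod_ge_0 (f (z + RtoC s * d)%C)). rewrite ln_pow by lra. simpl. toR; field. }
 replace (Re (l * d / f (z + RtoC t * d))%C) with (/ 2 * (/ (u t ^ 2 + v t ^ 2) * (2 * (u t * Re (l * d)%C + v t * Im (l * d)%C)))).
 - apply is_derive_scal. rewrite Rmult_comm.
  apply (is_derive_comp ln (fun s => u s ^ 2 + v s ^ 2)).
  apply is_derive_Reals, derivable_pt_lim_ln; auto. apply is_derive_sqmod; auto.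
 - apply Rmult_eq_reg_r with (Cmod (f (z + RtoC t * d)%C) ^ 2).
  2: apply Cmod_gt_0 in Hn; apply Rgt_not_eq; now apply pow_lt.
  rewrite Re_div by auto. unfold u, v in *. rewrite <- Cmod_sq in *.
  rewrite (Re_mult (l * d)%C). csimp. field. apply Cmod_gt_0 in Hn. lra.
Qed.

Lemma cos_sin_Zperiod (x : R) (n : Z) :
 cos (x + 2 * IZR n * PI) = cos x /\ sin (x + 2 * IZR n * PI) = sin x.
Proof.
 destruct (Z_le_dec 0 n) as [H|H].
 - rewrite <- (Z2Nat.id n H), <- INR_IZR_INZ. split. apply cos_period. apply sin_period.
 - set (k := Z.to_nat (- n)). assert (E : IZR n = - INR k).
  { unfold k. rewrite INR_IZR_INZ, Z2Nat.id by lia. rewrite opp_IZR. ring. }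
  rewrite E. rewrite <- (cos_period (x + 2 * - INR k * PI) k), <- (sin_period (x + 2 * - INR k * PI) k).
  split; f_equal; ring.
Qed.

(** A function of [cexp w] has period 2 pi i, so boundedness on an infinite strip reduces to a
    compact rectangle. *)
Lemma cexp_reduce (w : C) : exists y, 0 <= y <= 2 * PI /\ cexp w = cexp (Re w, y).
Proof.
 assert (HPI := PI_RGT_0).
 set (n := Int_part (Im w / (2 * PI))).
 destruct (base_Int_part (Im w / (2 * PI))) as [A B]. fold n in A, B.
 exists (Im w + 2 * IZR (- n) * PI). rewrite opp_IZR.
 assert (E : Im w = Im w / (2 * PI) * (2 * PI)) by (field; lra).
 split.
 - set (m := Im w / (2 * PI)) in *. rewrite E. assert (0 < 2 * PI) by lra. split; nra.
 - unfold cexp. simpl. destruct (cos_sin_Zperiod (Im w) (- n)) as [C1 C2]. rewrite opp_IZR in C1, C2.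
  now rewrite C1, C2.
Qed.

Lemma derive_nonneg_left (g : R -> R) (x D d : R) :
 is_derive g x D -> 0 < d -> g x = 0 -> (forall r, x - d <= r <= x -> g r <= 0) -> 0 <= D.
Proof.
 intros Hg Hd H0 H. apply Rnot_lt_le. intros HD. apply is_derive_Reals in Hg.
 destruct (Hg (- D / 2)) as [[e He] Hh]. lra. simpl in Hh.
 set (h := - Rmin (d / 2) (e / 2)).
 assert (Hm : 0 < Rmin (d / 2) (e / 2)) by (apply Rmin_pos; lra).
 pose proof (Rmin_l (d / 2) (e / 2)). pose proof (Rmin_r (d / 2) (e / 2)).
 specialize (Hh h ltac:(unfold h; lra) ltac:(unfold h; rewrite Rabs_left; lra)).
 assert (Hr := H (x + h) ltac:(unfold h; lra)). rewrite H0, Rminus_0_r in Hh.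
 apply Rabs_def2 in Hh. assert (hn : h < 0) by (unfold h; lra).
 assert (0 <= g (x + h) / h).
 { replace (g (x + h) / h) with ((- g (x + h)) * / (- h)) by (field; lra).
  mul_pos. lra. pos. }
 lra.
Qed.

(* Compare [f] at points symmetric with respect to the circle of radius 2 about [c]:
  the quotient has modulus one on that circle, so three circles controls its radial derivative. *)
Lemma log_derivative_lower_bound (U : C -> Prop) (f : C -> C) (lam tau M : R) (l : C) :
 let c := (lam + 2, tau) : C in
 hol 2 U f -> (forall z, f (Cconj z) = Cconj (f z)) ->
 (forall s, 4 / 3 <= Cmod (s - c) <= 2 -> U s /\ f s <> RtoC 0) ->
 (forall s, 2 <= Cmod (s - Cconj c) <= 3 -> U s) ->
 (forall s s', Cmod (s - Cconj c) = 3 -> Cmod (s' - c) = 4 / 3 -> Cmod (f s) <= exp M * Cmod (f s')) ->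
 cdiff f (lam, tau) l ->
 - M / (4 * ln (3 / 2)) <= Re (l / f (lam, tau))%C.
Proof.
 intros c Hf Hsym Hin Hout HM Hl.
 set (V := fun w : C => ln (4 / 3) <= Re w <= ln 2).
 (* Reflection in the circle of radius 2 about c sends c + z to c + 4 / conj z. Composed with
    complex conjugation, under which f is symmetric, it becomes [g'], which is holomorphic in w. *)
 set (g := fun w => (c + cexp w)%C). set (g' := fun w => (Cconj c + 4 * cexp (- w))%C).
 assert (L43 : ln (4 / 3) < ln 2) by (apply ln_increasing; lra).
 assert (Hg : forall w, Cmod (g w - c) = exp (Re w)).
 { intros w. unfold g. replace (c + cexp w - c)%C with (cexp w) by ring. apply Cmod_cexp. }
 assert (Hg' : forall w, Cmod (g' w - Cconj c) = 4 * exp (- Re w)).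
 { intros w. unfold g'. replace (Cconj c + 4 * cexp (- w) - Cconj c)%C with (4 * cexp (- w))%C by ring.
  rewrite Cmod_mult, Cmod_cexp, Cmod_R, Rabs_pos_eq by lra. reflexivity. }
 assert (ev : forall w, V w -> 4 / 3 <= exp (Re w) <= 2).
 { intros w [H1 H2]. replace 2 with (exp (ln 2)) by (apply exp_ln; lra).
  replace (4 / 3) with (exp (ln (4 / 3))) by (apply exp_ln; lra). split; now apply exp_le. }
 assert (ev' : forall w, V w -> 2 <= 4 * exp (- Re w) <= 3).
 { intros w Hw. destruct (ev w Hw) as [H1 H2]. rewrite exp_Ropp.
  split; apply Rmult_le_reg_r with (exp (Re w)); try lra; rewrite Rmult_assoc, Rinv_l; lra. }
 assert (Hd1 : forall w, V w -> U (g w) /\ f (g w) <> RtoC 0).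
 { intros w Hw. apply Hin. rewrite Hg. auto. }
 assert (Hd2 : forall w, V w -> U (g' w)).
 { intros w Hw. apply Hout. rewrite Hg'. auto. }
 set (q := fun w => (f (g' w) / f (g w))%C).
 assert (hq : hol 2 V q).
 { unfold q. apply hol_div.
  - intros w Hw. apply Hd1; auto.
  - apply hol_comp with U; auto. unfold g'. apply hol_plus. apply hol_const. apply hol_mult. apply hol_const.
   apply hol_exp_comp. apply hol_opp, hol_id.
  - apply hol_comp with U; auto. apply Hd1. unfold g. apply hol_plus. apply hol_const. apply hol_cexp. }
 (* Periodicity in the imaginary direction makes [q] bounded on the whole strip, as the three lines
    theorem demands. *)
 assert (HK : exists K, forall w, V w -> Cmod (q w) <= K).
 { destruct (rectangle_max (fun x y => Re (q (x, y)) ^ 2 + Im (q (x, y)) ^ 2) (ln (4 / 3)) (ln 2) 0 (2 * PI)) as [x0 [y0 [Hx0 [Hy0 Hmax]]]].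
  - lra.
  - pose proof PI_RGT_0; lra.
  - intros x y Hx Hy. destruct (continuity_2d_ccont q x y) as [C1 C2].
   { eapply hol_cont. exact hq. exact Hx. }
   apply continuity_2d_pt_ext with (fun u v => (Re (q (u, v)) * Re (q (u, v)) + Im (q (u, v)) * Im (q (u, v)))).
   { intros; ring. }
   apply continuity_2d_pt_plus; apply continuity_2d_pt_mult; auto.
  - exists (Cmod (q (x0, y0))). intros w Hw.
   destruct (cexp_reduce w) as [y [Hy Ey]].
   assert (Eq : q w = q (Re w, y)).
   { unfold q, g, g'. rewrite !cexp_opp, Ey. reflexivity. }
   rewrite Eq. specialize (Hmax (Re w) y Hw Hy). rewrite <- !Cmod_sq in Hmax.
   pose proof (Cmod_ge_0 (q (Re w, y))). pose proof (Cmod_ge_0 (q (x0, y0))). nra. }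
 destruct HK as [K HK].
 assert (TL := three_lines V q (ln (4 / 3)) (ln 2) K M 0 L43 hq (fun z Hz => Hz) HK).
 assert (T1 : forall z, Re z = ln (4 / 3) -> Cmod (q z) <= exp M).
 { intros z Hz. assert (Vz : V z) by (unfold V; lra). unfold q. rewrite Cmod_div by (apply Hd1; auto).
  assert (0 < Cmod (f (g z))) by (apply Cmod_gt_0, Hd1; auto).
  apply Rmult_le_reg_r with (Cmod (f (g z))); auto. unfold Rdiv. rewrite Rmult_assoc, Rinv_l, Rmult_1_r by lra.
  apply HM.
  - rewrite Hg', Hz, exp_Ropp, exp_ln by lra. field.
  - rewrite Hg, Hz, exp_ln by lra. reflexivity. }
 assert (T2 : forall z, Re z = ln 2 -> Cmod (q z) <= exp 0).
 { intros z Hz. assert (Vz : V z) by (unfold V; lra). unfold q. rewrite Cmod_div by (apply Hd1; auto).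
  assert (E : g' z = Cconj (g z)).
  { unfold g, g'. rewrite cexp_opp.
   assert (P : (cexp z * Cconj (cexp z) = 4)%C).
   { assert (P := Cmod2_conj (cexp z)). rewrite Cmod_cexp, Hz, exp_ln in P by lra. rewrite <- P. apply C_eq; simpl; ring. }
   pose proof (cexp_neq_0 z). rewrite <- P.
   replace (cexp z * Cconj (cexp z) * / cexp z)%C with (Cconj (cexp z)) by (field; auto).
   apply C_eq; csimp; ring. }
  rewrite E, Hsym, Cmod_conj, exp_0. right. unfold Rdiv. apply Rinv_r. apply Rgt_not_eq. apply Cmod_gt_0, Hd1; auto. }
 specialize (TL T1 T2). clear T1 T2 HK.
 (* The logarithm of |f| at distance s to the left of the centre; s = 2 is the point (lam, tau). *)
 set (L := fun s => ln (Cmod (f (c + RtoC s * (-1))%C))).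
 set (k := M / ln (3 / 2)).
 assert (L32 : ln 2 - ln (4 / 3) = ln (3 / 2)).
 { rewrite <- ln_div by lra. f_equal; lra. }
 assert (L32p : 0 < ln (3 / 2)) by lra.
 assert (Ec2 : (c + RtoC 2 * (-1))%C = (lam, tau)) by (unfold c; apply C_eq; csimp; ring).
 assert (H20 : f (c + RtoC 2 * (-1))%C <> RtoC 0).
 { apply Hin. replace (c + RtoC 2 * (-1) - c)%C with (RtoC (-2)) by (apply C_eq; csimp; ring).
  rewrite Cmod_R, Rabs_left; lra. }
 (* The hypotheses exclude zeros only up to radius 2, while the reflected points have radius 4/r
    slightly above 2; continuity at radius 2 keeps f away from 0 there. *)
 assert (Hnz : exists d, 0 < d < 1 / 2 /\ forall r, 2 - d <= r <= 2 -> f (c + RtoC (4 / r) * (-1))%C <> RtoC 0).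
 { rewrite Ec2 in H20. destruct (cdiff_cont _ _ _ Hl (Cmod (f (lam, tau))) ltac:(now apply Cmod_gt_0)) as [d [Hd Hc]].
  assert (Hm : 0 < Rmin d (1 / 2)) by (apply Rmin_pos; lra).
  pose proof (Rmin_l d (1 / 2)). pose proof (Rmin_r d (1 / 2)).
  exists (Rmin d (1 / 2) / 4). split. lra. intros r Hr E.
  specialize (Hc (c + RtoC (4 / r) * (-1))%C). rewrite E in Hc.
  replace (0 - f (lam, tau))%C with (- f (lam, tau))%C in Hc by ring. rewrite Cmod_opp in Hc.
  apply Rlt_irrefl with (Cmod (f (lam, tau))). apply Hc. rewrite <- Ec2.
  replace (c + RtoC (4 / r) * (-1) - (c + RtoC 2 * (-1)))%C with (RtoC (2 - 4 / r)) by (apply C_eq; csimp; ring).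
  rewrite Cmod_R. replace (2 - 4 / r) with (- (2 * (2 - r) / r)) by (field; lra). rewrite Rabs_Ropp, Rabs_pos_eq.
  - apply Rle_lt_trans with (2 * (2 - r) / 1). 2: lra.
   mono_l. lra. apply Rinv_le_contravar; lra.
  - mul_pos. lra. pos. }
 destruct Hnz as [d [Hd Hnz]].
 (* The three lines bound on the ray towards (lam, tau). Equality holds at r = 2, so the derivative
    2 W + k/2 of the left side there is nonnegative, which is the claim. *)
 assert (HG : forall r, 2 - d <= r <= 2 -> L (4 / r) - L r - k * (ln 2 - ln r) <= 0).
 { intros r Hr. assert (Hw : V (ln r, PI)).
  { unfold V; simpl. split.
   - destruct (Req_dec r (4 / 3)) as [->|N]. lra. left; apply ln_increasing; lra.
   - destruct (Req_dec r 2) as [->|N]. lra. left; apply ln_increasing; lra. }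
  assert (ce : cexp (ln r, PI) = RtoC (- r)).
  { rewrite exp_ln_cexp by lra. unfold cexp; simpl. rewrite exp_0, cos_PI, sin_PI. apply C_eq; simpl; ring. }
  assert (E1 : g (ln r, PI) = (c + RtoC r * (-1))%C).
  { unfold g. rewrite ce. apply C_eq; csimp; ring. }
  assert (E2 : g' (ln r, PI) = Cconj (c + RtoC (4 / r) * (-1))%C).
  { unfold g'. rewrite cexp_opp, ce, <- RtoC_inv by lra. apply C_eq; csimp; field; lra. }
  specialize (TL _ Hw). unfold q in TL. rewrite Cmod_div in TL by (apply Hd1; auto).
  destruct (Hd1 _ Hw) as [_ Hn]. rewrite E1 in *. rewrite E2, Hsym, Cmod_conj in TL. simpl in TL.
  set (A := Cmod (f (c + RtoC (4 / r) * (-1))%C)) in *. set (B := Cmod (f (c + RtoC r * (-1))%C)) in *.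
  assert (HB : 0 < B) by (apply Cmod_gt_0; auto).
  assert (HA : 0 < A) by (apply Cmod_gt_0; auto).
  assert (K1 : ln (A / B) <= k * (ln 2 - ln r)).
  { rewrite <- (ln_exp (k * (ln 2 - ln r))). 
   assert (TL' : A / B <= exp (k * (ln 2 - ln r))).
   { via TL. right. f_equal. unfold k. rewrite <- L32. field. lra. }
   destruct TL' as [T| ->]; [left; apply ln_increasing; auto; apply Rdiv_lt_0_compat; auto | lra]. }
  rewrite ln_div in K1 by auto. unfold L. fold A B. lra. }
 assert (DL : is_derive L 2 (- Re (l / f (lam, tau))%C)).
 { assert (D := ln_mod_derive f c (-1) l 2). rewrite Ec2 in D. specialize (D Hl). rewrite Ec2 in H20. specialize (D H20).
  replace (- Re (l / f (lam, tau))%C) with (Re (l * -1 / f (lam, tau))%C). exact D.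
  replace (l * -1 / f (lam, tau))%C with (- (l / f (lam, tau)))%C by (field; auto). apply Re_opp. }
 set (W := Re (l / f (lam, tau))%C) in *.
 assert (DG : is_derive (fun r => L (4 / r) - L r - k * (ln 2 - ln r)) 2 (2 * W + k / 2)).
 { replace (2 * W + k / 2) with ((-1) * (- W) - (- W) - k * (0 - / 2)) by field.
  apply (is_derive_minus (V := R_NormedModule)). apply (is_derive_minus (V := R_NormedModule)).
  - apply (is_derive_comp L (fun r => 4 / r)). replace (4 / 2) with 2 by field. exact DL.
   auto_derive. lra. field.
  - exact DL.
  - apply is_derive_scal. auto_derive; lra. }
 assert (D0 : 0 <= 2 * W + k / 2).
 { apply (derive_nonneg_left _ 2 _ d DG). lra. replace (4 / 2) with 2 by field. ring. exact HG. }
 replace (- M / (4 * ln (3 / 2))) with (- (k / 4)) by (unfold k; field; lra). lra.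
Qed.

(** * Complex functions of a real variable; the powers x^(-s) *)

Lemma rder_plus (F G : R -> C) (t : R) (a b : C) :
 rder F t a -> rder G t b -> rder (fun s => F s + G s)%C t (a + b)%C.
Proof.
 intros [A1 A2] [B1 B2]. split.
 - apply (is_derive_plus (V := R_NormedModule) _ _ _ _ _ A1 B1).
 - apply (is_derive_plus (V := R_NormedModule) _ _ _ _ _ A2 B2).
Qed.

Lemma rder_ext (F G : R -> C) (t : R) (a b : C) :
 (forall s, F s = G s) -> a = b -> rder F t a -> rder G t b.
Proof.
 intros E <- [A1 A2]. split.
 - apply is_derive_ext with (2 := A1). intros; now rewrite E.
 - apply is_derive_ext with (2 := A2). intros; now rewrite E.
Qed.

Lemma is_derive_Rmult (u v : R -> R) (t a b : R) :
 is_derive u t a -> is_derive v t b -> is_derive (fun s => u s * v s) t (a * v t + u t * b).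
Proof. intros A B. apply (is_derive_mult u v t a b A B). intros; apply Rmult_comm. Qed.

Lemma is_derive_Rplus (u v : R -> R) (t a b : R) :
 is_derive u t a -> is_derive v t b -> is_derive (fun s => u s + v s) t (a + b).
Proof. intros A B. apply (is_derive_plus (V := R_NormedModule) u v t a b A B). Qed.

Lemma is_derive_Rminus (u v : R -> R) (t a b : R) :
 is_derive u t a -> is_derive v t b -> is_derive (fun s => u s - v s) t (a - b).
Proof. intros A B. apply (is_derive_minus (V := R_NormedModule) u v t a b A B). Qed.

Lemma rder_mult (F G : R -> C) (t : R) (a b : C) :
 rder F t a -> rder G t b -> rder (fun s => F s * G s)%C t (a * G t + F t * b)%C.
Proof.
 intros [A1 A2] [B1 B2]. split.
 - apply is_derive_ext with (fun s => Re (F s) * Re (G s) - Im (F s) * Im (G s)). reflexivity.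
  replace (Re (a * G t + F t * b)%C) with ((Re a * Re (G t) + Re (F t) * Re b) - (Im a * Im (G t) + Im (F t) * Im b)) by (csimp; ring).
  apply is_derive_Rminus; apply is_derive_Rmult; auto.
 - apply is_derive_ext with (fun s => Re (F s) * Im (G s) + Im (F s) * Re (G s)). reflexivity.
  replace (Im (a * G t + F t * b)%C) with ((Re a * Im (G t) + Re (F t) * Im b) + (Im a * Re (G t) + Im (F t) * Re b)) by (csimp; ring).
  apply is_derive_Rplus; apply is_derive_Rmult; auto.
Qed.

Lemma rder_RtoC (u : R -> R) (t a : R) : is_derive u t a -> rder (fun s => RtoC (u s)) t (RtoC a).
Proof.
 intros H. split; simpl. exact H. apply (is_derive_const (V := R_NormedModule)).
Qed.

Lemma rder_comp (F : R -> C) (u : R -> R) (t a : R) (l : C) :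
 is_derive u t a -> rder F (u t) l -> rder (fun s => F (u s)) t (RtoC a * l)%C.
Proof.
 intros H [A B]. split.
 - replace (Re (RtoC a * l)%C) with (a * Re l) by (csimp; ring).
  apply (is_derive_comp (fun s => Re (F s)) u t (Re l) a A H).
 - replace (Im (RtoC a * l)%C) with (a * Im l) by (csimp; ring).
  apply (is_derive_comp (fun s => Im (F s)) u t (Im l) a B H).
Qed.

Lemma rder_const (c : C) (t : R) : rder (fun _ => c) t 0.
Proof. split; apply (is_derive_const (V := R_NormedModule)). Qed.

Lemma rder_cont (F : R -> C) (t : R) (l : C) : rder F t l ->
 continuous (fun s => Re (F s)) t /\ continuous (fun s => Im (F s)) t.
Proof.
 intros [A B]. split; apply (ex_derive_continuous (V := R_NormedModule)); eexists; eauto.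
Qed.

(* [xpow x s] is x^(-s). *)
Definition xpow (x : R) (s : C) : C := cexp (- s * (ln x)).

Lemma Cmod_xpow (x : R) (s : C) : Cmod (xpow x s) = exp (- Re s * ln x).
Proof. unfold xpow. rewrite Cmod_cexp. f_equal. csimp. ring. Qed.

Lemma xpow_plus (x : R) (s t : C) : xpow x (s + t) = (xpow x s * xpow x t)%C.
Proof. unfold xpow. rewrite <- cexp_plus. f_equal. ring. Qed.

Lemma xpow_1 (x : R) : 0 < x -> xpow x 1 = RtoC (/ x).
Proof.
 intros H. unfold xpow. replace (- (1) * (ln x))%C with (RtoC (- ln x)) by (apply C_eq; csimp; ring).
 rewrite cexp_R, exp_Ropp, exp_ln; auto.
Qed.

Lemma xpow_m1 (x : R) : 0 < x -> xpow x (- (1)) = RtoC x.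
Proof.
 intros H. unfold xpow. replace (- - (1) * (ln x))%C with (RtoC (ln x)) by (apply C_eq; csimp; ring).
 rewrite cexp_R, exp_ln; auto.
Qed.

Lemma xpow_x1 (s : C) : xpow 1 s = 1%C.
Proof. unfold xpow. rewrite ln_1. replace (- s * RtoC 0)%C with (RtoC 0) by ring. apply cexp_0. Qed.

Lemma xpow_mult (x y : R) (s : C) : 0 < x -> 0 < y -> xpow (x * y) s = (xpow x s * xpow y s)%C.
Proof.
 intros. unfold xpow. rewrite <- cexp_plus, ln_mult, RtoC_plus by auto. f_equal. ring.
Qed.

Lemma xpow_conj (x : R) (s : C) : xpow x (Cconj s) = Cconj (xpow x s).
Proof. unfold xpow. rewrite <- cexp_conj. f_equal. apply C_eq; csimp; ring. Qed.

Lemma rder_xpow (s : C) (x : R) : 0 < x -> rder (fun t => xpow t s) x (- s * xpow x (s + 1))%C.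
Proof.
 intros Hx. unfold xpow at 1.
 apply rder_ext with (F := fun t => cexp (RtoC (ln t) * (- s))) (a := (RtoC (/ x) * (- s * cexp (RtoC (ln x) * (- s))))%C).
 - intros t. f_equal. ring.
 - rewrite xpow_plus, xpow_1 by auto. unfold xpow.
  replace (- s * RtoC (ln x))%C with (RtoC (ln x) * - s)%C by ring. ring.
 - apply (rder_comp (fun l => cexp (RtoC l * (- s))) ln x (/ x)).
  apply is_derive_Reals, derivable_pt_lim_ln; auto. apply rder_cexp_line.
Qed.

(** * Series of complex numbers *)

Fixpoint csum (u : nat -> C) (N : nat) : C :=
 match N with O => 0%C | S n => (csum u n + u n)%C end.

Fixpoint rsum (u : nat -> R) (N : nat) : R :=
 match N with O => 0 | S n => rsum u n + u n end.

Lemma csum_ext (u v : nat -> C) (N : nat) : (forall n, (n < N)%nat -> u n = v n) -> csum u N = csum v N.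
Proof.
 induction N as [|N IH]; intros H; simpl; auto. rewrite IH, H; auto.
Qed.
Lemma rsum_ext (u v : nat -> R) (N : nat) : (forall n, (n < N)%nat -> u n = v n) -> rsum u N = rsum v N.
Proof.
 induction N as [|N IH]; intros H; simpl; auto. rewrite IH, H; auto.
Qed.
Lemma csum_plus (u v : nat -> C) (N : nat) : csum (fun n => u n + v n)%C N = (csum u N + csum v N)%C.
Proof. induction N as [|N IH]; simpl. ring. rewrite IH. ring. Qed.
Lemma csum_scal (c : C) (u : nat -> C) (N : nat) : csum (fun n => c * u n)%C N = (c * csum u N)%C.
Proof. induction N as [|N IH]; simpl. ring. rewrite IH. ring. Qed.
Lemma rsum_plus (u v : nat -> R) (N : nat) : rsum (fun n => u n + v n) N = rsum u N + rsum v N.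
Proof. induction N as [|N IH]; simpl. ring. rewrite IH. ring. Qed.
Lemma rsum_scal (c : R) (u : nat -> R) (N : nat) : rsum (fun n => c * u n) N = c * rsum u N.
Proof. induction N as [|N IH]; simpl. ring. rewrite IH. ring. Qed.
Lemma rsum_le (u v : nat -> R) (N : nat) : (forall n, (n < N)%nat -> u n <= v n) -> rsum u N <= rsum v N.
Proof.
 induction N as [|N IH]; intros H; simpl. lra. assert (A := H N ltac:(lia)).
 assert (rsum u N <= rsum v N) by (apply IH; auto). lra.
Qed.
Lemma rsum_nonneg (u : nat -> R) (N : nat) : (forall n, (n < N)%nat -> 0 <= u n) -> 0 <= rsum u N.
Proof.
 induction N as [|N IH]; intros H; simpl. lra. assert (A := H N ltac:(lia)).
 assert (0 <= rsum u N) by (apply IH; auto). lra.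
Qed.
Lemma rsum_const (c : R) (N : nat) : rsum (fun _ => c) N = INR N * c.
Proof. induction N as [|N IH]. simpl; ring. simpl rsum. rewrite IH, S_INR. ring. Qed.
Lemma csum_Cmod (u : nat -> C) (N : nat) : Cmod (csum u N) <= rsum (fun n => Cmod (u n)) N.
Proof.
 induction N as [|N IH]; simpl. rewrite Cmod_0; lra.
 via Cmod_triangle. lra.
Qed.
Lemma csum_app (u : nat -> C) (M N : nat) : csum u (M + N) = (csum u M + csum (fun n => u (M + n)%nat) N)%C.
Proof.
 induction N as [|N IH]. rewrite Nat.add_0_r; simpl; ring.
 rewrite Nat.add_succ_r. simpl. rewrite IH. ring.
Qed.
Lemma rsum_app (u : nat -> R) (M N : nat) : rsum u (M + N) = rsum u M + rsum (fun n => u (M + n)%nat) N.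
Proof.
 induction N as [|N IH]. rewrite Nat.add_0_r; simpl; ring.
 rewrite Nat.add_succ_r. simpl. rewrite IH. ring.
Qed.
Lemma Re_csum (u : nat -> C) (N : nat) : Re (csum u N) = rsum (fun n => Re (u n)) N.
Proof. induction N as [|N IH]; simpl. reflexivity. rewrite <- IH. reflexivity. Qed.
Lemma Im_csum (u : nat -> C) (N : nat) : Im (csum u N) = rsum (fun n => Im (u n)) N.
Proof. induction N as [|N IH]; simpl. reflexivity. rewrite <- IH. reflexivity. Qed.
Lemma rsum_sum_n (u : nat -> R) (N : nat) : rsum u (S N) = sum_n u N.
Proof.
 induction N as [|N IH]. simpl. rewrite sum_O. ring.
 rewrite sum_Sn, <- IH. reflexivity.
Qed.

Definition ctends (u : nat -> C) (l : C) : Prop :=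
 forall eps, 0 < eps -> exists N, forall n, (N <= n)%nat -> Cmod (u n - l) < eps.

Lemma ctends_unique (u : nat -> C) (a b : C) : ctends u a -> ctends u b -> a = b.
Proof.
 intros Ha Hb. destruct (Req_dec (Cmod (a - b)) 0) as [E|E].
 { apply Cmod_eq_0 in E. replace a with (a - b + b)%C by ring. rewrite E; ring. }
 exfalso. pose proof (Cmod_ge_0 (a - b)).
 destruct (Ha (Cmod (a - b) / 2)) as [N1 H1]. lra.
 destruct (Hb (Cmod (a - b) / 2)) as [N2 H2]. lra.
 specialize (H1 (N1 + N2)%nat ltac:(lia)). specialize (H2 (N1 + N2)%nat ltac:(lia)).
 assert (T := Cmod_triangle_minus (u (N1 + N2)%nat - b) (u (N1 + N2)%nat - a)).
 replace (u (N1 + N2)%nat - b - (u (N1 + N2)%nat - a))%C with (a - b)%C in T by ring. lra.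
Qed.

Lemma ctends_plus (u v : nat -> C) (a b : C) : ctends u a -> ctends v b -> ctends (fun n => u n + v n)%C (a + b)%C.
Proof.
 intros Ha Hb eps He. destruct (Ha (eps / 2)) as [N1 H1]. lra. destruct (Hb (eps / 2)) as [N2 H2]. lra.
 exists (N1 + N2)%nat. intros n Hn. specialize (H1 n ltac:(lia)). specialize (H2 n ltac:(lia)).
 replace (u n + v n - (a + b))%C with ((u n - a) + (v n - b))%C by ring.
 eapply Rle_lt_trans. apply Cmod_triangle. lra.
Qed.

Lemma ctends_const (a : C) : ctends (fun _ => a) a.
Proof. intros eps He. exists O. intros. replace (a - a)%C with (RtoC 0) by ring. rewrite Cmod_0; lra. Qed.

Lemma ctends_scal (c : C) (u : nat -> C) (a : C) : ctends u a -> ctends (fun n => c * u n)%C (c * a)%C.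
Proof.
 intros Ha eps He. pose proof (Cmod_ge_0 c). destruct (Ha (eps / (Cmod c + 1))) as [N H1]. pos.
 exists N. intros n Hn. specialize (H1 n Hn). replace (c * u n - c * a)%C with (c * (u n - a))%C by ring.
 rewrite Cmod_mult. pose proof (Cmod_ge_0 (u n - a)).
 apply Rmult_lt_compat_r with (r := Cmod c + 1) in H1; [|lra].
 unfold Rdiv in H1. rewrite Rmult_assoc, Rinv_l in H1 by lra. nra.
Qed.

Lemma ctends_ext (u v : nat -> C) (a : C) : (forall n, u n = v n) -> ctends u a -> ctends v a.
Proof. intros E H eps He. destruct (H eps He) as [N HN]. exists N. intros n Hn. rewrite <- E; auto. Qed.

Lemma ctends_sub (u : nat -> C) (a : C) (k : nat -> nat) :
 (forall n, (n <= k n)%nat) -> ctends u a -> ctends (fun n => u (k n)) a.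
Proof. intros E H eps He. destruct (H eps He) as [N HN]. exists N. intros n Hn. apply HN. specialize (E n). lia. Qed.


Lemma ctends_bound (u : nat -> C) (a : C) (B : R) (N : nat) :
 (forall n, (N <= n)%nat -> Cmod (u n) <= B) -> ctends u a -> Cmod a <= B.
Proof.
 intros H Ha. apply Rnot_lt_le. intros K. destruct (Ha (Cmod a - B)) as [M HM]. lra.
 specialize (HM (N + M)%nat ltac:(lia)). specialize (H (N + M)%nat ltac:(lia)).
 assert (T := Cmod_triangle_inv' a (u (N + M)%nat)). rewrite Cmod_minus_sym in T. lra.
Qed.

Definition CSer (u : nat -> C) : C := (Series (fun n => Re (u n)), Series (fun n => Im (u n))).

Lemma CSer_ext (u v : nat -> C) : (forall n, u n = v n) -> CSer u = CSer v.
Proof. intros E. unfold CSer. f_equal; apply Series_ext; intros n; now rewrite E. Qed.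

Lemma is_series_of_tends (u : nat -> R) (l : R) :
 is_lim_seq (rsum u) l -> is_series u l.
Proof.
 intros H. apply is_lim_seq_incr_1 in H. unfold is_series.
 apply (is_lim_seq_ext (fun n => rsum u (S n)) (sum_n u)) in H. exact H. intros; apply rsum_sum_n.
Qed.

Lemma ctends_CSer_of (u : nat -> C) (l : C) : ctends (csum u) l -> CSer u = l.
Proof.
 intros H. destruct l as [x y]. unfold CSer. f_equal; apply is_series_unique, is_series_of_tends.
 - apply is_lim_seq_spec. intros eps. destruct (H eps (cond_pos eps)) as [N HN]. exists N. intros n Hn.
  eapply Rle_lt_trans; [|apply (HN n Hn)]. rewrite <- Re_csum.
  replace (Re (csum u n) - x) with (Re (csum u n - (x, y))%C) by reflexivity. apply re_le_Cmod.
 - apply is_lim_seq_spec. intros eps. destruct (H eps (cond_pos eps)) as [N HN]. exists N. intros n Hn.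
  eapply Rle_lt_trans; [|apply (HN n Hn)]. rewrite <- Im_csum.
  replace (Im (csum u n) - y) with (Im (csum u n - (x, y))%C) by reflexivity. apply Im_le_Cmod.
Qed.

Lemma CSer_ctends (u : nat -> C) (v : nat -> R) :
 (forall n, Cmod (u n) <= v n) -> ex_series v -> ctends (csum u) (CSer u).
Proof.
 intros Hb Hv.
 assert (E1 : ex_series (fun n => Re (u n))).
 { apply (ex_series_le (K := R_AbsRing) (V := R_CompleteNormedModule)) with (b := v); auto.
  intros n. via re_le_Cmod. apply Hb. }
 assert (E2 : ex_series (fun n => Im (u n))).
 { apply (ex_series_le (K := R_AbsRing) (V := R_CompleteNormedModule)) with (b := v); auto.
  intros n. via Im_le_Cmod. apply Hb. }
 apply Series_correct in E1. apply Series_correct in E2.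
 intros eps He.
 assert (F1 : is_lim_seq (sum_n (fun n => Re (u n))) (Series (fun n => Re (u n)))) by exact E1.
 assert (F2 : is_lim_seq (sum_n (fun n => Im (u n))) (Series (fun n => Im (u n)))) by exact E2.
 apply is_lim_seq_spec in F1. apply is_lim_seq_spec in F2.
 destruct (F1 (mkposreal (eps / 2) ltac:(lra))) as [N1 H1]. destruct (F2 (mkposreal (eps / 2) ltac:(lra))) as [N2 H2].
 simpl in H1, H2.
 exists (S (N1 + N2)). intros n Hn. destruct n as [|n]. lia.
 specialize (H1 n ltac:(lia)). specialize (H2 n ltac:(lia)).
 eapply Rle_lt_trans. apply Cmod_le_abs. csimp.
 rewrite Re_csum, Im_csum, !rsum_sum_n. unfold CSer. csimp. lra.
Qed.

Lemma rsum_le_Series (v : nat -> R) (N : nat) : (forall n, 0 <= v n) -> ex_series v -> rsum v N <= Series v.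
Proof.
 intros Hp Hv. apply Series_correct in Hv.
 apply Rle_trans with (rsum v (S N)). simpl. specialize (Hp N). lra.
 rewrite rsum_sum_n. apply (is_lim_seq_incr_compare (sum_n v)). exact Hv.
 intros n. rewrite sum_Sn. unfold plus; simpl. specialize (Hp (S n)). lra.
Qed.

Lemma CSer_bound (u : nat -> C) (v : nat -> R) :
 (forall n, Cmod (u n) <= v n) -> ex_series v -> Cmod (CSer u) <= Series v.
Proof.
 intros Hb Hv. apply (ctends_bound (csum u) _ _ O). 2: now apply CSer_ctends with v.
 intros n _. via csum_Cmod. le_trans. apply rsum_le; intros; apply Hb.
 apply rsum_le_Series; auto. intros m. via Cmod_ge_0. apply Hb.
Qed.

Lemma ex_series_of_bounded (v : nat -> R) (B : R) :
 (forall n, 0 <= v n) -> (forall N, rsum v N <= B) -> ex_series v /\ Series v <= B.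
Proof.
 intros Hp HB.
 assert (E : ex_finite_lim_seq (sum_n v)).
 { apply ex_finite_lim_seq_incr with B.
  - intros n. rewrite sum_Sn. unfold plus; simpl. specialize (Hp (S n)). lra.
  - intros n. rewrite <- rsum_sum_n. apply HB. }
 destruct E as [l Hl]. split. exists l. exact Hl.
 rewrite (is_series_unique v l Hl).
 assert (T : Rbar_le l B).
 { apply is_lim_seq_le with (u := sum_n v) (v := fun _ => B); auto. intros n. rewrite <- rsum_sum_n. apply HB.
  apply is_lim_seq_const. }
 exact T.
Qed.

(** * Real powers and p-series *)

(** Comparison of a term with an integral: by the mean value theorem the right side is c^(-p) for
    some c between x and x + 1. Summed over x it telescopes. *)
Lemma power_step (p x : R) : 1 < p -> 0 < x ->
 exp (- p * ln (x + 1)) <= (exp ((1 - p) * ln x) - exp ((1 - p) * ln (x + 1))) / (p - 1).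
Proof.
 intros Hp Hx.
 destruct (MVT_gen (fun y => exp ((1 - p) * ln y)) x (x + 1) (fun y => (1 - p) / y * exp ((1 - p) * ln y))) as [c [Hc E]].
 - intros y Hy. rewrite Rmin_left, Rmax_right in Hy by lra. auto_derive. lra. field. lra.
 - intros y Hy. rewrite Rmin_left, Rmax_right in Hy by lra.
  apply derivable_continuous_pt. exists ((1 - p) / y * exp ((1 - p) * ln y)). apply is_derive_Reals. auto_derive. lra. field. lra.
 - rewrite Rmin_left, Rmax_right in Hc by lra.
  replace (exp ((1 - p) * ln x) - exp ((1 - p) * ln (x + 1))) with (- ((1 - p) / c * exp ((1 - p) * ln c) * (x + 1 - x))) by lra.
  assert (E2 : - ((1 - p) / c * exp ((1 - p) * ln c) * (x + 1 - x)) / (p - 1) = exp (- p * ln c)).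
  { replace ((1 - p) * ln c) with (- p * ln c + ln c) by ring. rewrite exp_plus, exp_ln by lra. field. lra. }
  rewrite E2. apply exp_le. assert (ln c <= ln (x + 1)).
  { destruct (Req_dec c (x + 1)) as [->|N]. lra. left; apply ln_increasing; lra. }
  nra.
Qed.

Lemma INR_S_pos (n : nat) : 0 < INR (S n).
Proof. apply lt_0_INR. lia. Qed.

Lemma rsum_pow_tail (p : R) (M N : nat) : 1 < p ->
 rsum (fun n => exp (- p * ln (INR (S (S (M + n)))))) N <= exp ((1 - p) * ln (INR (S M))) / (p - 1).
Proof.
 intros Hp.
 assert (H : rsum (fun n => exp (- p * ln (INR (S (S (M + n)))))) N
   <= (exp ((1 - p) * ln (INR (S M))) - exp ((1 - p) * ln (INR (S (M + N))))) / (p - 1)).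
 { induction N as [|N IH].
  - simpl rsum. rewrite Nat.add_0_r. right. field. lra.
  - simpl rsum. assert (T := power_step p (INR (S (M + N))) Hp (INR_S_pos _)).
   rewrite <- S_INR in T. replace (S (M + S N)) with (S (S (M + N))) by lia.
   apply Rle_trans with (1 := Rplus_le_compat _ _ _ _ IH T). right. field. lra. }
 via H. unfold Rdiv. mono_r. pos.
 pose proof (exp_pos ((1 - p) * ln (INR (S (M + N))))). lra.
Qed.

Definition pw (p : R) (n : nat) : R := exp (- p * ln (INR (S n))).

Lemma pw_pos (p : R) (n : nat) : 0 < pw p n. Proof. pos. Qed.

Lemma rsum_pw_le (p : R) (N : nat) : 1 < p -> rsum (pw p) N <= 1 + / (p - 1).
Proof.
 intros Hp. assert (0 < / (p - 1)) by pos.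
 destruct N as [|N]. simpl; lra.
 replace (S N) with (1 + N)%nat by lia. rewrite rsum_app.
 apply Rplus_le_compat.
 - simpl. unfold pw. simpl. rewrite ln_1, Rmult_0_r, exp_0. lra.
 - assert (T := rsum_pow_tail p 0 N Hp).
  replace (ln (INR 1)) with 0 in T by (simpl; now rewrite ln_1). rewrite Rmult_0_r, exp_0 in T. unfold Rdiv in T.
  rewrite Rmult_1_l in T. le_trans; [|exact T]. apply Req_le, rsum_ext. reflexivity.
Qed.

Lemma ex_series_pw (p : R) : 1 < p -> ex_series (pw p) /\ Series (pw p) <= 1 + / (p - 1).
Proof.
 intros Hp. apply ex_series_of_bounded. intros; left; apply pw_pos. intros; now apply rsum_pw_le.
Qed.

Lemma exp_pow_nat (x : R) (m : nat) : exp x ^ m = exp (INR m * x).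
Proof.
 induction m as [|m IH]. simpl. rewrite Rmult_0_l, exp_0; auto.
 rewrite <- tech_pow_Rmult, IH, <- exp_plus, S_INR. f_equal. ring.
Qed.

(* Logarithms are absorbed in an arbitrarily small power. *)
Lemma pow_le_exp (d l : R) (m : nat) : 0 < d -> 0 <= l -> l ^ m <= (INR (S m) / d) ^ m * exp (d * l).
Proof.
 intros Hd Hl. set (k := INR (S m)). assert (Hk : 0 < k) by apply INR_S_pos.
 assert (A : l <= k / d * exp (d * l / k)).
 { assert (T := exp_ineq1_le (d * l / k)).
  apply Rle_trans with (k / d * (d * l / k)). right; field; lra.
  mono_l. left; apply Rdiv_lt_0_compat; auto. lra. }
 apply Rle_trans with ((k / d * exp (d * l / k)) ^ m). apply pow_incr; lra.
 rewrite Rpow_mult_distr. mono_l. apply pow_le. left; apply Rdiv_lt_0_compat; auto.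
 rewrite exp_pow_nat. apply exp_le.
 assert (INR m <= k) by (unfold k; rewrite S_INR; lra).
 replace (INR m * (d * l / k)) with (d * l * (INR m / k)) by (field; lra).
 assert (INR m / k <= 1) by (apply Rmult_le_reg_r with k; auto; unfold Rdiv; rewrite Rmult_assoc, Rinv_l; lra).
 pose proof (pos_INR m). assert (0 <= d * l) by (mul_pos; lra).
 apply Rle_trans with (d * l * 1). mono_l; auto. lra.
Qed.

(** * Dirichlet-type functionals and the zeta function *)

Definition contpos (g : R -> R) : Prop := forall x, 0 < x -> continuous g x.

(* [L n] is a linear functional bounded by the sup norm over [[n+1, n+2]]; both point evaluation
  (Dirichlet series) and weighted integrals over unit intervals are of this kind. *)
Definition local_fun (L : nat -> (R -> R) -> R) : Prop :=
 (forall n g h c d, contpos g -> contpos h ->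
   L n (fun x => c * g x + d * h x) = c * L n g + d * L n h) /\
 (forall n g B, contpos g -> (forall x, INR (S n) <= x <= INR (S n) + 1 -> Rabs (g x) <= B) ->
   Rabs (L n g) <= B) /\
 (forall n g h, (forall x, g x = h x) -> L n g = L n h).

Definition contposC (g : R -> C) : Prop :=
 contpos (fun x => Re (g x)) /\ contpos (fun x => Im (g x)).

Definition LC (L : nat -> (R -> R) -> R) (n : nat) (g : R -> C) : C :=
 (L n (fun x => Re (g x)), L n (fun x => Im (g x))).

Lemma continuous_lin2 (g h : R -> R) (c d x : R) :
 continuous g x -> continuous h x -> continuous (fun y => c * g y + d * h y) x.
Proof.
 intros Hg Hh. apply (continuous_plus (V := R_NormedModule)).
 apply (continuous_scal_r c g x Hg). apply (continuous_scal_r d h x Hh).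
Qed.

Lemma contpos_lin2 (g h : R -> R) (c d : R) :
 contpos g -> contpos h -> contpos (fun y => c * g y + d * h y).
Proof. intros Hg Hh x Hx. apply continuous_lin2; auto. Qed.

Lemma contposC_lin (g h : R -> C) (c : C) :
 contposC g -> contposC h -> contposC (fun x => g x + c * h x)%C.
Proof.
 intros [A B] [A' B']. split.
 - intros x Hx. apply continuous_ext with (fun y => 1 * Re (g y) + 1 * (Re c * Re (h y) + - Im c * Im (h y))).
  intros; csimp; toR; ring. apply continuous_lin2. now apply A. apply contpos_lin2; auto.
 - intros x Hx. apply continuous_ext with (fun y => 1 * Im (g y) + 1 * (Re c * Im (h y) + Im c * Re (h y))).
  intros; csimp; toR; ring. apply continuous_lin2. now apply B. apply contpos_lin2; auto.
Qed.

Lemma LC_lin (L : nat -> (R -> R) -> R) (n : nat) (g h : R -> C) (c : C) :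
 local_fun L -> contposC g -> contposC h ->
 LC L n (fun x => g x + c * h x)%C = (LC L n g + c * LC L n h)%C.
Proof.
 intros [HL [_ HE]] [A B] [A' B']. unfold LC. apply C_eq; csimp.
 - rewrite (HE n _ (fun y => 1 * Re (g y) + 1 * (Re c * Re (h y) + - Im c * Im (h y)))).
  2: intros; csimp; ring.
  rewrite HL, HL; auto. ring. apply contpos_lin2; auto.
 - rewrite (HE n _ (fun y => 1 * Im (g y) + 1 * (Re c * Im (h y) + Im c * Re (h y)))).
  2: intros; csimp; ring.
  rewrite HL, HL; auto. ring. apply contpos_lin2; auto.
Qed.

Lemma LC_scal (L : nat -> (R -> R) -> R) (n : nat) (h : R -> C) (c : C) :
 local_fun L -> contposC h -> LC L n (fun x => c * h x)%C = (c * LC L n h)%C.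
Proof.
 intros HL Hh.
 assert (E := LC_lin L n h h (c - 1) HL Hh Hh).
 replace (c * LC L n h)%C with (LC L n h + (c - 1) * LC L n h)%C by ring. rewrite <- E.
 unfold LC. f_equal; apply HL; intros; f_equal; ring.
Qed.

(** The value is tested against its own direction, as for the mean value inequality, so passing to
    complex functions costs no factor. *)
Lemma LC_bound (L : nat -> (R -> R) -> R) (n : nat) (g : R -> C) (B : R) :
 local_fun L -> contposC g -> (forall x, INR (S n) <= x <= INR (S n) + 1 -> Cmod (g x) <= B) ->
 Cmod (LC L n g) <= B.
Proof.
 intros HL [A1 A2] HB. set (Z := LC L n g).
 assert (B0 : 0 <= B).
 { via Cmod_ge_0. apply (HB (INR (S n))). lra. }
 destruct (Req_dec (Cmod Z) 0) as [E|E]. lra.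
 assert (HZ : 0 < Cmod Z) by (pose proof (Cmod_ge_0 Z); lra).
 assert (S1 : Cmod Z ^ 2 = L n (fun x => Re Z * Re (g x) + Im Z * Im (g x))).
 { destruct HL as [HL _]. rewrite HL by auto. rewrite Cmod_sq. unfold Z at 2 4. unfold LC. csimp. 
  fold Z. unfold Z, LC. csimp. ring. }
 assert (S2 : Rabs (L n (fun x => Re Z * Re (g x) + Im Z * Im (g x))) <= Cmod Z * B).
 { apply HL. apply contpos_lin2; auto. intros x Hx.
  replace (Re Z * Re (g x) + Im Z * Im (g x)) with (Re (Cconj Z * g x)%C) by (csimp; ring).
  via re_le_Cmod. rewrite Cmod_mult, Cmod_conj. mono_l; auto. lra. }
 apply Rmult_le_reg_l with (Cmod Z); auto.
 replace (Cmod Z * Cmod Z) with (Cmod Z ^ 2) by ring. rewrite S1. via Rle_abs. exact S2.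
Qed.

(** The j-th derivative of x^(-s) with respect to s. *)
Definition Dfun (j : nat) (s : C) (x : R) : C := (RtoC ((- ln x) ^ j) * xpow x s)%C.

Definition IL (L : nat -> (R -> R) -> R) (g : R -> C) : C := CSer (fun n => LC L n g).

Lemma contposC_rder (g : R -> C) : (forall x, 0 < x -> exists l, rder g x l) -> contposC g.
Proof. intros H. split; intros x Hx; destruct (H x Hx) as [l Hl]; apply rder_cont in Hl; tauto. Qed.

Lemma Dfun_cont (j : nat) (s : C) : contposC (Dfun j s).
Proof.
 apply contposC_rder. intros x Hx. eexists. unfold Dfun. apply rder_mult.
 - apply rder_RtoC. auto_derive; auto.
 - apply rder_xpow; auto.
Qed.

Lemma ln_nonneg (x : R) : 1 <= x -> 0 <= ln x.
Proof. intros H. rewrite <- ln_1. destruct H as [H| <-]. left; apply ln_increasing; lra. lra. Qed.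

Lemma ln_le' (x y : R) : 0 < x -> x <= y -> ln x <= ln y.
Proof. intros Hx [H| ->]. left; now apply ln_increasing. lra. Qed.

Lemma INR_S_ge_1 (n : nat) : 1 <= INR (S n).
Proof. rewrite S_INR. pose proof (pos_INR n). lra. Qed.

Lemma pw_le_at (p x : R) (n : nat) : 0 <= p -> INR (S n) <= x -> exp (- p * ln x) <= pw p n.
Proof.
 intros Hp Hx. unfold pw. apply exp_le. pose proof (INR_S_pos n).
 assert (ln (INR (S n)) <= ln x) by (apply ln_le'; auto). nra.
Qed.

Lemma Dfun_bound (j n : nat) (s : C) (d x : R) : 0 < d -> d <= Re s -> INR (S n) <= x ->
 Cmod (Dfun j s x) <= (INR (S j) / d) ^ j * pw (Re s - d) n.
Proof.
 intros Hd Hs Hx. pose proof (INR_S_ge_1 n). assert (Hl : 0 <= ln x) by (apply ln_nonneg; lra).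
 unfold Dfun. rewrite Cmod_mult, Cmod_R, Cmod_xpow, <- RPow_abs, Rabs_Ropp, Rabs_pos_eq by auto.
 apply Rle_trans with ((INR (S j) / d) ^ j * exp (d * ln x) * exp (- Re s * ln x)).
 mono_r. pos. apply pow_le_exp; auto.
 rewrite Rmult_assoc, <- exp_plus. mono_l.
 apply pow_le. left. apply Rdiv_lt_0_compat; auto. apply INR_S_pos.
 replace (d * ln x + - Re s * ln x) with (- (Re s - d) * ln x) by ring. apply pw_le_at; lra.
Qed.

Lemma ex_series_scal_pw (c p : R) : 1 < p -> ex_series (fun n => c * pw p n).
Proof. intros Hp. apply (ex_series_scal c (pw p)). now apply ex_series_pw. Qed.

Lemma Series_scal_pw (c p : R) : Series (fun n => c * pw p n) = c * Series (pw p).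
Proof. apply Series_scal_l. Qed.

Lemma IL_tends (L : nat -> (R -> R) -> R) (j : nat) (s : C) : local_fun L -> 1 < Re s ->
 ctends (csum (fun n => LC L n (Dfun j s))) (IL L (Dfun j s)).
Proof.
 intros HL Hs. set (d := (Re s - 1) / 2).
 apply CSer_ctends with (fun n => (INR (S j) / d) ^ j * pw (Re s - d) n).
 - intros n. apply LC_bound; auto. apply Dfun_cont. intros x Hx. apply Dfun_bound; unfold d; lra.
 - apply ex_series_scal_pw. unfold d; lra.
Qed.

(** Termwise differentiation by a quadratic remainder: each term of the remainder is |h|^2 times a
    logarithm power times x^(-Re s) up to a small power of x, and these sum to a convergent
    series. *)
Lemma IL_derive (L : nat -> (R -> R) -> R) (j : nat) (s : C) : local_fun L -> 1 < Re s ->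
 cdiff (fun s => IL L (Dfun j s)) s (IL L (Dfun (S j) s)).
Proof.
 intros HL Hs. set (d := (Re s - 1) / 3). assert (Hd : 0 < d) by (unfold d; lra).
 set (c := (INR (S (j + 2)) / d) ^ (j + 2)).
 apply cdiff_of_quad with d (c * Series (pw (Re s - 2 * d))); auto.
 intros h Hh. pose proof (Cmod_ge_0 h).
 assert (Rh : Rabs (Re h) <= Cmod h) by apply re_le_Cmod. apply Rabs_le_between in Rh.
 assert (T : ctends (csum (fun n => LC L n (fun x => Dfun j (s + h) x + (-1) * (Dfun j s x + h * Dfun (S j) s x))%C))
   (IL L (Dfun j (s + h)) - IL L (Dfun j s) - h * IL L (Dfun (S j) s))%C).
 { replace (IL L (Dfun j (s + h)) - IL L (Dfun j s) - h * IL L (Dfun (S j) s))%C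
   with (IL L (Dfun j (s + h)) + (-1) * (IL L (Dfun j s) + h * IL L (Dfun (S j) s)))%C by ring.
  apply ctends_ext with (fun N => csum (fun n => LC L n (Dfun j (s + h))) N + (-1) * (csum (fun n => LC L n (Dfun j s)) N + h * csum (fun n => LC L n (Dfun (S j) s)) N))%C.
  - intros N. rewrite <- csum_scal, <- csum_plus, <- csum_scal, <- csum_plus. apply csum_ext. intros n _.
   rewrite (LC_lin L n (Dfun j (s + h)) (fun x => Dfun j s x + h * Dfun (S j) s x)%C); auto.
   rewrite (LC_lin L n (Dfun j s)); auto. apply Dfun_cont. apply Dfun_cont. apply Dfun_cont.
   apply contposC_lin; apply Dfun_cont.
  - apply ctends_plus. apply IL_tends; auto. csimp; unfold d in *; lra.
   apply ctends_scal. apply ctends_plus. apply IL_tends; auto. apply ctends_scal, IL_tends; auto. }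
 assert (B : forall n, Cmod (LC L n (fun x => Dfun j (s + h) x + (-1) * (Dfun j s x + h * Dfun (S j) s x))%C)
   <= (c * Cmod h ^ 2) * pw (Re s - 2 * d) n).
 { intros n. apply LC_bound; auto.
  - apply (contposC_lin (Dfun j (s + h)) (fun x => Dfun j s x + h * Dfun (S j) s x)%C). apply Dfun_cont.
   apply contposC_lin; apply Dfun_cont.
  - intros x [Hx _]. pose proof (INR_S_ge_1 n). assert (Hl : 0 <= ln x) by (apply ln_nonneg; lra).
   set (u := (- h * (ln x))%C).
   replace (Dfun j (s + h) x + (-1) * (Dfun j s x + h * Dfun (S j) s x))%C
    with (RtoC ((- ln x) ^ j) * xpow x s * (cexp u - 1 - u))%C.
   2:{ unfold Dfun. rewrite xpow_plus. unfold xpow at 2. unfold u. simpl pow. rewrite RtoC_mult, RtoC_opp.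
     change (cexp (- h * RtoC (ln x))) with (xpow x h). unfold xpow. ring. }
   rewrite !Cmod_mult, Cmod_R, Cmod_xpow, <- RPow_abs, Rabs_Ropp, Rabs_pos_eq by auto.
   assert (Cu : Cmod u = Cmod h * ln x).
   { unfold u. rewrite Cmod_mult, Cmod_opp, Cmod_R, Rabs_pos_eq; auto. }
   apply Rle_trans with (ln x ^ j * exp (- Re s * ln x) * ((Cmod h * ln x) ^ 2 * exp (d * ln x))).
   { mono_l. mul_pos. now apply pow_le. pos.
    via cexp_bound2. rewrite Cu. mono_l. apply pow2_ge_0. apply exp_le. nra. }
   apply Rle_trans with (Cmod h ^ 2 * (ln x ^ (j + 2) * (exp (- Re s * ln x) * exp (d * ln x)))).
   { right. rewrite pow_add, Rpow_mult_distr. ring. }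
   apply Rle_trans with (Cmod h ^ 2 * (c * exp (d * ln x) * (exp (- Re s * ln x) * exp (d * ln x)))).
   { mono_l. apply pow2_ge_0. mono_r.
    mul_pos; pos. apply pow_le_exp; auto. }
   replace (Cmod h ^ 2 * (c * exp (d * ln x) * (exp (- Re s * ln x) * exp (d * ln x))))
    with (c * Cmod h ^ 2 * (exp (d * ln x) * (exp (- Re s * ln x) * exp (d * ln x)))) by ring.
   mono_l. mul_pos. apply pow_le. left; apply Rdiv_lt_0_compat; auto. apply INR_S_pos. apply pow2_ge_0.
   rewrite <- !exp_plus. replace (d * ln x + (- Re s * ln x + d * ln x)) with (- (Re s - 2 * d) * ln x) by ring.
   apply pw_le_at; auto. unfold d; lra. }
 replace (c * Series (pw (Re s - 2 * d)) * Cmod h ^ 2) with (Series (fun n => (c * Cmod h ^ 2) * pw (Re s - 2 * d) n)).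
 2:{ rewrite Series_scal_pw. ring. }
 assert (Hp : 1 < Re s - 2 * d) by (unfold d; lra).
 cbv beta. rewrite (Cmult_comm (IL L (Dfun (S j) s)) h), <- (ctends_CSer_of _ _ T). apply CSer_bound; auto. apply ex_series_scal_pw; auto.
Qed.

Lemma IL_hol (L : nat -> (R -> R) -> R) (m j : nat) : local_fun L ->
 hol m (fun s => 1 < Re s) (fun s => IL L (Dfun j s)).
Proof.
 intros HL. revert j. induction m as [|m IH]; intros j. exact I.
 exists (fun s => IL L (Dfun (S j) s)). split. intros; apply IL_derive; auto. apply IH.
Qed.

Lemma IL_conj (L : nat -> (R -> R) -> R) (s : C) : local_fun L ->
 IL L (Dfun 0 (Cconj s)) = Cconj (IL L (Dfun 0 s)).
Proof.
 intros [HL [_ HE]]. unfold IL, CSer, LC. apply C_eq; csimp.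
 - apply Series_ext. intros n. csimp. apply HE. intros x. unfold Dfun. rewrite xpow_conj. csimp. simpl. ring.
 - rewrite <- Series_opp. apply Series_ext. intros n. csimp.
  assert (Cc : contpos (fun x => Im (Dfun 0 s x))) by (apply Dfun_cont).
  transitivity (L n (fun x => (-1) * Im (Dfun 0 s x) + 0 * Im (Dfun 0 s x))).
  + apply HE. intros x. unfold Dfun. rewrite xpow_conj. csimp. simpl. ring.
  + rewrite HL; auto. ring.
Qed.

Lemma IL_bound (L : nat -> (R -> R) -> R) (s : C) (p : R) : local_fun L -> 1 < p <= Re s ->
 Cmod (IL L (Dfun 0 s)) <= 1 + / (p - 1).
Proof.
 intros HL Hp. le_trans. 2: apply (ex_series_pw p); lra.
 apply CSer_bound. 2: apply ex_series_pw; lra.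
 intros n. apply LC_bound; auto. apply Dfun_cont. intros x Hx. unfold Dfun. simpl.
 rewrite Cmod_mult, Cmod_R, Rabs_R1, Rmult_1_l, Cmod_xpow.
 apply Rle_trans with (exp (- p * ln x)). apply exp_le. pose proof (INR_S_ge_1 n).
 assert (0 <= ln x) by (apply ln_nonneg; lra). nra. apply pw_le_at; lra.
Qed.

Definition Leval (n : nat) (g : R -> R) : R := g (INR (S n)).
(** The weight is the Peano kernel t (1 - t) of the trapezoidal rule, scaled to maximum 1 so that
    the functional is bounded by the sup norm. *)
Definition Ltrap (n : nat) (g : R -> R) : R := RInt (fun t => 4 * t * (1 - t) * g (INR (S n) + t)) 0 1.

Lemma Leval_local : local_fun Leval.
Proof.
 unfold Leval. repeat split; auto. intros n g B Hg H. apply H. lra.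
Qed.

Lemma Ltrap_cont (n : nat) (g : R -> R) (t : R) : contpos g -> 0 <= t <= 1 ->
 continuous (fun t => 4 * t * (1 - t) * g (INR (S n) + t)) t.
Proof.
 intros Hg Ht. apply (continuous_mult (K := R_AbsRing) (fun t => 4 * t * (1 - t)) (fun t => g (INR (S n) + t))).
 - apply (ex_derive_continuous (V := R_NormedModule)). auto_derive; auto.
 - apply (continuous_comp (fun t => INR (S n) + t) g).
  apply (ex_derive_continuous (V := R_NormedModule)). auto_derive; auto.
  apply Hg. pose proof (INR_S_pos n). lra.
Qed.

Lemma Ltrap_ex (n : nat) (g : R -> R) : contpos g -> ex_RInt (fun t => 4 * t * (1 - t) * g (INR (S n) + t)) 0 1.
Proof.
 intros Hg. apply (ex_RInt_continuous (V := R_CompleteNormedModule)). intros t Ht.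
 rewrite Rmin_left, Rmax_right in Ht by lra. apply Ltrap_cont; auto.
Qed.

Lemma Ltrap_local : local_fun Ltrap.
Proof.
 unfold Ltrap. repeat split.
 - intros n g h c d Hg Hh.
  apply is_RInt_unique.
  apply is_RInt_ext with (fun t => plus (scal c (4 * t * (1 - t) * g (INR (S n) + t))) (scal d (4 * t * (1 - t) * h (INR (S n) + t)))).
  { intros t _. unfold plus, scal; simpl; unfold mult; simpl. toR; ring. }
  apply (is_RInt_plus (V := R_NormedModule)); apply (is_RInt_scal (V := R_NormedModule));
   apply (RInt_correct (V := R_CompleteNormedModule)); now apply Ltrap_ex.
 - intros n g B Hg HB.
  apply Rle_trans with ((1 - 0) * B). 2: lra.
  apply abs_RInt_le_const. lra. now apply Ltrap_ex. intros t Ht.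
  rewrite Rabs_mult. rewrite <- (Rmult_1_l B). mono; try apply Rabs_pos.
  apply Rabs_le. pose proof (pow2_ge_0 (2 * t - 1)). nra. apply HB. lra.
 - intros n g h E. apply RInt_ext. intros; now rewrite E.
Qed.

Definition zeta_s (s : C) : C := IL Leval (Dfun 0 s).
Definition Omega (s : C) : C := IL Ltrap (Dfun 0 (s + 2)%C).
(** The second derivative of x^(-s) brings s (s + 1), the trapezoidal rule 1/2, and the scaling of
    the kernel 1/4; the factor s - 1 cancels the pole. *)
Definition xi_c (s : C) : C := (/ 8 * ((s - 1) * s * (s + 1)))%C.

(* (s-1) zeta(s), continued to Re s > -1 by the trapezoidal rule. *)
Definition fz (s : C) : C := ((s + 1) / 2 + xi_c s * Omega s)%C.

Lemma LC_Leval (s : C) (n : nat) : LC Leval n (Dfun 0 s) = xpow (INR (S n)) s.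
Proof.
 unfold LC, Leval, Dfun. simpl pow. apply C_eq; csimp; ring.
Qed.

Lemma zeta_s_tends (s : C) : 1 < Re s -> ctends (csum (fun n => xpow (INR (S n)) s)) (zeta_s s).
Proof.
 intros Hs. apply ctends_ext with (csum (fun n => LC Leval n (Dfun 0 s))).
 intros N. apply csum_ext. intros; apply LC_Leval. apply IL_tends; auto. apply Leval_local.
Qed.

(** The error of the trapezoidal rule on one unit interval, multiplied by s - 1. The primitive [P]
    is what two integrations by parts of t (1 - t) x^(-s-2) produce, so only a derivative has to be
    checked. *)
Lemma trap_step (s : C) (n : nat) :
 (xi_c s * LC Ltrap n (Dfun 0 (s + 2)))%C =
 ((s - 1) / 2 * (xpow (INR (S n)) s + xpow (INR (S n) + 1) s)
  + (xpow (INR (S n) + 1) (s - 1) - xpow (INR (S n)) (s - 1)))%C.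
Proof.
 set (X := INR (S n)). assert (HX : 0 < X) by apply INR_S_pos.
 rewrite <- LC_scal. 2: apply Ltrap_local. 2: apply Dfun_cont.
 set (P := fun t : R => (/ 2 * (RtoC (t * (1 - t)) * (- ((s - 1) * s) * xpow (X + t) (s + 1))
   - RtoC (1 - 2 * t) * ((s - 1) * xpow (X + t) s) + 2 * xpow (X + t) (s - 1)))%C).
 set (P' := fun t : R => (RtoC (4 * t * (1 - t)) * (xi_c s * Dfun 0 (s + 2) (X + t)))%C).
 assert (dx : forall a t, 0 <= t -> rder (fun t => xpow (X + t) a) t (- a * xpow (X + t) (a + 1))%C).
 { intros a t Ht. eapply rder_ext; [intros; reflexivity| |apply (rder_comp (fun y => xpow y a) (fun t => X + t) t 1)].
  2: auto_derive; auto; ring. 2: apply rder_xpow; lra. rewrite Cmult_1_l. reflexivity. }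
 assert (dcx : forall c a t, 0 <= t -> rder (fun t => c * xpow (X + t) a)%C t (0 * xpow (X + t) a + c * (- a * xpow (X + t) (a + 1)))%C).
 { intros c a t Ht. exact (rder_mult _ _ _ _ _ (rder_const c t) (dx a t Ht)). }
 assert (HP : forall t, 0 <= t <= 1 -> rder P t (P' t)).
 { intros t Ht.
  assert (R1 : rder (fun t => RtoC (t * (1 - t))) t (RtoC (1 - 2 * t))).
  { apply rder_RtoC. auto_derive; auto; ring. }
  assert (R2 : rder (fun t => RtoC (2 * t - 1)) t (RtoC 2)).
  { apply rder_RtoC. auto_derive; auto; ring. }
  assert (H1 := rder_mult _ _ _ _ _ R1 (dcx (- ((s - 1) * s))%C (s + 1)%C t (proj1 Ht))).
  assert (H2 := rder_mult _ _ _ _ _ R2 (dcx (s - 1)%C s t (proj1 Ht))).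
  assert (H3 := rder_mult _ _ _ _ _ (rder_const (/ 2)%C t) (rder_plus _ _ _ _ _ (rder_plus _ _ _ _ _ H1 H2) (dcx 2%C (s - 1)%C t (proj1 Ht)))).
  refine (rder_ext _ _ _ _ _ _ _ H3).
  - intros r. cbv beta. unfold P. replace (RtoC (1 - 2 * r)) with (- RtoC (2 * r - 1))%C by (rewrite <- RtoC_opp; f_equal; ring). ring.
  - cbv beta. replace (s - 1 + 1)%C with s by ring.
   replace (s + 1 + 1)%C with (s + 2)%C by (rewrite <- Cplus_assoc, <- RtoC_plus; do 3 f_equal; ring).
   unfold P', xi_c, Dfun. simpl pow.
   generalize (xpow (X + t) (s + 2)) (xpow (X + t) (s + 1)) (xpow (X + t) s). intros u v w.
   rewrite !RtoC_mult, !RtoC_minus, !RtoC_mult. field. }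
 assert (HC : forall t, 0 <= t <= 1 -> continuous (fun t => Re (P' t)) t /\ continuous (fun t => Im (P' t)) t).
 { intros t Ht.
  assert (R1 : rder (fun t => RtoC (4 * t * (1 - t))) t (RtoC (4 - 8 * t))).
  { apply rder_RtoC. auto_derive; auto; ring. }
  assert (H3 := rder_mult _ _ _ _ _ R1 (dcx (xi_c s) (s + 2)%C t (proj1 Ht))).
  eapply rder_cont. refine (rder_ext _ P' _ _ _ _ (eq_refl _) H3).
  intros r. unfold P', Dfun. simpl pow. ring. }
 assert (E1 : Re (LC Ltrap n (fun x => xi_c s * Dfun 0 (s + 2) x)%C) = Re (P 1) - Re (P 0)).
 { unfold LC, Ltrap. csimp. apply is_RInt_unique.
  apply is_RInt_ext with (fun t => Re (P' t)).
  { intros t _. unfold P'. rewrite (Re_mult (RtoC _)), Re_RtoC, Im_RtoC. fold X. toR. rewrite (Re_mult (xi_c s)), (Im_mult (xi_c s)). ring. }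
  apply (is_RInt_derive (V := R_CompleteNormedModule) (fun t => Re (P t))).
  - intros t Ht. rewrite Rmin_left, Rmax_right in Ht by lra. apply (HP t Ht).
  - intros t Ht. rewrite Rmin_left, Rmax_right in Ht by lra. apply (HC t Ht). }
 assert (E2 : Im (LC Ltrap n (fun x => xi_c s * Dfun 0 (s + 2) x)%C) = Im (P 1) - Im (P 0)).
 { unfold LC, Ltrap. csimp. apply is_RInt_unique.
  apply is_RInt_ext with (fun t => Im (P' t)).
  { intros t _. unfold P'. rewrite (Im_mult (RtoC _)), Re_RtoC, Im_RtoC. fold X. toR. rewrite (Re_mult (xi_c s)), (Im_mult (xi_c s)). ring. }
  apply (is_RInt_derive (V := R_CompleteNormedModule) (fun t => Im (P t))).
  - intros t Ht. rewrite Rmin_left, Rmax_right in Ht by lra. apply (HP t Ht).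
  - intros t Ht. rewrite Rmin_left, Rmax_right in Ht by lra. apply (HC t Ht). }
 transitivity (P 1 - P 0)%C.
 { apply C_eq. rewrite Re_minus; exact E1. rewrite Im_minus; exact E2. }
 unfold P. rewrite Rplus_0_r. fold X.
 replace (1 * (1 - 1)) with 0 by ring. replace (0 * (1 - 0)) with 0 by ring.
 replace (1 - 2 * 1) with (-1) by ring. replace (1 - 2 * 0) with 1 by ring. field.
Qed.

(** Truncated Euler-Maclaurin form of (s - 1) zeta(s): the partial sum with its last term halved,
    plus N^(1-s). Passing from N to N + 1 adds exactly one trapezoidal error. *)
Definition fN (N : nat) (s : C) : C :=
 ((s - 1) * csum (fun n => xpow (INR (S n)) s) N - (s - 1) / 2 * xpow (INR N) s + xpow (INR N) (s - 1))%C.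

Lemma fN_succ (N : nat) (s : C) :
 fN (S N) s = ((s + 1) / 2 + xi_c s * csum (fun n => LC Ltrap n (Dfun 0 (s + 2))) N)%C.
Proof.
 induction N as [|N IH].
 - unfold fN. simpl csum. simpl INR. rewrite !xpow_x1. field.
 - transitivity (((s + 1) / 2 + xi_c s * csum (fun n => LC Ltrap n (Dfun 0 (s + 2))) N)
   + xi_c s * LC Ltrap N (Dfun 0 (s + 2)))%C.
  2: simpl csum; ring.
  rewrite <- IH, trap_step. unfold fN.
  change (csum (fun n => xpow (INR (S n)) s) (S (S N))) with
   (csum (fun n => xpow (INR (S n)) s) N + xpow (INR (S N)) s + xpow (INR (S (S N))) s)%C.
  change (csum (fun n => xpow (INR (S n)) s) (S N)) with
   (csum (fun n => xpow (INR (S n)) s) N + xpow (INR (S N)) s)%C.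
  rewrite (S_INR (S N)). field.
Qed.

Lemma fN_tends (s : C) : -1 < Re s -> ctends (fun N => fN N s) (fz s).
Proof.
 intros Hs eps He.
 assert (T : ctends (fun N => fN (S N) s) (fz s)).
 { apply ctends_ext with (fun N => (s + 1) / 2 + xi_c s * csum (fun n => LC Ltrap n (Dfun 0 (s + 2))) N)%C.
  intros; now rewrite fN_succ.
  unfold fz. apply ctends_plus. apply ctends_const. apply ctends_scal. apply IL_tends. apply Ltrap_local. csimp. simpl. lra. }
 destruct (T eps He) as [N HN]. exists (S N). intros n Hn. destruct n as [|n]. lia. apply HN. lia.
Qed.

Lemma fz_hol (m : nat) : hol m (fun s => -1 < Re s) fz.
Proof.
 unfold fz, xi_c. apply hol_plus.
 - apply hol_mult. apply hol_plus. apply hol_id. apply hol_const. apply hol_const.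
 - apply hol_mult.
  + apply hol_mult. apply hol_const. repeat apply hol_mult; try apply hol_plus; try apply hol_id; apply hol_const.
  + unfold Omega. apply (hol_comp m (fun s => 1 < Re s) _ (fun s => IL Ltrap (Dfun 0 s)) (fun s => (s + 2)%C)).
   intros z Hz. csimp. simpl; lra. apply IL_hol, Ltrap_local. apply hol_plus. apply hol_id. apply hol_const.
Qed.

Lemma fz_conj (s : C) : fz (Cconj s) = Cconj (fz s).
Proof.
 unfold fz, xi_c, Omega.
 replace (Cconj s + 2)%C with (Cconj (s + 2)) by (apply C_eq; csimp; ring).
 rewrite IL_conj by apply Ltrap_local.
 rewrite Cplus_conj, !Cmult_conj, Cdiv_conj, !Cplus_conj, Cinv_conj, Cminus_conj.
 2,3: intros E; apply (f_equal Re) in E; simpl in E; lra.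
 assert (E : forall r : R, Cconj (RtoC r) = RtoC r) by (intros; apply C_eq; csimp; ring). now rewrite !E.
Qed.

Lemma fz_growth (s : C) : - (1 / 2) <= Re s -> Cmod (fz s) <= (Cmod s + 1) ^ 3.
Proof.
 intros Hs. unfold fz.
 assert (HO : Cmod (Omega s) <= 3).
 { unfold Omega. replace 3 with (1 + / (3 / 2 - 1)) by field. apply IL_bound. apply Ltrap_local. csimp. simpl; lra. }
 assert (A : Cmod (s + 1) <= Cmod s + 1) by (le_trans; [apply Cmod_triangle|rewrite Cmod_1; lra]).
 assert (B : Cmod (s - 1) <= Cmod s + 1) by (le_trans; [apply Cmod_triangle_minus|rewrite Cmod_1; lra]).
 pose proof (Cmod_ge_0 s). pose proof (Cmod_ge_0 (s + 1)). pose proof (Cmod_ge_0 (s - 1)). pose proof (Cmod_ge_0 (Omega s)).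
 assert (X : Cmod (xi_c s) <= / 8 * (Cmod s + 1) ^ 3).
 { unfold xi_c. rewrite !Cmod_mult, <- RtoC_inv, Cmod_R, Rabs_pos_eq by lra.
  mono_l. lra. replace ((Cmod s + 1) ^ 3) with ((Cmod s + 1) * (Cmod s + 1) * (Cmod s + 1)) by ring.
  mono; auto. mul_pos; auto. mono; auto. lra. }
 via Cmod_triangle. rewrite Cmod_mult, Cmod_div, Cmod_R, Rabs_pos_eq by (try lra; intros E; apply (f_equal Re) in E; simpl in E; lra).
 set (a := Cmod s + 1) in *. assert (1 <= a) by (unfold a; lra). assert (a <= a ^ 3) by nra.
 assert (Cmod (xi_c s) * Cmod (Omega s) <= / 8 * a ^ 3 * 3).
 { mono; auto. pos. }
 nra.
Qed.

Lemma INR_above (x : R) : exists N : nat, x < INR N.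
Proof.
 exists (Z.to_nat (up (Rabs x))). rewrite INR_IZR_INZ, Z2Nat.id.
 - destruct (archimed (Rabs x)) as [A _]. pose proof (Rle_abs x). lra.
 - apply le_IZR. destruct (archimed (Rabs x)) as [A _]. pose proof (Rabs_pos x). lra.
Qed.

Lemma xpow_tends_0 (s : C) : 0 < Re s -> ctends (fun N => xpow (INR N) s) 0.
Proof.
 intros Hs eps He. destruct (INR_above (exp (- ln eps / Re s))) as [N HN].
 exists N. intros n Hn. replace (xpow (INR n) s - 0)%C with (xpow (INR n) s) by ring. rewrite Cmod_xpow.
 apply le_INR in Hn. pose proof (exp_pos (- ln eps / Re s)).
 apply Rlt_le_trans with (exp (ln eps)). 2: right; now apply exp_ln. apply exp_increasing.
 assert (L : - ln eps / Re s < ln (INR n)).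
 { rewrite <- (ln_exp (- ln eps / Re s)). apply ln_increasing; lra. }
 apply Rmult_lt_compat_r with (r := Re s) in L; auto. unfold Rdiv in L. rewrite Rmult_assoc, Rinv_l in L; lra.
Qed.

Lemma C_neq_of_Re (a b : C) : Re a <> Re b -> a <> b.
Proof. intros H ->. auto. Qed.

Lemma fz_zeta (s : C) : 1 < Re s -> fz s = ((s - 1) * zeta_s s)%C.
Proof.
 intros Hs. apply (ctends_unique (fun N => fN N s)). apply fN_tends; lra.
 replace ((s - 1) * zeta_s s)%C with ((s - 1) * zeta_s s + (- ((s - 1) / 2)) * 0 + 0)%C by ring.
 apply ctends_ext with (fun N => (s - 1) * csum (fun n => xpow (INR (S n)) s) N + (- ((s - 1) / 2)) * xpow (INR N) s + xpow (INR N) (s - 1))%C.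
 intros; unfold fN; ring.
 apply ctends_plus. apply ctends_plus.
 - apply ctends_scal, zeta_s_tends; auto.
 - apply ctends_scal, xpow_tends_0; lra.
 - apply xpow_tends_0; csimp; lra.
Qed.

Lemma npow_neg_xpow (n : nat) (s : C) : npow_neg n (Re s) (Im s) = xpow (INR n) s.
Proof.
 unfold npow_neg, xpow, cexp. apply C_eq; csimp; rewrite ?Rmult_0_r, ?Rplus_0_l, ?Rminus_0_r.
 - replace (- Im s * ln (INR n)) with (- (Im s * ln (INR n))) by ring. rewrite cos_neg. ring.
 - replace (- Im s * ln (INR n)) with (- (Im s * ln (INR n))) by ring. rewrite sin_neg. ring.
Qed.

Definition eta_term (s : C) (n : nat) : C := (RtoC ((-1) ^ n) * xpow (INR (S n)) s)%C.

Lemma eta_CSer (s : C) : eta (Re s) (Im s) = CSer (eta_term s).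
Proof.
 unfold eta, CSer, eta_term. f_equal; apply Series_ext; intros n; rewrite npow_neg_xpow.
 - csimp. change (fst (xpow (INR (S n)) s)) with (Re (xpow (INR (S n)) s)). ring.
 - csimp. change (snd (xpow (INR (S n)) s)) with (Im (xpow (INR (S n)) s)). ring.
Qed.

Lemma csum_eta_even (s : C) (N : nat) :
 csum (eta_term s) (2 * N) =
 (csum (fun n => xpow (INR (S n)) s) (2 * N) - xpow 2 (s - 1) * csum (fun n => xpow (INR (S n)) s) N)%C.
Proof.
 assert (E2 : xpow 2 (s - 1) = (2 * xpow 2 s)%C).
 { unfold Cminus. rewrite xpow_plus, xpow_m1 by lra. ring. }
 induction N as [|N IH]. simpl. ring.
 replace (2 * S N)%nat with (S (S (2 * N))) by lia.
 assert (step : forall u M, csum u (S M) = (csum u M + u M)%C) by reflexivity.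
 rewrite !step, IH.
 assert (Eo : eta_term s (2 * N) = xpow (INR (S (2 * N))) s).
 { unfold eta_term. rewrite pow_1_even. ring. }
 assert (Ee : eta_term s (S (2 * N)) = (- xpow (INR (S (S (2 * N)))) s)%C).
 { unfold eta_term. rewrite pow_1_odd. ring. }
 assert (Ex : xpow (INR (S (S (2 * N)))) s = (xpow 2 s * xpow (INR (S N)) s)%C).
 { rewrite <- xpow_mult. f_equal. rewrite !S_INR, mult_INR. simpl. ring. lra. apply INR_S_pos. }
 rewrite Eo, Ee, Ex, E2. ring.
Qed.

(** In the strip the partial sums of n^(-s) diverge, but in [fN] at 2N minus 2^(1-s) times [fN] at N
    the terms N^(1-s) cancel and the halved end terms tend to 0. Odd partial sums of eta differ from
    even ones by a single vanishing term. *)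
Lemma eta_fz (s : C) : 0 < Re s -> Re s < 1 ->
 ((s - 1) * eta (Re s) (Im s))%C = (fz s * (1 - xpow 2 (s - 1)))%C.
Proof.
 intros Hs Hs1. set (l := (fz s * (1 - xpow 2 (s - 1)) / (s - 1))%C).
 assert (Hn : (s - 1)%C <> 0%C) by (apply C_neq_of_Re; csimp; simpl; lra).
 assert (T : ctends (fun N => csum (eta_term s) (2 * S N)) l).
 { apply ctends_ext with (fun N => / (s - 1) * (fN (2 * S N) s + (- xpow 2 (s - 1)) * fN (S N) s
    + (((s - 1) / 2) * (xpow (INR (2 * S N)) s + (- xpow 2 (s - 1)) * xpow (INR (S N)) s))))%C.
  - intros N. rewrite csum_eta_even. unfold fN.
   assert (Ex : xpow (INR (2 * S N)) (s - 1) = (xpow 2 (s - 1) * xpow (INR (S N)) (s - 1))%C).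
   { rewrite <- xpow_mult. f_equal. rewrite mult_INR. simpl INR. ring. lra. apply INR_S_pos. }
   rewrite Ex. field; auto.
  - replace l with (/ (s - 1) * (fz s + (- xpow 2 (s - 1)) * fz s + ((s - 1) / 2) * (0 + (- xpow 2 (s - 1)) * 0)))%C by (unfold l; field; auto).
   apply ctends_scal. apply ctends_plus. apply ctends_plus.
   + apply (ctends_sub (fun N => fN N s) _ (fun N => 2 * S N)%nat). intros; lia. apply fN_tends; lra.
   + apply ctends_scal. apply (ctends_sub (fun N => fN N s) _ S). intros; lia. apply fN_tends; lra.
   + apply ctends_scal. apply ctends_plus. apply (ctends_sub (fun N => xpow (INR N) s) _ (fun N => 2 * S N)%nat). intros; lia. apply xpow_tends_0; auto.
    apply ctends_scal. apply (ctends_sub (fun N => xpow (INR N) s) _ S). intros; lia. apply xpow_tends_0; auto. }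
 assert (T2 : ctends (csum (eta_term s)) l).
 { intros eps He. destruct (T (eps / 2)) as [N1 H1]. lra.
  destruct (xpow_tends_0 s Hs (eps / 2)) as [N2 H2]. lra.
  exists (2 * N1 + N2 + 3)%nat. intros n Hnn.
  destruct (Nat.Even_or_Odd n) as [[m Hm]|[m Hm]].
  - specialize (H1 (pred m) ltac:(lia)). replace (2 * S (pred m))%nat with n in H1 by lia. lra.
  - specialize (H1 (pred m) ltac:(lia)). replace (2 * S (pred m))%nat with (2 * m)%nat in H1 by lia.
   replace n with (S (2 * m)) by lia. simpl csum. replace (m + (m + 0))%nat with (2 * m)%nat by lia.
   replace (csum (eta_term s) (2 * m) + eta_term s (2 * m) - l)%C with ((csum (eta_term s) (2 * m) - l) + eta_term s (2 * m))%C by ring.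
   eapply Rle_lt_trans. apply Cmod_triangle.
   assert (Cmod (eta_term s (2 * m)) < eps / 2).
   { unfold eta_term. rewrite pow_1_even, Cmult_1_l. specialize (H2 (S (2 * m)) ltac:(lia)).
    replace (xpow (INR (S (2 * m))) s - 0)%C with (xpow (INR (S (2 * m))) s) in H2 by ring. exact H2. }
   lra. }
 rewrite eta_CSer, (ctends_CSer_of _ _ T2). unfold l. field. auto.
Qed.

Lemma zeta_den (s : C) : (exp ((1 - Re s) * ln 2) * cos (- Im s * ln 2), exp ((1 - Re s) * ln 2) * sin (- Im s * ln 2)) = xpow 2 (s - 1).
Proof.
 unfold xpow, cexp. apply C_eq; csimp; rewrite ?Rmult_0_r, ?Rplus_0_l, ?Rminus_0_r; do 2 f_equal; ring.
Qed.

(** To the left of Re s = 1 the modulus of 2^(1-s) exceeds 1. *)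
Lemma eta_den_neq_0 (s : C) : Re s < 1 -> (1 - xpow 2 (s - 1))%C <> 0%C.
Proof.
 intros Hs E. assert (E2 : xpow 2 (s - 1) = 1%C).
 { replace (xpow 2 (s - 1)) with (1 - (1 - xpow 2 (s - 1)))%C by ring. rewrite E; ring. }
 apply (f_equal Cmod) in E2. rewrite Cmod_xpow, Cmod_1 in E2. csimp.
 assert (0 < ln 2) by (rewrite <- ln_1; apply ln_increasing; lra).
 assert (T := exp_ineq1_le (- (Re s - 1) * ln 2)). nra.
Qed.

(** The bridge between the zeta of the statement, a quotient of eta, and the function used
    throughout. *)
Lemma zeta_zero_iff (s : C) : 0 < Re s < 1 -> (zeta (Re s) (Im s) = RtoC 0 <-> fz s = RtoC 0).
Proof.
 intros Hs. assert (E := eta_fz s ltac:(lra) ltac:(lra)).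
 assert (D := eta_den_neq_0 s ltac:(lra)). assert (Hn : (s - 1)%C <> 0%C) by (apply C_neq_of_Re; csimp; simpl; lra).
 unfold zeta. rewrite zeta_den. split; intros H.
 - assert (H0 : eta (Re s) (Im s) = 0%C).
  { replace (eta (Re s) (Im s)) with (eta (Re s) (Im s) / (1 - xpow 2 (s - 1)) * (1 - xpow 2 (s - 1)))%C by (field; auto).
   rewrite H. ring. }
  rewrite H0 in E. replace (fz s) with (fz s * (1 - xpow 2 (s - 1)) / (1 - xpow 2 (s - 1)))%C by (field; auto).
  rewrite <- E. field. auto.
 - rewrite H in E.
  replace (eta (Re s) (Im s)) with ((s - 1) * eta (Re s) (Im s) / (s - 1))%C by (field; auto).
  rewrite E. field. auto.
Qed.

Lemma RH_fz (s : C) : RH -> 0 < Re s < 1 -> fz s = RtoC 0 -> Re s = 1 / 2.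
Proof. intros HR Hs H. apply (HR (Re s) (Im s)); auto. apply zeta_zero_iff; auto. Qed.

Lemma zeta_s_derive (s : C) : 1 < Re s -> cdiff zeta_s s (IL Leval (Dfun 1 s)).
Proof. intros Hs. exact (IL_derive Leval 0 s Leval_local Hs). Qed.

Lemma zeta_s_bound (s : C) (p : R) : 1 < p <= Re s -> Cmod (zeta_s s) <= 1 + / (p - 1).
Proof. intros H. exact (IL_bound Leval s p Leval_local H). Qed.

(** * Arithmetic functions *)

Definition divb (d n : nat) : bool := Nat.eqb (Nat.modulo n d) 0.

Lemma divb_spec (d n : nat) : (0 < d)%nat -> (divb d n = true <-> exists m, n = (m * d)%nat).
Proof.
 intros Hd. unfold divb. rewrite Nat.eqb_eq. rewrite Nat.Lcm0.mod_divide. reflexivity.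
Qed.

Lemma rsum_multiples (D : nat) (G : nat -> R) (N : nat) : (0 < D)%nat ->
 rsum (fun i => if divb D (S i) then G (S i) else 0) N = rsum (fun j => G (D * S j)%nat) (N / D).
Proof.
 intros HD. induction N as [|N IH].
 - rewrite Nat.Div0.div_0_l. reflexivity.
 - simpl rsum. rewrite IH. unfold divb. destruct (Nat.eqb_spec (S N mod D) 0) as [E|E].
  + apply Nat.Div0.div_exact in E.
   assert (E2 : (N / D)%nat = pred (S N / D)).
   { destruct (S N / D)%nat as [|q] eqn:Q. lia.
    symmetry. simpl. apply Nat.div_unique with (D - 1)%nat; nia. }
   destruct (S N / D)%nat as [|q] eqn:Q. lia. simpl in E2. rewrite E2. simpl rsum.
   now rewrite E at 1.
  + assert (E2 : (S N / D = N / D)%nat).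
   { assert (A := Nat.div_mod (S N) D ltac:(lia)). assert (B := Nat.mod_upper_bound (S N) D ltac:(lia)).
    apply Nat.div_unique with (S N mod D - 1)%nat; lia. }
   rewrite E2. ring.
Qed.

Lemma rsum_single (N m : nat) (x : R) : (m < N)%nat -> rsum (fun i => if Nat.eqb i m then x else 0) N = x.
Proof.
 intros H. induction N as [|N IH]. lia.
 simpl. destruct (Nat.eqb_spec N m) as [->|Hn].
 - rewrite (rsum_ext _ (fun _ => 0)), rsum_const. ring.
  intros n Hn. destruct (Nat.eqb_spec n m); lia || auto.
 - rewrite IH by lia. ring.
Qed.

Lemma rsum_shrink (u : nat -> R) (M N : nat) : (M <= N)%nat ->
 (forall i, (M <= i < N)%nat -> u i = 0) -> rsum u N = rsum u M.
Proof.
 intros H Hu. replace N with (M + (N - M))%nat by lia. rewrite rsum_app.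
 rewrite (rsum_ext (fun n => u (M + n)%nat) (fun _ => 0)), rsum_const. ring. intros n Hn. apply Hu. lia.
Qed.

Lemma ln_nonneg' (x : R) : 1 <= x -> 0 <= ln x.
Proof. intros H. rewrite <- ln_1. destruct H as [H| <-]. left; apply ln_increasing; lra. lra. Qed.

Module Multiplicative.
From mathcomp Require Import ssreflect ssrfun ssrbool eqtype ssrnat seq div prime.

Definition mu (n : nat) : R :=
 if all (fun p => logn p n == 1%N) (primes n) then (-1) ^ size (primes n) else 0.

(** Von Mangoldt's function: [primes n] lists distinct primes, so it is a singleton exactly for the
    prime powers. *)
Definition Lam (n : nat) : R := if primes n is [:: p] then ln (INR p) else 0.

Lemma divbE d n : (0 < d)%N -> divb d n = (d %| n)%N.
Proof.
 move=> Hd. apply/idP/idP.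
 - move=> H. have [m ->] : exists m, n = (m * d)%coq_nat by apply divb_spec => //; apply/ltP.
  by apply: dvdn_mull.
 - move=> /dvdnP [m ->]. apply divb_spec. by apply/ltP. by exists m.
Qed.

Lemma mu_le1 n : Rabs (mu n) <= 1.
Proof.
 rewrite /mu; case: ifP => _; last by rewrite Rabs_R0; lra.
 rewrite -RPow_abs Rabs_Ropp Rabs_R1 pow1; lra.
Qed.

Lemma mu_mul_prime p e : prime p -> (0 < e)%N -> ~~ (p %| e)%N -> mu (p * e) = - mu e.
Proof.
 move=> pp e0 npe. have p0 := prime_gt0 pp.
 have P : perm_eq (primes (p * e)) (p :: primes e).
 { apply: uniq_perm; [by apply: primes_uniq | by rewrite /= primes_uniq mem_primes (negbTE npe) !andbF |].
  by move=> q; rewrite primesM // primes_prime // mem_seq1 in_cons. }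
 rewrite /mu (perm_all _ P) (perm_size P) /=.
 have L : forall q, logn q (p * e) = ((q == p) + logn q e)%N by move=> q; rewrite lognM // logn_prime.
 have -> : logn p (p * e) == 1%N.
 { rewrite L eqxx /=. have -> : logn p e = 0%N by apply/eqP; rewrite -leqn0 leqNgt logn_gt0 mem_primes (negbTE npe) !andbF. done. }
 have -> : all (fun q => logn q (p * e) == 1%N) (primes e) = all (fun q => logn q e == 1%N) (primes e).
 { apply: eq_in_all => q qe. rewrite L.
  have -> : (q == p) = false by apply/negbTE/eqP => E; move: qe; rewrite E mem_primes (negbTE npe) !andbF.
  done. }
 rewrite /=; case: ifP => _; lra.
Qed.

Lemma mu_mul_sq p e : prime p -> (0 < e)%N -> (p %| e)%N -> mu (p * e) = 0.
Proof.
 move=> pp e0 pe. have p0 := prime_gt0 pp.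
 rewrite /mu. case: allP => // H.
 have pin : p \in primes (p * e) by rewrite primesM // primes_prime // mem_seq1 eqxx.
 move: (H p pin). rewrite lognM // logn_prime // eqxx.
 have : (0 < logn p e)%N by rewrite logn_gt0 mem_primes pp e0 pe.
 by case: (logn p e).
Qed.

(** For n > 1 fix a prime p dividing n. A divisor d prime to p is paired with p d, which has the
    opposite sign; the divisors p d with p dividing d contribute 0. *)
Lemma mu_sum n : (0 < n)%N -> rsum (fun i => if divb (S i) n then mu (S i) else 0) n = if Nat.eqb n 1 then 1 else 0.
Proof.
 move=> n0. case: (leqP n 1) => Hn.
 { have -> : n = 1%N by apply/eqP; rewrite eqn_leq Hn n0. rewrite /= /mu /=; lra. }
 have -> : Nat.eqb n 1 = false by apply/Nat.eqb_neq => E; rewrite E in Hn.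
 set p := pdiv n. have pp : prime p by apply: pdiv_prime. have p0 := prime_gt0 pp.
 have pn : (p %| n)%N by apply: pdiv_dvd.
 set g1 := fun d => if (d %| n)%N && ~~ (p %| d)%N then mu d else 0.
 have -> : rsum (fun i => if divb (S i) n then mu (S i) else 0) n
  = rsum (fun i => g1 (S i) + (if divb p (S i) then (if (S i %| n)%N then mu (S i) else 0) else 0)) n.
 { apply rsum_ext => i _. rewrite !divbE // /g1. case: (S i %| n)%N; case: (p %| S i)%N => /=; lra. }
 rewrite (rsum_plus (fun i => g1 (S i))) (rsum_multiples p (fun d => if (d %| n)%N then mu d else 0)); last by apply/ltP.
 set q := Nat.div n p.
 have En : n = (p * q)%N.
 { apply Nat.Div0.div_exact. apply Nat.Lcm0.mod_divide. move/dvdnP: pn => [m Em]. by exists m. }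
 have q0 : (0 < q)%N by move: n0; rewrite En muln_gt0 => /andP [].
 have -> : rsum (fun j => if (p * S j %| n)%N then mu (p * S j) else 0) q = rsum (fun j => (-1) * g1 (S j)) q.
 { apply rsum_ext => j _. rewrite /g1. case Hpj: (p %| S j)%N => /=.
  - rewrite andbF mu_mul_sq //; case: ifP; lra.
  - have -> : (p * S j %| n)%N = (S j %| n)%N.
   { rewrite Gauss_dvd ?pn //. by rewrite prime_coprime // Hpj. }
   rewrite andbT; case: ifP => _; [rewrite mu_mul_prime ?Hpj //; lra | lra]. }
 rewrite rsum_scal (rsum_shrink (fun i => g1 (S i)) q n); first by lra.
 - apply/leP. by rewrite En leq_pmull.
 - move=> i [/leP Hi /ltP Hin]. rewrite /g1. case: ifP => // /andP [Hd Hnp]. exfalso.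
  have : (p * S i %| p * q)%N by rewrite -En Gauss_dvd ?pn ?Hd // prime_coprime.
  rewrite dvdn_pmul2l // => /(dvdn_leq q0) Hle.
  by move: (leq_ltn_trans Hi Hle); rewrite ltnn.
Qed.

Lemma ln_eq_0 x : ln x = 0 -> x <= 0 \/ x = 1.
Proof.
 move=> H. case: (Rle_dec x 0) => Hx; [by left | right].
 by rewrite -(exp_ln x) ?H ?exp_0 //; lra.
Qed.

Lemma Lam_ge0 n : 0 <= Lam n.
Proof.
 rewrite /Lam. case E: (primes n) => [|p [|q s]]; try lra.
 have : p \in primes n by rewrite E mem_seq1.
 rewrite mem_primes => /andP [/prime_gt0 pp _]. 
 apply ln_nonneg'. rewrite -[1]/(INR 1). apply le_INR. by apply/leP.
Qed.
Lemma Lam_cases d : (0 < d)%N -> Lam d <> 0 -> exists q j, [/\ prime q, (0 < j)%N, d = (q ^ j)%N & Lam d = ln (INR q)].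
Proof.
 move=> d0. rewrite /Lam. case E: (primes d) => [|q [|r s]] // _.
 have qd : q \in primes d by rewrite E mem_seq1.
 have pq : prime q by move: qd; rewrite mem_primes => /andP [].
 exists q, (logn q d); split => //; first by rewrite logn_gt0.
 have q0 : (0 < q ^ logn q d)%N by rewrite expn_gt0 prime_gt0.
 apply: (eqn_from_log d0 q0) => r. rewrite lognX (@logn_prime r q pq).
 case: eqP => [->|/eqP nr]; first by rewrite /= muln1.
 rewrite /= muln0. apply/eqP. rewrite -leqn0 leqNgt logn_gt0 E mem_seq1. exact: nr.
Qed.

Lemma Lam_prime_power q j : prime q -> (0 < j)%N -> Lam (q ^ j) = ln (INR q).
Proof.
 move=> pq j0. rewrite /Lam. have -> : primes (q ^ j) = [:: q] by rewrite primesX // primes_prime.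
 done.
Qed.

(** Induction on n = p m with p the smallest prime factor: the divisors of n that do not divide m
    and are prime powers reduce to one, p to the power 1 + (exponent of p in m), which contributes
    log p. *)
Lemma Lam_sum n : (0 < n)%N -> rsum (fun i => if divb (S i) n then Lam (S i) else 0) n = ln (INR n).
Proof.
 elim/ltn_ind: n => n IH n0. case: (leqP n 1) => Hn.
 { have -> : n = 1%N by apply/eqP; rewrite eqn_leq Hn n0. rewrite /= /Lam /= ln_1; lra. }
 set p := pdiv n. have pp : prime p by apply: pdiv_prime. have p0 := prime_gt0 pp.
 have pn : (p %| n)%N by apply: pdiv_dvd.
 set m := (n %/ p)%N. have En : n = (p * m)%N by rewrite mulnC divnK.
 have m0 : (0 < m)%N by move: n0; rewrite En muln_gt0 => /andP [].
 have mn : (m < n)%N by rewrite En -{1}[m]mul1n ltn_pmul2r // prime_gt1.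
 set a := (logn p m).+1.
 have pa : (p ^ a %| n)%N by rewrite En expnS dvdn_pmul2l // pfactor_dvdnn.
 have pa0 : (0 < p ^ a)%N by rewrite expn_gt0 p0.
 have key : forall i, (if divb (S i) n then Lam (S i) else 0) =
   (if divb (S i) m then Lam (S i) else 0) + (if Nat.eqb i (p ^ a).-1 then ln (INR p) else 0).
 { move=> i. rewrite !divbE //.
  case: (Req_dec (Lam (S i)) 0) => [L0|L1].
  - rewrite L0. case: Nat.eqb_spec => Hi.
   + exfalso. move: L0. rewrite Hi prednK // Lam_prime_power // => /ln_eq_0 H.
    have : (1 < p)%N by apply: prime_gt1. move/ltP/lt_INR => H2. rewrite /= in H2. lra.
   + do 2 case: ifP; lra.
  - have [q [j [pq j0 Ed ->]]] := Lam_cases (S i) (ltn0Sn i) L1.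
   have Hi : Nat.eqb i (p ^ a).-1 = ((q ^ j)%N == (p ^ a)%N).
   { rewrite -Ed -[(p ^ a)%N]prednK // eqSS. }
   rewrite Hi Ed !pfactor_dvdn // En lognM // logn_prime //.
   have -> : ((q ^ j)%N == (p ^ a)%N) = (q == p) && (j == a).
   { apply/eqP/andP => [E|[/eqP -> /eqP ->] //].
    have Eq : q = p.
    { have : logn q (q ^ j) = logn q (p ^ a) by rewrite E.
     rewrite pfactorK // lognX logn_prime //. case: (q =P p) => [//|_]; rewrite muln0 => E0. by move: j0; rewrite E0. }
    split; first by rewrite Eq.
    have : logn p (q ^ j) = logn p (p ^ a) by rewrite E. by rewrite Eq !pfactorK // => ->. }
   case: (q =P p) => [->|_] /=; last by rewrite add0n; case: ifP; lra.
   rewrite add1n. rewrite /a. case: (ltngtP j (logn p m).+1) => Hj.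
   + have -> : (j <= logn p m)%N by rewrite -ltnS. rewrite /=; lra.
   + have -> : (j <= logn p m)%N = false by apply/negbTE; rewrite -ltnNge; apply: ltnW. rewrite /=; lra.
   + have -> : (j <= logn p m)%N = false by rewrite Hj ltnn. rewrite /=; lra. }
 rewrite (rsum_ext _ _ n (fun i _ => key i)) rsum_plus rsum_single; last first.
 { apply/ltP. rewrite prednK //. exact: dvdn_leq. }
 rewrite (rsum_shrink _ m n).
 - rewrite IH //. rewrite {1}En mult_INR ln_mult; first by lra.
  by apply lt_0_INR; apply/ltP. by apply lt_0_INR; apply/ltP.
 - by apply/leP/ltnW.
 - move=> i [/leP Hi _]. rewrite divbE //. case: ifP => // /(dvdn_leq m0) H.
  by move: (leq_ltn_trans Hi H); rewrite ltnn.
Qed.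

(** M is the largest integer whose k-th power divides n. If d^k also divides n, so does lcm(d, M)^k,
    as exponents show prime by prime; maximality forces lcm(d, M) = M. *)
Lemma power_divisor k n : (0 < k)%N -> (0 < n)%N ->
 exists M, (0 < M)%N /\ forall d, (0 < d)%N -> (d ^ k %| n)%N = (d %| M)%N.
Proof.
 move=> k0 n0.
 have ex : exists d, (d ^ k %| n)%N && (0 < d)%N by exists 1%N; rewrite exp1n dvd1n.
 have bd : forall d, (d ^ k %| n)%N && (0 < d)%N -> (d <= n)%N.
 { move=> d /andP [H d0]. apply: leq_trans (dvdn_leq n0 H). by rewrite -{1}[d]expn1 leq_pexp2l. }
 case: (ex_maxnP ex bd) => M /andP [HM M0] Hmax. exists M; split => // d d0.
 apply/idP/idP => [Hd|Hd]; last first.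
 { apply: dvdn_trans HM. by apply: dvdn_exp2r. }
 have L0 : (0 < lcmn d M)%N by rewrite lcmn_gt0 d0 M0.
 have HL : ((lcmn d M) ^ k %| n)%N.
 { have X0 : (0 < (lcmn d M) ^ k)%N by rewrite expn_gt0 L0.
  have -> : ((lcmn d M) ^ k)%N = gcdn ((lcmn d M) ^ k) n.
  { apply: eqn_from_log => //; first by rewrite gcdn_gt0 X0.
   move=> r. rewrite logn_gcd // lognX logn_lcm //.
   have A := dvdn_leq_log r n0 Hd. have B := dvdn_leq_log r n0 HM. rewrite !lognX in A B.
   apply/esym/minn_idPl. rewrite maxnMr geq_max. by rewrite A B. }
  exact: dvdn_gcdr. }
 have : (lcmn d M <= M)%N by apply: Hmax; rewrite HL L0.
 move=> H. have E : lcmn d M = M by apply/eqP; rewrite eqn_leq H dvdn_leq // dvdn_lcmr.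
 by rewrite -E dvdn_lcml.
Qed.

Lemma prime_Z p : prime p -> Znumtheory.prime (Z.of_nat p).
Proof.
 move=> pp. apply/Znumtheory.prime_alt. have p1 := prime_gt1 pp. split.
 - have : (1 < p)%coq_nat by apply/ltP. lia.
 - move=> n Hn [q Hq].
  have Hd : (Z.to_nat n %| p)%N.
  { apply/dvdnP. exists (Z.to_nat q). rewrite -[p]Nat2Z.id Hq -[(_ * _)%N]/(Nat.mul _ _) Z2Nat.inj_mul //; nia. }
  have [/eqP H|H] := boolP (Z.to_nat n == 1%N); first by lia.
  have E : Z.to_nat n = p by apply/(prime_nt_dvdP pp H). lia.
Qed.

(** The condition d^k | n becomes d | M, so the sum is 1 or 0 according to whether M = 1; and M > 1
    holds exactly when some prime power p^k divides n. *)
Lemma kfree_sum k n : (0 < k)%N -> (0 < n)%N ->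
 rsum (fun i => if divb (Nat.pow (S i) k) n then mu (S i) else 0) n =
 if excluded_middle_informative (k_free k n) then 1 else 0.
Proof.
 move=> k0 n0. have [M [M0 HM]] := power_divisor k n k0 n0.
 have pw : forall d, Nat.pow d k = (d ^ k)%N.
 { move=> d. clear. elim: k => [//|k IH]. by rewrite expnS -IH. }
 have Mn : (M <= n)%N.
 { have H : (M ^ k %| n)%N by rewrite HM.
  apply: leq_trans (dvdn_leq n0 H). by rewrite -{1}[M]expn1 leq_pexp2l. }
 rewrite (rsum_ext _ (fun i => if divb (S i) M then mu (S i) else 0)); last first.
 { move=> i _. rewrite pw !divbE //; last by rewrite expn_gt0. by rewrite HM. }
 rewrite (rsum_shrink _ M n); first last.
 - move=> i [/leP Hi _]. rewrite divbE //. case: ifP => // /(dvdn_leq M0) H.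
  by move: (leq_ltn_trans Hi H); rewrite ltnn.
 - by apply/leP.
 rewrite mu_sum //. case: Nat.eqb_spec => HM1; case: excluded_middle_informative => F //; exfalso.
 - apply: F => p pp [q Hq]. have p2 := Znumtheory.prime_ge_2 p pp.
  have H : (Z.to_nat p ^ k %| n)%N.
  { apply/dvdnP. exists (Z.to_nat q). rewrite -pw. apply Nat2Z.inj.
   rewrite Hq Nat2Z.inj_mul Nat2Z.inj_pow !Z2Nat.id //; try lia. }
  rewrite HM in H; last by apply/ltP; lia.
  rewrite HM1 dvdn1 in H. move/eqP: H. lia.
 - have M1 : (1 < M)%N by case: (M) M0 HM1 => [|[|m]].
  have pp := pdiv_prime M1.
  apply: (F _ (prime_Z _ pp)). 
  have : (pdiv M ^ k %| n)%N by rewrite HM ?pdiv_dvd // prime_gt0.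
  move=> /dvdnP [q Hq]. exists (Z.of_nat q). rewrite Hq -pw.
  by rewrite -[(_ * _)%N]/(Nat.mul _ _) Nat2Z.inj_mul Nat2Z.inj_pow.
Qed.
End Multiplicative.

Notation mu := Multiplicative.mu.
Notation Lam := Multiplicative.Lam.

Lemma csum_multiples (D : nat) (G : nat -> C) (N : nat) : (0 < D)%nat ->
 csum (fun i => if divb D (S i) then G (S i) else 0%C) N = csum (fun j => G (D * S j)%nat) (N / D).
Proof.
 intros HD. apply C_eq.
 - rewrite !Re_csum, <- (rsum_multiples D (fun n => Re (G n))) by auto. apply rsum_ext. intros i _. now destruct divb.
 - rewrite !Im_csum, <- (rsum_multiples D (fun n => Im (G n))) by auto. apply rsum_ext. intros i _. now destruct divb.
Qed.

(** Double counting of the pairs (i, n) with e(i) | n. It serves with e(d) = d for Dirichlet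
    products and with e(d) = d^k for k-free integers. *)
Lemma hyperbola (e : nat -> nat) (g : nat -> R) (b : nat -> C) (N M : nat) :
 (forall i, (0 < e (S i))%nat) ->
 csum (fun n => RtoC (rsum (fun i => if divb (e (S i)) (S n) then g (S i) else 0) M) * b (S n))%C N
 = csum (fun i => (g (S i)) * csum (fun j => b (e (S i) * S j)%nat) (N / e (S i)))%C M.
Proof.
 intros He. induction M as [|M IH].
 - simpl. rewrite (csum_ext _ (fun _ => RtoC 0 * 0)%C), csum_scal. ring. intros; ring.
 - simpl. rewrite <- IH, <- (csum_multiples (e (S M)) b) by auto.
  rewrite <- csum_scal, <- csum_plus. apply csum_ext. intros n _. rewrite RtoC_plus.
  destruct divb; ring.
Qed.

Lemma divb_le (d n : nat) : (0 < d)%nat -> divb d (S n) = true -> (d <= S n)%nat.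
Proof. intros Hd H. apply divb_spec in H; auto. destruct H as [m Hm]. destruct m; nia. Qed.

Lemma divisor_sum_extend (g : nat -> R) (n N : nat) : (n < N)%nat ->
 rsum (fun i => if divb (S i) (S n) then g (S i) else 0) N =
 rsum (fun i => if divb (S i) (S n) then g (S i) else 0) (S n).
Proof.
 intros H. apply rsum_shrink. lia. intros i Hi. destruct (divb (S i) (S n)) eqn:E; auto.
 apply divb_le in E; lia.
Qed.

(* Tannery's theorem for the truncated sums below. *)
Lemma tannery (u : nat -> nat -> C) (v : nat -> R) :
 (forall N d, (d < N)%nat -> Cmod (u N d) <= v d) -> (forall d, 0 <= v d) -> ex_series v ->
 (forall d, ctends (fun N => u N d) 0) -> ctends (fun N => csum (u N) N) 0.
Proof.
 intros Hb Hp Hs Hu eps He.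
 assert (HD : exists D, forall K, rsum (fun i => v (D + i)%nat) K < eps / 2).
 { assert (Hs' := Hs). apply Series_correct in Hs'.
  assert (HL : is_lim_seq (sum_n v) (Series v)) by exact Hs'.
  apply is_lim_seq_spec in HL. destruct (HL (mkposreal (eps / 2) ltac:(lra))) as [D HD]. simpl in HD.
  exists (S D). intros K. specialize (HD D ltac:(lia)). rewrite <- rsum_sum_n in HD.
  assert (T := rsum_le_Series v (S D + K) Hp Hs). rewrite rsum_app in T.
  apply Rabs_def2 in HD. lra. }
 destruct HD as [D HD].
 assert (HF : exists N0, forall N, (N0 <= N)%nat -> Cmod (csum (u N) D) < eps / 2).
 { clear HD. induction D as [|D IH].
  - exists O. intros. simpl. rewrite Cmod_0. lra.
  - assert (T : ctends (fun N => csum (u N) (S D)) 0).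
   { clear IH. induction (S D) as [|E IHE]. apply ctends_ext with (fun _ => RtoC 0). reflexivity. apply ctends_const.
    assert (Q := ctends_plus _ _ _ _ IHE (Hu E)). replace (0 + 0)%C with (RtoC 0) in Q by ring. exact Q. }
   destruct (T (eps / 2)) as [N0 H]. lra. exists N0. intros N HN. specialize (H N HN).
   replace (csum (u N) (S D) - 0)%C with (csum (u N) (S D)) in H by ring. exact H. }
 destruct HF as [N0 HF]. exists (N0 + D)%nat. intros N HN.
 replace (csum (u N) N - 0)%C with (csum (u N) N) by ring.
 replace N with (D + (N - D))%nat at 2 by lia. rewrite csum_app.
 eapply Rle_lt_trans. apply Cmod_triangle.
 assert (Cmod (csum (fun n => u N (D + n)%nat) (N - D)) < eps / 2).
 { eapply Rle_lt_trans. apply csum_Cmod. eapply Rle_lt_trans. 2: apply (HD (N - D)%nat).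
  apply rsum_le. intros n Hn. apply Hb. lia. }
 specialize (HF N ltac:(lia)). lra.
Qed.

Definition dterm (a : nat -> R) (s : C) (i : nat) : C := ((a (S i)) * xpow (INR (S i)) s)%C.

Lemma div_tends_infty (d N0 : nat) : exists N1, forall N, (N1 <= N)%nat -> (N0 <= N / S d)%nat.
Proof.
 exists (N0 * S d)%nat. intros N HN. rewrite <- (Nat.div_mul N0 (S d)) by lia. apply Nat.Div0.div_le_mono. lia.
Qed.

Lemma zeta_partial_bound (s : C) (M : nat) : 1 < Re s ->
 Cmod (csum (fun n => xpow (INR (S n)) s) M) <= 1 + / (Re s - 1).
Proof.
 intros Hs. via csum_Cmod. upto (rsum_pw_le (Re s) M Hs).
 apply rsum_le. intros n _. rewrite Cmod_xpow. apply Rle_refl.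
Qed.

(** A partial sum of the product series is the sum over i of the i-th term times a partial sum of
    zeta of length N / i. Replacing each of these by zeta(s) costs an error which vanishes by
    Tannery's theorem. *)
Lemma dirichlet_product (a : nat -> R) (s : C) (v : nat -> R) : 1 < Re s ->
 (forall i, Cmod (dterm a s i) <= v i) -> ex_series v ->
 ctends (csum (fun n => RtoC (rsum (fun i => if divb (S i) (S n) then a (S i) else 0) (S n)) * xpow (INR (S n)) s)%C)
  (CSer (dterm a s) * zeta_s s)%C.
Proof.
 intros Hs Hb Hv.
 set (Z := fun M => csum (fun n => xpow (INR (S n)) s) M).
 assert (Hp : forall i, 0 <= v i) by (intros i; le_trans; [apply Cmod_ge_0|apply Hb]).
 apply ctends_ext with (fun N => zeta_s s * csum (dterm a s) N + csum (fun i => dterm a s i * (Z (N / S i)%nat - zeta_s s)) N)%C.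
 { intros N. rewrite <- csum_scal, <- csum_plus.
  rewrite (csum_ext (fun n => RtoC (rsum (fun i => if divb (S i) (S n) then a (S i) else 0) (S n)) * xpow (INR (S n)) s)%C
   (fun n => RtoC (rsum (fun i => if divb (S i) (S n) then a (S i) else 0) N) * xpow (INR (S n)) s)%C).
  2:{ intros n Hn. now rewrite (divisor_sum_extend a n N Hn). }
  rewrite (hyperbola (fun d => d) a (fun n => xpow (INR n) s) N N) by (intros; lia).
  apply csum_ext. intros i _. unfold dterm, Z.
  rewrite (csum_ext (fun j => xpow (INR (S i * S j)) s) (fun j => xpow (INR (S i)) s * xpow (INR (S j)) s)%C).
  rewrite csum_scal. ring. intros j _. rewrite mult_INR, xpow_mult; auto; apply INR_S_pos. }
 replace (CSer (dterm a s) * zeta_s s)%C with (zeta_s s * CSer (dterm a s) + 0)%C by ring.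
 apply ctends_plus. apply ctends_scal. apply CSer_ctends with v; auto.
 set (B := 1 + / (Re s - 1)).
 assert (HB : 0 < B) by (unfold B; assert (0 < / (Re s - 1)) by pos; lra).
 apply (tannery (fun N i => dterm a s i * (Z (N / S i)%nat - zeta_s s))%C (fun i => (2 * B) * v i)).
 - intros N i _. rewrite Cmod_mult, Rmult_comm.
  mono; try apply Cmod_ge_0; auto.
  via Cmod_triangle_minus.
  assert (Cmod (Z (N / S i)%nat) <= B) by (now apply zeta_partial_bound).
  assert (Cmod (zeta_s s) <= B) by (apply zeta_s_bound; lra). lra.
 - intros i. mul_pos; auto; lra.
 - now apply (ex_series_scal (2 * B) v).
 - intros i. replace (RtoC 0) with (dterm a s i * 0)%C by ring. apply ctends_scal.
  intros eps He. destruct (zeta_s_tends s Hs eps He) as [N0 HN0].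
  destruct (div_tends_infty i N0) as [N1 HN1]. exists N1. intros N HN.
  replace (Z (N / S i)%nat - zeta_s s - 0)%C with (Z (N / S i)%nat - zeta_s s)%C by ring. apply HN0, HN1, HN.
Qed.

Definition mus (s : C) : C := CSer (dterm mu s).
Definition Lams (s : C) : C := CSer (dterm Lam s).

Lemma dterm_mu_bound (s : C) (i : nat) : Cmod (dterm mu s i) <= pw (Re s) i.
Proof.
 unfold dterm. rewrite Cmod_mult, Cmod_R, Cmod_xpow. unfold pw.
 rewrite <- (Rmult_1_l (exp _)) at 2. mono_r. pos. apply Multiplicative.mu_le1.
Qed.

Lemma mus_bound (s : C) : 1 < Re s -> Cmod (mus s) <= 1 + / (Re s - 1).
Proof.
 intros Hs. le_trans. 2: apply (ex_series_pw (Re s)); lra. unfold mus.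
 apply CSer_bound. apply dterm_mu_bound. now apply ex_series_pw.
Qed.

Lemma mus_zeta (s : C) : 1 < Re s -> (mus s * zeta_s s)%C = 1%C.
Proof.
 intros Hs. eapply ctends_unique.
 - apply (dirichlet_product mu s (pw (Re s)) Hs (dterm_mu_bound s)). now apply ex_series_pw.
 - assert (E : forall N, csum (fun n => RtoC (rsum (fun i => if divb (S i) (S n) then mu (S i) else 0) (S n)) * xpow (INR (S n)) s)%C (S N) = 1%C).
  { induction N as [|N IH].
   - change (csum ?u 1) with (0 + u O)%C. cbv beta. rewrite Multiplicative.mu_sum by reflexivity. simpl. rewrite xpow_x1. ring.
   - change (csum ?u (S (S N))) with (csum u (S N) + u (S N))%C. rewrite IH. cbv beta. rewrite Multiplicative.mu_sum by reflexivity. simpl. ring. }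
  intros eps He. exists 1%nat. intros n Hn. destruct n as [|n]. lia. rewrite E.
  replace (1 - 1)%C with (RtoC 0) by ring. rewrite Cmod_0; auto.
Qed.

Lemma zeta_s_neq_0 (s : C) : 1 < Re s -> zeta_s s <> 0%C.
Proof. intros Hs E. assert (H := mus_zeta s Hs). rewrite E, Cmult_0_r in H. apply (f_equal Re) in H. simpl in H. lra. Qed.

Lemma fz_neq_0_right (s : C) : 1 < Re s -> fz s <> 0%C.
Proof.
 intros Hs. rewrite fz_zeta by auto. apply Cmult_neq_0.
 apply Re_pos_neq_0. csimp. lra. now apply zeta_s_neq_0.
Qed.

Lemma Lam_le (n : nat) : (0 < n)%nat -> Lam n <= ln (INR n).
Proof.
 intros Hn. destruct n as [|n]. lia. rewrite <- Multiplicative.Lam_sum by reflexivity.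
 assert (E : divb (S n) (S n) = true) by (apply divb_spec; [lia|exists 1%nat; lia]).
 simpl rsum. rewrite E.
 assert (0 <= rsum (fun i => if divb (S i) (S n) then Lam (S i) else 0) n).
 { apply rsum_nonneg. intros i _. destruct (divb (S i) (S n)); [apply Multiplicative.Lam_ge0|lra]. }
 lra.
Qed.

Lemma dterm_Lam_bound (s : C) (d : R) (i : nat) : 0 < d -> d <= Re s -> Cmod (dterm Lam s i) <= (2 / d) * pw (Re s - d) i.
Proof.
 intros Hd Hs. unfold dterm. rewrite Cmod_mult, Cmod_R, Cmod_xpow, Rabs_pos_eq by apply Multiplicative.Lam_ge0.
 assert (Hl : 0 <= ln (INR (S i))) by (apply ln_nonneg, INR_S_ge_1).
 assert (T := pow_le_exp d (ln (INR (S i))) 1 Hd Hl). simpl in T. rewrite !Rmult_1_r in T.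
 replace (1 + 1) with 2 in T by ring.
 apply Rle_trans with (2 / d * exp (d * ln (INR (S i))) * exp (- Re s * ln (INR (S i)))).
 mono_r. pos. le_trans. apply Lam_le; lia. exact T.
 rewrite Rmult_assoc, <- exp_plus. unfold pw. right. do 2 f_equal. ring.
Qed.

(** The divisor sums of Lambda are logarithms, the coefficients of - zeta'(s). *)
Lemma Lams_zeta (s : C) : 1 < Re s -> (Lams s * zeta_s s)%C = (- IL Leval (Dfun 1 s))%C.
Proof.
 intros Hs. set (d := (Re s - 1) / 2). eapply ctends_unique.
 - apply (dirichlet_product Lam s (fun i => (2 / d) * pw (Re s - d) i) Hs).
  intros; apply dterm_Lam_bound; unfold d; lra. apply ex_series_scal_pw; unfold d; lra.
 - apply ctends_ext with (fun N => (RtoC (-1)) * csum (fun n => LC Leval n (Dfun 1 s)) N)%C.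
  + intros N. rewrite <- csum_scal. apply csum_ext. intros n _. rewrite Multiplicative.Lam_sum by reflexivity.
   unfold LC, Leval, Dfun. apply C_eq; csimp; ring.
  + replace (- IL Leval (Dfun 1 s))%C with (RtoC (-1) * IL Leval (Dfun 1 s))%C by ring.
   apply ctends_scal, IL_tends; auto. apply Leval_local.
Qed.

Lemma Re_CSer (u : nat -> C) : Re (CSer u) = Series (fun n => Re (u n)). Proof. reflexivity. Qed.

Lemma Re_xpow (x : R) (s : C) : Re (xpow x s) = exp (- Re s * ln x) * cos (Im s * ln x).
Proof.
 unfold xpow, cexp. csimp. rewrite <- (cos_neg (Im s * ln x)). f_equal; f_equal; ring.
Qed.

(** Termwise 3 + 4 cos y + cos 2y = 2 (1 + cos y)^2, with nonnegative coefficients. *)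
Lemma Lams_341 (sigma t : R) : 1 < sigma ->
 0 <= 3 * Re (Lams (sigma, 0)) + 4 * Re (Lams (sigma, t)) + Re (Lams (sigma, 2 * t)).
Proof.
 intros Hs. unfold Lams. rewrite !Re_CSer.
 assert (ex : forall y, ex_series (fun n => Re (dterm Lam (sigma, y) n))).
 { intros y. set (d := (sigma - 1) / 2).
  apply (ex_series_le (K := R_AbsRing) (V := R_CompleteNormedModule)) with (b := fun i => (2 / d) * pw (sigma - d) i).
  intros n. via re_le_Cmod. apply (dterm_Lam_bound (sigma, y)); unfold d; simpl; lra.
  apply ex_series_scal_pw. unfold d; lra. }
 assert (exs : forall c y, ex_series (fun n => c * Re (dterm Lam (sigma, y) n))) by (intros c y; exact (ex_series_scal c _ (ex y))).
 assert (ex2 : ex_series (fun n => 3 * Re (dterm Lam (sigma, 0) n) + 4 * Re (dterm Lam (sigma, t) n))).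
 { exact (ex_series_plus (V := R_NormedModule) _ _ (exs 3 0) (exs 4 t)). }
 rewrite <- !Series_scal_l. rewrite <- Series_plus by apply exs. rewrite <- Series_plus by (exact ex2 || apply ex).
 assert (Z0 : Series (fun _ : nat => 0 * 0) = 0) by (rewrite Series_scal_l; ring).
 le_trans; [right; symmetry; exact Z0|].
 apply Series_le.
 2: exact (ex_series_plus (V := R_NormedModule) _ _ ex2 (ex (2 * t))).
 intros n. split. lra. rewrite Rmult_0_l.
 unfold dterm. rewrite !Re_mult, !Re_RtoC, !Im_RtoC, !Re_xpow. csimp.
 set (l := ln (INR (S n))). rewrite !(Rmult_0_l l), cos_0, !Rmult_0_l, !Rminus_0_r.
 rewrite Rmult_assoc, cos_2a_cos.
 set (c := cos (t * l)). pose proof (Multiplicative.Lam_ge0 (S n)). pose proof (exp_pos (- sigma * l)).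
 replace (3 * (Lam (S n) * (exp (- sigma * l) * 1)) + 4 * (Lam (S n) * (exp (- sigma * l) * c)) + Lam (S n) * (exp (- sigma * l) * (2 * c * c - 1)))
  with (Lam (S n) * exp (- sigma * l) * (2 * (1 + c) ^ 2)) by ring.
 mul_pos. mul_pos; lra. pose proof (pow2_ge_0 (1 + c)). lra.
Qed.

(** * Zero-free region *)

Lemma fz_derivative : exists f1, (forall z, -1 < Re z -> cdiff fz z (f1 z)) /\ hol 4 (fun s => -1 < Re s) f1.
Proof. destruct (fz_hol 5) as [f1 H]. exists f1. exact H. Qed.

Definition fz1 : C -> C := proj1_sig (constructive_indefinite_description _ fz_derivative).

Lemma fz1_spec (z : C) : -1 < Re z -> cdiff fz z (fz1 z).
Proof. exact (proj1 (proj2_sig (constructive_indefinite_description _ fz_derivative)) z). Qed.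

Lemma fz1_hol : hol 4 (fun s => -1 < Re s) fz1.
Proof. exact (proj2 (proj2_sig (constructive_indefinite_description _ fz_derivative))). Qed.

(** The logarithmic derivative of (s - 1) zeta(s), that is zeta'/zeta + 1/(s - 1): regular at s =
    1. *)
Definition W (s : C) : C := (fz1 s / fz s)%C.

Lemma fz_at_1 : fz 1 = 1%C.
Proof. unfold fz, xi_c. field. Qed.

Lemma W_right (s : C) : 1 < Re s -> W s = (/ (s - 1) - Lams s)%C.
Proof.
 intros Hs. assert (Hn : (s - 1)%C <> 0%C) by (apply Re_pos_neq_0; csimp; lra).
 assert (Hz := zeta_s_neq_0 s Hs).
 assert (D : cdiff fz s ((1 + 0) * zeta_s s + (s - 1) * IL Leval (Dfun 1 s))%C).
 { apply cdiff_ext_loc with (fun w => (w + - (1)) * zeta_s w)%C (Re s - 1). lra.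
  - intros w Hw. symmetry. apply fz_zeta. assert (T := re_le_Cmod (w - s)%C). csimp. 
   assert (T2 : Rabs (Re w - Re s) < Re s - 1) by lra. apply Rabs_def2 in T2. lra.
  - apply (cdiff_mult (fun w => w + - (1))%C zeta_s). apply cdiff_plus. apply cdiff_id. apply cdiff_const. now apply zeta_s_derive. }
 assert (E := cdiff_unique _ _ _ _ (fz1_spec s ltac:(lra)) D).
 assert (L := Lams_zeta s Hs).
 unfold W. rewrite E, (fz_zeta s Hs).
 replace (IL Leval (Dfun 1 s)) with (- (Lams s * zeta_s s))%C by (rewrite L; ring).
 field. auto.
Qed.

(** 1/zeta is bounded by its absolutely convergent Moebius series. *)
Lemma fz_lower (s : C) : 1 < Re s -> Cmod (s - 1) <= (1 + / (Re s - 1)) * Cmod (fz s).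
Proof.
 intros Hs. assert (M := mus_zeta s Hs).
 replace (s - 1)%C with (mus s * fz s)%C.
 2:{ rewrite fz_zeta by auto. replace (mus s * ((s - 1) * zeta_s s))%C with ((s - 1) * (mus s * zeta_s s))%C by ring. rewrite M; ring. }
 rewrite Cmod_mult. mono_r. pos. now apply mus_bound.
Qed.

(* [m] is the multiplicity of [z0] as a zero of [fz]; on the line Re s = 1 zeros are at most simple
  because 1/zeta has at most a simple pole there. *)
Lemma W_near (z0 : C) : Re z0 = 1 -> exists m : R,
 (fz z0 = 0%C -> m = 1) /\ 0 <= m /\ (fz z0 <> 0%C -> m = 0) /\
 forall eps, 0 < eps -> exists d, 0 < d /\ forall x, 0 < x < d -> Rabs (x * Re (W (z0 + RtoC x)%C) - m) < eps.
Proof.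
 intros H1.
 assert (ext : forall g : C -> C, ccont g z0 -> (forall x, 0 < x < 1 -> g (z0 + RtoC x)%C = (RtoC x * W (z0 + RtoC x))%C) ->
  forall eps, 0 < eps -> exists d, 0 < d /\ forall x, 0 < x < d -> Rabs (x * Re (W (z0 + RtoC x)%C) - Re (g z0)) < eps).
 { intros g Hg E eps He. destruct (Hg eps He) as [d [Hd H]]. exists (Rmin d 1). split. apply Rmin_pos; lra.
  intros x Hx. pose proof (Rmin_l d 1). pose proof (Rmin_r d 1).
  specialize (H (z0 + RtoC x)%C). replace (z0 + RtoC x - z0)%C with (RtoC x) in H by ring.
  rewrite Cmod_R, Rabs_pos_eq in H by lra. specialize (H ltac:(lra)). rewrite E in H by lra.
  replace (x * Re (W (z0 + RtoC x)%C) - Re (g z0)) with (Re (RtoC x * W (z0 + RtoC x) - g z0)%C) by (csimp; ring).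
  eapply Rle_lt_trans. apply re_le_Cmod. exact H. }
 assert (Hc1 : ccont fz1 z0) by (apply (hol_cont 3 _ _ z0 fz1_hol); lra).
 destruct (classic (fz z0 = 0%C)) as [Hz|Hz].
 - exists 1. split; [auto|]. split; [lra|]. split; [tauto|].
  destruct (fz1_spec z0 ltac:(lra)) as [phi [P1 [P2 P3]]].
  assert (HIm : Im z0 <> 0).
  { intros E. assert (z0 = 1%C) by (apply C_eq; simpl; auto). subst z0. rewrite fz_at_1 in Hz. apply (f_equal Re) in Hz. simpl in Hz. lra. }
  assert (Ef : forall x, fz (z0 + RtoC x)%C = (phi (z0 + RtoC x) * RtoC x)%C).
  { intros x. rewrite (P3 (z0 + RtoC x)%C), Hz. ring. }
  (* The lower bound for |fz| right of the line, divided by the zero, keeps the difference quotient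
     away from 0: this is the simplicity of the zero. *)
  assert (Hlow : forall x, 0 < x < 1 -> Rabs (Im z0) / 2 <= Cmod (phi (z0 + RtoC x)%C)).
  { intros x Hx. assert (T := fz_lower (z0 + RtoC x)%C ltac:(csimp; lra)).
   assert (A : Rabs (Im z0) <= Cmod (z0 + RtoC x - 1)).
   { replace (Im z0) with (Im (z0 + RtoC x - 1)%C) by (csimp; simpl; ring). apply Im_le_Cmod. }
   rewrite Ef, Cmod_mult, Cmod_R, Rabs_pos_eq in T by lra.
   replace (Re (z0 + RtoC x)%C - 1) with x in T by (csimp; lra).
   replace ((1 + / x) * (Cmod (phi (z0 + RtoC x)%C) * x)) with ((x + 1) * Cmod (phi (z0 + RtoC x)%C)) in T by (field; lra).
   pose proof (Cmod_ge_0 (phi (z0 + RtoC x)%C)).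
   assert ((x + 1) * Cmod (phi (z0 + RtoC x)%C) <= 2 * Cmod (phi (z0 + RtoC x)%C)) by (mono_r; lra). lra. }
  assert (Ha : 0 < Rabs (Im z0)) by (apply Rabs_pos_lt; auto).
  assert (Hphi : phi z0 <> 0%C).
  { intros E. destruct (P2 (Rabs (Im z0) / 2)) as [d [Hd H]]. lra.
   set (x := Rmin d 1 / 2). assert (0 < Rmin d 1) by (apply Rmin_pos; lra).
   pose proof (Rmin_l d 1). pose proof (Rmin_r d 1).
   specialize (H (z0 + RtoC x)%C). rewrite E in H. replace (z0 + RtoC x - z0)%C with (RtoC x) in H by ring.
   rewrite Cmod_R, Rabs_pos_eq in H by (unfold x; lra). specialize (H ltac:(unfold x; lra)).
   replace (phi (z0 + RtoC x) - 0)%C with (phi (z0 + RtoC x)%C) in H by ring.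
   specialize (Hlow x ltac:(unfold x; lra)). lra. }
  assert (G : ccont (fun w => fz1 w * / phi w)%C z0).
  { apply ccont_mult; auto. apply ccont_inv; auto. }
  assert (EX := ext _ G).
  replace 1 with (Re (fz1 z0 * / phi z0)%C).
  2:{ rewrite P1. rewrite Cinv_r. reflexivity. rewrite <- P1. exact Hphi. }
  apply EX. intros x Hx. unfold W. rewrite Ef. specialize (Hlow x Hx).
  assert (N1 : phi (z0 + RtoC x)%C <> 0%C) by (apply Cmod_gt_0; lra).
  assert (N2 : RtoC x <> 0%C) by (intros E; apply (f_equal Re) in E; simpl in E; lra).
  field. auto.
 - exists 0. split; [tauto|]. split; [lra|]. split; [auto|].
  assert (G : ccont (fun w => (w + - z0) * (fz1 w * / fz w))%C z0).
  { apply ccont_mult. apply ccont_plus. apply ccont_id. apply ccont_const. apply ccont_mult; auto. apply ccont_inv; auto.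
   apply (hol_cont 4 _ _ z0 (fz_hol 5)). lra. }
  assert (EX := ext _ G). cbv beta in EX.
  replace ((z0 + - z0) * (fz1 z0 * / fz z0))%C with (RtoC 0) in EX by ring.
  apply EX. intros x Hx. unfold W. unfold Cdiv. ring.
Qed.

(** The 3-4-1 inequality times x at abscissa 1 + x, with x small: the pole contributes 3, a zero at
    height t would contribute -4, and the value at height 2t is nearly nonpositive. The sum would be
    negative. *)
Lemma fz_neq_0_line (t : R) : fz (1, t) <> 0%C.
Proof.
 intros Hz.
 destruct (W_near (1, t) eq_refl) as [m1 [M1 [_ [_ L1]]]]. rewrite (M1 Hz) in L1. clear m1 M1.
 destruct (W_near (1, 2 * t) eq_refl) as [m2 [_ [M2 [_ L2]]]].
 destruct (W_near (1, 0) eq_refl) as [m0 [_ [_ [M0 L0]]]].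
 assert (E1 : fz (1, 0) <> 0%C).
 { replace ((1, 0) : C) with (RtoC 1) by reflexivity. rewrite fz_at_1. intros E. apply (f_equal Re) in E. simpl in E. lra. }
 rewrite (M0 E1) in L0.
 assert (Ht : t <> 0) by (intros ->; auto).
 destruct (L1 (1 / 100)) as [d1 [D1 H1]]. lra. destruct (L2 (1 / 100)) as [d2 [D2 H2]]. lra. destruct (L0 (1 / 100)) as [d0 [D0 H0]]. lra.
 (* The bound t^2 / 100 makes x^2 / (x^2 + y^2), the contribution of 1/(s - 1), at most 1/100 at the
    heights t and 2t. *)
 set (x := Rmin (Rmin d1 d2) (Rmin d0 (Rmin (t ^ 2 / 100) 1)) / 2).
 assert (Ht2 : 0 < t ^ 2) by (apply pow2_gt_0; auto).
 assert (P : 0 < Rmin (Rmin d1 d2) (Rmin d0 (Rmin (t ^ 2 / 100) 1))) by (repeat apply Rmin_pos; lra).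
 assert (Hx : 0 < x < d1 /\ x < d2 /\ x < d0 /\ x < t ^ 2 / 100 /\ x < 1).
 { revert P. unfold x, Rmin. repeat destruct Rle_dec; lra. }
 specialize (H1 x ltac:(lra)). specialize (H2 x ltac:(lra)). specialize (H0 x ltac:(lra)).
 assert (E : forall y, ((1, y) + RtoC x)%C = (1 + x, y)) by (intros; apply C_eq; simpl; ring).
 rewrite E in *. rewrite !W_right in * by (simpl; lra).
 assert (K := Lams_341 (1 + x) t ltac:(lra)).
 assert (R : forall y, x * Re (/ (((1 + x)%R, y) - 1))%C = x ^ 2 / (x ^ 2 + y ^ 2)).
 { intros y. replace (((1 + x)%R, y) - 1)%C with ((x, y) : C) by (apply C_eq; csimp; simpl; ring).
  unfold Cinv. simpl. field. nra. }
 rewrite !Re_minus in *. rewrite !Rmult_minus_distr_l, R in *.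
 apply Rabs_def2 in H1. apply Rabs_def2 in H2. apply Rabs_def2 in H0.
 assert (S : forall y, t ^ 2 <= y ^ 2 -> 0 <= x ^ 2 / (x ^ 2 + y ^ 2) <= 1 / 100).
 { intros y Hy. split. mul_pos. nra. left; apply Rinv_0_lt_compat; nra.
  apply Rmult_le_reg_r with (x ^ 2 + y ^ 2). nra. unfold Rdiv. rewrite Rmult_assoc, Rinv_l by nra. nra. }
 assert (S1 := S t ltac:(lra)). assert (S2 := S (2 * t) ltac:(nra)).
 assert (S0 : x ^ 2 / (x ^ 2 + 0 ^ 2) = 1) by (field; lra).
 assert (K2 : 0 <= x * (3 * Re (Lams (1 + x, 0)) + 4 * Re (Lams (1 + x, t)) + Re (Lams (1 + x, 2 * t)))) by (mul_pos; lra).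
 lra.
Qed.

Lemma fz_neq_0 (s : C) : RH -> 1 / 2 < Re s -> fz s <> 0%C.
Proof.
 intros HR Hs. destruct (Rlt_dec (Re s) 1) as [H|H].
 - intros E. assert (T := RH_fz s HR ltac:(lra) E). lra.
 - destruct (Req_dec (Re s) 1) as [E|E].
  + destruct s as [x y]. simpl in E. subst x. apply fz_neq_0_line.
  + apply fz_neq_0_right. lra.
Qed.

Lemma hol_le (m n : nat) (U : C -> Prop) (f : C -> C) : (m <= n)%nat -> hol n U f -> hol m U f.
Proof. intros H. induction H; auto. intros Hf. apply IHle, hol_S, Hf. Qed.

Lemma W_hol (U : C -> Prop) : (forall s, U s -> -1 < Re s) -> (forall s, U s -> fz s <> 0%C) -> hol 4 U W.
Proof.
 intros HU Hn. apply hol_div; auto. apply hol_sub with (2 := fz1_hol); auto. apply hol_sub with (2 := fz_hol 4); auto.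
Qed.

(** * Bounds for zeta under the Riemann hypothesis *)

Lemma ln_32_lower : 0.4 <= ln (3 / 2).
Proof.
 rewrite <- (ln_exp 0.4). apply ln_le'. pos.
 replace 0.4 with (INR 20 * 0.02) by (simpl; lra). rewrite <- exp_pow_nat.
 apply Rle_trans with ((/ (1 - 0.02)) ^ 20). apply pow_incr. split. pos. apply exp_small_ub; lra.
 replace (/ (1 - 0.02)) with (50 / 49) by lra. lra.
Qed.

Lemma Cmod_pair_le (x y : R) : Cmod (x, y) <= Rabs x + Rabs y.
Proof. apply (Cmod_le_abs (x, y)). Qed.

(** The measure of size at height t. It is never below log X, so bounds in terms of it hold at every
    height on a line chosen from X alone, and it varies slowly on bounded discs. *)
Definition LX (X t : R) : R := ln (Rabs t + X).

Lemma LX_ge (X t : R) : 1 < X -> ln X <= LX X t.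
Proof. intros H. unfold LX. apply ln_le'. lra. pose proof (Rabs_pos t). lra. Qed.

Lemma ln_add_le (A y : R) : 0 < A -> 0 <= y -> ln (A + y) <= ln A + y / A.
Proof.
 intros HA Hy. replace (A + y) with (A * (1 + y / A)) by (field; lra).
 assert (0 <= y / A) by (mul_pos; [lra|pos]).
 rewrite ln_mult by lra. apply Rplus_le_compat_l. rewrite <- (ln_exp (y / A)) at 2. apply ln_le'. lra. apply exp_ineq1_le.
Qed.

Lemma LX_shift (X t t' : R) : 1 < X -> LX X t' <= LX X t + Rabs (t' - t) / X.
Proof.
 intros H. unfold LX. pose proof (Rabs_pos t). pose proof (Rabs_pos (t' - t)).
 apply Rle_trans with (ln (Rabs t + X + Rabs (t' - t))).
 - apply ln_le'. pose proof (Rabs_pos t'); lra. assert (T := Rabs_triang t (t' - t)). replace (t + (t' - t)) with t' in T by ring. lra.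
 - le_trans. apply ln_add_le; lra. apply Rplus_le_compat_l. unfold Rdiv. mono_l; auto. apply Rinv_le_contravar; lra.
Qed.

(** The circle of radius 2 about (lam + 2, tau) touches the point (lam, tau), and the annulus inside
    it lies in Re s > 1/2, free of zeros under RH. The hypothesis on log X is what turns the
    additive constants into the factor 2. *)
Lemma W_lower (X lam tau : R) : RH -> 1000 <= X -> 20 <= ln X -> 1 / 2 < lam <= 40 ->
 - 2 * LX X tau <= Re (W (lam, tau)).
Proof.
 intros HR HX HlX Hl. set (c := ((lam + 2)%R, tau) : C).
 (* Cubic growth of fz on the outer circle, against |fz| >= 1/42 on the circle of radius 4/3, whose
    points have real part above 7/6. *)
 set (M := 3 * ln (Rabs tau + 50) + ln 42). pose proof (Rabs_pos tau).
 assert (Hre : forall s z, Rabs (Re s - Re z) <= Cmod (s - z)) by (intros; rewrite <- Re_minus; apply re_le_Cmod).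
 assert (K := log_derivative_lower_bound (fun s => -1 < Re s) fz lam tau M (fz1 (lam, tau))). cbv zeta in K. fold c in K.
 assert (K1 : - M / (4 * ln (3 / 2)) <= Re (W (lam, tau))).
 { apply K.
  - apply fz_hol.
  - apply fz_conj.
  - intros s Hs. assert (T := Hre s c). unfold c in T at 1. simpl in T. apply Rabs_le_between' in T. 
   split. lra. apply fz_neq_0; auto. lra.
  - intros s Hs. assert (T := Hre s (Cconj c)). unfold c in T at 1. simpl in T. apply Rabs_le_between' in T. lra.
  - intros s s' Hs Hs'.
   assert (T := Hre s (Cconj c)). unfold c in T at 1. simpl in T. apply Rabs_le_between' in T.
   assert (T' := Hre s' c). unfold c in T' at 1. simpl in T'. apply Rabs_le_between' in T'.
   assert (A : Cmod (fz s) <= (Rabs tau + 50) ^ 3).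
   { via fz_growth. lra. apply pow_incr. split. pose proof (Cmod_ge_0 s); lra.
    replace s with ((s - Cconj c) + Cconj c)%C by ring.
    le_trans. apply Rplus_le_compat_r, Cmod_triangle. rewrite Hs, Cmod_conj.
    assert (Q := Cmod_pair_le (lam + 2) tau). fold c in Q. rewrite (Rabs_pos_eq (lam + 2)) in Q by lra. lra. }
   assert (B : 1 / 6 <= 7 * Cmod (fz s')).
   { assert (F := fz_lower s' ltac:(lra)).
    assert (G : 1 / 6 <= Cmod (s' - 1)). { le_trans; [|apply Re_le_mod]. csimp. lra. }
    assert (I : 1 + / (Re s' - 1) <= 7).
    { assert (/ (Re s' - 1) <= / (1 / 6)) by (apply Rinv_le_contravar; lra). lra. }
    pose proof (Cmod_ge_0 (fz s')).
    assert ((1 + / (Re s' - 1)) * Cmod (fz s') <= 7 * Cmod (fz s')) by (mono_r; lra). lra. }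
   unfold M. rewrite exp_plus, exp_ln by lra. replace 3 with (INR 3) at 1 by (simpl; ring).
   rewrite <- exp_pow_nat, exp_ln by lra.
   assert (0 < (Rabs tau + 50) ^ 3) by (apply pow_lt; lra).
   via A. set (q := (Rabs tau + 50) ^ 3) in *. nra.
  - apply fz1_spec. simpl; lra. }
 le_trans; [|exact K1].
 assert (HL := LX_ge X tau ltac:(lra)). pose proof ln_32_lower.
 assert (H1 : ln (Rabs tau + 50) <= LX X tau) by (apply ln_le'; lra).
 assert (H2 : ln 42 <= 4).
 { rewrite <- (ln_exp 4). apply ln_le'. lra. replace 4 with (INR 4 * 1) by (simpl; ring). rewrite <- exp_pow_nat.
  assert (E1 : 2.55 <= exp 1).
  { replace 1 with (INR 10 * 0.1) by (simpl; lra). rewrite <- exp_pow_nat. assert (1.1 <= exp 0.1) by (assert (T := exp_ineq1_le 0.1); lra).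
   apply Rle_trans with (1.1 ^ 10). lra. apply pow_incr; lra. }
  apply Rle_trans with (2.55 ^ 4). lra. apply pow_incr; lra. }
 apply Rmult_le_reg_r with (4 * ln (3 / 2)). lra.
 replace (- M / (4 * ln (3 / 2)) * (4 * ln (3 / 2))) with (- M) by (field; lra).
 unfold M. nra.
Qed.

Lemma W_far (s : C) : 3 / 2 <= Re s -> Cmod (W s) <= 42.
Proof.
 intros Hs. rewrite W_right by lra. via Cmod_triangle_minus.
 assert (N : (s - 1)%C <> 0%C) by (apply Re_pos_neq_0; csimp; lra).
 assert (A : Cmod (/ (s - 1)) <= 2).
 { rewrite Cmod_inv by auto. replace 2 with (/ (1 / 2)) by field. apply Rinv_le_contravar. lra.
  le_trans; [|apply Re_le_mod]. csimp. lra. }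
 assert (B : Cmod (Lams s) <= 40).
 { unfold Lams. le_trans.
  - apply CSer_bound with (v := fun i => (2 / (1 / 4)) * pw (5 / 4) i). 2: apply ex_series_scal_pw; lra.
   intros i. le_trans. apply (dterm_Lam_bound s (1 / 4)); lra.
   mono_l. lra. unfold pw. apply exp_le. 
   assert (0 <= ln (INR (S i))) by (apply ln_nonneg, INR_S_ge_1). nra.
  - rewrite Series_scal_pw. destruct (ex_series_pw (5 / 4) ltac:(lra)) as [_ T]. 
   replace (1 + / (5 / 4 - 1)) with 5 in T by lra. lra. }
 lra.
Qed.

(** By the lower bound, W plus about 2 [LX] has positive real part on a disc of radius 38 >= 19 b to
    the right of the critical line. Removing the shift costs (1 + 2.25) (2 LX + 1) <= 6.7 LX. *)
Lemma W_harnack (X b tau : R) : RH -> 1000 <= X -> 20 <= ln X -> 0 < b <= 2 ->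
 Cmod (W (1 / 2 + b / 2, tau)) <= 2.25 * Cmod (W (1 / 2 + b, tau)) + 6.7 * LX X tau.
Proof.
 intros HR HX HlX Hb. set (A0 := 2 * LX X tau + 1).
 assert (HL := LX_ge X tau ltac:(lra)).
 assert (K := harnack_half (fun s => 1 / 2 < Re s) (fun s => W s + RtoC A0)%C (1 / 2) b tau). cbv beta in K.
 assert (K1 : Cmod (W (1 / 2 + b / 2, tau) + RtoC A0) <= 2.25 * Cmod (W (1 / 2 + b, tau) + RtoC A0)).
 { apply K. lra.
  - apply (hol_le 2 4). lia. apply hol_plus. 2: apply hol_const. apply W_hol. intros; lra. intros; now apply fz_neq_0.
  - intros s Hs Hd. split; auto.
   assert (T1 : Rabs (Re s - 1 / 2) <= 38).
   { le_trans. exact (re_le_Cmod (s - ((1 / 2)%R, tau))%C). lra. }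
   assert (T2 : Rabs (Im s - tau) <= 38).
   { le_trans. exact (Im_le_Cmod (s - ((1 / 2)%R, tau))%C). lra. }
   apply Rabs_le_between' in T1.
   assert (Q := W_lower X (Re s) (Im s) HR HX HlX ltac:(lra)).
   replace ((Re s, Im s) : C) with s in Q by (now destruct s).
   assert (S := LX_shift X tau (Im s) ltac:(lra)).
   assert (Rabs (Im s - tau) / X <= 0.1).
   { apply Rmult_le_reg_r with X. lra. unfold Rdiv. rewrite Rmult_assoc, Rinv_l; lra. }
   rewrite Re_plus, Re_RtoC. unfold A0. lra. }
 assert (I1 := Cmod_triangle_inv (W (1 / 2 + b / 2, tau)) (RtoC A0)).
 assert (I2 := Cmod_triangle (W (1 / 2 + b, tau)) (RtoC A0)).
 rewrite Cmod_R, Rabs_pos_eq in * by (unfold A0; lra). unfold A0 in *. lra.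
Qed.

(** Harnack repeated j times, starting from the far right. The constant grows with j and is of no
    value in itself: it supplies the finiteness that three lines and the contraction argument start
    from. *)
Lemma W_apriori (X : R) (j : nat) : RH -> 1000 <= X -> 42 <= ln X ->
 exists K, forall b tau, (/ 2) ^ j <= b -> Cmod (W (1 / 2 + b, tau)) <= K * LX X tau.
Proof.
 intros HR HX HlX. induction j as [|j [K IH]].
 - exists 1. intros b tau Hb. simpl in Hb. via W_far. simpl; lra.
  assert (HL := LX_ge X tau ltac:(lra)). lra.
 - exists (Rmax 1 (2.25 * K + 6.7)). intros b tau Hb. assert (HL := LX_ge X tau ltac:(lra)).
  pose proof (Rmax_l 1 (2.25 * K + 6.7)). pose proof (Rmax_r 1 (2.25 * K + 6.7)).
  assert (0 < (/ 2) ^ S j) by (apply pow_lt; lra).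
  destruct (Rle_dec 1 b) as [Hb1|Hb1].
  + via W_far. simpl; lra. nra.
  + assert (Q := W_harnack X (2 * b) tau HR HX ltac:(lra) ltac:(lra)).
   replace (2 * b / 2) with b in Q by field.
   assert (T := IH (2 * b) tau ltac:(simpl in Hb; lra)). nra.
Qed.

(** The growth of [LX] along a vertical line, absorbed by half of nothing more than a Gaussian
    factor, so that three lines can be used with constant edge bounds. *)
Lemma gauss_absorb (X y : R) : 1000 <= X -> 0 <= y -> 1 + y / X <= exp (0.001 + 0.01 * y ^ 2).
Proof.
 intros HX Hy. le_trans; [|apply exp_ineq1_le].
 assert (y / X <= y / 1000). { unfold Rdiv. mono_l; auto. apply Rinv_le_contravar; lra. }
 assert (0 <= (y - 0.05) ^ 2) by apply pow2_ge_0. nra.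
Qed.

(** Interpolation between m LX on the left line and 42 on Re s = 3/2, for W times a Gaussian centred
    at the point considered. The exponent 0.011 is 0.001 from absorbing the growth of [LX] plus 0.01
    for horizontal distances up to 1. *)
Lemma W_three_lines (X b m sigma tau : R) : RH -> 1000 <= X -> 42 <= ln X -> 0 < b < 1 -> 1 <= m ->
 (forall t, Cmod (W (1 / 2 + b, t)) <= m * LX X t) -> 1 / 2 + b <= sigma <= 3 / 2 ->
 Cmod (W (sigma, tau)) <= exp (0.011) * (m * LX X tau) *
   exp (- (ln (m * LX X tau) - ln 42) * ((sigma - 1 / 2 - b) / (1 - b))).
Proof.
 intros HR HX HlX Hb Hm HP Hs. set (s0 := (sigma, tau) : C).
 assert (HL := LX_ge X tau ltac:(lra)).
 assert (HmL : 0 < m * LX X tau) by pos.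
 set (U := fun s => 1 / 2 < Re s).
 set (F := fun s => (W s * cexp (RtoC 0.01 * ((s - s0) * (s - s0))))%C).
 assert (CF : forall s, Cmod (F s) = Cmod (W s) * exp (0.01 * (Re s - sigma) ^ 2 - 0.01 * (Im s - tau) ^ 2)).
 { intros s. unfold F. rewrite Cmod_mult, Cmod_cexp. do 2 f_equal. unfold s0. csimp. ring. }
 assert (hF : hol 2 U F).
 { apply hol_mult. apply (hol_le 2 4). lia. apply W_hol; unfold U; intros. lra. now apply fz_neq_0.
  apply hol_exp_comp. apply hol_mult. apply hol_const. apply hol_mult; apply hol_minus; try apply hol_id; apply hol_const. }
 assert (gs : forall t K s, 0 <= K -> t = Im s -> 1 / 2 + b <= Re s <= 3 / 2 -> Cmod (W s) <= K * LX X t ->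
   Cmod (F s) <= K * LX X tau * exp 0.011).
 { intros t K s HK -> Hre HW. rewrite CF.
  assert (S := LX_shift X tau (Im s) ltac:(lra)). set (y := Rabs (Im s - tau)) in *.
  assert (Hy : 0 <= y) by apply Rabs_pos.
  assert (Ey : (Im s - tau) ^ 2 = y ^ 2) by (unfold y; rewrite <- !Rsqr_pow2; apply Rsqr_abs).
  rewrite Ey. assert (G := gauss_absorb X y HX Hy).
  assert (A : LX X (Im s) <= LX X tau * exp (0.001 + 0.01 * y ^ 2)).
  { assert (0 <= y / X) by (mul_pos; [auto|pos]). nra. }
  apply Rle_trans with (K * (LX X tau * exp (0.001 + 0.01 * y ^ 2)) * exp (0.01 * (Re s - sigma) ^ 2 - 0.01 * y ^ 2)).
  - mono_r. pos. via HW. mono_l; auto.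
  - replace (K * (LX X tau * exp (0.001 + 0.01 * y ^ 2)) * exp (0.01 * (Re s - sigma) ^ 2 - 0.01 * y ^ 2))
    with (K * LX X tau * (exp (0.001 + 0.01 * y ^ 2) * exp (0.01 * (Re s - sigma) ^ 2 - 0.01 * y ^ 2))) by ring.
   rewrite <- exp_plus. mono_l. mul_pos; lra. apply exp_le.
   assert ((Re s - sigma) ^ 2 <= 1) by (assert (-1 <= Re s - sigma <= 1) by lra; nra). lra. }
 assert (ap : exists K, 0 <= K /\ forall s, 1 / 2 + b <= Re s -> Cmod (W s) <= K * LX X (Im s)).
 { destruct (pow_lt_1_zero (/ 2) ltac:(rewrite Rabs_pos_eq; lra) b ltac:(lra)) as [j Hj].
  destruct (W_apriori X j HR HX HlX) as [K HK]. exists (Rabs K). split. apply Rabs_pos.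
  intros s Hre. specialize (Hj j ltac:(lia)). rewrite Rabs_pos_eq in Hj by (apply pow_le; lra).
  specialize (HK (Re s - 1 / 2) (Im s) ltac:(lra)). replace (1 / 2 + (Re s - 1 / 2)) with (Re s) in HK by ring.
  replace ((Re s, Im s) : C) with s in HK by (now destruct s). via HK.
  mono_r. pose proof (LX_ge X (Im s) ltac:(lra)). lra. apply Rle_abs. }
 destruct ap as [K [HK0 HK]].
 assert (TL := three_lines U F (1 / 2 + b) (3 / 2) (K * LX X tau * exp 0.011) (ln (m * LX X tau) + 0.011) (ln 42 + 0.011)).
 specialize (TL ltac:(lra) hF ltac:(intros z Hz; unfold U; lra)).
 specialize (TL ltac:(intros z Hz; apply (gs (Im z)); auto; apply HK; lra)).
 assert (T1 : forall z, Re z = 1 / 2 + b -> Cmod (F z) <= exp (ln (m * LX X tau) + 0.011)).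
 { intros z Hz. rewrite exp_plus, exp_ln by auto. apply (gs (Im z)); auto; try lra.
  destruct z as [p q]. simpl in Hz |- *. rewrite Hz. apply HP. }
 assert (T2 : forall z, Re z = 3 / 2 -> Cmod (F z) <= exp (ln 42 + 0.011)).
 { intros z Hz. rewrite CF, exp_plus, exp_ln by lra. mono. pos. pos.
  apply W_far; lra. apply exp_le. assert (0 <= (Im z - tau) ^ 2) by apply pow2_ge_0.
  assert ((Re z - sigma) ^ 2 <= 1) by (rewrite Hz; assert (0 <= 3 / 2 - sigma <= 1) by lra; nra). lra. }
 specialize (TL T1 T2 s0 ltac:(simpl; lra)).
 rewrite CF in TL. unfold s0 in TL. simpl in TL.
 replace (0.01 * ((sigma - sigma) * ((sigma - sigma) * 1)) - 0.01 * ((tau - tau) * ((tau - tau) * 1))) with 0 in TL by ring.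
 rewrite exp_0, Rmult_1_r in TL. via TL.
 rewrite <- (exp_ln (m * LX X tau)) at 3 by auto. rewrite <- !exp_plus. apply exp_le. right. field. lra.
Qed.

Lemma exp_mult_lower (h : R) (n : nat) : 0 <= h -> (1 + h) ^ n <= exp (INR n * h).
Proof.
 intros Hh. rewrite <- exp_pow_nat. apply pow_incr. split. lra. apply exp_ineq1_le.
Qed.

Lemma exp_30_large : 10 ^ 6 <= exp 30.
Proof.
 apply Rle_trans with ((1 + 1) ^ 30). lra. replace 30 with (INR 30 * 1) by (simpl; lra). apply exp_mult_lower; lra.
Qed.

Lemma loglog_large (X : R) : 30 <= ln (ln X) -> 1 < X -> 10 ^ 6 <= ln X /\ 1000 <= X /\ ln X = exp (ln (ln X)).
Proof.
 intros Hv HX.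
 assert (HlX : 0 < ln X) by (rewrite <- ln_1; apply ln_increasing; lra).
 assert (E : ln X = exp (ln (ln X))) by (symmetry; now apply exp_ln).
 assert (A : 10 ^ 6 <= ln X).
 { rewrite E. via exp_30_large. now apply exp_le. }
 repeat split; auto. assert (T := exp_ineq1_le (ln X)). rewrite exp_ln in T by lra. lra.
Qed.

(** Numerical logarithms and exponentials are certified by (1 + h)^n <= exp (n h), which reduces
    them to rational arithmetic. *)
Lemma ln_42_div (m h : R) (n : nat) : 0 < m -> 0 <= h -> 42 / m <= (1 + h) ^ n -> ln 42 - ln m <= INR n * h.
Proof.
 intros Hm Hh H. rewrite <- ln_div by lra. rewrite <- (ln_exp (INR n * h)). apply ln_le'.
 pos. via H. now apply exp_mult_lower.
Qed.

Lemma exp_neg_upper (x h B : R) (n : nat) : 0 <= h -> INR n * h <= x -> 0 < B -> / B <= (1 + h) ^ n -> exp (- x) <= B.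
Proof.
 intros Hh Hx HB H. rewrite exp_Ropp. rewrite <- (Rinv_inv B). apply Rinv_le_contravar. pos.
 via H. le_trans. now apply exp_mult_lower. now apply exp_le.
Qed.

Lemma exp_0011 : exp 0.011 <= 1.0113.
Proof. le_trans. apply exp_small_ub; lra. replace (1 - 0.011) with 0.989 by lra. lra. Qed.

(* A bound for W just to the right of the critical line propagates to itself with a contraction:
  Harnack doubles the distance to the line and the three lines theorem gains there. *)
Lemma W_near_line (X : R) : RH -> 1 < X -> 30 <= ln (ln X) ->
 forall t, Cmod (W (1 / 2 + 2 / ln (ln X), t)) <= 12 * LX X t.
Proof.
 intros HR HX1 Hv. destruct (loglog_large X Hv HX1) as [HlX [HX EX]].
 set (v := ln (ln X)) in *. set (b := 2 / v).
 assert (Hb : 0 < b <= 1 / 15).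
 { unfold b. split. pos. apply Rmult_le_reg_r with v. lra. unfold Rdiv at 1. rewrite Rmult_assoc, Rinv_l; lra. }
 assert (Lv : forall t, v <= ln (LX X t)).
 { intros t. assert (HL := LX_ge X t HX1). unfold v. apply ln_le'; lra. }
 (* At distance 2b three lines gains a factor 0.1755, since log(LX) b is nearly 2 or more; Harnack
    back to distance b costs 2.25. The product with 1.0113 is below 0.4, and 6.7 is Harnack's
    additive term. *)
 assert (step : forall m, 10 <= m -> (forall t, Cmod (W (1 / 2 + b, t)) <= m * LX X t) ->
   forall t, Cmod (W (1 / 2 + b, t)) <= (6.7 + 0.4 * m) * LX X t).
 { intros m Hm HP t. assert (HL := LX_ge X t HX1).
  assert (Q := W_harnack X (2 * b) t HR HX ltac:(lra) ltac:(lra)). replace (2 * b / 2) with b in Q by field.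
  assert (T := W_three_lines X b m (1 / 2 + 2 * b) t HR HX ltac:(lra) ltac:(lra) ltac:(lra) HP ltac:(lra)).
  assert (E : exp (- (ln (m * LX X t) - ln 42) * ((1 / 2 + 2 * b - 1 / 2 - b) / (1 - b))) <= 0.1755).
  { assert (A : v - 1.6 <= ln (m * LX X t) - ln 42).
   { rewrite ln_mult by lra. assert (B := ln_42_div 10 0.05 32 ltac:(lra) ltac:(lra) ltac:(lra)).
    assert (INR 32 = 32) by (simpl; lra). assert (ln 10 <= ln m) by (apply ln_le'; lra). specialize (Lv t). lra. }
   assert (D : b <= (1 / 2 + 2 * b - 1 / 2 - b) / (1 - b)).
   { replace (1 / 2 + 2 * b - 1 / 2 - b) with b by lra. apply Rmult_le_reg_r with (1 - b). lra. unfold Rdiv. rewrite Rmult_assoc, Rinv_l by lra. nra. }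
   assert (G : 1.89 <= (v - 1.6) * b).
   { replace ((v - 1.6) * b) with (2 - 1.6 * b) by (unfold b; field; lra). lra. }
   replace (- (ln (m * LX X t) - ln 42) * ((1 / 2 + 2 * b - 1 / 2 - b) / (1 - b)))
    with (- ((ln (m * LX X t) - ln 42) * ((1 / 2 + 2 * b - 1 / 2 - b) / (1 - b)))) by ring.
   apply exp_neg_upper with 0.05 37%nat; try lra.
   assert (INR 37 = 37) by (simpl; lra). rewrite H. le_trans. 2: mono; [| |exact A|exact D]; lra. lra. }
  assert (Hw : Cmod (W (1 / 2 + 2 * b, t)) <= 1.0113 * (m * LX X t) * 0.1755).
  { assert (0 < m * LX X t) by pos.
   via T. mono; try (left; apply exp_pos); auto.
   mul_pos; [left; apply exp_pos|lra]. mono_r. lra. apply exp_0011. }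
  replace (1 / 2 + 2 * b) with (1 / 2 + 2 * b) in Q by ring. nra. }
 destruct (pow_lt_1_zero (/ 2) ltac:(rewrite Rabs_pos_eq; lra) b ltac:(lra)) as [j Hj].
 specialize (Hj j ltac:(lia)). rewrite Rabs_pos_eq in Hj by (apply pow_le; lra).
 destruct (W_apriori X j HR HX ltac:(lra)) as [K HK].
 set (K1 := Rmax K 0). assert (HK1 : 0 <= K1) by apply Rmax_r. assert (K <= K1) by apply Rmax_l.
 (* The map m -> 6.7 + 0.4 m has its fixed point below 12; iterating it removes the a priori
    constant geometrically. *)
 assert (it : forall n t, Cmod (W (1 / 2 + b, t)) <= (12 + 0.4 ^ n * K1) * LX X t).
 { induction n as [|n IH]; intros t; assert (HL := LX_ge X t HX1).
  - simpl. assert (T := HK b t ltac:(lra)). nra.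
  - assert (0 <= 0.4 ^ n * K1) by (mul_pos; auto; apply pow_le; lra).
   assert (T := step (12 + 0.4 ^ n * K1) ltac:(lra) IH t). via T. mono_r; simpl; lra. }
 intros t. assert (HL := LX_ge X t HX1). apply Rnot_lt_le. intros Hlt.
 set (d := Cmod (W (1 / 2 + b, t)) - 12 * LX X t) in *. assert (Hd : 0 < d) by (unfold d; lra).
 assert (HKL : 0 < K1 * LX X t + 1) by (assert (0 <= K1 * LX X t) by (mul_pos; lra); lra).
 destruct (pow_lt_1_zero 0.4 ltac:(rewrite Rabs_pos_eq; lra) (d / (K1 * LX X t + 1)) ltac:(pos)) as [n Hn].
 specialize (Hn n ltac:(lia)). rewrite Rabs_pos_eq in Hn by (apply pow_le; lra).
 apply Rmult_lt_compat_r with (r := K1 * LX X t + 1) in Hn; auto. unfold Rdiv in Hn. rewrite Rmult_assoc, Rinv_l in Hn by lra.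
 specialize (it n t). assert (0 <= 0.4 ^ n) by (apply pow_le; lra). unfold d in *. nra.
Qed.

Lemma monotone_from_derivative (g g' : R -> R) (a b : R) : a <= b ->
 (forall x, a <= x <= b -> is_derive g x (g' x)) -> (forall x, a <= x <= b -> 0 <= g' x) -> g a <= g b.
Proof.
 intros Hab Hd Hp. destruct (MVT_gen g a b g') as [c [Hc E]].
 - intros x Hx. rewrite Rmin_left, Rmax_right in Hx by lra. apply Hd; lra.
 - intros x Hx. rewrite Rmin_left, Rmax_right in Hx by lra.
  apply derivable_continuous_pt. exists (g' x). apply is_derive_Reals, Hd; lra.
 - rewrite Rmin_left, Rmax_right in Hc by lra. assert (0 <= g' c * (b - a)) by (mul_pos; [apply Hp|]; lra). lra.
Qed.

(** Re W is integrated horizontally up to Re s = 3/2. By three lines |W| decays like exp (- r (s -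
    1/2 - b)) with r close to v, so the integral is its initial value over r. Monotonicity of g - h
    and g + h replaces the integral. *)
Lemma log_fz_variation (X tau s0 : R) : RH -> 1 < X -> 30 <= ln (ln X) ->
 let v := ln (ln X) in 1 / 2 + 6 / v <= s0 <= 3 / 2 ->
 Rabs (ln (Cmod (fz (s0, tau))) - ln (Cmod (fz (3 / 2, tau)))) <= 0.32 * LX X tau / v.
Proof.
 intros HR HX1 Hv v Hs0'. fold v in Hv. destruct (loglog_large X Hv HX1) as [HlX [HX EX]].
 fold v in EX. assert (HP := W_near_line X HR HX1 Hv). fold v in HP. set (b := 2 / v) in *.
 assert (Hb : 0 < b <= 1 / 15).
 { unfold b. split. pos. apply Rmult_le_reg_r with v. lra. unfold Rdiv at 1. rewrite Rmult_assoc, Rinv_l; lra. }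
 assert (HL := LX_ge X tau HX1). assert (Lv : v <= ln (LX X tau)) by (unfold v; apply ln_le'; lra).
 (* A lower bound for log(12 LX) - log 42, as log(42/12) < 1.3. *)
 set (r := v - 13 / 10). set (B := 1.0113 * (12 * LX X tau)).
 assert (HB : 0 < B) by (unfold B; lra).
 assert (HW : forall s, 1 / 2 + b <= s <= 3 / 2 -> Cmod (W (s, tau)) <= B * exp (- r * (s - 1 / 2 - b))).
 { intros s Hs. le_trans. apply (W_three_lines X b 12 s tau); auto; lra.
  mono; try (left; apply exp_pos).
  mul_pos; [left; apply exp_pos|lra].
  unfold B. mono_r. lra. apply exp_0011.
  apply exp_le.
  assert (A : r <= ln (12 * LX X tau) - ln 42).
  { rewrite ln_mult by lra. assert (Q := ln_42_div 12 0.05 26 ltac:(lra) ltac:(lra) ltac:(lra)).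
   assert (INR 26 = 26) by (simpl; lra). unfold r. lra. }
  assert (D : s - 1 / 2 - b <= (s - 1 / 2 - b) / (1 - b)).
  { apply Rmult_le_reg_r with (1 - b). lra. unfold Rdiv at 2. rewrite Rmult_assoc, Rinv_l by lra. nra. }
  assert (r * (s - 1 / 2 - b) <= (ln (12 * LX X tau) - ln 42) * ((s - 1 / 2 - b) / (1 - b))).
  { mono; unfold r in *; lra. }
  lra. }
 set (g := fun s => ln (Cmod (fz (s, tau)))). set (h := fun s => B / r * exp (- r * (s - 1 / 2 - b))).
 assert (Hr : 28 <= r) by (unfold r; lra).
 assert (Dg : forall s, 1 / 2 < s -> is_derive g s (Re (W (s, tau)))).
 { intros s Hs. assert (E : forall y, ((0, tau) + RtoC y * 1)%C = (y, tau)) by (intros; apply C_eq; csimp; simpl; ring).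
  assert (D := ln_mod_derive fz (0, tau) 1 (fz1 (s, tau)) s). rewrite E in D.
  specialize (D (fz1_spec (s, tau) ltac:(simpl; lra)) (fz_neq_0 (s, tau) HR Hs)).
  replace (Re (W (s, tau))) with (Re (fz1 (s, tau) * 1 / fz (s, tau))%C).
  2:{ unfold W. now rewrite Cmult_1_r. }
  apply is_derive_ext with (2 := D). intros y. unfold g. now rewrite E. }
 assert (Dh : forall s, is_derive h s (- B * exp (- r * (s - 1 / 2 - b)))).
 { intros s. unfold h.
  replace (- B * exp (- r * (s - 1 / 2 - b))) with (B / r * (- r * exp (- r * (s - 1 / 2 - b)))) by (field; lra).
  apply is_derive_scal. apply (is_derive_comp exp (fun s => - r * (s - 1 / 2 - b))).
  apply is_derive_Reals, derivable_pt_lim_exp. auto_derive. auto. ring. }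
 assert (H6 : 6 / v <= 0.2) by (apply Rmult_le_reg_r with v; [lra|unfold Rdiv; rewrite Rmult_assoc, Rinv_l; lra]).
 assert (Hs0 : 1 / 2 + b <= s0 <= 3 / 2).
 { unfold b. assert (0 < / v) by pos. unfold Rdiv in *. lra. }
 assert (M1 : g s0 - h s0 <= g (3 / 2) - h (3 / 2)).
 { apply (monotone_from_derivative (fun s => g s - h s) (fun s => Re (W (s, tau)) - (- B * exp (- r * (s - 1 / 2 - b))))). lra.
  intros s Hs. apply is_derive_Rminus; auto. apply Dg; lra.
  intros s Hs. assert (T := HW s ltac:(lra)). assert (T2 := re_le_Cmod (W (s, tau))). apply Rabs_le_between in T2. lra. }
 assert (M2 : - (g s0 + h s0) <= - (g (3 / 2) + h (3 / 2))).
 { assert (M := monotone_from_derivative (fun s => - 1 * (g s + h s)) (fun s => -1 * (Re (W (s, tau)) + (- B * exp (- r * (s - 1 / 2 - b))))) s0 (3 / 2)).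
  cbv beta in M. assert (M' : -1 * (g s0 + h s0) <= -1 * (g (3 / 2) + h (3 / 2))). 2: lra.
  apply M. lra. intros s Hs. apply is_derive_scal. apply is_derive_Rplus; auto. apply Dg; lra.
  intros s Hs. assert (T := HW s ltac:(lra)). assert (T2 := Re_le_mod (W (s, tau))). lra. }
 assert (Hh : forall s, 0 < h s) by (intros s; unfold h; apply Rmult_lt_0_compat; [apply Rdiv_lt_0_compat; lra|pos]).
 assert (P1 := Hh (3 / 2)).
 assert (F : h s0 <= 0.32 * LX X tau / v).
 (* The distance from b = 2/v to 6/v gives an exponent of nearly -4, and 1.0113 times 12 times
    0.0246 times 30/28.7 is below 0.32. *)
 { unfold h. assert (E1 : exp (- r * (s0 - 1 / 2 - b)) <= 0.0246).
  { replace (- r * (s0 - 1 / 2 - b)) with (- (r * (s0 - 1 / 2 - b))) by ring.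
   apply exp_neg_upper with 0.05 76%nat; try lra.
   assert (INR 76 = 76) by (simpl; lra). rewrite H.
   apply Rle_trans with (r * (1 / 2 + 6 / v - 1 / 2 - b)). 2: mono_l; lra.
   replace (r * (1 / 2 + 6 / v - 1 / 2 - b)) with (4 - 13 / 10 * (4 / v)) by (unfold r, b; field; lra).
   assert (4 / v <= 4 / 30) by (unfold Rdiv; mono_l; [lra|apply Rinv_le_contravar; lra]). lra. }
  apply Rle_trans with (B / r * 0.0246). mono_l; auto. pos.
  unfold B. apply Rmult_le_reg_r with (v * r). pos.
  replace (1.0113 * (12 * LX X tau) / r * 0.0246 * (v * r)) with (1.0113 * 12 * 0.0246 * LX X tau * v * (r * / r)) by (unfold Rdiv; ring).
  replace (0.32 * LX X tau / v * (v * r)) with (0.32 * LX X tau * r * (v * / v)) by (unfold Rdiv; ring). rewrite !Rinv_r by lra.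
  assert (v <= 30 / 28.7 * r) by (unfold r; lra). nra. }
 apply Rabs_le. unfold g in *. split; lra.
Qed.

Lemma mod_ratio_1 (a b t : R) : Rabs a <= b -> Cmod (a, t) <= Cmod (b, t).
Proof.
 intros H. assert (A := Cmod_sq (a, t)). assert (B := Cmod_sq (b, t)). rewrite ?Re_pair, ?Im_pair in *.
 pose proof (Cmod_ge_0 (a, t)). pose proof (Cmod_ge_0 (b, t)). apply Rabs_le_between in H. nra.
Qed.

Lemma mod_ratio_2 (a b K t : R) : 1 <= K -> 0 <= b <= K * Rabs a -> Cmod (b, t) <= K * Cmod (a, t).
Proof.
 intros HK H. assert (A := Cmod_sq (a, t)). assert (B := Cmod_sq (b, t)). rewrite ?Re_pair, ?Im_pair in *.
 pose proof (Cmod_ge_0 (a, t)). pose proof (Cmod_ge_0 (b, t)).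
 assert (Rabs a ^ 2 = a ^ 2) by (rewrite <- !Rsqr_pow2; symmetry; apply Rsqr_abs).
 pose proof (Rabs_pos a). 
 assert (b ^ 2 <= K ^ 2 * a ^ 2) by (rewrite <- H2, <- Rpow_mult_distr; apply pow_incr; lra).
 assert (1 <= K ^ 2) by nra. assert (0 <= t ^ 2) by apply pow2_ge_0.
 assert (t ^ 2 <= K ^ 2 * t ^ 2) by (rewrite <- (Rmult_1_l (t ^ 2)) at 1; mono_r; lra).
 assert (Cmod (b, t) ^ 2 <= (K * Cmod (a, t)) ^ 2) by (rewrite Rpow_mult_distr, A, B; lra).
 assert (0 <= K * Cmod (a, t)) by (mul_pos; lra).
 apply Rnot_lt_le. intros Hlt. assert ((K * Cmod (a, t)) ^ 2 < Cmod (b, t) ^ 2) by nra. lra.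
Qed.

(** Comparison with Re s = 3/2, where zeta and 1/zeta are at most 3. The three parts bound 1/zeta,
    the polynomial growth of fz, and zeta itself away from the pole. *)
Lemma zeta_bounds (X tau s0 : R) : RH -> 1 < X -> 30 <= ln (ln X) ->
 let v := ln (ln X) in let s := (s0, tau) : C in 1 / 2 + 6 / v <= s0 <= 3 / 2 ->
 Cmod (s - 1) <= 3 * exp (0.32 * LX X tau / v) * Cmod (fz s) /\
 Cmod (fz s) <= 3 * exp (0.32 * LX X tau / v) * (1 + Rabs tau) /\
 (s0 <= 3 / 4 -> Cmod (fz s) <= 6 * exp (0.32 * LX X tau / v) * Cmod (s - 1)).
Proof.
 intros HR HX1 Hv v s Hs0. fold v in Hv. assert (K := log_fz_variation X tau s0 HR HX1 Hv Hs0). fold v in K. cbv zeta in K. fold s in K.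
 assert (H6 : 0 < 6 / v) by pos.
 set (a := 0.32 * LX X tau / v) in *. set (q := (3 / 2, tau) : C). fold q in K.
 assert (N1 : 0 < Cmod (fz s)) by (apply Cmod_gt_0, fz_neq_0; auto; simpl; lra).
 assert (N2 : 0 < Cmod (fz q)) by (apply Cmod_gt_0, fz_neq_0; auto; simpl; lra).
 apply Rabs_le_between in K.
 assert (A1 : Cmod (fz q) <= exp a * Cmod (fz s)).
 { rewrite <- (exp_ln (Cmod (fz q))), <- (exp_ln (Cmod (fz s))) by auto. rewrite <- exp_plus. apply exp_le. lra. }
 assert (A2 : Cmod (fz s) <= exp a * Cmod (fz q)).
 { rewrite <- (exp_ln (Cmod (fz q))), <- (exp_ln (Cmod (fz s))) by auto. rewrite <- exp_plus. apply exp_le. lra. }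
 assert (Eq : (q - 1)%C = (1 / 2, tau)) by (apply C_eq; csimp; simpl; field).
 assert (Es : (s - 1)%C = (s0 - 1, tau)) by (apply C_eq; unfold s; csimp; simpl; ring).
 assert (B1 : Cmod (q - 1) <= 3 * Cmod (fz q)).
 { assert (T := fz_lower q ltac:(simpl; lra)). replace (1 + / (Re q - 1)) with 3 in T by (simpl; field). exact T. }
 assert (B2 : Cmod (fz q) <= 3 * Cmod (q - 1)).
 { rewrite fz_zeta by (simpl; lra). rewrite Cmod_mult, Rmult_comm. mono_r. pos.
  replace 3 with (1 + / (3 / 2 - 1)) by field. apply zeta_s_bound. simpl; lra. }
 pose proof (exp_pos a). split; [|split].
 - assert (D1 : Cmod (s - 1) <= Cmod (q - 1)).
  { rewrite Eq, Es. apply mod_ratio_1. apply Rabs_le. lra. }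
  nra.
 - assert (D1 : Cmod (q - 1) <= 1 + Rabs tau).
  { via Cmod_le_abs. rewrite Eq, Re_pair, Im_pair, Rabs_pos_eq; lra. }
  nra.
 - intros H34. assert (D2 : Cmod (q - 1) <= 2 * Cmod (s - 1)).
  { rewrite Eq, Es. apply mod_ratio_2. lra. rewrite Rabs_left1; lra. }
  nra.
Qed.

(** * Contour integrals *)

Definition contC (F : R -> C) (t : R) : Prop :=
 continuous (fun s => Re (F s)) t /\ continuous (fun s => Im (F s)) t.

Definition CInt (F : R -> C) (a b : R) : C :=
 (RInt (fun t => Re (F t)) a b, RInt (fun t => Im (F t)) a b).

Lemma ex_RInt_cont (g : R -> R) (a b : R) : a <= b -> (forall t, a <= t <= b -> continuous g t) -> ex_RInt g a b.
Proof.
 intros H Hg. apply (ex_RInt_continuous (V := R_CompleteNormedModule)). intros t Ht.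
 rewrite Rmin_left, Rmax_right in Ht by lra. auto.
Qed.

Lemma is_RInt_CInt (F : R -> C) (a b : R) : a <= b -> (forall t, a <= t <= b -> contC F t) ->
 is_RInt (fun t => Re (F t)) a b (Re (CInt F a b)) /\ is_RInt (fun t => Im (F t)) a b (Im (CInt F a b)).
Proof.
 intros Hab HF. split; apply (RInt_correct (V := R_CompleteNormedModule)); apply ex_RInt_cont; auto; intros t Ht; apply (HF t Ht).
Qed.

Lemma CInt_of (F : R -> C) (a b : R) (l : C) :
 is_RInt (fun t => Re (F t)) a b (Re l) -> is_RInt (fun t => Im (F t)) a b (Im l) -> CInt F a b = l.
Proof. intros H1 H2. unfold CInt. apply C_eq; csimp; now apply is_RInt_unique. Qed.

Lemma CInt_ext (F G : R -> C) (a b : R) : a <= b -> (forall t, a <= t <= b -> F t = G t) -> CInt F a b = CInt G a b.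
Proof.
 intros Hab E. unfold CInt. f_equal; apply RInt_ext; intros t Ht; rewrite Rmin_left, Rmax_right in Ht by lra; now rewrite E by lra.
Qed.

Lemma is_RInt_lin2 (u v : R -> R) (a b p q x y : R) :
 is_RInt u a b x -> is_RInt v a b y -> is_RInt (fun t => p * u t + q * v t) a b (p * x + q * y).
Proof.
 intros Hu Hv. apply (is_RInt_plus (V := R_NormedModule) (fun t => p * u t) (fun t => q * v t)).
 apply (is_RInt_scal (V := R_NormedModule) u a b p x Hu). apply (is_RInt_scal (V := R_NormedModule) v a b q y Hv).
Qed.

Lemma CInt_lin (F G : R -> C) (a b : R) (c : C) : a <= b ->
 (forall t, a <= t <= b -> contC F t) -> (forall t, a <= t <= b -> contC G t) ->
 CInt (fun t => F t + c * G t)%C a b = (CInt F a b + c * CInt G a b)%C.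
Proof.
 intros Hab HF HG. destruct (is_RInt_CInt F a b Hab HF) as [A1 A2]. destruct (is_RInt_CInt G a b Hab HG) as [B1 B2].
 apply CInt_of.
 - apply is_RInt_ext with (fun t => 1 * Re (F t) + 1 * (Re c * Re (G t) + - Im c * Im (G t))).
  intros; csimp; toR; ring.
  replace (Re (CInt F a b + c * CInt G a b)%C) with (1 * Re (CInt F a b) + 1 * (Re c * Re (CInt G a b) + - Im c * Im (CInt G a b))) by (csimp; ring).
  apply is_RInt_lin2; auto. apply is_RInt_lin2; auto.
 - apply is_RInt_ext with (fun t => 1 * Im (F t) + 1 * (Re c * Im (G t) + Im c * Re (G t))).
  intros; csimp; toR; ring.
  replace (Im (CInt F a b + c * CInt G a b)%C) with (1 * Im (CInt F a b) + 1 * (Re c * Im (CInt G a b) + Im c * Re (CInt G a b))) by (csimp; ring).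
  apply is_RInt_lin2; auto. apply is_RInt_lin2; auto.
Qed.

Lemma CInt_scal (G : R -> C) (a b : R) (c : C) : a <= b -> (forall t, a <= t <= b -> contC G t) ->
 CInt (fun t => c * G t)%C a b = (c * CInt G a b)%C.
Proof.
 intros Hab HG. assert (E := CInt_lin G G a b (c - 1) Hab HG HG).
 replace (c * CInt G a b)%C with (CInt G a b + (c - 1) * CInt G a b)%C by ring. rewrite <- E.
 apply CInt_ext; auto. intros; ring.
Qed.

Lemma CInt_bound (F : R -> C) (g : R -> R) (a b M : R) : a <= b -> (forall t, a <= t <= b -> contC F t) ->
 is_RInt g a b M -> (forall t, a <= t <= b -> Cmod (F t) <= g t) -> Cmod (CInt F a b) <= M.
Proof.
 intros Hab HF Hg HB. destruct (is_RInt_CInt F a b Hab HF) as [A1 A2]. set (Z := CInt F a b) in *.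
 assert (HM : 0 <= M).
 { apply (is_RInt_le (fun _ => 0) g a b (scal (b - a) 0) M) in Hg; auto.
  unfold scal in Hg; simpl in Hg; unfold mult in Hg; simpl in Hg. lra.
  apply (is_RInt_const (V := R_NormedModule)). intros t Ht. via Cmod_ge_0. apply HB; lra. }
 destruct (Req_dec (Cmod Z) 0) as [E|E]. lra.
 assert (HZ : 0 < Cmod Z) by (pose proof (Cmod_ge_0 Z); lra).
 assert (I1 := is_RInt_lin2 _ _ _ _ (Re Z) (Im Z) _ _ A1 A2).
 assert (I2 := is_RInt_scal (V := R_NormedModule) g a b (Cmod Z) M Hg).
 assert (L : Re Z * Re Z + Im Z * Im Z <= Cmod Z * M).
 { apply (is_RInt_le _ _ a b _ _ Hab I1 I2). intros t Ht.
  replace (Re Z * Re (F t) + Im Z * Im (F t)) with (Re (Cconj Z * F t)%C) by (csimp; ring).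
  via Re_le_mod. rewrite Cmod_mult, Cmod_conj.
  change (scal (Cmod Z) (g t)) with (Cmod Z * g t).
  mono_l. lra. apply HB; lra. }
 apply Rmult_le_reg_l with (Cmod Z); auto.
 replace (Cmod Z * Cmod Z) with (Cmod Z ^ 2) by ring. rewrite Cmod_sq. lra.
Qed.

Lemma CInt_bound_const (F : R -> C) (a b B : R) : a <= b -> (forall t, a <= t <= b -> contC F t) ->
 (forall t, a <= t <= b -> Cmod (F t) <= B) -> Cmod (CInt F a b) <= (b - a) * B.
Proof.
 intros Hab HF HB. apply CInt_bound with (fun _ => B); auto. apply (is_RInt_const (V := R_NormedModule)).
Qed.

Lemma CInt_Chasles (F : R -> C) (a b c : R) : a <= b <= c -> (forall t, a <= t <= c -> contC F t) ->
 CInt F a c = (CInt F a b + CInt F b c)%C.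
Proof.
 intros H HF. apply C_eq; [rewrite Re_plus | rewrite Im_plus]; symmetry.
 - apply (RInt_Chasles (V := R_CompleteNormedModule) (fun t => Re (F t)) a b c);
   apply ex_RInt_cont; try lra; intros t Ht; destruct (HF t); auto; lra.
 - apply (RInt_Chasles (V := R_CompleteNormedModule) (fun t => Im (F t)) a b c);
   apply ex_RInt_cont; try lra; intros t Ht; destruct (HF t); auto; lra.
Qed.

Lemma CInt_FTC (P P' : R -> C) (a b : R) : a <= b -> (forall t, a <= t <= b -> rder P t (P' t)) ->
 (forall t, a <= t <= b -> contC P' t) -> CInt P' a b = (P b - P a)%C.
Proof.
 intros Hab HP HC. apply CInt_of.
 - apply (is_RInt_derive (V := R_CompleteNormedModule) (fun t => Re (P t))); intros t Ht;
   rewrite Rmin_left, Rmax_right in Ht by lra. apply HP; auto. destruct (HC t Ht); auto.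
 - apply (is_RInt_derive (V := R_CompleteNormedModule) (fun t => Im (P t))); intros t Ht;
   rewrite Rmin_left, Rmax_right in Ht by lra. apply HP; auto. destruct (HC t Ht); auto.
Qed.

Definition copen (U : C -> Prop) : Prop := forall z, U z -> exists r, 0 < r /\ forall w, Cmod (w - z) < r -> U w.

Lemma ccont_vert (F : C -> C) (s t : R) : ccont F (s, t) -> contC (fun y => F (s, y)) t.
Proof.
 intros H. split; apply continuity_pt_filterlim; intros eps He;
  destruct (H eps He) as [d [Hd Hf]]; exists d; (split; [exact Hd|]); intros y [_ Hy]; simpl in *; unfold R_dist in *.
 all: assert (A : Cmod ((s, y) - (s, t)) < d) by
  (eapply Rle_lt_trans; [apply Cmod_le_abs|]; csimp; rewrite Rminus_diag, Rabs_R0; lra).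
 - eapply Rle_lt_trans; [|apply (Hf _ A)]. rewrite <- Re_minus. apply re_le_Cmod.
 - eapply Rle_lt_trans; [|apply (Hf _ A)]. rewrite <- Im_minus. apply Im_le_Cmod.
Qed.

(** Integration in the height t rather than in z: the factor i of dz is dropped, so residues appear
    with 2 pi. *)
Definition vint (F : C -> C) (T s : R) : C := CInt (fun t => F (s, t)) (- T) T.

Lemma cdiff_horiz (F : C -> C) (s t : R) (l : C) : cdiff F (s, t) l -> rder (fun u => F (u, t)) s l.
Proof.
 intros H. assert (E : forall u, ((0, t) + RtoC u * 1)%C = (u, t)) by (intros; apply C_eq; csimp; simpl; ring).
 assert (K := cdiff_line F (0, t) 1 l s). rewrite E in K. specialize (K H).
 apply rder_ext with (3 := K). intros; now rewrite E. ring.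
Qed.

Lemma cdiff_vert (F : C -> C) (s t : R) (l : C) : cdiff F (s, t) l -> rder (fun u => F (s, u)) t (Ci * l)%C.
Proof.
 intros H. assert (E : forall u, ((s, 0) + RtoC u * Ci)%C = (s, u)) by (intros; apply C_eq; csimp; simpl; ring).
 assert (K := cdiff_line F (s, 0) Ci l t). rewrite E in K. specialize (K H).
 apply rder_ext with (3 := K). intros; now rewrite E. ring.
Qed.

(** The derivative under the integral sign is F', and i F' is the derivative in t, so the integral
    of F' is a difference of end values. This is Cauchy's theorem for rectangles in differential
    form. *)
Lemma vint_derive (U : C -> Prop) (F : C -> C) (T s : R) : copen U -> hol 2 U F -> 0 <= T ->
 (forall t, - T <= t <= T -> U (s, t)) ->
 rder (vint F T) s (- Ci * (F (s, T) - F (s, (- T)%R)))%C.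
Proof.
 intros HU HF HT Hs. assert (HF0 := HF). destruct HF as [F1 [D1 HF1]].
 assert (C1 : forall z, U z -> ccont F1 z) by (intros z Hz; apply (hol_cont 0 U); auto).
 (* Compactness of the segment: an open set containing it contains all nearby vertical segments. *)
 assert (tube : exists d, 0 < d /\ forall u t, Rabs (u - s) < d -> - T <= t <= T -> U (u, t)).
 { destruct (classic (exists d, 0 < d /\ forall u t, Rabs (u - s) < d -> - T <= t <= T -> U (u, t))) as [H|H]; auto.
  exfalso.
  assert (R0 : forall t, exists r, 0 < r /\ (- T <= t <= T -> forall w, Cmod (w - (s, t)) < r -> U w)).
  { intros t. destruct (classic (- T <= t <= T)) as [Ht|Ht].
   - destruct (HU _ (Hs t Ht)) as [r [Hr Hw]]. exists r. auto.
   - exists 1. split. lra. tauto. }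
  set (rr := fun t => proj1_sig (constructive_indefinite_description _ (R0 t))).
  assert (Hrr : forall t, 0 < rr t /\ (- T <= t <= T -> forall w, Cmod (w - (s, t)) < rr t -> U w)).
  { intros t. unfold rr. destruct constructive_indefinite_description; auto. }
  assert (Hr2 : forall t, 0 < rr t / 2) by (intros t; destruct (Hrr t); lra).
  clearbody rr.
  destruct (compactness_value_1d (- T) T (fun t => mkposreal (rr t / 2) (Hr2 t))) as [d Hd]. apply H. exists d. split. apply cond_pos. intros u t Hu Ht. apply NNPP. intros NU.
  apply (Hd t Ht). intros [t0 [Ht0 [Hc1 Hc2]]]. simpl in *. apply NU.
  destruct (Hrr t0) as [P Q]. apply (Q Ht0).
  eapply Rle_lt_trans. apply Cmod_le_abs. csimp. lra. }
 destruct tube as [d [Hd Hdu]].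
 assert (Vc : forall t, - T <= t <= T -> contC (fun y => F1 (s, y)) t).
 { intros t Ht. apply ccont_vert, C1, Hs, Ht. }
 assert (E : (- Ci * (F (s, T) - F (s, (- T)%R)))%C = CInt (fun t => F1 (s, t)) (- T) T).
 { assert (X := CInt_FTC (fun t => F (s, t)) (fun t => Ci * F1 (s, t))%C (- T) T ltac:(lra)).
  rewrite <- X.
  - rewrite CInt_scal by (auto; lra). replace (- Ci * (Ci * CInt (fun t => F1 (s, t)) (- T) T))%C with (- (Ci * Ci) * CInt (fun t => F1 (s, t)) (- T) T)%C by ring.
   replace (Ci * Ci)%C with (- (1))%C by (apply C_eq; simpl; ring). ring.
  - intros t Ht. apply cdiff_vert, D1, Hs, Ht.
  - intros t Ht. destruct (Vc t Ht) as [A B].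
   split.
   + apply continuous_ext with (fun y => (-1) * Im (F1 (s, y)) + 0 * Im (F1 (s, y))). intros; unfold Ci; csimp; toR; ring.
    apply continuous_lin2; auto.
   + apply continuous_ext with (fun y => 1 * Re (F1 (s, y)) + 0 * Im (F1 (s, y))). intros; unfold Ci; csimp; toR; ring.
    apply continuous_lin2; auto. }
 assert (HR : forall u t, Rabs (u - s) < d -> - T <= t <= T -> rder (fun y => F (y, t)) u (F1 (u, t))).
 { intros u t Hu Ht. apply cdiff_horiz, D1, Hdu; auto. }
 assert (Hmm : forall t, Rmin (- T) T <= t <= Rmax (- T) T -> - T <= t <= T).
 { intros t. rewrite Rmin_left, Rmax_right by lra. auto. }
 assert (part : forall (p : C -> R), (forall u t l, rder (fun y => F (y, t)) u l -> is_derive (fun y => p (F (y, t))) u (p l)) ->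
   (forall z, ccont F1 z -> continuity_2d_pt (fun u v => p (F1 (u, v))) (Re z) (Im z)) ->
   (forall u, Rabs (u - s) < d -> ex_RInt (fun t => p (F (u, t))) (- T) T) ->
   is_derive (fun u => RInt (fun t => p (F (u, t))) (- T) T) s (RInt (fun t => p (F1 (s, t))) (- T) T)).
 { intros p Pd Pc Pi.
  assert (Dv : forall u t, Rabs (u - s) < d -> - T <= t <= T -> Derive (fun y => p (F (y, t))) u = p (F1 (u, t))).
  { intros u t Hu Ht. apply is_derive_unique, Pd, HR; auto. }
  assert (s0 : Rabs (s - s) < d) by (rewrite Rminus_diag, Rabs_R0; auto).
  rewrite (RInt_ext (fun t => p (F1 (s, t))) (fun t => Derive (fun y => p (F (y, t))) s)).
  2:{ intros t Ht. symmetry. apply Dv; auto. apply Hmm; lra. }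
  apply (is_derive_RInt_param (fun u t => p (F (u, t)))).
  - exists (mkposreal d Hd). intros u Hu t Ht. exists (p (F1 (u, t))). apply Pd, HR. exact Hu. apply Hmm, Ht.
  - intros t Ht. apply Hmm in Ht.
   apply continuity_2d_pt_ext_loc with (fun u v => p (F1 (u, v))).
   2:{ apply (Pc (s, t)). apply C1, Hs, Ht. }
   destruct (HU _ (Hs t Ht)) as [r [Hr Hw]].
   exists (mkposreal (r / 2) ltac:(lra)). simpl. intros u v Hu Hv. symmetry.
   apply is_derive_unique, Pd, cdiff_horiz, D1, Hw. eapply Rle_lt_trans. apply Cmod_le_abs. csimp. lra.
  - exists (mkposreal d Hd). intros u Hu. apply Pi. exact Hu. }
 assert (Fc : forall u, Rabs (u - s) < d -> forall t, - T <= t <= T -> contC (fun y => F (u, y)) t).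
 { intros u Hu t Ht. apply ccont_vert. apply (hol_cont 1 U); auto. }
 rewrite E. split.
 - apply (part Re).
  + intros u t l [A B]. exact A.
  + intros z Hz. destruct z as [x y]. apply (continuity_2d_ccont F1 x y Hz).
  + intros u Hu. apply ex_RInt_cont. lra. intros t Ht. apply (Fc u Hu t Ht).
 - apply (part Im).
  + intros u t l [A B]. exact B.
  + intros z Hz. destruct z as [x y]. apply (continuity_2d_ccont F1 x y Hz).
  + intros u Hu. apply ex_RInt_cont. lra. intros t Ht. apply (Fc u Hu t Ht).
Qed.

(** Only the horizontal edges matter: the mean value inequality in the abscissa bounds the change by
    their sup norm. *)
Lemma vint_shift (U : C -> Prop) (F : C -> C) (T a b B : R) : copen U -> hol 2 U F -> 0 <= T -> a <= b ->
 (forall s t, a <= s <= b -> - T <= t <= T -> U (s, t)) ->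
 (forall s, a <= s <= b -> Cmod (F (s, T)) <= B /\ Cmod (F (s, (- T)%R)) <= B) ->
 Cmod (vint F T b - vint F T a) <= 2 * B * (b - a).
Proof.
 intros HU HF HT Hab Hin HB.
 apply (mean_value_C (vint F T) (fun s => - Ci * (F (s, T) - F (s, (- T)%R)))%C); auto.
 - intros s Hs. apply vint_derive with U; auto.
 - intros s Hs. rewrite Cmod_mult, Cmod_opp, Cmod_Ci, Rmult_1_l. via Cmod_triangle_minus.
  destruct (HB s Hs). lra.
Qed.

Lemma ccont_vert_seg (F : C -> C) (T s : R) : (forall t, - T <= t <= T -> ccont F (s, t)) ->
 forall t, - T <= t <= T -> contC (fun y => F (s, y)) t.
Proof. intros H t Ht. apply ccont_vert. auto. Qed.

Lemma vint_cont (N : C -> C) (T p r : R) : 0 <= T -> 0 < r ->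
 (forall s t, Rabs (s - p) < r -> - T <= t <= T -> ccont N (s, t)) ->
 forall eps, 0 < eps -> exists d, 0 < d /\ forall s, Rabs (s - p) <= d -> Cmod (vint N T s - vint N T p) <= eps.
Proof.
 intros HT Hr HN eps He. set (e' := eps / (4 * T + 4)).
 assert (He' : 0 < e') by pos.
 assert (Hp : Rabs (p - p) < r) by (rewrite Rminus_diag, Rabs_R0; auto).
 destruct (uniform_continuity_2d_1d' (fun u v => Re (N (u, v))) (- T) T p) with (eps := mkposreal e' He') as [d1 H1].
 { intros t Ht. apply (continuity_2d_ccont N p t). auto. }
 destruct (uniform_continuity_2d_1d' (fun u v => Im (N (u, v))) (- T) T p) with (eps := mkposreal e' He') as [d2 H2].
 { intros t Ht. apply (continuity_2d_ccont N p t). auto. }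
 exists (Rmin (r / 2) (Rmin d1 d2)). split.
 { apply Rmin_pos. lra. apply Rmin_pos; apply cond_pos. }
 intros s Hs.
 assert (S0 : Rabs (s - p) <= r / 2) by (le_trans; [exact Hs|apply Rmin_l]).
 assert (S1 : Rabs (s - p) <= d1) by (le_trans; [exact Hs|le_trans; [apply Rmin_r|apply Rmin_l]]).
 assert (S2 : Rabs (s - p) <= d2) by (le_trans; [exact Hs|le_trans; [apply Rmin_r|apply Rmin_r]]).
 apply Rabs_le_between in S1. apply Rabs_le_between in S2.
 assert (Vs : forall t, - T <= t <= T -> contC (fun y => N (s, y)) t).
 { apply ccont_vert_seg. intros; apply HN; auto. lra. }
 assert (Vp : forall t, - T <= t <= T -> contC (fun y => N (p, y)) t).
 { apply ccont_vert_seg. intros; apply HN; auto. }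
 unfold vint. replace (CInt (fun t => N (s, t)) (- T) T - CInt (fun t => N (p, t)) (- T) T)%C
  with (CInt (fun t => N (s, t)) (- T) T + - (1) * CInt (fun t => N (p, t)) (- T) T)%C by ring.
 rewrite <- CInt_lin by (auto; lra).
 apply Rle_trans with ((T - - T) * (2 * e')).
 - apply CInt_bound_const. lra.
  + intros t Ht. apply (ccont_vert (fun z => N z + - (1) * N (p, Im z))%C s t).
   apply ccont_plus. apply HN; auto; lra. apply ccont_mult. apply ccont_const.
   intros ep Hep. destruct (HN p t Hp Ht ep Hep) as [d [Hd Hn]]. exists d. split; auto.
   intros w Hw. apply Hn. eapply Rle_lt_trans. 2: exact Hw.
   assert (A := Im_le_Cmod (w - (s, t))). rewrite Im_minus, Im_pair in A.
   via Cmod_le_abs. csimp. rewrite Rminus_diag, Rabs_R0. lra.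
  + intros t Ht.
   assert (A := H1 t p t s Ht ltac:(destruct d1; simpl in *; lra) Ht ltac:(lra) ltac:(rewrite Rminus_diag, Rabs_R0; apply cond_pos)).
   assert (B := H2 t p t s Ht ltac:(destruct d2; simpl in *; lra) Ht ltac:(lra) ltac:(rewrite Rminus_diag, Rabs_R0; apply cond_pos)).
   simpl in A, B. via Cmod_le_abs.
   replace (N (s, t) + - (1) * N (p, t))%C with (N (s, t) - N (p, t))%C by ring.
   rewrite Re_minus, Im_minus. unfold Re, Im in *. lra.
 - unfold e'. replace ((T - - T) * (2 * (eps / (4 * T + 4)))) with (eps * (T / (T + 1))) by (field; lra).
  rewrite <- (Rmult_1_r eps) at 2. mono_l. lra.
  apply Rmult_le_reg_r with (T + 1). lra. unfold Rdiv. rewrite Rmult_assoc, Rinv_l by lra. lra.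
Qed.

Lemma hol_ext_open (n : nat) (U : C -> Prop) (f g : C -> C) : copen U ->
 (forall z, U z -> f z = g z) -> hol n U f -> hol n U g.
Proof.
 destruct n as [|n]; intros HU E H. exact I. destruct H as [f' [H1 H2]]. exists f'. split; auto.
 intros z Hz. destruct (HU z Hz) as [r [Hr Hw]]. apply cdiff_ext_loc with f r; auto.
Qed.

Lemma copen_minus_point (U : C -> Prop) (p : C) : copen U -> copen (fun z => U z /\ z <> p).
Proof.
 intros HU z [Hz Hp]. destruct (HU z Hz) as [r [Hr Hw]].
 assert (H : 0 < Cmod (z - p)).
 { apply Cmod_gt_0. intros E. apply Hp. replace z with ((z - p) + p)%C by ring. rewrite E. ring. }
 exists (Rmin r (Cmod (z - p))). split. apply Rmin_pos; auto. intros w Hw'. split.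
 - apply Hw. eapply Rlt_le_trans. exact Hw'. apply Rmin_l.
 - intros ->. rewrite Cmod_minus_sym in Hw'. assert (A := Rmin_r r (Cmod (z - p))). lra.
Qed.

Lemma vint_shift_punctured (U : C -> Prop) (N : C -> C) (T a b p B : R) : copen U -> 0 < T -> a < p < b ->
 hol 2 (fun z => U z /\ z <> RtoC p) N -> ccont N (RtoC p) ->
 (forall s t, a <= s <= b -> - T <= t <= T -> U (s, t)) ->
 (forall s, a <= s <= b -> Cmod (N (s, T)) <= B /\ Cmod (N (s, (- T)%R)) <= B) ->
 Cmod (vint N T b - vint N T a) <= 2 * B * (b - a).
Proof.
 intros HU HT Hp HN HC Hin HB.
 assert (B0 : 0 <= B).
 { via Cmod_ge_0. apply (HB p). lra. }
 assert (HcN : forall s t, a <= s <= b -> - T <= t <= T -> ccont N (s, t)).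
 { intros s t Hs Ht. destruct (classic ((s, t) = RtoC p)) as [->|E]. exact HC.
  apply (hol_cont 1) with (1 := HN). split; auto. }
 apply Rle_plus_epsilon. intros eps He.
 destruct (vint_cont N T p (Rmin (p - a) (b - p))) with (eps := eps / 2) as [d [Hd Hv]].
 - lra.
 - apply Rmin_pos; lra.
 - intros s t Hs Ht. apply HcN; auto. assert (A1 := Rmin_l (p - a) (b - p)). assert (A2 := Rmin_r (p - a) (b - p)).
  apply Rabs_lt_between in Hs. lra.
 - lra.
 - set (h := Rmin d (Rmin (p - a) (b - p)) / 2).
  assert (Hh : 0 < h) by (unfold h; assert (0 < Rmin d (Rmin (p - a) (b - p))) by (repeat apply Rmin_pos; lra); lra).
  assert (Hh2 : h <= d /\ h < p - a /\ h < b - p).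
  { assert (A0 := Rmin_l d (Rmin (p - a) (b - p))). assert (A3 := Rmin_r d (Rmin (p - a) (b - p))).
   assert (A1 := Rmin_l (p - a) (b - p)). assert (A2 := Rmin_r (p - a) (b - p)). unfold h in *. lra. }
  assert (V1 := Hv (p + h) ltac:(rewrite Rabs_pos_eq; lra)).
  assert (V2 := Hv (p - h) ltac:(rewrite Rabs_left1; lra)).
  assert (Out : forall s t, Rabs (s - p) >= h -> (s, t) <> RtoC p).
  { intros s t Hs E. apply (f_equal Re) in E. csimp. subst s. rewrite Rminus_diag, Rabs_R0 in Hs. lra. }
  assert (S1 := vint_shift _ N T (p + h) b B (copen_minus_point U (RtoC p) HU) HN ltac:(lra) ltac:(lra)
   ltac:(intros s t Hs Ht; split; [apply Hin; lra|apply Out; rewrite Rabs_pos_eq; lra])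
   ltac:(intros s Hs; apply HB; lra)).
  assert (S2 := vint_shift _ N T a (p - h) B (copen_minus_point U (RtoC p) HU) HN ltac:(lra) ltac:(lra)
   ltac:(intros s t Hs Ht; split; [apply Hin; lra|apply Out; rewrite Rabs_left1; lra])
   ltac:(intros s Hs; apply HB; lra)).
  replace (vint N T b - vint N T a)%C with ((vint N T b - vint N T (p + h)) + (vint N T (p - h) - vint N T a)
   + ((vint N T (p + h) - vint N T p) - (vint N T (p - h) - vint N T p)))%C by ring.
  via Cmod_triangle. via Rplus_le_compat. apply Cmod_triangle. apply Cmod_triangle_minus.
  assert (2 * B * (b - (p + h)) + 2 * B * (p - h - a) <= 2 * B * (b - a)) by nra. lra.
Qed.

Lemma atan_le_id (x : R) : 0 <= x -> atan x <= x.
Proof.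
 intros Hx. assert (H := monotone_from_derivative (fun x => x - atan x) (fun x => 1 - / (1 + x²)) 0 x Hx).
 cbv beta in H. rewrite atan_0, Rminus_0_r in H. cut (0 <= x - atan x). lra. apply H.
 - intros y _. apply is_derive_Rminus. apply (is_derive_id (K := R_AbsRing)). apply is_derive_atan.
 - intros y _. assert (A := Rle_0_sqr y). assert (/ (1 + y²) <= / 1) by (apply Rinv_le_contravar; lra). lra.
Qed.

Lemma atan_large (y : R) : 0 < y -> PI / 2 - / y <= atan y <= PI / 2.
Proof.
 intros Hy. split. 2: left; apply atan_bound.
 assert (A := atan_inv y Hy). assert (B := atan_le_id (/ y) ltac:(pos)). lra.
Qed.

Lemma ccont_inv_linear (p : R) (z : C) : z <> RtoC p -> ccont (fun w => / (w - RtoC p))%C z.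
Proof.
 intros H. apply ccont_inv.
 - intros E. apply H. replace z with ((z - RtoC p) + RtoC p)%C by ring. rewrite E. ring.
 - apply (ccont_plus (fun w => w) (fun _ => (- RtoC p)%C)). apply ccont_id. apply ccont_const.
Qed.

(** Explicit primitive by arctangent and logarithm. The sign change of the arctangent across s = p
    is where the 2 pi of the residue comes from. *)
Lemma vint_inv_linear (T p s : R) : 0 <= T -> s <> p -> vint (fun w => / (w - RtoC p))%C T s = RtoC (2 * atan (T / (s - p))).
Proof.
 intros HT Hs. set (c := s - p). assert (Hc : c <> 0) by (unfold c; lra).
 assert (P2 : forall t, 0 < c ^ 2 + t ^ 2) by (intros t; assert (0 < c ^ 2) by nra; assert (0 <= t ^ 2) by nra; lra).
 assert (E : forall t, (/ ((s, t) - RtoC p))%C = (c / (c ^ 2 + t ^ 2), - t / (c ^ 2 + t ^ 2))).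
 { intros t. unfold Cinv. apply C_eq; csimp; simpl; unfold c; f_equal; try f_equal; ring. }
 unfold vint. rewrite (CInt_FTC (fun t => (atan (t / c), - (1 / 2) * ln (c ^ 2 + t ^ 2))) (fun t => / ((s, t) - RtoC p))%C).
 2: lra.
 2:{ intros t _. rewrite E. split; csimp.
   - apply is_derive_ext with (fun t => atan (/ c * t)). intros t0. replace (t0 / c) with (/ c * t0) by (field; auto). reflexivity.
    replace (c / (c ^ 2 + t ^ 2)) with (scal (/ c * 1) (/ (1 + (/ c * t)²)))
     by (unfold scal; simpl; unfold mult; simpl; unfold Rsqr; field; specialize (P2 t); split; nra).
    apply (is_derive_comp atan (fun t => / c * t)). apply is_derive_atan. apply is_derive_scal, (is_derive_id (K := R_AbsRing)).
   - change (is_derive (fun t => - (1 / 2) * ln (c ^ 2 + t ^ 2)) t (- t / (c ^ 2 + t ^ 2))).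
    specialize (P2 t). auto_derive. simpl in *; lra. field. nra. }
 2:{ intros t Ht. apply (ccont_vert (fun w => / (w - RtoC p))%C), ccont_inv_linear. intros EE. apply (f_equal Re) in EE. csimp. auto. }
 apply C_eq; csimp.
 - replace (- T / c) with (- (T / c)) by (field; auto). rewrite atan_opp. ring.
 - replace ((- T) ^ 2) with (T ^ 2) by ring. ring.
Qed.

(* The residue at a removable singularity of [G], by comparison with [G p / (w - p)]. *)
Lemma residue_bound (U : C -> Prop) (G : C -> C) (T a b p B : R) (l : C) : copen U -> 0 < T -> a < p < b ->
 hol 2 (fun z => U z /\ z <> RtoC p) G -> cdiff G (RtoC p) l ->
 (forall s t, a <= s <= b -> - T <= t <= T -> U (s, t)) ->
 (forall s, a <= s <= b -> Cmod (G (s, T)) <= B /\ Cmod (G (s, (- T)%R)) <= B) ->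
 Cmod (vint (fun w => G w / (w - RtoC p))%C T b - vint (fun w => G w / (w - RtoC p))%C T a - RtoC (2 * PI) * G (RtoC p))
  <= 2 * (b - a) * (B + 2 * Cmod (G (RtoC p))) / T.
Proof.
 intros HU HT Hp HG [phi [P1 [P2 P3]]] Hin HB. set (g := Cmod (G (RtoC p))).
 assert (Hne : forall z : C, z <> RtoC p -> (z - RtoC p)%C <> 0%C).
 { intros z H E. apply H. replace z with ((z - RtoC p) + RtoC p)%C by ring. rewrite E. ring. }
 assert (Hs : forall s t, s <> p -> (s, t) <> RtoC p) by (intros s t H E; apply H; now apply (f_equal Re) in E).
 assert (Ephi : forall w, w <> RtoC p -> phi w = ((G w - G (RtoC p)) / (w - RtoC p))%C).
 { intros w H. rewrite (P3 w) at 1. field. now apply Hne. }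
 assert (Eu : forall w, w <> RtoC p -> (G w / (w - RtoC p))%C = (phi w + G (RtoC p) * / (w - RtoC p))%C).
 { intros w H. rewrite Ephi by auto. field. now apply Hne. }
 assert (Hphi : hol 2 (fun z => U z /\ z <> RtoC p) phi).
 { apply hol_ext_open with (fun w => (G w - G (RtoC p)) * / (w - RtoC p))%C.
  - now apply copen_minus_point.
  - intros z [_ Hz]. rewrite Ephi by auto. reflexivity.
  - apply hol_mult. apply hol_minus; auto. apply hol_const. apply hol_inv. intros z [_ Hz]. now apply Hne.
   apply hol_minus. apply hol_id. apply hol_const. }
 assert (Hcphi : forall s t, a <= s <= b -> - T <= t <= T -> ccont phi (s, t)).
 { intros s t H1 H2. destruct (classic ((s, t) = RtoC p)) as [->|E]. exact P2.
  apply (hol_cont 1) with (1 := Hphi). split; auto. }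
 assert (Vu : forall s, s <> p -> a <= s <= b -> vint (fun w => G w / (w - RtoC p))%C T s
  = (vint phi T s + G (RtoC p) * RtoC (2 * atan (T / (s - p))))%C).
 { intros s H1 H2. rewrite <- vint_inv_linear by (auto; lra). unfold vint. rewrite <- CInt_lin.
  - apply CInt_ext. lra. intros t Ht. apply (Eu (s, t)). auto.
  - lra.
  - apply ccont_vert_seg. auto.
  - apply (ccont_vert_seg (fun w => / (w - RtoC p))%C). intros; apply ccont_inv_linear; auto. }
 rewrite !Vu by lra.
 assert (S := vint_shift_punctured U phi T a b p ((B + g) / T) HU HT Hp Hphi P2 Hin).
 assert (Bd : forall s t, a <= s <= b -> (t = T \/ t = - T) -> Cmod (phi (s, t)) <= (B + g) / T).
 { intros s t H1 H2.
  assert (NE : (s, t) <> RtoC p) by (intros E; apply (f_equal Im) in E; csimp; destruct H2; lra).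
  rewrite Ephi by auto. unfold Cdiv. rewrite Cmod_mult, Cmod_inv by (apply Hne; auto).
  mono. pos. left; apply Rinv_0_lt_compat, Cmod_gt_0, Hne; auto.
  - via Cmod_triangle_minus. apply Rplus_le_compat_r. destruct (HB s H1). destruct H2; subst t; auto.
  - apply Rinv_le_contravar; auto. upto Im_le_Cmod. csimp. rewrite Rminus_0_r.
   destruct H2; subst t; [rewrite Rabs_pos_eq|rewrite Rabs_left1]; lra. }
 specialize (S ltac:(intros s H; split; apply Bd; auto)).
 assert (A1 := atan_large (T / (b - p)) ltac:(pos)).
 assert (A2 := atan_large (T / (p - a)) ltac:(pos)).
 replace (T / (a - p)) with (- (T / (p - a))) by (field; lra). rewrite atan_opp.
 assert (E1 : / (T / (b - p)) = (b - p) / T) by (field; lra). assert (E2 : / (T / (p - a)) = (p - a) / T) by (field; lra).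
 rewrite E1 in A1. rewrite E2 in A2.
 set (x1 := atan (T / (b - p))) in *. set (x2 := atan (T / (p - a))) in *.
 replace (vint phi T b + G (RtoC p) * RtoC (2 * x1) - (vint phi T a + G (RtoC p) * RtoC (2 * - x2)) - RtoC (2 * PI) * G (RtoC p))%C
  with ((vint phi T b - vint phi T a) + G (RtoC p) * RtoC (2 * x1 + 2 * x2 - 2 * PI))%C by (apply C_eq; csimp; ring).
 via Cmod_triangle. rewrite Cmod_mult, Cmod_R. fold g.
 (* Each arctangent misses pi/2 by at most the reciprocal of its argument. *)
 assert (L : Rabs (2 * x1 + 2 * x2 - 2 * PI) <= 2 * (b - a) / T).
 { apply Rabs_le. replace (2 * (b - a) / T) with (2 * ((b - p) / T) + 2 * ((p - a) / T)) by (field; lra). lra. }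
 assert (g0 : 0 <= g) by pos.
 replace (2 * (b - a) * (B + 2 * g) / T) with (2 * ((B + g) / T) * (b - a) + g * (2 * (b - a) / T)) by (field; lra).
 apply Rplus_le_compat; auto. mono_l; auto.
Qed.

(** Second-order Taylor expansion of H at p along the segment to p + h, its remainder bounded by the
    mean value inequality, then division by h. *)
Lemma removable_quotient (H H1 : C -> C) (p H2 : C) (r : R) : 0 < r ->
 (forall w, Cmod (w - p) < r -> cdiff H w (H1 w)) -> cdiff H1 p H2 -> H p = 0%C ->
 cdiff (fun w => if excluded_middle_informative (w = p) then H1 p else H w / (w - p))%C p (H2 / 2)%C.
Proof.
 intros Hr D1 D2 H0. apply cdiff_of_eps. intros eps He.
 destruct (cdiff_eps _ _ _ D2 eps He) as [d [Hd Hh]]. exists (Rmin d r). split. now apply Rmin_pos.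
 intros h Hh'.
 assert (h1 : Cmod h < d) by (eapply Rlt_le_trans; [exact Hh'|apply Rmin_l]).
 assert (h2 : Cmod h < r) by (eapply Rlt_le_trans; [exact Hh'|apply Rmin_r]).
 assert (h0 := Cmod_ge_0 h).
 destruct (excluded_middle_informative (p = p)) as [_|]; [|tauto].
 destruct (excluded_middle_informative ((p + h)%C = p)) as [E|n].
 { assert (h = 0%C) by (replace h with (p + h - p)%C by ring; rewrite E; ring). subst h.
  replace (H1 p - H1 p - H2 / 2 * 0)%C with (RtoC 0) by ring. rewrite !Cmod_0. lra. }
 assert (hn : h <> 0%C) by (intros ->; apply n; ring).
 set (Rm := fun t : R => (H (p + RtoC t * h) - RtoC t * (h * H1 p) - RtoC (t * t) * (h * h * H2 / 2))%C).
 assert (M : Cmod (Rm 1 - Rm 0) <= eps * Cmod h ^ 2 * (1 - 0)).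
 { apply (mean_value_C Rm (fun t => h * (H1 (p + RtoC t * h) - H1 p - H2 * (RtoC t * h)))%C). lra.
  - intros t Ht. unfold Rm.
   apply rder_ext with (F := fun t => (H (p + RtoC t * h) + (RtoC (- t) * (h * H1 p) + RtoC (- (t * t)) * (h * h * H2 / 2)))%C)
    (a := (H1 (p + RtoC t * h) * h + ((RtoC (-1) * (h * H1 p) + RtoC (- t) * 0) + (RtoC (- (2 * t)) * (h * h * H2 / 2) + RtoC (- (t * t)) * 0)))%C).
   + intros s. rewrite !RtoC_opp. ring.
   + assert (E2 : H2 = (RtoC 2 * (H2 / 2))%C) by (field; apply RtoC_neq_0; lra).
    replace (h * h * H2 / 2)%C with (h * h * (H2 / 2))%C by (unfold Cdiv; ring).
    set (q := (H2 / 2)%C) in *. rewrite E2. change (RtoC (-1)) with (RtoC (- (1))). rewrite !RtoC_opp, !RtoC_mult. ring.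
   + apply rder_plus. apply (cdiff_line H p h). apply D1.
    replace (p + RtoC t * h - p)%C with (RtoC t * h)%C by ring. rewrite Cmod_mult, Cmod_R, Rabs_pos_eq by lra. nra.
    apply rder_plus.
    * apply (rder_mult (fun t => RtoC (- t)) (fun _ => (h * H1 p)%C)). apply rder_RtoC. auto_derive; auto; toR; lra. apply rder_const.
    * apply (rder_mult (fun t => RtoC (- (t * t))) (fun _ => (h * h * H2 / 2)%C)). apply rder_RtoC. auto_derive; auto; toR; lra. apply rder_const.
  - intros t Ht. rewrite Cmod_mult.
   assert (A : Cmod (RtoC t * h) <= Cmod h) by (rewrite Cmod_mult, Cmod_R, Rabs_pos_eq by lra; nra).
   specialize (Hh (RtoC t * h)%C ltac:(lra)). replace (eps * Cmod h ^ 2) with (Cmod h * (eps * Cmod h)) by ring.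
   mono_l; auto. via Hh. mono_l; lra. }
 replace (Rm 1 - Rm 0)%C with ((H (p + h) / (p + h - p) - H1 p - H2 / 2 * h) * h)%C in M.
 2:{ unfold Rm. replace (p + RtoC 0 * h)%C with p by ring. replace (p + RtoC 1 * h)%C with (p + h)%C by ring.
   rewrite H0. rewrite Rmult_1_l, Rmult_0_l. replace (p + h - p)%C with h by ring. field. exact hn. }
 rewrite Cmod_mult in M. apply Rmult_le_reg_r with (Cmod h). now apply Cmod_gt_0. lra.
Qed.

Lemma vint_bound (F : C -> C) (T s B : R) : 0 <= T -> (forall t, - T <= t <= T -> ccont F (s, t)) ->
 (forall t, - T <= t <= T -> Cmod (F (s, t)) <= B) -> Cmod (vint F T s) <= 2 * T * B.
Proof.
 intros HT HF HB. replace (2 * T * B) with ((T - - T) * B) by ring. apply CInt_bound_const; auto. lra.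
 now apply ccont_vert_seg.
Qed.

Lemma vint_ext (F G : C -> C) (T s : R) : 0 <= T -> (forall t, - T <= t <= T -> F (s, t) = G (s, t)) -> vint F T s = vint G T s.
Proof. intros HT E. apply CInt_ext. lra. auto. Qed.

Lemma vint_lin (F G : C -> C) (T s : R) (c : C) : 0 <= T ->
 (forall t, - T <= t <= T -> ccont F (s, t)) -> (forall t, - T <= t <= T -> ccont G (s, t)) ->
 vint (fun w => F w + c * G w)%C T s = (vint F T s + c * vint G T s)%C.
Proof.
 intros HT HF HG. apply (CInt_lin (fun t => F (s, t)) (fun t => G (s, t))). lra. now apply ccont_vert_seg. now apply ccont_vert_seg.
Qed.

Lemma vint_limit (F : C -> C) (FM : nat -> C -> C) (T s B : R) (A : C) (M1 : nat) : 0 <= T ->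
 (forall t, - T <= t <= T -> ccont F (s, t)) -> (forall M t, - T <= t <= T -> ccont (FM M) (s, t)) ->
 (forall eps, 0 < eps -> exists M0, forall M t, (M0 <= M)%nat -> - T <= t <= T -> Cmod (F (s, t) - FM M (s, t)) <= eps) ->
 (forall M, (M1 <= M)%nat -> Cmod (vint (FM M) T s - A) <= B) -> Cmod (vint F T s - A) <= B.
Proof.
 intros HT HF HFM HU HB. apply Rle_plus_epsilon. intros eps He.
 destruct (HU (eps / (2 * T + 1))) as [M0 HM]. pos.
 specialize (HB (M0 + M1)%nat ltac:(lia)). set (M := (M0 + M1)%nat) in *.
 replace (vint F T s - A)%C with ((vint (FM M) T s - A) + (vint F T s + - (1) * vint (FM M) T s))%C by ring.
 rewrite <- vint_lin by auto. via Cmod_triangle. apply Rplus_le_compat; auto.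
 apply Rle_trans with (2 * T * (eps / (2 * T + 1))).
 - apply vint_bound; auto.
  + intros t Ht. apply ccont_plus; auto. apply ccont_mult. apply ccont_const. auto.
  + intros t Ht. replace (F (s, t) + - (1) * FM M (s, t))%C with (F (s, t) - FM M (s, t))%C by ring. apply HM; auto. unfold M; lia.
 - apply Rmult_le_reg_r with (2 * T + 1). lra. replace (2 * T * (eps / (2 * T + 1)) * (2 * T + 1)) with (2 * T * eps) by (field; lra). nra.
Qed.

(** * Perron's formula with a ramp kernel *)

(** On a line Re w = c > 0 its integral over all heights is 2 pi max(v, 0). The square in the
    denominator makes the integral absolutely convergent. *)
Definition Jker (v : R) (w : C) : C := (cexp (RtoC v * w) / (w * w))%C.

Lemma Jker_hol (n : nat) (v : R) : hol n (fun w => True /\ w <> RtoC 0) (Jker v).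
Proof.
 apply (hol_div n _ (fun w => cexp (RtoC v * w)) (fun w => w * w)%C).
 - intros z [_ Hz]. now apply Cmult_neq_0.
 - apply (hol_exp_comp n _ (fun w => RtoC v * w)%C). apply hol_mult. apply hol_const. apply hol_id.
 - apply hol_mult; apply hol_id.
Qed.

Lemma copen_True : copen (fun _ => True).
Proof. intros z _. exists 1. split. lra. auto. Qed.

Lemma pair_neq_0 (s t : R) : s <> 0 \/ t <> 0 -> (s, t) <> RtoC 0.
Proof. intros [H|H] E; apply H; [now apply (f_equal Re) in E | now apply (f_equal Im) in E]. Qed.

Lemma Jker_cont (v s t : R) : s <> 0 \/ t <> 0 -> ccont (Jker v) (s, t).
Proof. intros H. apply (hol_cont 0) with (1 := Jker_hol 1 v). split. exact I. now apply pair_neq_0. Qed.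

Lemma Jker_bound (v s t m : R) : 0 < m -> m <= Rabs s \/ m <= Rabs t -> Cmod (Jker v (s, t)) <= exp (s * v) / m ^ 2.
Proof.
 intros Hm H. unfold Jker, Cdiv. assert (Hn : (s, t) <> RtoC 0).
 { apply pair_neq_0. destruct H as [H|H]; [left|right]; intros ->; rewrite Rabs_R0 in H; lra. }
 rewrite Cmod_mult, Cmod_inv, Cmod_mult, Cmod_cexp by (now apply Cmult_neq_0).
 replace (Re (RtoC v * (s, t))%C) with (s * v) by (csimp; ring).
 mono_l. pos. apply Rinv_le_contravar. nra.
 assert (A : m <= Cmod (s, t)).
 { destruct H as [H|H]; le_trans; try exact H; [apply (re_le_Cmod (s, t))|apply (Im_le_Cmod (s, t))]. }
 nra.
Qed.

Lemma exp_scale_le (s c v : R) : v * (s - c) <= 0 -> exp (s * v) <= exp (c * v).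
Proof. intros H. apply exp_le. nra. Qed.

(** The line is pushed away from the pole to abscissa T or -T, the direction in which e^(s v) does
    not increase; there the kernel is at most e^(c v) / T^2. *)
Lemma Jker_side (v c T : R) : 0 < Rabs c -> Rabs c <= T -> c * v <= 0 ->
 Cmod (vint (Jker v) T c) <= 4 * exp (c * v) / T.
Proof.
 intros Hc HT Hv.
 assert (Hc0 : c <> 0) by (intros ->; rewrite Rabs_R0 in Hc; lra).
 assert (HT0 : 0 < T) by lra.
 set (s := if Rle_dec 0 c then T else - T).
 assert (Hs : Rabs s = T) by (unfold s; destruct (Rle_dec 0 c); [apply Rabs_pos_eq|rewrite Rabs_left]; lra).
 assert (Hvs : forall u, Rmin c s <= u <= Rmax c s -> exp (u * v) <= exp (c * v)).
 { intros u Hu. apply exp_scale_le. unfold s in Hu. destruct (Rle_dec 0 c).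
  - rewrite Rabs_pos_eq in HT by lra. rewrite Rmin_left, Rmax_right in Hu by lra. assert (v <= 0) by nra. nra.
  - rewrite Rabs_left in HT by lra. rewrite Rmin_right, Rmax_left in Hu by lra. assert (0 <= v) by nra. nra. }
 assert (B1 : forall u, Rmin c s <= u <= Rmax c s -> Cmod (Jker v (u, T)) <= exp (c * v) / T ^ 2 /\ Cmod (Jker v (u, (- T)%R)) <= exp (c * v) / T ^ 2).
 { intros u Hu. split; (le_trans; [apply Jker_bound with (m := T); [lra|right; try rewrite Rabs_Ropp; rewrite Rabs_pos_eq; lra]|]);
   (mono_r; [left; apply Rinv_0_lt_compat, pow_lt; lra|now apply Hvs]). }
 assert (V : Cmod (vint (Jker v) T s) <= 2 * T * (exp (c * v) / T ^ 2)).
 { apply vint_bound. lra. intros t _. apply Jker_cont. left. intros E; rewrite E, Rabs_R0 in Hs; lra.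
  intros t _. le_trans. apply Jker_bound with (m := T). lra. left; lra.
  mono_r; [left; apply Rinv_0_lt_compat, pow_lt; lra|]. apply Hvs.
  split. apply Rmin_r. apply Rmax_r. }
 assert (D : Cmod (vint (Jker v) T c - vint (Jker v) T s) <= 2 * (exp (c * v) / T ^ 2) * (Rmax c s - Rmin c s)).
 { assert (X : forall a b, a <= b -> a * b > 0 -> Rmin a b = Rmin c s -> Rmax a b = Rmax c s -> Cmod (vint (Jker v) T b - vint (Jker v) T a) <= 2 * (exp (c * v) / T ^ 2) * (b - a)).
  { intros a b Hab Hp E1 E2. apply (vint_shift _ _ _ _ _ _ (copen_minus_point _ 0%C copen_True) (Jker_hol 2 v)); try lra.
   - intros u t Hu _. split. exact I. apply pair_neq_0. left. intros ->. nra.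
   - intros u Hu. apply B1. rewrite <- E1, <- E2. rewrite Rmin_left, Rmax_right by lra. exact Hu. }
  unfold s in *. destruct (Rle_dec 0 c).
  - rewrite Rabs_pos_eq in HT by lra. rewrite Rmin_left, Rmax_right in * by lra. rewrite Cmod_minus_sym. apply X; try nra; rewrite ?Rmin_left, ?Rmax_right; lra.
  - rewrite Rabs_left in HT by lra. rewrite Rmin_right, Rmax_left in * by lra. apply X; try nra; rewrite ?Rmin_left, ?Rmax_right; lra. }
 assert (L : Rmax c s - Rmin c s <= T).
 { unfold s. destruct (Rle_dec 0 c). rewrite Rabs_pos_eq in HT by lra. rewrite Rmin_left, Rmax_right; lra.
  rewrite Rabs_left in HT by lra. rewrite Rmin_right, Rmax_left; lra. }
 replace (vint (Jker v) T c) with ((vint (Jker v) T c - vint (Jker v) T s) + vint (Jker v) T s)%C by ring.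
 via Cmod_triangle.
 assert (P : 0 < exp (c * v) / T ^ 2) by (apply Rdiv_lt_0_compat; [apply exp_pos|apply pow_lt; lra]).
 replace (4 * exp (c * v) / T) with (2 * (exp (c * v) / T ^ 2) * T + 2 * T * (exp (c * v) / T ^ 2)) by (field; lra).
 apply Rplus_le_compat; auto. via D. mono_l; lra.
Qed.

(** The double pole is split as e^(vw) / w^2 = G(w) / w + 1 / w^2 with G(w) = (e^(vw) - 1) / w
    removable and G(0) = v. The first part has residue v; the second is the case v = 0 of the side
    estimate. *)
Lemma Jker_main (v c T : R) : 0 < c -> c <= T -> 1 <= T -> 0 <= v ->
 Cmod (vint (Jker v) T c - RtoC (2 * PI * v)) <= (4 * c * (2 * exp (c * v) + 2 * v) + 12) / T.
Proof.
 intros Hc HcT HT Hv.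
 set (G := fun w : C => if excluded_middle_informative (w = 0%C) then (RtoC v * cexp (RtoC v * 0))%C else ((cexp (RtoC v * w) - 1) / (w - 0))%C).
 assert (DE : forall w, cdiff (fun w => cexp (RtoC v * w))%C w (RtoC v * cexp (RtoC v * w))%C).
 { intros w. apply cdiff_eq with (cexp (RtoC v * w) * RtoC v)%C. ring.
  apply (cdiff_comp cexp (fun w => RtoC v * w)%C). 2: apply cdiff_cexp.
  apply cdiff_eq with (0 * w + RtoC v * 1)%C. ring. apply (cdiff_mult (fun _ => RtoC v) (fun w => w)). apply cdiff_const. apply cdiff_id. }
 assert (DH : forall w, cdiff (fun w => cexp (RtoC v * w) - 1)%C w (RtoC v * cexp (RtoC v * w))%C).
 { intros w. apply cdiff_eq with (RtoC v * cexp (RtoC v * w) + 0)%C. ring.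
  apply (cdiff_plus (fun w => cexp (RtoC v * w)) (fun _ => (- (1))%C)). apply DE. apply cdiff_const. }
 assert (DG : exists l, cdiff G 0 l).
 { eexists. apply (removable_quotient (fun w => cexp (RtoC v * w) - 1)%C (fun w => RtoC v * cexp (RtoC v * w))%C 0
   (0 * cexp (RtoC v * 0) + RtoC v * (RtoC v * cexp (RtoC v * 0)))%C 1). lra.
  intros w _. apply DH.
  apply (cdiff_mult (fun _ => RtoC v) (fun w => cexp (RtoC v * w))%C). apply cdiff_const. apply DE.
  replace (RtoC v * 0)%C with (RtoC 0) by ring. rewrite cexp_0. ring. }
 destruct DG as [l DG].
 assert (EG : forall w : C, w <> 0%C -> G w = ((cexp (RtoC v * w) - 1) / w)%C).
 { intros w Hw. unfold G. destruct excluded_middle_informative; [tauto|]. replace (w - 0)%C with w by ring. reflexivity. }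
 assert (G0 : G 0%C = RtoC v).
 { unfold G. destruct excluded_middle_informative as [_|n]; [|tauto]. replace (RtoC v * 0)%C with (RtoC 0) by ring. rewrite cexp_0. ring. }
 assert (HG : hol 2 (fun w => True /\ w <> RtoC 0) G).
 { apply hol_ext_open with (fun w => (cexp (RtoC v * w) - 1) / w)%C. apply copen_minus_point, copen_True.
  intros z [_ Hz]. now rewrite EG. apply hol_div. now intros z [_ Hz].
  apply hol_minus. apply (hol_exp_comp 2 _ (fun w => RtoC v * w)%C). apply hol_mult. apply hol_const. apply hol_id. apply hol_const.
  apply hol_id. }
 assert (EE : exp (c * v) >= 1) by (rewrite <- exp_0; apply Rle_ge, exp_le; nra).
 assert (R0 := residue_bound _ G T (- c) c 0 (2 * exp (c * v)) l copen_True ltac:(lra) ltac:(lra) HG DG (fun _ _ _ _ => I)).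
 rewrite G0, Cmod_R, Rabs_pos_eq in R0 by lra.
 assert (R1 : Cmod (vint (fun w => G w / (w - 0))%C T c - vint (fun w => G w / (w - 0))%C T (- c) - RtoC (2 * PI) * RtoC v)
   <= 2 * (c - - c) * (2 * exp (c * v) + 2 * v) / T).
 { apply R0. assert (X : forall u t, - c <= u <= c -> Rabs t = T -> Cmod (G (u, t)) <= 2 * exp (c * v)).
  { intros u t Hu Ht. assert (Hn : (u, t) <> RtoC 0) by (apply pair_neq_0; right; intros ->; rewrite Rabs_R0 in Ht; lra).
   rewrite EG by auto. unfold Cdiv. rewrite Cmod_mult, Cmod_inv by auto.
   assert (A : T <= Cmod (u, t)) by (rewrite <- Ht; apply (Im_le_Cmod (u, t))).
   assert (A2 : / Cmod (u, t) <= 1) by (rewrite <- Rinv_1; apply Rinv_le_contravar; lra).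
   assert (A3 : Cmod (cexp (RtoC v * (u, t)) - 1) <= 2 * exp (c * v)).
   { via Cmod_triangle_minus. rewrite Cmod_1, Cmod_cexp.
    replace (Re (RtoC v * (u, t))%C) with (u * v) by (csimp; ring).
    assert (exp (u * v) <= exp (c * v)) by (apply exp_scale_le; nra). lra. }
   assert (A4 := Cmod_ge_0 (cexp (RtoC v * (u, t)) - 1)). assert (0 < / Cmod (u, t)) by (apply Rinv_0_lt_compat, Cmod_gt_0; auto). nra. }
  intros u Hu. split; apply X; auto. apply Rabs_pos_eq; lra. rewrite Rabs_left; lra. }
 assert (EJ : forall s, s <> 0 -> vint (Jker v) T s = (vint (fun w => G w / (w - 0)) T s + 1 * vint (Jker 0) T s)%C).
 { intros s Hs. rewrite <- vint_lin.
  - apply vint_ext. lra. intros t _. assert (Hn : (s, t) <> RtoC 0) by (apply pair_neq_0; auto). unfold Jker. rewrite EG by auto.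
   replace (RtoC 0 * (s, t))%C with (RtoC 0) by ring. rewrite cexp_0. field. auto.
  - lra.
  - intros t _. apply (hol_cont 0 (fun w => True /\ w <> RtoC 0) (fun w => G w / (w - 0))%C). 2:{ split; [exact I|now apply pair_neq_0; left]. }
   apply hol_div. intros z [_ Hz] E. apply Hz. rewrite <- E. ring.
   now apply (hol_le 1 2); [lia|]. apply hol_minus. apply hol_id. apply hol_const.
  - intros t _. apply Jker_cont. auto. }
 assert (J1 := Jker_side 0 c T ltac:(rewrite Rabs_pos_eq; lra) ltac:(rewrite Rabs_pos_eq; lra) ltac:(lra)).
 assert (J2 := Jker_side 0 (- c) T ltac:(rewrite Rabs_left; lra) ltac:(rewrite Rabs_left; lra) ltac:(lra)).
 assert (J3 := Jker_side v (- c) T ltac:(rewrite Rabs_left; lra) ltac:(rewrite Rabs_left; lra) ltac:(nra)).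
 rewrite Rmult_0_r, exp_0 in J1, J2.
 assert (J3' : 4 * exp (- c * v) / T <= 4 * 1 / T).
 { mono_r. pos. mono_l. lra. rewrite <- exp_0. apply exp_le. nra. }
 assert (E1 := EJ c ltac:(lra)). assert (E2 := EJ (- c) ltac:(lra)).
 replace (vint (Jker v) T c - RtoC (2 * PI * v))%C with
  ((vint (fun w => G w / (w - 0))%C T c - vint (fun w => G w / (w - 0))%C T (- c) - RtoC (2 * PI) * RtoC v)
   + (vint (Jker v) T (- c) + (vint (Jker 0) T c - vint (Jker 0) T (- c))))%C.
 2:{ rewrite E1, E2. rewrite !RtoC_mult. ring. }
 via Cmod_triangle. via Rplus_le_compat_l. via Cmod_triangle.
 apply Rplus_le_compat_l. apply Cmod_triangle_minus.
 replace ((4 * c * (2 * exp (c * v) + 2 * v) + 12) / T) with (2 * (c - - c) * (2 * exp (c * v) + 2 * v) / T + 3 * (4 * 1 / T)) by (field; lra).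
 lra.
Qed.

(** The error keeps the factor e^(c v), which decays for negative v, so that it can be summed over
    the terms of a Dirichlet series. *)
Lemma Jker_all (b c : R) : 0 < c -> exists C0, 0 < C0 /\ forall v T, v <= b -> c <= T -> 1 <= T ->
 Cmod (vint (Jker v) T c - RtoC (2 * PI * Rmax v 0)) <= C0 * exp (c * v) / T.
Proof.
 intros Hc. set (b' := Rmax b 0). assert (b0 : 0 <= b') by apply Rmax_r. assert (bb : b <= b') by apply Rmax_l.
 assert (PP := exp_pos (c * b')).
 exists (4 * c * (2 * exp (c * b') + 2 * b') + 12). split. nra.
 intros v T Hv HcT HT. destruct (Rle_dec 0 v) as [H|H].
 - rewrite Rmax_left by lra. le_trans. apply Jker_main; auto.
  mono_r. pos.
  assert (E1 : 1 <= exp (c * v)) by (rewrite <- exp_0; apply exp_le; nra).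
  assert (E2 : exp (c * v) <= exp (c * b')) by (apply exp_le; nra).
  apply Rle_trans with (4 * c * (2 * exp (c * b') + 2 * b') + 12). nra.
  rewrite <- (Rmult_1_r (4 * c * (2 * exp (c * b') + 2 * b') + 12)) at 1. mono_l. nra. exact E1.
 - rewrite Rmax_right by lra. rewrite Rmult_0_r. replace (vint (Jker v) T c - 0)%C with (vint (Jker v) T c) by ring.
  le_trans. apply Jker_side; try (rewrite Rabs_pos_eq; lra). nra.
  mono_r. pos.
  mono_r. pos. nra.
Qed.

Lemma RtoC_neq_0 (r : R) : r <> 0 -> RtoC r <> RtoC 0.
Proof. intros H E. now apply (f_equal Re) in E. Qed.

(** Difference quotient of [Jker] in v: integrated against e^(-l w) it gives 2 pi times a cut-off in
    l that is 1 up to a, 0 from b on, and linear between. This is a continuous substitute for the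
    step in the usual Perron formula. *)
Definition kern (a b : R) (w : C) : C := ((cexp (RtoC b * w) - cexp (RtoC a * w)) / (RtoC (b - a) * (w * w)))%C.

Definition ramp (a b l : R) : R := (Rmax (b - l) 0 - Rmax (a - l) 0) / (b - a).

Lemma vint_scal (F : C -> C) (T s : R) (c : C) : 0 <= T ->
 (forall t, - T <= t <= T -> ccont F (s, t)) -> vint (fun w => c * F w)%C T s = (c * vint F T s)%C.
Proof. intros HT HF. apply (CInt_scal (fun t => F (s, t))). lra. now apply ccont_vert_seg. Qed.

Lemma kern_shift (a b l : R) (w : C) : a < b -> w <> RtoC 0 ->
 (cexp (RtoC (- l) * w) * kern a b w)%C = (RtoC (/ (b - a)) * (Jker (b - l) w + - (1) * Jker (a - l) w))%C.
Proof.
 intros Hab Hw. unfold kern, Jker.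
 replace (RtoC (b - l) * w)%C with (RtoC (- l) * w + RtoC b * w)%C by (rewrite RtoC_minus, RtoC_opp; ring).
 replace (RtoC (a - l) * w)%C with (RtoC (- l) * w + RtoC a * w)%C by (rewrite RtoC_minus, RtoC_opp; ring).
 rewrite !cexp_plus, RtoC_inv by lra. field. split; auto. apply RtoC_neq_0. lra.
Qed.

Lemma kern_hol (n : nat) (a b : R) : a < b -> hol n (fun w => True /\ w <> RtoC 0) (kern a b).
Proof.
 intros Hab. apply (hol_div n _ (fun w => cexp (RtoC b * w) - cexp (RtoC a * w))%C (fun w => RtoC (b - a) * (w * w))%C).
 - intros z [_ Hz]. apply Cmult_neq_0. apply RtoC_neq_0; lra. now apply Cmult_neq_0.
 - apply hol_minus; apply (hol_exp_comp n _ (fun w => RtoC _ * w)%C); apply hol_mult; (apply hol_const || apply hol_id).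
 - apply hol_mult. apply hol_const. apply hol_mult; apply hol_id.
Qed.

Lemma kern_cont (a b s t : R) : a < b -> s <> 0 \/ t <> 0 -> ccont (kern a b) (s, t).
Proof. intros Hab H. apply (hol_cont 0) with (1 := kern_hol 1 a b Hab). split. exact I. now apply pair_neq_0. Qed.

Lemma cexp_lin_cont (l : R) (z : C) : ccont (fun w => cexp (RtoC l * w)) z.
Proof. apply (hol_cont 0 (fun _ => True)). apply (hol_exp_comp 1 _ (fun w => RtoC l * w)%C). apply hol_mult. apply hol_const. apply hol_id. exact I. Qed.

Lemma kern_term (a b c : R) : a < b -> 0 < c -> exists C0, 0 < C0 /\ forall l T, 0 <= l -> c <= T -> 1 <= T ->
 Cmod (vint (fun w => cexp (RtoC (- l) * w) * kern a b w)%C T c - RtoC (2 * PI * ramp a b l)) <= C0 * exp (- c * l) / T.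
Proof.
 intros Hab Hc. destruct (Jker_all b c Hc) as [C0 [H0 HJ]].
 set (C1 := / (b - a) * (C0 * exp (c * b) + C0 * exp (c * a))).
 assert (Hi : 0 < / (b - a)) by pos.
 assert (Pa := exp_pos (c * a)). assert (Pb := exp_pos (c * b)).
 exists C1. split. apply Rmult_lt_0_compat; auto; nra.
 intros l T Hl HcT HT.
 assert (Jc : forall v t, - T <= t <= T -> ccont (Jker v) (c, t)) by (intros; apply Jker_cont; left; lra).
 rewrite (vint_ext _ (fun w => RtoC (/ (b - a)) * (Jker (b - l) w + - (1) * Jker (a - l) w))%C).
 2: lra. 2:{ intros t Ht. apply kern_shift; auto. apply pair_neq_0. left; lra. }
 rewrite vint_scal. 2: lra. 2:{ intros t Ht. apply ccont_plus; auto. apply ccont_mult; auto. apply ccont_const. }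
 rewrite vint_lin; auto. 2: lra.
 assert (A := HJ (b - l) T ltac:(lra) HcT HT). assert (B := HJ (a - l) T ltac:(lra) HcT HT).
 set (X := vint (Jker (b - l)) T c) in *. set (Y := vint (Jker (a - l)) T c) in *.
 replace (RtoC (/ (b - a)) * (X + - (1) * Y) - RtoC (2 * PI * ramp a b l))%C with
  (RtoC (/ (b - a)) * ((X - RtoC (2 * PI * Rmax (b - l) 0)) - (Y - RtoC (2 * PI * Rmax (a - l) 0))))%C.
 2:{ unfold ramp. apply C_eq; csimp; field; lra. }
 rewrite Cmod_mult, Cmod_R, Rabs_pos_eq by lra.
 replace (C1 * exp (- c * l) / T) with (/ (b - a) * (C0 * exp (c * (b - l)) / T + C0 * exp (c * (a - l)) / T)).
 2:{ unfold C1. replace (c * (b - l)) with (c * b + - c * l) by ring. replace (c * (a - l)) with (c * a + - c * l) by ring.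
   rewrite !exp_plus. field. lra. }
 mono_l. lra. via Cmod_triangle_minus. lra.
Qed.

Lemma ramp_0 (a b l : R) : a < b -> b <= l -> ramp a b l = 0.
Proof. intros H1 H2. unfold ramp. rewrite !Rmax_right by lra. field. lra. Qed.

Lemma ramp_1 (a b l : R) : a < b -> l <= a -> ramp a b l = 1.
Proof. intros H1 H2. unfold ramp. rewrite !Rmax_left by lra. field. lra. Qed.

Lemma ramp_range (a b l : R) : a < b -> 0 <= ramp a b l <= 1.
Proof.
 intros H. unfold ramp. assert (0 < / (b - a)) by pos.
 assert (0 <= Rmax (b - l) 0 - Rmax (a - l) 0 <= b - a).
 { unfold Rmax. repeat destruct Rle_dec; lra. }
 split. unfold Rdiv; nra. apply Rmult_le_reg_r with (b - a). lra. unfold Rdiv. rewrite Rmult_assoc, Rinv_l by lra. lra.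
Qed.

Lemma csum_shrink (u : nat -> C) (M N : nat) : (M <= N)%nat ->
 (forall i, (M <= i < N)%nat -> u i = 0%C) -> csum u N = csum u M.
Proof.
 intros H Hu. replace N with (M + (N - M))%nat by lia. rewrite csum_app.
 rewrite (csum_ext (fun n => u (M + n)%nat) (fun n => 0 * 0)%C). rewrite csum_scal. ring.
 intros n Hn. rewrite Hu by lia. ring.
Qed.

Lemma csum_cont (u : nat -> C -> C) (M : nat) (z : C) : (forall n, ccont (u n) z) -> ccont (fun w => csum (fun n => u n w) M) z.
Proof.
 intros H. induction M as [|M IH]. exact (ccont_const 0 z).
 change (ccont (fun w => csum (fun n => u n w) M + u M w)%C z). now apply ccont_plus.
Qed.

Lemma vint_csum (u : nat -> C -> C) (M : nat) (T s : R) : 0 <= T -> (forall n t, - T <= t <= T -> ccont (u n) (s, t)) ->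
 vint (fun w => csum (fun n => u n w) M) T s = csum (fun n => vint (u n) T s) M.
Proof.
 intros HT H. induction M as [|M IH].
 - simpl csum. unfold vint. replace (RtoC 0) with (0 * 0)%C at 2 by ring.
  rewrite (CInt_ext _ (fun t => 0 * 0)%C) by (intros; try lra; ring). rewrite (CInt_scal (fun _ => RtoC 0)). ring. lra.
  intros t _. apply (ccont_vert (fun _ => RtoC 0) 0 t). apply ccont_const.
 - change (csum (fun n => vint (u n) T s) (S M)) with (csum (fun n => vint (u n) T s) M + vint (u M) T s)%C.
  rewrite <- IH. rewrite <- (Cmult_1_l (vint (u M) T s)). rewrite <- vint_lin; auto.
  + apply vint_ext; auto. intros t Ht. change (csum (fun n => u n (s, t)) (S M)) with (csum (fun n => u n (s, t)) M + u M (s, t))%C. ring.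
  + intros t Ht. apply csum_cont. auto.
Qed.

(* [D] is a general Dirichlet series with real exponents [l n >= 0], absolutely convergent on [Re w = c]. *)
Lemma perron (a b c : R) : a < b -> 0 < c -> exists C0, 0 < C0 /\
 forall (coef : nat -> C) (l : nat -> R) (D : C -> C) (S0 : R) (N : nat) (T : R),
 (forall n, 0 <= l n) -> (forall M, rsum (fun n => Cmod (coef n) * exp (- c * l n)) M <= S0) ->
 (forall n, (N <= n)%nat -> b <= l n) ->
 (forall t, ccont D (c, t)) ->
 (forall eps, 0 < eps -> exists M0, forall M t, (M0 <= M)%nat ->
   Cmod (D (c, t) - csum (fun n => coef n * cexp (RtoC (- l n) * (c, t)))%C M) <= eps) ->
 c <= T -> 1 <= T ->
 Cmod (vint (fun w => D w * kern a b w)%C T c - RtoC (2 * PI) * csum (fun n => coef n * RtoC (ramp a b (l n)))%C N) <= C0 * S0 / T.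
Proof.
 intros Hab Hc. destruct (kern_term a b c Hab Hc) as [C0 [H0 HK]]. exists C0. split; auto.
 intros coef l D S0 N T Hl HS HN HD HU HcT HT.
 set (u := fun n w => (coef n * (cexp (RtoC (- l n) * w) * kern a b w))%C).
 assert (Kc : forall t, ccont (kern a b) (c, t)) by (intros; apply kern_cont; auto; left; lra).
 assert (Kc' : forall n t, ccont (fun w => cexp (RtoC (- l n) * w) * kern a b w)%C (c, t)).
 { intros. apply ccont_mult; auto. apply cexp_lin_cont. }
 assert (uc : forall n t, ccont (u n) (c, t)).
 { intros. apply (ccont_mult (fun _ => coef n)). apply ccont_const. apply Kc'. }
 apply (vint_limit _ (fun M w => csum (fun n => u n w) M) T c _ _ N). lra.
 - intros. now apply ccont_mult.
 - intros. now apply csum_cont.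
 - intros eps He. set (m := (exp (c * b) + exp (c * a)) / ((b - a) * c ^ 2)).
  assert (Hm : 0 < m).
  { assert (X := exp_pos (c * b)). assert (Y := exp_pos (c * a)). apply Rdiv_lt_0_compat. lra. apply Rmult_lt_0_compat. lra. nra. }
  destruct (HU (eps / m)) as [M0 HM]. now apply Rdiv_lt_0_compat.
  exists M0. intros M t HMM Ht. specialize (HM M t HMM).
  replace (D (c, t) * kern a b (c, t) - csum (fun n => u n (c, t)) M)%C
   with ((D (c, t) - csum (fun n => coef n * cexp (RtoC (- l n) * (c, t)))%C M) * kern a b (c, t))%C.
  2:{ rewrite (csum_ext (fun n => u n (c, t)) (fun n => kern a b (c, t) * (coef n * cexp (RtoC (- l n) * (c, t))))%C).
    rewrite csum_scal. ring. intros n _. unfold u. ring. }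
  rewrite Cmod_mult. apply Rle_trans with (eps / m * m). 2: right; field; lra.
  mono; auto; try apply Cmod_ge_0.
  unfold kern, Cdiv. assert (cn : (c, t) <> RtoC 0) by (apply pair_neq_0; left; lra).
  assert (bn : RtoC (b - a) <> RtoC 0) by (apply RtoC_neq_0; lra).
  rewrite Cmod_mult, Cmod_inv, !Cmod_mult, Cmod_R, Rabs_pos_eq by (try lra; repeat apply Cmult_neq_0; auto).
  mono. pos.
  { left. apply Rinv_0_lt_compat. apply Cmod_gt_0 in cn. apply Rmult_lt_0_compat. lra. nra. }
  + via Cmod_triangle_minus. rewrite !Cmod_cexp. right. f_equal; f_equal; csimp; ring.
  + apply Rinv_le_contravar. apply Rmult_lt_0_compat; nra. mono_l. lra.
   assert (A := re_le_Cmod (c, t)). rewrite Re_pair, Rabs_pos_eq in A by lra. nra.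
 - intros M HM. rewrite vint_csum by (auto; lra).
  rewrite <- (csum_shrink _ N M HM).
  2:{ intros i Hi. rewrite ramp_0; auto. ring. apply HN. lia. }
  rewrite <- csum_scal.
  replace (csum (fun n => vint (u n) T c) M - csum (fun n => RtoC (2 * PI) * (coef n * RtoC (ramp a b (l n))))%C M)%C
   with (csum (fun n => coef n * (vint (fun w => cexp (RtoC (- l n) * w) * kern a b w)%C T c - RtoC (2 * PI * ramp a b (l n))))%C M).
  2:{ rewrite (csum_ext (fun n => vint (u n) T c) (fun n => coef n * vint (fun w => cexp (RtoC (- l n) * w) * kern a b w)%C T c)%C).
    2:{ intros n _. unfold u. apply vint_scal. lra. auto. }
    replace (csum (fun n => coef n * vint (fun w => cexp (RtoC (- l n) * w) * kern a b w)%C T c)%C M - csum (fun n => RtoC (2 * PI) * (coef n * RtoC (ramp a b (l n))))%C M)%C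
     with (csum (fun n => coef n * vint (fun w => cexp (RtoC (- l n) * w) * kern a b w)%C T c)%C M + - (1) * csum (fun n => RtoC (2 * PI) * (coef n * RtoC (ramp a b (l n))))%C M)%C by ring.
    rewrite <- csum_scal, <- csum_plus. apply csum_ext. intros n _. rewrite (RtoC_mult (2 * PI)). ring. }
  via csum_Cmod.
  apply Rle_trans with (rsum (fun n => (C0 / T) * (Cmod (coef n) * exp (- c * l n))) M).
  + apply rsum_le. intros n _. rewrite Cmod_mult. specialize (HK (l n) T (Hl n) HcT HT).
   replace (C0 / T * (Cmod (coef n) * exp (- c * l n))) with (Cmod (coef n) * (C0 * exp (- c * l n) / T)) by (field; lra).
   mono_l; auto. pos.
  + rewrite rsum_scal. replace (C0 * S0 / T) with (C0 / T * S0) by (field; lra). mono_l; auto.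
   left. pos.
Qed.

Lemma CInt_bound_derive (F : R -> C) (P g : R -> R) (a b : R) : a <= b -> (forall t, a <= t <= b -> contC F t) ->
 (forall t, a <= t <= b -> is_derive P t (g t)) -> (forall t, a <= t <= b -> continuous g t) ->
 (forall t, a <= t <= b -> Cmod (F t) <= g t) -> Cmod (CInt F a b) <= P b - P a.
Proof.
 intros Hab HF HP Hg HB. apply CInt_bound with g; auto.
 apply (is_RInt_derive (V := R_CompleteNormedModule) P g a b); intros t Ht; rewrite Rmin_left, Rmax_right in Ht by lra; auto.
Qed.

Lemma continuous_of_derive (g : R -> R) (t : R) : ex_derive g t -> continuous g t.
Proof. intros H. exact (ex_derive_continuous (K := R_AbsRing) (V := R_NormedModule) g t H). Qed.

(** Up to height x the integrand decays like 1/|t| and yields the logarithm; beyond it decays like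
    |t|^(-3/2), so the tails are bounded independently of T. *)
Lemma int_majorant (F : R -> C) (x A T : R) : 1 <= x -> x <= T -> 0 <= A ->
 (forall t, - T <= t <= T -> contC F t) ->
 (forall t, Rabs t <= x -> Cmod (F t) <= A / (1 + Rabs t)) ->
 (forall t, x <= Rabs t <= T -> Cmod (F t) <= A * sqrt x / (Rabs t * sqrt (Rabs t))) ->
 Cmod (CInt F (- T) T) <= A * (2 * ln (1 + x) + 4).
Proof.
 intros Hx HxT HA HF H1 H2.
 assert (sx : 0 < sqrt x) by (apply sqrt_lt_R0; lra).
 assert (sT : 0 < sqrt T) by (apply sqrt_lt_R0; lra).
 rewrite (CInt_Chasles F (- T) (- x) T) by (auto; lra).
 rewrite (CInt_Chasles F (- x) 0 T) by (try lra; intros; apply HF; lra).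
 rewrite (CInt_Chasles F 0 x T) by (try lra; intros; apply HF; lra).
 assert (I1 : Cmod (CInt F 0 x) <= A * ln (1 + x) - A * ln (1 + 0)).
 { apply (CInt_bound_derive F (fun t => A * ln (1 + t)) (fun t => A / (1 + t))). lra. intros; apply HF; lra.
  - intros t Ht. auto_derive. lra. field. lra.
  - intros t Ht. apply continuous_of_derive. auto_derive. lra.
  - intros t Ht. assert (X := H1 t). rewrite Rabs_pos_eq in X by lra. apply X. lra. }
 assert (I2 : Cmod (CInt F (- x) 0) <= - A * ln (1 - 0) - - A * ln (1 - - x)).
 { apply (CInt_bound_derive F (fun t => - A * ln (1 - t)) (fun t => A / (1 - t))). lra. intros; apply HF; lra.
  - intros t Ht. auto_derive. lra. field. lra.
  - intros t Ht. apply continuous_of_derive. auto_derive. lra.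
  - intros t Ht. assert (X := H1 t). rewrite Rabs_left1 in X by lra. apply X. lra. }
 assert (I3 : Cmod (CInt F x T) <= - 2 * A * sqrt x / sqrt T - - 2 * A * sqrt x / sqrt x).
 { apply (CInt_bound_derive F (fun t => - 2 * A * sqrt x / sqrt t) (fun t => A * sqrt x / (t * sqrt t))). lra. intros; apply HF; lra.
  - intros t Ht. assert (0 < sqrt t) by (apply sqrt_lt_R0; lra). assert (E : sqrt t * sqrt t = t) by (apply sqrt_sqrt; lra).
   auto_derive. split. lra. split. lra. auto. rewrite E. field. lra.
  - intros t Ht. assert (0 < sqrt t) by (apply sqrt_lt_R0; lra). apply continuous_of_derive. auto_derive.
   repeat split; try lra. apply Rmult_integral_contrapositive. split; lra.
  - intros t Ht. assert (X := H2 t). rewrite Rabs_pos_eq in X by lra. apply X. lra. }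
 assert (I4 : Cmod (CInt F (- T) (- x)) <= 2 * A * sqrt x / sqrt (- - x) - 2 * A * sqrt x / sqrt (- - T)).
 { apply (CInt_bound_derive F (fun t => 2 * A * sqrt x / sqrt (- t)) (fun t => A * sqrt x / (- t * sqrt (- t)))). lra. intros; apply HF; lra.
  - intros t Ht. assert (0 < sqrt (- t)) by (apply sqrt_lt_R0; lra). assert (E : sqrt (- t) * sqrt (- t) = - t) by (apply sqrt_sqrt; lra).
   auto_derive. split. lra. split. lra. auto. rewrite E. field. lra.
  - intros t Ht. assert (0 < sqrt (- t)) by (apply sqrt_lt_R0; lra). apply continuous_of_derive. auto_derive.
   repeat split; try lra. apply Rmult_integral_contrapositive. split; lra.
  - intros t Ht. assert (X := H2 t). rewrite Rabs_left1 in X by lra. apply X. lra. }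
 rewrite !Ropp_involutive in I4. rewrite Rplus_0_r, ln_1 in I1. rewrite Rminus_0_r, ln_1 in I2. replace (1 - - x) with (1 + x) in I2 by ring.
 assert (P : 0 <= 2 * A * sqrt x / sqrt T).
 { mul_pos. nra. pos. }
 assert (E1 : -2 * A * sqrt x / sqrt T = - (2 * A * sqrt x / sqrt T)) by (field; lra).
 assert (E2 : -2 * A * sqrt x / sqrt x = - (2 * A)) by (field; lra).
 assert (E3 : 2 * A * sqrt x / sqrt x = 2 * A) by (field; lra). rewrite E1, E2 in I3. rewrite E3 in I4.
 via Cmod_triangle. via (Rplus_le_compat_l _ _ _ (Cmod_triangle _ _)).
 le_trans. apply Rplus_le_compat_l, Rplus_le_compat_l, Cmod_triangle. lra.
Qed.

Lemma kern_bound_2 (a b : R) (w : C) (m : R) : a < b -> w <> RtoC 0 -> exp (a * Re w) <= m -> exp (b * Re w) <= m ->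
 Cmod (kern a b w) <= 2 * m / ((b - a) * Cmod w ^ 2).
Proof.
 intros Hab Hw Ha Hb. unfold kern, Cdiv. assert (bn : RtoC (b - a) <> RtoC 0) by (apply RtoC_neq_0; lra).
 rewrite Cmod_mult, Cmod_inv, !Cmod_mult, Cmod_R, Rabs_pos_eq by (try lra; repeat apply Cmult_neq_0; auto).
 replace (Cmod w ^ 2) with (Cmod w * Cmod w) by ring. apply Cmod_gt_0 in Hw.
 mono_r. left; apply Rinv_0_lt_compat, Rmult_lt_0_compat; nra.
 via Cmod_triangle_minus. rewrite !Cmod_cexp.
 replace (Re (RtoC b * w)%C) with (b * Re w) by (csimp; ring). replace (Re (RtoC a * w)%C) with (a * Re w) by (csimp; ring). lra.
Qed.

(** The mean value inequality in the exponent cancels b - a. This bound is the better one for |w|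
    below 1/(b - a), the quadratic one beyond. *)
Lemma kern_bound_1 (a b : R) (w : C) (m : R) : a < b -> w <> RtoC 0 -> exp (a * Re w) <= m -> exp (b * Re w) <= m ->
 Cmod (kern a b w) <= m / Cmod w.
Proof.
 intros Hab Hw Ha Hb.
 assert (M : Cmod (cexp (RtoC b * w) - cexp (RtoC a * w)) <= Cmod w * m * (b - a)).
 { apply (mean_value_C (fun s => cexp (RtoC s * w)) (fun s => w * cexp (RtoC s * w))%C). lra.
  - intros t _. apply rder_cexp_line.
  - intros t Ht. rewrite Cmod_mult. mono_l. pos. rewrite Cmod_cexp.
   replace (Re (RtoC t * w)%C) with (t * Re w) by (csimp; ring).
   destruct (Rle_dec 0 (Re w)). upto Hb. apply exp_le; nra. upto Ha. apply exp_le; nra. }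
 unfold kern, Cdiv. assert (bn : RtoC (b - a) <> RtoC 0) by (apply RtoC_neq_0; lra).
 rewrite Cmod_mult, Cmod_inv, !Cmod_mult, Cmod_R, Rabs_pos_eq by (try lra; repeat apply Cmult_neq_0; auto).
 apply Cmod_gt_0 in Hw. set (q := Cmod w) in *.
 replace (m / q) with (q * m * (b - a) * / ((b - a) * (q * q))) by (field; lra).
 mono_r; auto. left; apply Rinv_0_lt_compat, Rmult_lt_0_compat; nra.
Qed.

(** Below height X the linear kernel bound is used, above it the quadratic one with 1/(b - a) <= 2X;
    the square-root growth of D leaves the exponent 3/2 of decay. *)
Lemma kernel_line_bound (D : C -> C) (X A kap a b s m T : R) : 1 <= X <= T -> 0 <= A -> 0 <= kap -> a < b ->
 1 / 2 <= Rabs s -> / (2 * X) <= b - a -> exp (a * s) <= m -> exp (b * s) <= m ->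
 (forall t, ccont D (s, t)) -> (forall t, Cmod (D (s, t)) <= A * sqrt (1 + kap * Rabs t / X)) ->
 Cmod (vint (fun w => D w * kern a b w)%C T s) <= 4 * A * (1 + kap) * m * (2 * ln (1 + X) + 4).
Proof.
 intros HX HA Hk Hab0 Hs Hab ml ml2 Dc Db.
 assert (sn : s <> 0) by (intros ->; rewrite Rabs_R0 in Hs; lra).
 assert (c0 : forall t, (s, t) <> RtoC 0) by (intros; apply pair_neq_0; auto).
 assert (m0 : 0 < m) by (eapply Rlt_le_trans; [apply exp_pos|exact ml]).
 assert (AP : 0 <= A * (1 + kap) * m) by (repeat mul_pos; lra).
 assert (Sq : forall q, 0 <= q / X -> 0 <= 1 + kap * q / X).
 { intros q Hq. replace (kap * q / X) with (kap * (q / X)) by (unfold Rdiv; ring). nra. }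
 apply (int_majorant (fun t => (fun w => D w * kern a b w)%C (s, t)) X (4 * A * (1 + kap) * m) T); try lra.
 - intros t _. apply (ccont_vert (fun w => D w * kern a b w)%C). apply ccont_mult; auto. apply kern_cont; auto.
 - intros t Ht. rewrite Cmod_mult. pose proof (Rabs_pos t). assert (K1 := kern_bound_1 a b (s, t) m Hab0 (c0 t) ml ml2).
  assert (Q : 0 <= Rabs t / X <= 1).
  { split. mul_pos; [lra|pos]. apply Rmult_le_reg_r with X; [lra|unfold Rdiv; rewrite Rmult_assoc, Rinv_l; lra]. }
  assert (S0 : sqrt (1 + kap * Rabs t / X) <= 1 + kap).
  { rewrite <- (sqrt_square (1 + kap)) by lra. replace (kap * Rabs t / X) with (kap * (Rabs t / X)) by (unfold Rdiv; ring). apply sqrt_le_1; nra. }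
  assert (W3 : (1 + Rabs t) / 3 <= Cmod (s, t)).
  { assert (W1 := re_le_Cmod (s, t)). assert (W2 := Im_le_Cmod (s, t)). rewrite Re_pair in W1. rewrite Im_pair in W2. lra. }
  apply Rle_trans with (A * (1 + kap) * (m / ((1 + Rabs t) / 3))).
  + mono; try apply Cmod_ge_0. via Db. mono_l; lra.
   via K1. mono_l. lra. apply Rinv_le_contravar; lra.
  + replace (A * (1 + kap) * (m / ((1 + Rabs t) / 3))) with (3 * (A * (1 + kap) * m) / (1 + Rabs t)) by (field; lra).
   mono_r. pos. lra.
 - intros t Ht. rewrite Cmod_mult. set (q := Rabs t) in *. assert (q1 : 1 <= q) by lra.
  assert (K1 := kern_bound_2 a b (s, t) m Hab0 (c0 t) ml ml2). assert (W2 := Im_le_Cmod (s, t)). rewrite Im_pair in W2. fold q in W2.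
  assert (sq : 1 <= sqrt q) by (rewrite <- sqrt_1; apply sqrt_le_1; lra). assert (sqq : sqrt q * sqrt q = q) by (apply sqrt_sqrt; lra).
  assert (sX : 1 <= sqrt X) by (rewrite <- sqrt_1; apply sqrt_le_1; lra). assert (sXX : sqrt X * sqrt X = X) by (apply sqrt_sqrt; lra).
  assert (qX : 0 <= q / X) by (mul_pos; [lra|pos]).
  assert (S2 : sqrt (1 + kap * q / X) * sqrt X <= (1 + kap) * sqrt q).
  { rewrite <- sqrt_mult by (auto; lra). rewrite <- (sqrt_square (1 + kap)), <- sqrt_mult by nra.
   replace ((1 + kap * q / X) * X) with (X + kap * q) by (field; lra). apply sqrt_le_1; nra. }
  apply Rle_trans with (A * sqrt (1 + kap * q / X) * (2 * m * (2 * X) / q ^ 2)).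
  + mono; try apply Cmod_ge_0. apply Db. via K1.
   unfold Rdiv. rewrite Rinv_mult. rewrite (Rmult_assoc (2 * m)). mono_l. lra.
   mono. pos. left; apply Rinv_0_lt_compat; nra.
   * rewrite <- (Rinv_inv (2 * X)). apply Rinv_le_contravar; auto. pos.
   * apply Rinv_le_contravar; nra.
  + assert (E3 : forall r, 1 <= r -> r / (r * r) ^ 2 = / (r * r * r)) by (intros; field; lra).
   specialize (E3 (sqrt q) sq). rewrite sqq in E3.
   replace (4 * A * (1 + kap) * m * sqrt X / (q * sqrt q)) with (4 * (A * m) * sqrt X / q ^ 2 * ((1 + kap) * sqrt q)).
   2:{ replace (4 * (A * m) * sqrt X / q ^ 2 * ((1 + kap) * sqrt q)) with (4 * A * (1 + kap) * m * sqrt X * (sqrt q / q ^ 2)) by (field; lra).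
     rewrite E3. reflexivity. }
   replace (A * sqrt (1 + kap * q / X) * (2 * m * (2 * X) / q ^ 2)) with (4 * (A * m) * sqrt X / q ^ 2 * (sqrt (1 + kap * q / X) * sqrt X)).
   2:{ rewrite <- sXX at 5. field. lra. }
   mono_l; auto. mul_pos. repeat mul_pos; try lra. left; apply Rinv_0_lt_compat; nra.
Qed.

(** * Sums of the Moebius function *)

(** 1/zeta, continued to Re s > 1/2 under RH. *)
Definition muz (s : C) : C := ((s - 1) / fz s)%C.

Lemma muz_mus (s : C) : 1 < Re s -> muz s = mus s.
Proof.
 intros Hs. assert (M := mus_zeta s Hs). assert (F := fz_neq_0_right s Hs). unfold muz.
 assert (E : (s - 1)%C = (mus s * fz s)%C).
 { rewrite fz_zeta by auto. transitivity ((s - 1) * (mus s * zeta_s s))%C. rewrite M; ring. ring. }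
 rewrite E. field. exact F.
Qed.

Lemma muz_hol (n : nat) : RH -> hol n (fun s => 1 / 2 < Re s) muz.
Proof.
 intros HR. apply hol_div. intros; now apply fz_neq_0. apply hol_minus. apply hol_id. apply hol_const.
 apply hol_sub with (2 := fz_hol n). intros; lra.
Qed.

(** The common growth factor of zeta and 1/zeta at height t on lines at distance at least 6 / log
    log X from the critical line. *)
Definition Eg (X t : R) : R := exp (0.32 * LX X t / ln (ln X)).

Lemma Eg_ge_1 (X t : R) : 1 < X -> 30 <= ln (ln X) -> 1 <= Eg X t.
Proof.
 intros HX Hv. destruct (loglog_large X Hv HX) as [HlX _]. unfold Eg. rewrite <- exp_0. apply exp_le.
 assert (H := LX_ge X t HX). mul_pos. lra. pos.
Qed.

Lemma muz_bound (X : R) (s : C) : RH -> 1 < X -> 30 <= ln (ln X) -> 1 / 2 + 6 / ln (ln X) <= Re s ->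
 Cmod (muz s) <= 3 * Eg X (Im s).
Proof.
 intros HR HX Hv Hs. assert (Hv' : 0 < 6 / ln (ln X)) by pos.
 assert (Hn : fz s <> RtoC 0) by (apply fz_neq_0; auto; lra). unfold muz, Cdiv. rewrite Cmod_mult, Cmod_inv by auto.
 assert (P : 0 < Cmod (fz s)) by now apply Cmod_gt_0.
 apply Rmult_le_reg_r with (Cmod (fz s)); auto. rewrite Rmult_assoc, Rinv_l, Rmult_1_r by lra.
 destruct (Rle_dec (Re s) (3 / 2)) as [H|H].
 - destruct (zeta_bounds X (Im s) (Re s) HR HX Hv ltac:(lra)) as [Z _]. destruct s as [x t]. exact Z.
 - assert (T := fz_lower s ltac:(lra)). assert (E := Eg_ge_1 X (Im s) HX Hv).
  via T. mono_r. lra.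
  assert (/ (Re s - 1) <= / (1 / 2)) by (apply Rinv_le_contravar; lra). lra.
Qed.

Lemma sqrt_exp_ln (y : R) : 0 < y -> sqrt y = exp (1 / 2 * ln y).
Proof.
 intros H. rewrite <- (exp_ln y) at 1 by auto. replace (ln y) with (1 / 2 * ln y + 1 / 2 * ln y) at 1 by field.
 rewrite exp_plus. apply sqrt_square. pos.
Qed.

Lemma LX_add (X t u : R) : 1 < X -> LX X (t + u) <= LX X t + ln (1 + Rabs u / X).
Proof.
 intros HX. unfold LX. pose proof (Rabs_pos t). pose proof (Rabs_pos u). assert (0 < / X) by pos.
 assert (0 <= Rabs u / X) by (unfold Rdiv; nra). assert (0 <= Rabs t * (Rabs u / X)) by nra.
 rewrite <- ln_mult by lra. apply ln_le'. pose proof (Rabs_pos (t + u)); lra.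
 replace ((Rabs t + X) * (1 + Rabs u / X)) with (Rabs t + X + Rabs u + Rabs t * (Rabs u / X)) by (field; lra).
 pose proof (Rabs_triang t u). lra.
Qed.

(** Since 0.32 / log log X is at most 1/2, a shift in height costs no more than a square root, which
    the kernel can absorb. *)
Lemma Eg_add (X t u : R) : 1 < X -> 30 <= ln (ln X) -> Eg X (t + u) <= Eg X t * sqrt (1 + Rabs u / X).
Proof.
 intros HX Hv. assert (0 < / X) by pos. pose proof (Rabs_pos u).
 assert (0 <= Rabs u / X) by (unfold Rdiv; nra).
 rewrite sqrt_exp_ln by lra. unfold Eg. rewrite <- exp_plus. apply exp_le. set (v := ln (ln X)) in *.
 assert (A := LX_add X t u HX). assert (L : 0 <= ln (1 + Rabs u / X)) by (apply ln_nonneg; lra).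
 assert (I : 0.32 / v <= 1 / 2). { apply Rmult_le_reg_r with v. lra. unfold Rdiv at 1. rewrite Rmult_assoc, Rinv_l; lra. }
 assert (I0 : 0 < 0.32 / v) by pos.
 replace (0.32 * LX X (t + u) / v) with (0.32 / v * LX X (t + u)) by (unfold Rdiv; ring).
 replace (0.32 * LX X t / v) with (0.32 / v * LX X t) by (unfold Rdiv; ring). nra.
Qed.

Lemma le_of_all_T (q K C1 T0 : R) : (forall T, T0 <= T -> q <= K + C1 / T) -> q <= K.
Proof.
 intros H. apply Rle_plus_epsilon. intros eps He. pose proof (Rabs_pos C1). pose proof (Rabs_pos T0).
 assert (P : 0 <= Rabs C1 / eps) by (mul_pos; [lra|pos]).
 set (T := Rabs T0 + Rabs C1 / eps + 1).
 assert (HT : 1 <= T) by (unfold T; lra). assert (Z := Rle_abs T0). assert (Z2 := Rle_abs C1).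
 specialize (H T ltac:(unfold T; lra)). via H. apply Rplus_le_compat_l.
 apply Rmult_le_reg_r with T. lra. unfold Rdiv at 1. rewrite Rmult_assoc, Rinv_l by lra.
 assert (E : Rabs C1 / eps * eps = Rabs C1) by (field; lra). unfold T. nra.
Qed.

(** w times [kern], with its limit 1 filled in at 0, so that the residue lemma for quotients by w
    applies. *)
Definition kernq (a b : R) (w : C) : C :=
 if excluded_middle_informative (w = RtoC 0) then RtoC 1 else ((cexp (RtoC b * w) - cexp (RtoC a * w)) / RtoC (b - a) / w)%C.

Lemma kernq_kern (a b : R) (w : C) : a < b -> w <> RtoC 0 -> (kernq a b w / w)%C = kern a b w.
Proof.
 intros Hab Hw. unfold kernq, kern. destruct excluded_middle_informative. tauto.
 field. split; auto. apply RtoC_neq_0; lra.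
Qed.

Lemma cdiff_cexp_lin (l : R) (w : C) : cdiff (fun w => cexp (RtoC l * w))%C w (RtoC l * cexp (RtoC l * w))%C.
Proof.
 apply cdiff_eq with (cexp (RtoC l * w) * RtoC l)%C. ring.
 apply (cdiff_comp cexp (fun w => RtoC l * w)%C). 2: apply cdiff_cexp.
 apply cdiff_eq with (0 * w + RtoC l * 1)%C. ring. apply (cdiff_mult (fun _ => RtoC l) (fun w => w)). apply cdiff_const. apply cdiff_id.
Qed.

Lemma cdiff_scal (f : C -> C) (z l c : C) : cdiff f z l -> cdiff (fun w => c * f w)%C z (c * l)%C.
Proof.
 intros H. apply cdiff_eq with (0 * f z + c * l)%C. ring. apply (cdiff_mult (fun _ => c) f). apply cdiff_const. exact H.
Qed.

Lemma kernq_cdiff (a b : R) : a < b -> exists l, cdiff (kernq a b) 0 l.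
Proof.
 intros Hab. assert (bn : RtoC (b - a) <> RtoC 0) by (apply RtoC_neq_0; lra).
 set (f := fun w => (/ RtoC (b - a) * (cexp (RtoC b * w) + - (1) * cexp (RtoC a * w)))%C).
 set (f1 := fun w => (/ RtoC (b - a) * (RtoC b * cexp (RtoC b * w) + - (1) * (RtoC a * cexp (RtoC a * w))))%C).
 assert (X := removable_quotient f f1 0
  (/ RtoC (b - a) * (RtoC b * (RtoC b * cexp (RtoC b * 0)) + - (1) * (RtoC a * (RtoC a * cexp (RtoC a * 0)))))%C 1 ltac:(lra)).
 eexists. apply cdiff_ext with (2 := X
  ltac:(intros w _; apply cdiff_scal, cdiff_plus; [|apply cdiff_scal]; apply cdiff_cexp_lin)
  ltac:(apply cdiff_scal, cdiff_plus; [|apply cdiff_scal]; apply cdiff_scal, cdiff_cexp_lin)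
  ltac:(unfold f; rewrite !Cmult_0_r, cexp_0; ring)).
 intros w. unfold kernq. destruct excluded_middle_informative as [->|n].
 - unfold f1. rewrite !Cmult_0_r, cexp_0, RtoC_minus. field. rewrite <- RtoC_minus. exact bn.
 - unfold f. field. auto.
Qed.

Lemma kernq_hol (n : nat) (a b : R) : a < b -> hol n (fun w => True /\ w <> RtoC 0) (kernq a b).
Proof.
 intros Hab. apply hol_ext_open with (fun w => w * kern a b w)%C. apply copen_minus_point, copen_True.
 - intros z [_ Hz]. rewrite <- kernq_kern by auto. field. exact Hz.
 - apply hol_mult. apply hol_id. now apply kern_hol.
Qed.

Lemma copen_Re (r : R) : copen (fun w => r < Re w).
Proof.
 intros z Hz. exists (Re z - r). split. lra. intros w Hw.
 assert (A := re_le_Cmod (w - z)). rewrite Re_minus in A. apply Rle_lt_trans with (2 := Hw) in A. apply Rabs_lt_between in A. lra.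
Qed.

Lemma dterm_exp (a : nat -> R) (z w : C) (n : nat) :
 dterm a (z + w) n = (dterm a z n * cexp (RtoC (- ln (INR (S n))) * w))%C.
Proof.
 unfold dterm. rewrite xpow_plus. rewrite Cmult_assoc. f_equal. unfold xpow. f_equal. rewrite RtoC_opp. ring.
Qed.

Lemma series_tail (v : nat -> R) : ex_series v -> (forall n, 0 <= v n) -> forall eps, 0 < eps ->
 exists M0, forall M K, (M0 <= M)%nat -> rsum (fun i => v (M + i)%nat) K <= eps.
Proof.
 intros Hv Hp eps He. assert (Hs := Series_correct _ Hv).
 assert (L : is_lim_seq (sum_n v) (Series v)) by exact Hs. apply is_lim_seq_spec in L.
 destruct (L (mkposreal eps He)) as [M0 HM]. simpl in HM. exists (S M0). intros M K HMM. destruct M as [|M]. lia.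
 specialize (HM M ltac:(lia)). rewrite <- rsum_sum_n in HM.
 assert (A := rsum_le_Series v (S M + K) Hp Hv). rewrite rsum_app in A.
 apply Rabs_lt_between in HM. lra.
Qed.

Lemma CSer_uniform (u : nat -> C) (v : nat -> R) (M : nat) (eps : R) :
 (forall n, Cmod (u n) <= v n) -> ex_series v -> (forall K, rsum (fun i => v (M + i)%nat) K <= eps) ->
 Cmod (CSer u - csum u M) <= eps.
Proof.
 intros Hu Hv HT. apply (ctends_bound (fun K => csum u (M + K) + - csum u M)%C _ _ 0).
 - intros K _. rewrite csum_app. replace (csum u M + csum (fun n => u (M + n)%nat) K + - csum u M)%C with (csum (fun n => u (M + n)%nat) K) by ring.
  via csum_Cmod. upto (HT K). apply rsum_le. auto.
 - apply ctends_plus. 2: apply ctends_const.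
  apply (ctends_sub (csum u) _ (fun K => (M + K)%nat)). intros; lia. apply CSer_ctends with v; auto.
Qed.

Lemma ln_1_ge (u : R) : 0 <= u <= 1 -> u / 2 <= ln (1 + u).
Proof.
 intros H. assert (X := exp_ineq1_le (- ln (1 + u))). rewrite exp_Ropp, exp_ln in X by lra.
 assert (/ (1 + u) <= 1 - u / 2). { apply Rmult_le_reg_r with (1 + u). lra. rewrite Rinv_l by lra. nra. }
 lra.
Qed.

(** The ramp runs from log N to log (N + sqrt N). It adds at most sqrt N + 1 terms, each at most
    N^(-Re z) in modulus, while its width in l stays of order 1 / sqrt N. *)
Lemma ramp_sum_approx (N : nat) (z : C) : (1 <= N)%nat -> exists M, (N <= M)%nat /\
 (forall n, (M <= n)%nat -> ln (INR N + sqrt (INR N)) <= ln (INR (S n))) /\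
 Cmod (csum (fun n => dterm mu z n * RtoC (ramp (ln (INR N)) (ln (INR N + sqrt (INR N))) (ln (INR (S n)))))%C M - csum (dterm mu z) N)
  <= 2 * sqrt (INR N) * exp (- Re z * ln (INR N)) \/ Re z < 0.
Proof.
 intros HN. destruct (Rlt_dec (Re z) 0) as [Hz|Hz]. exists N. now right.
 assert (N1 : 1 <= INR N) by (change 1 with (INR 1); now apply le_INR).
 assert (s1 : 1 <= sqrt (INR N)) by (rewrite <- sqrt_1; apply sqrt_le_1; lra).
 assert (K0 : exists K : nat, sqrt (INR N) <= INR K <= sqrt (INR N) + 1).
 { destruct (archimed (sqrt (INR N))) as [A B]. exists (Z.to_nat (up (sqrt (INR N)))).
  rewrite (INR_IZR_INZ (Z.to_nat _)), Z2Nat.id. lra. apply le_IZR. lra. }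
 destruct K0 as [K HK].
 set (a := ln (INR N)). set (b := ln (INR N + sqrt (INR N))).
 assert (Hab : a < b) by (apply ln_increasing; lra).
 exists (N + K)%nat. left. repeat split.
 - lia.
 - intros n Hn. apply ln_le'. lra. rewrite S_INR. apply le_INR in Hn. rewrite plus_INR in Hn. lra.
 - rewrite csum_app.
  rewrite (csum_ext (fun n => dterm mu z n * RtoC (ramp a b (ln (INR (S n)))))%C (dterm mu z)).
  2:{ intros n Hn. rewrite ramp_1. ring. exact Hab. apply ln_le'. apply INR_S_pos. apply le_INR. lia. }
  match goal with |- Cmod (?A + ?B - ?A) <= _ => replace (A + B - A)%C with B by ring end.
  via csum_Cmod.
  apply Rle_trans with (rsum (fun _ => exp (- Re z * ln (INR N))) K).
  + apply rsum_le. intros n _. rewrite Cmod_mult, Cmod_R.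
   assert (R1 := ramp_range a b (ln (INR (S (N + n)))) Hab). rewrite Rabs_pos_eq by lra.
   assert (R2 := dterm_mu_bound z (N + n)). assert (R3 : pw (Re z) (N + n) <= exp (- Re z * ln (INR N))).
   { apply exp_le. assert (ln (INR N) <= ln (INR (S (N + n)))) by (apply ln_le'; [lra|apply le_INR; lia]). nra. }
   assert (0 <= Cmod (dterm mu z (N + n))) by pos. nra.
  + rewrite rsum_const. mono_r. pos. lra.
Qed.

(** Perron's formula for 1/zeta(z + w) on Re w = 1, moved to the left line; the pole at w = 0
    contributes 1/zeta(z), so the tail is what remains on the left. *)
Lemma mu_tail_bound (X : R) (N : nat) (z : C) : RH -> 1 < X -> 30 <= ln (ln X) ->
 (1 <= N)%nat -> INR N <= X -> 1 + 12 / ln (ln X) <= Re z ->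
 Cmod (muz z - csum (dterm mu z) N)
  <= 10 * exp (- (Re z - 1 / 2 - 6 / ln (ln X)) * ln (INR N)) * Eg X (Im z) * ln X.
Proof.
 intros HR HX Hv HN HNX Hz. destruct (loglog_large X Hv HX) as [HlX [HX3 _]].
 set (v := ln (ln X)) in *.
 assert (N1 : 1 <= INR N) by (change 1 with (INR 1); now apply le_INR).
 assert (s1 : 1 <= sqrt (INR N)) by (rewrite <- sqrt_1; apply sqrt_le_1; lra).
 assert (ss : sqrt (INR N) * sqrt (INR N) = INR N) by (apply sqrt_sqrt; lra).
 assert (H6 : 0 < 6 / v) by pos.
 assert (H12 : 12 / v = 2 * (6 / v)) by (field; lra).
 (* Re w = -be is the line Re (z + w) = 1/2 + 6/v. The hypothesis on Re z keeps it at distance at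
    least 1/2 from the pole of the kernel. *)
 set (be := Re z - 1 / 2 - 6 / v). assert (Hbe : 1 / 2 <= be) by (unfold be; lra).
 set (a := ln (INR N)). set (b := ln (INR N + sqrt (INR N))).
 assert (a0 : 0 <= a) by (apply ln_nonneg; lra).
 assert (Hab : / (2 * sqrt (INR N)) <= b - a).
 { unfold b, a. rewrite <- ln_div by lra. replace ((INR N + sqrt (INR N)) / INR N) with (1 + / sqrt (INR N)).
  2:{ clear - ss s1. set (q := sqrt (INR N)) in *. rewrite <- ss. field. lra. }
  replace (/ (2 * sqrt (INR N))) with (/ sqrt (INR N) / 2) by (field; lra). apply ln_1_ge. split.
  pos. rewrite <- Rinv_1. apply Rinv_le_contravar; lra. }
 assert (Hab0 : a < b). { assert (0 < / (2 * sqrt (INR N))) by pos. lra. }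
 set (m := exp (- be * a)). assert (m0 : 0 < m) by pos.
 set (E := Eg X (Im z)). assert (E1 : 1 <= E) by (now apply Eg_ge_1).
 destruct (ramp_sum_approx N z HN) as [M [[HNM [HM Hap]]|]]. 2: lra. fold a b in HM, Hap.
 set (S := csum (fun n => dterm mu z n * RtoC (ramp a b (ln (INR (S n)))))%C M) in *.
 destruct (perron a b 1 Hab0 ltac:(lra)) as [C0 [HC0 HP]].
 set (D := fun w => muz (z + w)%C).
 assert (Hser := ex_series_pw (Re z + 1) ltac:(lra)).
 assert (Dhol : forall n, hol n (fun w => - be - 6 / v < Re w) D).
 { intros n. refine (hol_comp n (fun s => 1 / 2 < Re s) _ muz (fun w => z + w)%C _ _ _).
  intros w Hw. rewrite Re_plus. unfold be in Hw. lra. now apply muz_hol. apply hol_plus. apply hol_const. apply hol_id. }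
 assert (Dc : forall s t, - be <= s -> ccont D (s, t)).
 { intros s t Hs. apply (hol_cont 0) with (1 := Dhol 1%nat). simpl. lra. }
 assert (Db : forall s t, - be <= s -> Cmod (D (s, t)) <= 3 * (E * sqrt (1 + Rabs t / X))).
 { intros s t Hs. le_trans. refine (muz_bound X (z + (s, t)) HR HX Hv _). rewrite Re_plus, Re_pair. fold v. unfold be in Hs. lra.
  mono_l. lra. rewrite Im_plus, Im_pair. now apply Eg_add. }
 assert (P1 : forall T, 1 <= T -> Cmod (vint (fun w => D w * kern a b w)%C T 1 - RtoC (2 * PI) * S) <= C0 * Series (pw (Re z + 1)) / T).
 { intros T HT. apply (HP (dterm mu z) (fun n => ln (INR (Datatypes.S n))) D); auto.
  - intros n. apply ln_nonneg, INR_S_ge_1.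
  - intros K. upto (rsum_le_Series _ K (fun n => Rlt_le _ _ (pw_pos _ n)) (proj1 Hser)).
   apply rsum_le. intros n _. via Rmult_le_compat_r. pos. apply dterm_mu_bound.
   unfold pw. rewrite <- exp_plus. right. f_equal. ring.
  - intros t. apply Dc. lra.
  - intros eps He. destruct (series_tail _ (proj1 Hser) (fun n => Rlt_le _ _ (pw_pos _ n)) eps He) as [M0 HM0].
   exists M0. intros K t HK. unfold D. rewrite muz_mus by (csimp; lra).
   rewrite (csum_ext _ (dterm mu (z + (1, t)))) by (intros; now rewrite dterm_exp).
   apply CSer_uniform with (pw (Re z + 1)); auto. 2: apply (proj1 Hser).
   intros n. via dterm_mu_bound. rewrite Re_plus, Re_pair. lra. }
 set (G := fun w => (D w * kernq a b w)%C).
 set (Uo := fun w => - be - 6 / v < Re w).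
 assert (GD : exists l, cdiff G 0 l).
 { destruct (kernq_cdiff a b Hab0) as [l Hl]. destruct (Dhol 1%nat) as [D1 [HD1 _]].
  eexists. apply (cdiff_mult D (kernq a b)). apply HD1. csimp. lra. exact Hl. }
 destruct GD as [l GD].
 assert (Gh : hol 2 (fun w => Uo w /\ w <> RtoC 0) G).
 { apply hol_mult. apply hol_sub with (2 := Dhol 2%nat). intros w [Hw _]; exact Hw.
  apply hol_sub with (2 := kernq_hol 2 a b Hab0). tauto. }
 assert (G0 : G 0%C = muz z).
 { unfold G, D, kernq. destruct excluded_middle_informative as [_|n]. 2: tauto. rewrite Cplus_0_r. ring. }
 assert (GK : forall w, w <> RtoC 0 -> (G w / (w - RtoC 0))%C = (D w * kern a b w)%C).
 { intros w Hw. rewrite <- kernq_kern by auto. unfold G. replace (w - RtoC 0)%C with w by ring. field. exact Hw. }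
 set (mb := exp (b * 1)).
 assert (mb1 : forall s, - be <= s <= 1 -> exp (a * s) <= mb /\ exp (b * s) <= mb).
 { intros s Hs. split; apply exp_le; nra. }
 set (B := 12 * E * (mb / (b - a))).
 (* Moving the line: on the horizontal edges the kernel decays like 1/T^2 and D grows at most like
    sqrt T, so the discrepancy is O(1/T). *)
 assert (P2 : forall T, 1 <= T -> Cmod (vint (fun w => D w * kern a b w)%C T 1 - vint (fun w => D w * kern a b w)%C T (- be) - RtoC (2 * PI) * muz z)
   <= 2 * (1 - - be) * (B + 2 * Cmod (muz z)) / T).
 { intros T HT. rewrite <- G0.
  rewrite (vint_ext _ (fun w => G w / (w - RtoC 0))%C T 1), (vint_ext _ (fun w => G w / (w - RtoC 0))%C T (- be)); try lra.
  2,3: intros t _; rewrite GK; auto; apply pair_neq_0; left; lra.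
  apply (residue_bound Uo G T (- be) 1 0 B l); auto; try lra.
  - apply copen_Re.
  - intros s t Hs _. unfold Uo. simpl. lra.
  - assert (X0 : forall s t, - be <= s <= 1 -> Rabs t = T -> Cmod (G (s, t)) <= B).
   { intros s t Hs Ht. assert (Hn : (s, t) <> RtoC 0) by (apply pair_neq_0; right; intros ->; rewrite Rabs_R0 in Ht; lra).
    assert (HT2 : T <= Cmod (s, t)) by (rewrite <- Ht; apply (Im_le_Cmod (s, t))).
    replace (G (s, t)) with (D (s, t) * (kern a b (s, t) * (s, t)))%C.
    2:{ unfold G. rewrite <- kernq_kern by auto. field. exact Hn. }
    rewrite !Cmod_mult. set (q := Cmod (s, t)) in *.
    assert (K2 := kern_bound_2 a b (s, t) mb Hab0 Hn (proj1 (mb1 s Hs)) (proj2 (mb1 s Hs))). fold q in K2.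
    assert (K3 : Cmod (kern a b (s, t)) * q <= 2 * (mb / (b - a)) / T).
    { apply Rle_trans with (2 * mb / ((b - a) * q ^ 2) * q). mono_r; lra.
     replace (2 * mb / ((b - a) * q ^ 2) * q) with (2 * (mb / (b - a)) / q) by (field; lra).
     mono_l. mul_pos. lra. left; apply Rdiv_lt_0_compat. pos. lra. apply Rinv_le_contravar; lra. }
    assert (D2 := Db s t ltac:(lra)). rewrite Ht in D2.
    assert (Sq : sqrt (1 + T / X) <= 2 * T).
    { rewrite <- (sqrt_square (2 * T)) by lra. apply sqrt_le_1. assert (0 <= T / X) by (mul_pos; [lra|pos]). lra. nra.
     assert (T / X <= T) by (apply Rmult_le_reg_r with X; [lra|unfold Rdiv; rewrite Rmult_assoc, Rinv_l; nra]). nra. }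
    unfold B. replace (12 * E * (mb / (b - a))) with (3 * (E * (2 * T)) * (2 * (mb / (b - a)) / T)) by (field; lra).
    mono; auto. pos. mul_pos; pos.
    via D2. mono_l. lra. mono_l; lra. }
   intros s Hs. split; apply X0; auto. apply Rabs_pos_eq; lra. rewrite Rabs_left; lra. }
 assert (P3 : forall T, X <= T -> Cmod (vint (fun w => D w * kern a b w)%C T (- be)) <= 4 * (3 * E) * (1 + 1) * m * (2 * ln (1 + X) + 4)).
 { intros T HT. apply (kernel_line_bound D); auto; try lra.
  - rewrite Rabs_left; lra.
  - upto Hab. apply Rinv_le_contravar; nra.
  - unfold m. right; f_equal; ring.
  - apply exp_le; nra.
  - intros t. apply Dc; lra.
  - intros t. assert (D1 := Db (- be) t ltac:(lra)). rewrite Rmult_1_l. lra. }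
 (* The cut-off height tends to infinity: the estimate on the left line is uniform in T, all other
    errors are O(1/T). *)
 assert (Fin : Cmod (RtoC (2 * PI) * (S - muz z)) <= 24 * m * E * (2 * ln (1 + X) + 4)).
 { apply le_of_all_T with (C1 := 2 * (1 - - be) * (B + 2 * Cmod (muz z)) + C0 * Series (pw (Re z + 1))) (T0 := X). intros T HT.
  specialize (P1 T ltac:(lra)). specialize (P2 T ltac:(lra)). specialize (P3 T HT).
  replace (4 * (3 * E) * (1 + 1) * m) with (24 * m * E) in P3 by ring.
  set (V1 := vint (fun w => D w * kern a b w)%C T 1) in *. set (V2 := vint (fun w => D w * kern a b w)%C T (- be)) in *.
  replace (RtoC (2 * PI) * (S - muz z))%C with (V2 + ((V1 - V2 - RtoC (2 * PI) * muz z) - (V1 - RtoC (2 * PI) * S)))%C by ring.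
  via Cmod_triangle. apply Rplus_le_compat; auto. via Cmod_triangle_minus.
  rewrite Rdiv_plus_distr. lra. }
 rewrite Cmod_mult, Cmod_R, Rabs_pos_eq in Fin by (assert (PP := PI_RGT_0); lra).
 replace (muz z - csum (dterm mu z) N)%C with ((S - csum (dterm mu z) N) - (S - muz z))%C by ring.
 via Cmod_triangle_minus.
 assert (L1 : ln (1 + X) <= ln X + 1).
 { apply Rle_trans with (ln (X * 2)). apply ln_le'; lra. rewrite (ln_mult X 2) by lra. assert (ln 2 <= 1) by (rewrite <- (ln_exp 1); apply ln_le'; [lra|]; assert (Z := exp_ineq1_le 1); lra). lra. }
 assert (m2 : 2 * sqrt (INR N) * exp (- Re z * ln (INR N)) <= 2 * m).
 { rewrite sqrt_exp_ln by lra. rewrite Rmult_assoc, <- exp_plus. mono_l. lra. apply exp_le. unfold be. fold a. nra. }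
 assert (PP : 3 <= PI) by (assert (Z := PI2_3_2); lra).
 assert (mE : m <= m * E) by nra.
 assert (Fin2 : Cmod (S - muz z) <= 4 * (m * E) * (2 * ln X + 6)).
 { assert (6 * Cmod (S - muz z) <= 2 * PI * Cmod (S - muz z)) by (mono_r; [apply Cmod_ge_0|lra]).
  assert (24 * m * E * (2 * ln (1 + X) + 4) <= 24 * (m * E) * (2 * ln X + 6)) by (replace (24 * m * E) with (24 * (m * E)) by ring; mono_l; lra). lra. }
 fold m. replace (10 * m * E * ln X) with (10 * (m * E) * ln X) by ring.
 fold a in m2. assert (0 <= m * E) by lra. assert (0 <= ln X - 100) by lra. assert (0 <= (m * E) * (ln X - 100)) by (mul_pos; auto). lra.
Qed.

(** * Counting k-free integers *)

Definition ind (P : Prop) : R := if excluded_middle_informative P then 1 else 0.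

Lemma ind_true (P : Prop) : P -> ind P = 1.
Proof. unfold ind. destruct excluded_middle_informative; tauto. Qed.

Lemma ind_false (P : Prop) : ~ P -> ind P = 0.
Proof. unfold ind. destruct excluded_middle_informative; tauto. Qed.

Lemma count_floor (u : R) (M : nat) : 0 <= u ->
 rsum (fun i => ind (INR (S i) <= u)) M <= u /\ (u <= INR M -> u - 1 <= rsum (fun i => ind (INR (S i) <= u)) M).
Proof.
 intros Hu. set (c := rsum (fun i => ind (INR (S i) <= u))).
 assert (H : c M <= u /\ c M <= INR M /\ (u - 1 <= c M \/ INR M <= c M)).
 { induction M as [|M IH].
  - unfold c; simpl. lra.
  - change (c (S M)) with (c M + ind (INR (S M) <= u)). destruct (Rle_dec (INR (S M)) u) as [Hd|Hd].
   + rewrite ind_true by auto. rewrite S_INR in *. lra.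
   + rewrite ind_false by auto. rewrite S_INR in *. lra. }
 destruct H as [A [B [C|C]]]; split; auto; intros; lra.
Qed.

Lemma ramp_indicator (x h n : R) : 0 < x -> 0 < h -> 0 < n ->
 ind (n <= x) <= ramp (ln x) (ln (x + h)) (ln n) <= ind (n <= x + h).
Proof.
 intros Hx Hh Hn. assert (Hab : ln x < ln (x + h)) by (apply ln_increasing; lra).
 assert (R0 := ramp_range (ln x) (ln (x + h)) (ln n) Hab). split.
 - destruct (Rle_dec n x) as [H|H]. rewrite ramp_1. rewrite ind_true by auto. lra. exact Hab. now apply ln_le'. rewrite ind_false by auto. lra.
 - destruct (Rle_dec n (x + h)) as [H|H]. rewrite ind_true by auto. lra. rewrite ramp_0. rewrite ind_false by auto. lra. exact Hab. apply ln_le'; lra.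
Qed.

Definition kf (k n : nat) : R := ind (k_free k n).

Lemma count_kfree_rsum (k N : nat) (x : R) :
 INR (count_kfree k N x) = rsum (fun i => kf k (S i) * ind (INR (S i) <= x)) N.
Proof.
 induction N as [|N IH]. reflexivity.
 change (rsum (fun i => kf k (S i) * ind (INR (S i) <= x)) (S N)) with
  (rsum (fun i => kf k (S i) * ind (INR (S i) <= x)) N + kf k (S N) * ind (INR (S N) <= x)).
 cbn [count_kfree]. rewrite plus_INR, IH. f_equal. unfold kf, ind.
 repeat destruct excluded_middle_informative; cbn [INR]; try lra; tauto.
Qed.

Lemma Qk_rsum (k : nat) (x : R) (M : nat) : 0 <= x -> x <= INR M ->
 Qk k x = rsum (fun i => kf k (S i) * ind (INR (S i) <= x)) M.
Proof.
 intros Hx HM. unfold Qk. rewrite count_kfree_rsum. set (N := Z.to_nat (up x)).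
 assert (HN : x < INR N).
 { unfold N. destruct (archimed x) as [A _]. rewrite INR_IZR_INZ, Z2Nat.id. lra. apply le_IZR. lra. }
 assert (Z : forall K i, x <= INR K -> (K <= i)%nat -> kf k (S i) * ind (INR (S i) <= x) = 0).
 { intros K i HK Hi. rewrite ind_false. ring. apply le_INR in Hi. rewrite S_INR. lra. }
 destruct (Nat.le_ge_cases N M) as [H|H].
 - symmetry. apply rsum_shrink; auto. intros i Hi. apply (Z N); [lra|lia].
 - apply rsum_shrink; auto. intros i Hi. apply (Z M); [lra|lia].
Qed.

Lemma csum_RtoC (f : nat -> R) (N : nat) : csum (fun n => RtoC (f n)) N = RtoC (rsum f N).
Proof. apply C_eq. rewrite Re_csum. reflexivity. rewrite Im_csum. csimp. rewrite (rsum_ext _ (fun _ => 0)), rsum_const. ring. reflexivity. Qed.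

Lemma kf_sum (k n M : nat) : (0 < k)%nat -> (n < M)%nat ->
 rsum (fun i => if divb (Nat.pow (S i) k) (S n) then mu (S i) else 0) M = kf k (S n).
Proof.
 intros Hk Hn. rewrite (rsum_shrink _ (S n) M).
 - destruct k as [|k]. lia. rewrite (Multiplicative.kfree_sum (S k) (S n) eq_refl eq_refl).
  unfold kf, ind. now destruct excluded_middle_informative.
 - lia.
 - intros i Hi. destruct (divb (Nat.pow (S i) k) (S n)) eqn:E; auto. exfalso.
  apply divb_le in E. 2: apply Nat.neq_0_lt_0, Nat.pow_nonzero; lia.
  assert (S i <= S i ^ k)%nat. { rewrite <- (Nat.pow_1_r (S i)) at 1. apply Nat.pow_le_mono_r; lia. } lia.
Qed.

Lemma INR_pow_ln (d k : nat) : INR (Nat.pow (S d) k) = exp (INR k * ln (INR (S d))).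
Proof. rewrite pow_INR, <- exp_pow_nat, exp_ln; auto. apply INR_S_pos. Qed.

(** A smoothed count of the multiples of d^k, with d = i + 1: a substitute for the floor of x /
    d^k. *)
Definition Rd (k M : nat) (a b : R) (i : nat) : R := rsum (fun j => ramp a b (ln (INR (S j)) + INR k * ln (INR (S i)))) M.

(** The indicator of k-free integers is expanded over d^k | n and the sums are exchanged. Smoothing
    affects only the integers between x and x + h, at most h + 1 of them. *)
Lemma Qk_smooth (k M : nat) (x h : R) : (0 < k)%nat -> 0 < x -> 0 < h -> x + h <= INR M ->
 Rabs (Qk k x - rsum (fun i => mu (S i) * Rd k M (ln x) (ln (x + h)) i) M) <= h + 1.
Proof.
 intros Hk Hx Hh HM. set (a := ln x). set (b := ln (x + h)).
 assert (Hab : a < b) by (apply ln_increasing; lra).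
 assert (E : rsum (fun i => mu (S i) * Rd k M a b i) M = rsum (fun i => kf k (S i) * ramp a b (ln (INR (S i)))) M).
 { assert (H := hyperbola (fun i => Nat.pow i k) mu (fun n => RtoC (ramp a b (ln (INR n)))) M M).
  cbv beta in H. rewrite (csum_ext _ (fun n => RtoC (kf k (S n) * ramp a b (ln (INR (S n)))))) in H.
  2:{ intros n Hn. rewrite kf_sum by auto. now rewrite RtoC_mult. }
  rewrite csum_RtoC in H.
  rewrite (csum_ext _ (fun i => RtoC (mu (S i) * Rd k M a b i))) in H.
  - rewrite csum_RtoC in H. symmetry. apply (f_equal Re) in H. exact H. intros i. apply Nat.neq_0_lt_0, Nat.pow_nonzero; lia.
  - intros i Hi. rewrite RtoC_mult. f_equal. rewrite csum_RtoC. f_equal.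
   set (D := Nat.pow (S i) k). assert (HD : (0 < D)%nat) by (apply Nat.neq_0_lt_0, Nat.pow_nonzero; lia).
   assert (ED : forall j, ln (INR (D * S j)) = ln (INR (S j)) + INR k * ln (INR (S i))).
   { intros j. rewrite mult_INR, ln_mult. unfold D at 1. rewrite INR_pow_ln, ln_exp. ring. now apply lt_0_INR. apply INR_S_pos. }
   rewrite (rsum_ext _ (fun j => ramp a b (ln (INR (S j)) + INR k * ln (INR (S i))))) by (intros; now rewrite ED).
   symmetry. unfold Rd. apply rsum_shrink. apply Nat.Div0.div_le_upper_bound. nia.
   intros j Hj. rewrite <- ED. apply ramp_0; auto. apply ln_le'. lra. via HM. apply le_INR.
   assert (Q := Nat.mul_succ_div_gt M D ltac:(lia)). nia. }
 rewrite E, (Qk_rsum k x M) by lra.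
 assert (C1 := count_floor x M ltac:(lra)). assert (C2 := count_floor (x + h) M ltac:(lra)).
 replace (rsum (fun i => kf k (S i) * ind (INR (S i) <= x)) M) with (- (-1) * rsum (fun i => kf k (S i) * ind (INR (S i) <= x)) M) by ring.
 assert (L : 0 <= rsum (fun i => kf k (S i) * ramp a b (ln (INR (S i)))) M + (-1) * rsum (fun i => kf k (S i) * ind (INR (S i) <= x)) M
   <= rsum (fun i => ind (INR (S i) <= x + h)) M + (-1) * rsum (fun i => ind (INR (S i) <= x)) M).
 { rewrite <- !rsum_scal, <- !rsum_plus.
  assert (T : forall i, 0 <= kf k (S i) * ramp a b (ln (INR (S i))) + -1 * (kf k (S i) * ind (INR (S i) <= x)) <= ind (INR (S i) <= x + h) + -1 * ind (INR (S i) <= x)).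
  { intros i. assert (R := ramp_indicator x h (INR (S i)) Hx Hh (INR_S_pos i)). fold a b in R.
   assert (K : kf k (S i) = 0 \/ kf k (S i) = 1) by (unfold kf, ind; destruct excluded_middle_informative; auto).
   destruct K as [-> | ->]; lra. }
  split. apply rsum_nonneg. intros; apply T. apply rsum_le. intros; apply T. }
 apply Rabs_le. lra.
Qed.

(** The smoothed count lies between the floors of x / d^k and of (x + h) / d^k. *)
Lemma Rd_approx (k M i : nat) (x h : R) : (0 < k)%nat -> 0 < x -> 0 < h -> x + h <= INR M ->
 Rabs (Rd k M (ln x) (ln (x + h)) i - x * pw (INR k) i) <= 1 + h * pw (INR k) i.
Proof.
 intros Hk Hx Hh HM. set (p := pw (INR k) i). assert (p0 : 0 < p) by apply pw_pos.
 assert (Ep : exp (INR k * ln (INR (S i))) = / p) by (unfold p, pw; rewrite <- exp_Ropp; f_equal; ring).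
 assert (Hp1 : p <= 1).
 { unfold p, pw. rewrite <- exp_0. apply exp_le. assert (0 <= ln (INR (S i))) by apply ln_nonneg, INR_S_ge_1.
  assert (0 <= INR k) by apply pos_INR. nra. }
 assert (In : forall j u, INR (S j) * exp (INR k * ln (INR (S i))) <= u <-> INR (S j) <= u * p).
 { intros j u. rewrite Ep. split; intros H.
  - apply Rmult_le_reg_r with (/ p). pos. rewrite Rmult_assoc, Rinv_r, Rmult_1_r by lra. exact H.
  - apply Rmult_le_reg_r with p; auto. rewrite Rmult_assoc, Rinv_l, Rmult_1_r by lra. exact H. }
 assert (ind_iff : forall P Q : Prop, (P <-> Q) -> ind P = ind Q).
 { intros P Q H. unfold ind. repeat destruct excluded_middle_informative; tauto. }
 assert (C1 := count_floor (x * p) M ltac:(nra)). assert (C2 := count_floor ((x + h) * p) M ltac:(nra)).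
 assert (L : rsum (fun j => ind (INR (S j) <= x * p)) M <= Rd k M (ln x) (ln (x + h)) i <= rsum (fun j => ind (INR (S j) <= (x + h) * p)) M).
 { unfold Rd. assert (T : forall j, ind (INR (S j) <= x * p) <= ramp (ln x) (ln (x + h)) (ln (INR (S j)) + INR k * ln (INR (S i))) <= ind (INR (S j) <= (x + h) * p)).
  { intros j. rewrite <- (ind_iff _ _ (In j x)), <- (ind_iff _ _ (In j (x + h))).
   replace (ln (INR (S j)) + INR k * ln (INR (S i))) with (ln (INR (S j) * exp (INR k * ln (INR (S i))))).
   apply ramp_indicator; auto. apply Rmult_lt_0_compat. apply INR_S_pos. pos.
   rewrite ln_mult, ln_exp; auto. apply INR_S_pos. pos. }
  split; apply rsum_le; intros; apply T. }
 assert (x * p <= INR M) by nra. apply Rabs_le. split; nra.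
Qed.

(** Each d <= Y costs 1 + h d^(-k), and the sum of d^(-k) is at most 2. *)
Lemma small_part (k Y M : nat) (x h : R) : (2 <= k)%nat -> 0 < x -> 0 < h -> x + h <= INR M ->
 Rabs (rsum (fun i => mu (S i) * Rd k M (ln x) (ln (x + h)) i) Y - x * rsum (fun i => mu (S i) * pw (INR k) i) Y) <= INR Y + 2 * h.
Proof.
 intros Hk Hx Hh HM. assert (k2 := two_le_INR k Hk).
 assert (S2 : rsum (pw (INR k)) Y <= 2).
 { via rsum_pw_le. lra. assert (/ (INR k - 1) <= / 1) by (apply Rinv_le_contravar; lra). lra. }
 assert (H : forall N, Rabs (rsum (fun i => mu (S i) * Rd k M (ln x) (ln (x + h)) i) N - x * rsum (fun i => mu (S i) * pw (INR k) i) N) <= INR N + h * rsum (pw (INR k)) N).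
 { induction N as [|N IH]. simpl. rewrite Rmult_0_r, Rminus_0_r, Rabs_R0. lra.
  change (rsum (fun i => mu (S i) * Rd k M (ln x) (ln (x + h)) i) (S N)) with (rsum (fun i => mu (S i) * Rd k M (ln x) (ln (x + h)) i) N + mu (S N) * Rd k M (ln x) (ln (x + h)) N).
  change (rsum (fun i => mu (S i) * pw (INR k) i) (S N)) with (rsum (fun i => mu (S i) * pw (INR k) i) N + mu (S N) * pw (INR k) N).
  change (rsum (pw (INR k)) (S N)) with (rsum (pw (INR k)) N + pw (INR k) N). rewrite S_INR.
  assert (A := Rd_approx k M N x h ltac:(lia) Hx Hh HM). assert (B := Multiplicative.mu_le1 (S N)).
  match goal with |- Rabs (?A1 + ?m * ?r - x * (?A2 + ?m * ?q)) <= _ => replace (A1 + m * r - x * (A2 + m * q)) with ((A1 - x * A2) + m * (r - x * q)) by ring end.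
  via Rabs_triang. rewrite Rabs_mult.
  assert (Rabs (mu (S N)) * Rabs (Rd k M (ln x) (ln (x + h)) N - x * pw (INR k) N) <= 1 * (1 + h * pw (INR k) N)).
  { mono; auto; apply Rabs_pos. }
  lra. }
 specialize (H Y). nra.
Qed.

Definition Zt (w : C) : C := (fz w / (w - 1))%C.
(** The continuation of the sum over d > Y of mu(d) d^(-kw): the full series is replaced by
    1/zeta(kw), which makes sense further to the left. *)
Definition Ptail (k Y : nat) (w : C) : C := (muz ((INR k) * w) - csum (dterm mu ((INR k) * w)) Y)%C.

Lemma hol_csum (n : nat) (U : C -> Prop) (u : nat -> C -> C) (N : nat) : (forall i, hol n U (u i)) -> hol n U (fun w => csum (fun i => u i w) N).
Proof.
 intros H. induction N as [|N IH]. apply (hol_const n U 0).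
 change (hol n U (fun w => csum (fun i => u i w) N + u N w)%C). now apply hol_plus.
Qed.

Lemma Ptail_hol (n k Y : nat) : RH -> (2 <= k)%nat -> hol n (fun w => 1 / 2 < Re w) (Ptail k Y).
Proof.
 intros HR Hk. assert (k2 := two_le_INR k Hk).
 assert (HL : hol n (fun w => 1 / 2 < Re w) (fun w => (INR k) * w)%C) by (apply hol_mult; [apply hol_const|apply hol_id]).
 apply hol_minus.
 - refine (hol_comp n (fun s => 1 / 2 < Re s) _ muz (fun w => (INR k) * w)%C _ _ HL).
  intros w Hw. rewrite Re_mult, Re_RtoC, Im_RtoC. nra. now apply muz_hol.
 - apply (hol_csum n _ (fun i w => dterm mu ((INR k) * w) i)). intros i. unfold dterm, xpow.
  apply hol_mult. apply hol_const. apply (hol_exp_comp n _ (fun w => - ((INR k) * w) * (ln (INR (S i))))%C).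
  apply hol_mult. now apply hol_opp. apply hol_const.
Qed.

Lemma Re_Rmult (r : R) (w : C) : Re (RtoC r * w)%C = r * Re w.
Proof. rewrite Re_mult, Re_RtoC, Im_RtoC. ring. Qed.

Lemma Im_Rmult (r : R) (w : C) : Im (RtoC r * w)%C = r * Im w.
Proof. rewrite Im_mult, Re_RtoC, Im_RtoC. ring. Qed.

Lemma Zt_right (w : C) : 1 < Re w -> Zt w = zeta_s w.
Proof.
 intros H. unfold Zt. rewrite fz_zeta by auto. field. apply Re_pos_neq_0. rewrite Re_minus. csimp. lra.
Qed.

Lemma Zt_cont (s t : R) : 1 < s -> ccont Zt (s, t).
Proof.
 intros H. apply (hol_cont 0 (fun w => 1 < Re w)). 2: exact H. apply hol_div.
 - intros z Hz. apply Re_pos_neq_0. rewrite Re_minus. csimp. lra.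
 - apply hol_sub with (2 := fz_hol 1). intros; lra.
 - apply hol_minus. apply hol_id. apply hol_const.
Qed.

Lemma xpow_exp (r : R) (w : C) (c : R) : xpow r (RtoC c * w) = cexp (RtoC (- (c * ln r)) * w).
Proof. unfold xpow. f_equal. rewrite RtoC_opp, RtoC_mult. ring. Qed.

(** One Perron formula for every d, with a constant independent of d; the error carries d^(-3k/2) so
    that it can be summed over d. *)
Lemma zeta_perron (k M : nat) (a b : R) : (2 <= k)%nat -> a < b -> b <= ln (INR M) -> (0 < M)%nat ->
 exists C0, 0 < C0 /\ forall i T, 2 <= T ->
 Cmod (vint (fun w => Zt w * cexp (RtoC (- (INR k * ln (INR (S i)))) * w) * kern a b w)%C T (3 / 2) - RtoC (2 * PI) * RtoC (Rd k M a b i))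
  <= C0 * pw (3 / 2 * INR k) i / T.
Proof.
 intros Hk Hab HM HM0. assert (k2 := two_le_INR k Hk).
 destruct (perron a b (3 / 2) Hab ltac:(lra)) as [C0 [H0 HP]]. exists (C0 * 3). split. lra.
 intros i T HT. set (lam := INR k * ln (INR (S i))).
 assert (l0 : 0 <= lam) by (mul_pos; [lra|apply ln_nonneg, INR_S_ge_1]).
 assert (Hser := ex_series_pw (3 / 2) ltac:(lra)).
 assert (Elam : exp (- (3 / 2) * lam) = pw (3 / 2 * INR k) i) by (unfold pw, lam; f_equal; ring).
 assert (Q := HP (fun _ => RtoC 1) (fun n => ln (INR (S n)) + lam) (fun w => Zt w * cexp (RtoC (- lam) * w))%C
  (3 * exp (- (3 / 2) * lam)) M T).
 rewrite Elam in Q. rewrite (csum_ext _ (fun n => RtoC (ramp a b (ln (INR (S n)) + lam)))) in Q by (intros; ring).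
 rewrite csum_RtoC in Q. replace (C0 * 3 * pw (3 / 2 * INR k) i / T) with (C0 * (3 * pw (3 / 2 * INR k) i) / T) by (unfold Rdiv; ring).
 apply Q; try lra.
 - intros n. assert (0 <= ln (INR (S n))) by apply ln_nonneg, INR_S_ge_1. lra.
 - intros K. rewrite (rsum_ext _ (fun n => exp (- (3 / 2) * lam) * pw (3 / 2) n)).
  2:{ intros n _. rewrite Cmod_1, Rmult_1_l. unfold pw. rewrite <- exp_plus. f_equal. ring. }
  rewrite rsum_scal, <- Elam. rewrite (Rmult_comm 3). mono_l. pos.
  via rsum_pw_le. lra. lra.
 - intros n Hn. assert (ln (INR M) <= ln (INR (S n))). { apply ln_le'. now apply lt_0_INR. apply le_INR. lia. } lra.
 - intros t. apply ccont_mult. apply Zt_cont; lra. apply cexp_lin_cont.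
 - intros eps He. destruct (series_tail _ (proj1 Hser) (fun n => Rlt_le _ _ (pw_pos _ n)) eps He) as [M0 HM0'].
  exists M0. intros K t HK. rewrite Zt_right by (simpl; lra). set (w := (3 / 2, t) : C).
  rewrite (csum_ext _ (fun n => cexp (RtoC (- lam) * w) * xpow (INR (S n)) w)%C).
  2:{ intros n _. rewrite Cmult_1_l. unfold xpow. rewrite <- cexp_plus. f_equal. rewrite !RtoC_opp, RtoC_plus. ring. }
  rewrite csum_scal. replace (zeta_s w * cexp (RtoC (- lam) * w) - cexp (RtoC (- lam) * w) * csum (fun n => xpow (INR (S n)) w) K)%C
   with (cexp (RtoC (- lam) * w) * (zeta_s w - csum (fun n => xpow (INR (S n)) w) K))%C by ring.
  rewrite Cmod_mult, Cmod_cexp, Re_Rmult. rewrite <- (Rmult_1_l eps). mono; try apply Cmod_ge_0. pos.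
  { rewrite <- exp_0. apply exp_le. simpl. nra. }
  rewrite <- (ctends_CSer_of _ _ (zeta_s_tends w ltac:(simpl; lra))).
  apply CSer_uniform with (pw (3 / 2)); auto. 2: apply (proj1 Hser).
  intros n. rewrite Cmod_xpow. unfold pw. simpl. lra.
Qed.

(** Sum of the previous formulas over d > Y with weights mu(d): the exponentials d^(-kw) assemble
    into the tail of 1/zeta(kw). *)
Lemma big_part_perron (k Y M : nat) (a b : R) : RH -> (2 <= k)%nat -> a < b -> b <= ln (INR M) -> (0 < M)%nat -> (Y <= M)%nat ->
 exists C1, forall T, 2 <= T ->
 Cmod (vint (fun w => Zt w * Ptail k Y w * kern a b w)%C T (3 / 2)
  - RtoC (2 * PI * rsum (fun i => mu (S (Y + i)) * Rd k M a b (Y + i)) (M - Y))) <= C1 / T.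
Proof.
 intros HR Hk Hab HM HM0 HYM. assert (k2 := two_le_INR k Hk).
 destruct (zeta_perron k M a b Hk Hab HM HM0) as [C0 [H0 HZ]].
 assert (Hser := ex_series_pw (3 / 2 * INR k) ltac:(lra)).
 exists (C0 * Series (pw (3 / 2 * INR k))). intros T HT.
 set (e := fun i w => cexp (RtoC (- (INR k * ln (INR (S (Y + i))))) * w)).
 set (g := fun i w => (Zt w * e i w * kern a b w)%C).
 assert (gc : forall i t, ccont (g i) (3 / 2, t)).
 { intros. apply ccont_mult. apply ccont_mult. apply Zt_cont; lra. apply cexp_lin_cont. apply kern_cont; auto. left; lra. }
 apply (vint_limit _ (fun K w => csum (fun i => RtoC (mu (S (Y + i))) * g i w)%C K) T (3 / 2) _ _ (M - Y)). lra.
 - intros t _. apply ccont_mult. apply ccont_mult. apply Zt_cont; lra.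
  apply (hol_cont 0) with (1 := Ptail_hol 1 k Y HR Hk). simpl; lra. apply kern_cont; auto. left; lra.
 - intros K t _. apply csum_cont. intros i. apply (ccont_mult (fun _ => RtoC (mu (S (Y + i))))). apply ccont_const. apply gc.
 - intros eps He. set (m := 3 * (2 * exp (Rmax a b * (3 / 2)) / ((b - a) * (3 / 2) ^ 2))).
  assert (m0 : 0 < m).
  { unfold m. apply Rmult_lt_0_compat. lra. apply Rdiv_lt_0_compat. apply Rmult_lt_0_compat. lra. pos. pos. }
  destruct (series_tail _ (proj1 Hser) (fun n => Rlt_le _ _ (pw_pos _ n)) (eps / m) ltac:(now apply Rdiv_lt_0_compat)) as [M0 HM0'].
  exists M0. intros K t HK _. set (w := (3 / 2, t) : C). assert (wn : w <> RtoC 0) by (apply pair_neq_0; left; lra).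
  assert (Rk : Re (RtoC (INR k) * w)%C = 3 / 2 * INR k) by (rewrite Re_Rmult; simpl; ring).
  assert (EE : csum (fun i => RtoC (mu (S (Y + i))) * g i w)%C K = (Zt w * kern a b w * csum (fun i => dterm mu (RtoC (INR k) * w) (Y + i)%nat) K)%C).
  { rewrite <- csum_scal. apply csum_ext. intros i _. unfold g, e, dterm. rewrite xpow_exp. ring. }
  rewrite EE. unfold Ptail. rewrite muz_mus by lra. set (z := (RtoC (INR k) * w)%C) in *.
  replace (Zt w * (mus z - csum (dterm mu z) Y) * kern a b w - Zt w * kern a b w * csum (fun i => dterm mu z (Y + i)%nat) K)%C
   with (Zt w * kern a b w * (mus z - csum (dterm mu z) (Y + K)))%C by (rewrite csum_app; ring).
  rewrite !Cmod_mult. replace eps with (m * (eps / m)) by (field; lra). mono; try apply Cmod_ge_0.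
  { mul_pos; pos. }
  + unfold m. mono; try apply Cmod_ge_0.
   * rewrite Zt_right by (simpl; lra). replace 3 with (1 + / (3 / 2 - 1)) by field. apply zeta_s_bound. simpl; lra.
   * assert (L1 := Rmax_l a b). assert (L2 := Rmax_r a b).
    le_trans. apply (kern_bound_2 a b w (exp (Rmax a b * (3 / 2)))); auto; apply exp_le; simpl; nra.
    mono_l. mul_pos. lra. pos.
    apply Rinv_le_contravar. pos. mono_l. lra.
    apply pow_incr. split. lra. assert (A := re_le_Cmod w). simpl in A. rewrite Rabs_pos_eq in A; lra.
  + apply CSer_uniform with (pw (3 / 2 * INR k)). intros n. rewrite <- Rk. apply dterm_mu_bound. apply (proj1 Hser). intros K'. apply HM0'. lia.
 - intros K HK. rewrite vint_csum. 2: lra.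
  2:{ intros i t _. apply (ccont_mult (fun _ => RtoC (mu (S (Y + i))))). apply ccont_const. apply gc. }
  rewrite (csum_ext _ (fun i => RtoC (mu (S (Y + i))) * vint (g i) T (3 / 2))%C) by (intros; apply vint_scal; [lra|auto]).
  (* For d > M already the first multiple d^k lies beyond the end of the ramp, so these smoothed
     counts vanish. *)
  rewrite <- (rsum_shrink _ (M - Y) K HK).
  2:{ intros i Hi. replace (Rd k M a b (Y + i)) with 0. ring. unfold Rd. rewrite (rsum_ext _ (fun _ => 0)). rewrite rsum_const. ring.
    intros j _. apply ramp_0; auto. assert (0 <= ln (INR (S j))) by apply ln_nonneg, INR_S_ge_1.
    assert (ln (INR M) <= ln (INR (S (Y + i)))). { apply ln_le'. now apply lt_0_INR. apply le_INR. lia. }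
    assert (0 <= ln (INR (S (Y + i)))) by apply ln_nonneg, INR_S_ge_1. nra. }
  rewrite RtoC_mult, <- csum_RtoC, <- csum_scal.
  match goal with |- Cmod (csum ?u K - csum ?v K) <= _ =>
   replace (csum u K - csum v K)%C with (csum (fun i => u i + - (1) * v i)%C K) by (rewrite csum_plus, csum_scal; ring) end.
  via csum_Cmod.
  apply Rle_trans with (rsum (fun i => (C0 / T) * pw (3 / 2 * INR k) (Y + i)) K).
  + apply rsum_le. intros i _. rewrite (RtoC_mult (mu (S (Y + i)))).
   replace (RtoC (mu (S (Y + i))) * vint (g i) T (3 / 2) + - (1) * (RtoC (2 * PI) * (RtoC (mu (S (Y + i))) * RtoC (Rd k M a b (Y + i)))))%C
    with (RtoC (mu (S (Y + i))) * (vint (g i) T (3 / 2) - RtoC (2 * PI) * RtoC (Rd k M a b (Y + i))))%C by ring.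
   rewrite Cmod_mult, Cmod_R. specialize (HZ (Y + i)%nat T HT). assert (B := Multiplicative.mu_le1 (S (Y + i))).
   replace (C0 / T * pw (3 / 2 * INR k) (Y + i)) with (1 * (C0 * pw (3 / 2 * INR k) (Y + i) / T)) by (field; lra).
   mono; auto. apply Rabs_pos. pos.
  + rewrite rsum_scal. replace (C0 * Series (pw (3 / 2 * INR k)) / T) with (C0 / T * Series (pw (3 / 2 * INR k))) by (field; lra).
   mono_l. pos.
   assert (A := rsum_le_Series _ (Y + K) (fun n => Rlt_le _ _ (pw_pos (3 / 2 * INR k) n)) (proj1 Hser)). rewrite rsum_app in A.
   assert (B := rsum_nonneg (pw (3 / 2 * INR k)) Y (fun n _ => Rlt_le _ _ (pw_pos (3 / 2 * INR k) n))). lra.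
Qed.

Lemma csum_mu_bound (s : C) (Y : nat) : 0 <= Re s -> Cmod (csum (dterm mu s) Y) <= INR Y.
Proof.
 intros Hs. via csum_Cmod. rewrite <- (Rmult_1_r (INR Y)), <- rsum_const. apply rsum_le.
 intros n _. via dterm_mu_bound. unfold pw. rewrite <- exp_0. apply exp_le.
 assert (0 <= ln (INR (S n))) by apply ln_nonneg, INR_S_ge_1. nra.
Qed.

(** Both growth factors together: 2 times 0.32 gives 0.64, and 0.64 / log log X <= 1/2 again leaves
    only a square root in the height. *)
Lemma Eg_prod (X k t : R) : 1 < X -> 30 <= ln (ln X) -> 1 <= k ->
 Eg X t * Eg X (k * t) <= exp (0.64 * ln X / ln (ln X)) * sqrt (1 + k * Rabs t / X).
Proof.
 intros HX Hv Hk. set (v := ln (ln X)) in *. pose proof (Rabs_pos t). assert (0 < / X) by pos.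
 assert (Q : 0 <= k * Rabs t / X). { unfold Rdiv. repeat mul_pos; lra. }
 rewrite sqrt_exp_ln by lra. unfold Eg. fold v. rewrite <- !exp_plus. apply exp_le.
 assert (L0 : LX X 0 = ln X) by (unfold LX; rewrite Rabs_R0, Rplus_0_l; reflexivity).
 assert (A1 := LX_add X 0 t HX). assert (A2 := LX_add X 0 (k * t) HX). rewrite L0, Rplus_0_l in A1, A2.
 rewrite Rabs_mult, (Rabs_pos_eq k) in A2 by lra.
 assert (A3 : ln (1 + Rabs t / X) <= ln (1 + k * Rabs t / X)).
 { assert (Rabs t / X <= k * Rabs t / X) by (unfold Rdiv; mono_r; nra). apply ln_le'; auto.
  assert (0 <= Rabs t / X) by (unfold Rdiv; nra). lra. lra. }
 assert (L : 0 <= ln (1 + k * Rabs t / X)) by (apply ln_nonneg; lra).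
 assert (I : 0.64 / v <= 1 / 2). { apply Rmult_le_reg_r with v. lra. unfold Rdiv at 1. rewrite Rmult_assoc, Rinv_l; lra. }
 assert (I0 : 0 < 0.64 / v) by pos.
 replace (0.32 * LX X t / v + 0.32 * LX X (k * t) / v) with (0.64 / v * (/ 2 * (LX X t + LX X (k * t)))) by (unfold Rdiv; lra).
 replace (0.64 * ln X / v) with (0.64 / v * ln X) by (unfold Rdiv; ring).
 assert (0.64 / v * (/ 2 * (LX X t + LX X (k * t))) <= 0.64 / v * (ln X + ln (1 + k * Rabs t / X))) by (mono_l; lra). nra.
Qed.

(** On Re w = s0 zeta is at most 6 [Eg], and the tail at kw is bounded by [mu_tail_bound], whose
    argument has real part k s0. *)
Lemma big_part_bound (k Y : nat) (X h : R) : RH -> 1 < X -> 30 <= ln (ln X) -> (2 <= k)%nat -> (1 <= Y)%nat -> INR Y <= X ->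
 1 <= h <= X -> let a := ln X in let b := ln (X + h) in let s0 := 1 / 2 + 6 / ln (ln X) in
 forall T, X <= T -> Cmod (vint (fun w => Zt w * Ptail k Y w * kern a b w)%C T s0)
  <= 720 * ((1 + INR k) * exp (- (INR k - 1) * s0 * ln (INR Y)) * exp (0.64 * ln X / ln (ln X)) * exp (b * s0)) * ln X ^ 2.
Proof.
 intros HR HX Hv Hk HY HYX Hh a b s0 T HT. destruct (loglog_large X Hv HX) as [HlX [HX3 _]]. set (v := ln (ln X)) in *.
 assert (k2 := two_le_INR k Hk).
 assert (Y1 : 1 <= INR Y) by (change 1 with (INR 1); now apply le_INR).
 assert (H6 : 0 < 6 / v) by pos.
 assert (H62 : 6 / v <= 0.2) by (apply Rmult_le_reg_r with v; [lra|unfold Rdiv; rewrite Rmult_assoc, Rinv_l; lra]).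
 assert (H12 : 12 / v = 2 * (6 / v)) by (field; lra).
 assert (Hab : h / (2 * X) <= b - a).
 { unfold b, a. rewrite <- ln_div by lra. replace ((X + h) / X) with (1 + h / X) by (field; lra).
  replace (h / (2 * X)) with (h / X / 2) by (field; lra). apply ln_1_ge. split.
  pos. apply Rmult_le_reg_r with X. lra. unfold Rdiv; rewrite Rmult_assoc, Rinv_l; lra. }
 assert (hX : 0 < h / (2 * X)) by pos.
 assert (a0 : 0 <= a) by (apply ln_nonneg; lra).
 set (m := exp (b * s0)). assert (m0 : 0 < m) by pos.
 assert (ml : exp (a * s0) <= m) by (apply exp_le; unfold s0 in *; nra).
 set (y := exp (- (INR k - 1) * s0 * ln (INR Y))). set (Ee := exp (0.64 * ln X / v)).
 assert (y0 : 0 < y) by pos. assert (Ee0 : 0 < Ee) by pos.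
 set (A0 := 60 * (y * Ee) * ln X).
 assert (A00 : 0 < A0) by (unfold A0; apply Rmult_lt_0_compat; [apply Rmult_lt_0_compat; [lra|apply Rmult_lt_0_compat; auto]|lra]).
 assert (FB : forall t, Cmod (Zt (s0, t) * Ptail k Y (s0, t)) <= A0 * sqrt (1 + INR k * Rabs t / X)).
 { intros t. rewrite Cmod_mult.
  assert (Z1 : Cmod (Zt (s0, t)) <= 6 * Eg X t).
  { destruct (zeta_bounds X t s0 HR HX Hv ltac:(unfold s0 in *; fold v; lra)) as [_ [_ Z]]. specialize (Z ltac:(unfold s0; lra)).
   fold v in Z. change (exp (0.32 * LX X t / v)) with (Eg X t) in Z. unfold Zt, Cdiv.
   assert (sn : ((s0, t) - 1)%C <> RtoC 0) by (apply C_neq_of_Re; csimp; unfold s0; lra).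
   rewrite Cmod_mult, Cmod_inv by auto. apply Cmod_gt_0 in sn.
   apply Rmult_le_reg_r with (Cmod ((s0, t) - 1)); auto. rewrite Rmult_assoc, Rinv_l by lra. lra. }
  (* As s0 = 1/2 + 6/v, the exponent k s0 - 1/2 - 6/v of Y is exactly (k - 1) s0. *)
  assert (Z2 : Cmod (Ptail k Y (s0, t)) <= 10 * y * Eg X (INR k * t) * ln X).
  { unfold Ptail. le_trans. apply (mu_tail_bound X); auto; fold v. rewrite Re_Rmult, Re_pair. unfold s0. rewrite H12. nra.
   rewrite Re_Rmult, Im_Rmult, Re_pair, Im_pair. right.
   replace y with (exp (- (INR k * s0 - 1 / 2 - 6 / v) * ln (INR Y))) by (unfold y, s0; f_equal; field; lra). reflexivity. }
  assert (Z3 := Eg_prod X (INR k) t HX Hv ltac:(lra)). fold v in Z3. fold Ee in Z3.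
  le_trans. mono; try apply Cmod_ge_0; eassumption.
  replace (6 * Eg X t * (10 * y * Eg X (INR k * t) * ln X)) with (60 * y * ln X * (Eg X t * Eg X (INR k * t))) by ring.
  replace (A0 * sqrt (1 + INR k * Rabs t / X)) with (60 * y * ln X * (Ee * sqrt (1 + INR k * Rabs t / X))) by (unfold A0; ring).
  mono_l; auto. mul_pos; lra. }
 assert (Fin : Cmod (vint (fun w => Zt w * Ptail k Y w * kern a b w)%C T s0) <= 4 * A0 * (1 + INR k) * m * (2 * ln (1 + X) + 4)).
 { apply (kernel_line_bound (fun w => Zt w * Ptail k Y w)%C); auto; try lra.
  - rewrite Rabs_pos_eq; unfold s0; lra.
  - upto Hab. unfold Rdiv. rewrite <- (Rmult_1_l (/ (2 * X))) at 1. mono_r. pos. lra.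
  - unfold m; lra.
  - intros t. apply ccont_mult.
   + apply (hol_cont 0 (fun w => 1 / 2 < Re w < 1)). 2: simpl; unfold s0; lra. apply hol_div.
    intros z Hz. apply C_neq_of_Re. rewrite Re_minus. csimp. lra. apply hol_sub with (2 := fz_hol 1). intros; lra. apply hol_minus. apply hol_id. apply hol_const.
   + apply (hol_cont 0) with (1 := Ptail_hol 1 k Y HR Hk). simpl; unfold s0; lra. }
 via Fin.
 assert (L1 : 2 * ln (1 + X) + 4 <= 3 * ln X).
 { assert (ln (1 + X) <= ln (X * 2)) by (apply ln_le'; lra). rewrite (ln_mult X 2) in H by lra. assert (ln 2 <= 1) by (rewrite <- (ln_exp 1); apply ln_le'; [lra|]; assert (Z := exp_ineq1_le 1); lra). lra. }
 replace (720 * ((1 + INR k) * y * Ee * m) * ln X ^ 2) with (4 * A0 * (1 + INR k) * m * (3 * ln X)) by (unfold A0; ring).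
 mono_l; auto. repeat mul_pos; lra.
Qed.

(** On the horizontal edges fz times the tail is O(T^2), which the kernel cancels; division by w - 1
    then makes these edges vanish in the limit. The value of B is irrelevant. *)
Lemma big_part_edge (k Y : nat) (X a b : R) : RH -> 1 < X -> 30 <= ln (ln X) -> (2 <= k)%nat -> 0 <= a < b ->
 let s0 := 1 / 2 + 6 / ln (ln X) in exists B, forall T s t, 1 <= T -> s0 <= s <= 3 / 2 -> Rabs t = T ->
 Cmod (fz (s, t) * Ptail k Y (s, t) * kern a b (s, t)) <= B.
Proof.
 intros HR HX Hv Hk Hab s0. destruct (loglog_large X Hv HX) as [HlX [HX3 _]]. set (v := ln (ln X)) in *.
 assert (k2 := two_le_INR k Hk).
 assert (H6 : 0 < 6 / v) by pos.
 set (e0 := exp (0.64 * ln X / v)). set (mb := exp (b * (3 / 2))).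
 assert (e00 : 0 < e0) by pos. assert (mb0 : 0 < mb) by pos.
 assert (Yp : 0 <= INR Y) by apply pos_INR.
 exists (3 * 2 * ((3 + INR Y) * (e0 * (2 * INR k))) * (2 * mb / (b - a))). intros T s t HT Hs Ht.
 assert (Hn : (s, t) <> RtoC 0) by (apply pair_neq_0; right; intros ->; rewrite Rabs_R0 in Ht; lra).
 assert (HT2 : T <= Cmod (s, t)) by (rewrite <- Ht; apply (Im_le_Cmod (s, t))).
 destruct (zeta_bounds X t s HR HX Hv Hs) as [_ [Z _]]. fold v in Z. change (exp (0.32 * LX X t / v)) with (Eg X t) in Z. rewrite Ht in Z.
 assert (s05 : 1 / 2 < s) by (unfold s0 in Hs; lra). assert (sk : s <= INR k * s) by nra. assert (s1 : 1 / 2 + 6 / v <= s) by (unfold s0 in Hs; lra).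
 assert (P1 : Cmod (Ptail k Y (s, t)) <= (3 + INR Y) * Eg X (INR k * t)).
 { unfold Ptail. via Cmod_triangle_minus. assert (E1 := Eg_ge_1 X (INR k * t) HX Hv).
  assert (A1 := muz_bound X (RtoC (INR k) * (s, t)) HR HX Hv). rewrite Re_Rmult, Im_Rmult, Re_pair, Im_pair in A1.
  specialize (A1 ltac:(fold v; lra)).
  assert (A2 := csum_mu_bound (RtoC (INR k) * (s, t)) Y). rewrite Re_Rmult, Re_pair in A2. specialize (A2 ltac:(lra)). nra. }
 assert (EP := Eg_prod X (INR k) t HX Hv ltac:(lra)). fold v in EP. fold e0 in EP. rewrite Ht in EP.
 assert (SQ : sqrt (1 + INR k * T / X) <= 2 * INR k * T).
 { rewrite <- (sqrt_square (2 * INR k * T)) by nra.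
  assert (Q1 : 0 <= INR k * T / X) by (mul_pos; [nra|pos]).
  assert (Q2 : INR k * T / X <= INR k * T) by (apply Rmult_le_reg_r with X; [lra|unfold Rdiv; rewrite Rmult_assoc, Rinv_l by lra; mono_l; [nra|lra]]).
  assert (2 <= INR k * T) by nra. apply sqrt_le_1; nra. }
 assert (KB := kern_bound_2 a b (s, t) mb ltac:(lra) Hn). rewrite Re_pair in KB. unfold s0 in Hs.
 specialize (KB ltac:(apply exp_le; nra) ltac:(apply exp_le; nra)).
 assert (KB2 : Cmod (kern a b (s, t)) <= 2 * mb / (b - a) / (T * T)).
 { via KB. replace (2 * mb / (b - a) / (T * T)) with (2 * mb / ((b - a) * (T * T))) by (field; lra).
  mono_l. lra. apply Rinv_le_contravar. apply Rmult_lt_0_compat; nra. mono_l; nra. }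
 rewrite !Cmod_mult.
 assert (FP : Cmod (fz (s, t)) * Cmod (Ptail k Y (s, t)) <= 3 * (2 * T) * ((3 + INR Y) * (e0 * (2 * INR k * T)))).
 { apply Rle_trans with (3 * Eg X t * (1 + T) * ((3 + INR Y) * Eg X (INR k * t))).
  mono; auto; pos.
  replace (3 * Eg X t * (1 + T) * ((3 + INR Y) * Eg X (INR k * t))) with (3 * (1 + T) * ((3 + INR Y) * (Eg X t * Eg X (INR k * t)))) by ring.
  assert (G1 := Eg_ge_1 X t HX Hv). assert (G2 := Eg_ge_1 X (INR k * t) HX Hv). assert (1 <= Eg X t * Eg X (INR k * t)) by nra.
  mono. lra. mul_pos; lra. lra. mono_l. lra.
  via EP. mono_l; lra. }
 replace (3 * 2 * ((3 + INR Y) * (e0 * (2 * INR k))) * (2 * mb / (b - a))) with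
  (3 * (2 * T) * ((3 + INR Y) * (e0 * (2 * INR k * T))) * (2 * mb / (b - a) / (T * T))) by (field; lra).
 mono; auto; try apply Cmod_ge_0. mul_pos; pos.
Qed.

(** The line is moved from 3/2 to s0 across the pole of zeta at w = 1, whose residue is the main
    term of the range d > Y. *)
Lemma big_part (k Y M : nat) (X h : R) : RH -> 1 < X -> 30 <= ln (ln X) -> (2 <= k)%nat -> (1 <= Y)%nat -> INR Y <= X ->
 1 <= h <= X -> X + h <= INR M -> let a := ln X in let b := ln (X + h) in let s0 := 1 / 2 + 6 / ln (ln X) in
 Cmod (RtoC (rsum (fun i => mu (S (Y + i)) * Rd k M a b (Y + i)) (M - Y)) - Ptail k Y 1 * RtoC (h / (b - a)))
  <= 120 * ((1 + INR k) * exp (- (INR k - 1) * s0 * ln (INR Y)) * exp (0.64 * ln X / ln (ln X)) * exp (b * s0)) * ln X ^ 2.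
Proof.
 intros HR HX Hv Hk HY HYX Hh HM a b s0. destruct (loglog_large X Hv HX) as [HlX [HX3 _]].
 assert (H6 : 0 < 6 / ln (ln X)) by pos.
 assert (H62 : 6 / ln (ln X) <= 0.2) by (apply Rmult_le_reg_r with (ln (ln X)); [lra|unfold Rdiv; rewrite Rmult_assoc, Rinv_l; lra]).
 assert (s05 : 1 / 2 < s0 < 1) by (unfold s0; lra).
 assert (Hab : a < b) by (apply ln_increasing; lra).
 assert (a0 : 0 <= a) by (apply ln_nonneg; lra).
 assert (HbM : b <= ln (INR M)) by (apply ln_le'; lra).
 assert (HM0 : (0 < M)%nat) by (apply INR_lt; simpl; lra).
 assert (HYM : (Y <= M)%nat) by (apply INR_le; lra).
 assert (HL := big_part_bound k Y X h HR HX Hv Hk HY HYX Hh). cbv zeta in HL. fold a b s0 in HL.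
 match type of HL with forall T, _ -> _ <= 720 * ?E * _ => set (Q := E) in * end. change (Cmod (RtoC (rsum (fun i => mu (S (Y + i)) * Rd k M a b (Y + i)) (M - Y)) - Ptail k Y 1 * RtoC (h / (b - a))) <= 120 * Q * ln X ^ 2).
 destruct (big_part_perron k Y M a b HR Hk Hab HbM HM0 HYM) as [C1 HP].
 destruct (big_part_edge k Y X a b HR HX Hv Hk (conj a0 Hab)) as [B HB]. fold s0 in HB.
 set (G := fun w => (fz w * Ptail k Y w * kern a b w)%C). set (S := rsum (fun i => mu (Datatypes.S (Y + i)) * Rd k M a b (Y + i)) (M - Y)) in *.
 assert (Gh : forall n, hol n (fun w => 1 / 2 < Re w) G).
 { intros n. apply hol_mult. apply hol_mult. apply hol_sub with (2 := fz_hol n). intros; lra. now apply Ptail_hol.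
  apply hol_sub with (2 := kern_hol n a b Hab). intros z Hz. split. exact I. intros ->. simpl in Hz. lra. }
 destruct (Gh 1%nat) as [G1 [HG1 _]].
 (* With a = log X and b = log (X + h) the kernel at 1 is ((X + h) - X) / (b - a). *)
 assert (EG1 : G 1%C = (Ptail k Y 1 * RtoC (h / (b - a)))%C).
 { unfold G. rewrite fz_at_1. replace (kern a b 1) with (RtoC (h / (b - a))). ring. unfold kern. rewrite !Cmult_1_r, !cexp_R.
  unfold a at 2, b at 2. rewrite !exp_ln by lra. unfold Rdiv. rewrite RtoC_mult, RtoC_inv by lra.
  replace h with ((X + h) - X) at 1 by ring. rewrite RtoC_minus. unfold Cdiv. ring. }
 assert (P2 : forall T, 1 <= T -> Cmod (vint (fun w => Zt w * Ptail k Y w * kern a b w)%C T (3 / 2) - vint (fun w => Zt w * Ptail k Y w * kern a b w)%C T s0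
   - RtoC (2 * PI) * G 1%C) <= 2 * (3 / 2 - s0) * (B + 2 * Cmod (G 1%C)) / T).
 { intros T HT. assert (GE : forall w, (G w / (w - RtoC 1))%C = (Zt w * Ptail k Y w * kern a b w)%C) by (intros; unfold G, Zt, Cdiv; ring).
  rewrite (vint_ext _ (fun w => G w / (w - RtoC 1))%C T (3 / 2)), (vint_ext _ (fun w => G w / (w - RtoC 1))%C T s0); try lra; try (intros; now rewrite GE).
  apply (residue_bound (fun w => 1 / 2 < Re w) G T s0 (3 / 2) 1 B (G1 1%C)); auto; try lra.
  - apply copen_Re.
  - apply hol_sub with (2 := Gh 2%nat). tauto.
  - apply HG1. simpl. lra.
  - intros s t Hs _. simpl. lra.
  - intros s Hs. split; apply (HB T); auto. apply Rabs_pos_eq; lra. rewrite Rabs_left; lra. }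
 assert (Fin : Cmod (RtoC (2 * PI) * (RtoC S - G 1%C)) <= 720 * Q * ln X ^ 2).
 { apply le_of_all_T with (C1 := 2 * (3 / 2 - s0) * (B + 2 * Cmod (G 1%C)) + C1) (T0 := X). intros T HT.
  specialize (HP T ltac:(lra)). specialize (P2 T ltac:(lra)). specialize (HL T HT). rewrite RtoC_mult in HP.
  set (V1 := vint (fun w => Zt w * Ptail k Y w * kern a b w)%C T (3 / 2)) in *. set (V2 := vint (fun w => Zt w * Ptail k Y w * kern a b w)%C T s0) in *.
  replace (RtoC (2 * PI) * (RtoC S - G 1%C))%C with (V2 + ((V1 - V2 - RtoC (2 * PI) * G 1%C) - (V1 - RtoC (2 * PI) * RtoC S)))%C by ring.
  via Cmod_triangle. apply Rplus_le_compat; auto. via Cmod_triangle_minus.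
  rewrite Rdiv_plus_distr. lra. }
 rewrite Cmod_mult, Cmod_R, Rabs_pos_eq in Fin by (assert (PP := PI_RGT_0); lra).
 rewrite <- EG1. assert (PP : 3 <= PI) by (assert (Z := PI2_3_2); lra).
 assert (6 * Cmod (RtoC S - G 1%C) <= 2 * PI * Cmod (RtoC S - G 1%C)) by (mono_r; [apply Cmod_ge_0|lra]). lra.
Qed.

Definition invzeta (k : nat) : R := Re (mus (RtoC (INR k))).

Lemma dterm_mu_real (k i : nat) : dterm mu (RtoC (INR k)) i = RtoC (mu (S i) * pw (INR k) i).
Proof.
 unfold dterm, xpow. rewrite RtoC_mult. f_equal. replace (- RtoC (INR k) * RtoC (ln (INR (S i))))%C with (RtoC (- INR k * ln (INR (S i)))).
 apply cexp_R. rewrite RtoC_mult, RtoC_opp. reflexivity.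
Qed.

Lemma Ptail_at_1 (k Y : nat) : (2 <= k)%nat -> Re (Ptail k Y 1) = invzeta k - rsum (fun i => mu (S i) * pw (INR k) i) Y.
Proof.
 intros Hk. assert (k2 := two_le_INR k Hk).
 unfold Ptail. rewrite Cmult_1_r, muz_mus by (simpl; lra). rewrite Re_minus, Re_csum. unfold invzeta.
 rewrite (rsum_ext _ (fun i => mu (S i) * pw (INR k) i)). reflexivity. intros i _. now rewrite dterm_mu_real.
Qed.

Lemma invzeta_tail (k Y : nat) : (2 <= k)%nat -> Rabs (invzeta k - rsum (fun i => mu (S i) * pw (INR k) i) Y) <= 2.
Proof.
 intros Hk. assert (k2 := two_le_INR k Hk).
 rewrite <- Ptail_at_1 by auto. via re_le_Cmod. unfold Ptail. rewrite Cmult_1_r, muz_mus by (simpl; lra).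
 assert (Hser := ex_series_pw (INR k) ltac:(lra)).
 apply CSer_uniform with (pw (INR k)); auto. intros n. apply (dterm_mu_bound (RtoC (INR k))). apply (proj1 Hser).
 intros K. assert (A := rsum_pw_le (INR k) (Y + K) ltac:(lra)). rewrite rsum_app in A.
 assert (/ (INR k - 1) <= / 1) by (apply Rinv_le_contravar; lra).
 assert (B := rsum_nonneg (pw (INR k)) Y (fun n _ => Rlt_le _ _ (pw_pos (INR k) n))). lra.
Qed.

(** The errors h + 1 from smoothing, Y + 2h from small d and 2h from the main term of large d add up
    to at most 7h; the rest is the integral on the left line. *)
Lemma RH_bound_raw (k Y : nat) (X h : R) : RH -> 1 < X -> 30 <= ln (ln X) -> (2 <= k)%nat -> (1 <= Y)%nat -> INR Y <= h ->
 1 <= h <= X -> let b := ln (X + h) in let s0 := 1 / 2 + 6 / ln (ln X) in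
 Rabs (Qk k X - X * invzeta k) <= 7 * h +
  120 * ((1 + INR k) * exp (- (INR k - 1) * s0 * ln (INR Y)) * exp (0.64 * ln X / ln (ln X)) * exp (b * s0)) * ln X ^ 2.
Proof.
 intros HR HX Hv Hk HY HYh Hh b s0. destruct (INR_above (X + h)) as [M HM].
 assert (HYM : (Y <= M)%nat) by (apply INR_le; lra).
 assert (B := big_part k Y M X h HR HX Hv Hk HY ltac:(lra) Hh ltac:(lra)). cbv zeta in B. fold b s0 in B.
 assert (A := Qk_smooth k M X h ltac:(lia) ltac:(lra) ltac:(lra) ltac:(lra)). fold b in A.
 assert (C0 := small_part k Y M X h Hk ltac:(lra) ltac:(lra) ltac:(lra)). fold b in C0.
 assert (EM := rsum_app (fun i => mu (S i) * Rd k M (ln X) b i) Y (M - Y)).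
 replace (Y + (M - Y))%nat with M in EM by lia. rewrite EM in A. clear EM.
 set (S1 := rsum (fun i => mu (S i) * Rd k M (ln X) b i) Y) in *.
 set (S2 := rsum (fun i => mu (S (Y + i)) * Rd k M (ln X) b (Y + i)) (M - Y)) in *.
 set (Sm := rsum (fun i => mu (S i) * pw (INR k) i) Y) in *.
 set (Eb := 120 * ((1 + INR k) * exp (- (INR k - 1) * s0 * ln (INR Y)) * exp (0.64 * ln X / ln (ln X)) * exp (b * s0)) * ln X ^ 2) in *.
 assert (B' : Rabs (S2 - (invzeta k - Sm) * (h / (b - ln X))) <= Eb).
 { upto B. upto re_le_Cmod. right. f_equal.
  rewrite Re_minus, Re_mult, Re_RtoC, Re_RtoC, Im_RtoC, Ptail_at_1 by auto. fold Sm. ring. }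
 assert (T := invzeta_tail k Y Hk). fold Sm in T.
 (* The logarithmic mean of X and X + h lies between them, so the residue may be replaced by X times
    the tail at a cost of at most 2h. *)
 assert (K : X <= h / (b - ln X) <= X + h).
 { unfold b. assert (Hq : 0 < ln (X + h) - ln X) by (assert (ln X < ln (X + h)) by (apply ln_increasing; lra); lra).
  rewrite <- ln_div in * by lra. assert (Q1 := exp_ineq1_le (ln ((X + h) / X))). assert (Q2 := exp_ineq1_le (- ln ((X + h) / X))).
  rewrite exp_Ropp in Q2. rewrite exp_ln in Q1, Q2 by pos.
  replace (/ ((X + h) / X)) with (X / (X + h)) in Q2 by (field; lra).
  replace ((X + h) / X) with (1 + h / X) in Q1 at 2 by (field; lra).
  replace (X / (X + h)) with (1 - h / (X + h)) in Q2 by (field; lra).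
  set (L := ln ((X + h) / X)) in *. split.
  - apply Rmult_le_reg_r with L; auto. unfold Rdiv. rewrite Rmult_assoc, Rinv_l by lra.
   assert (L * X <= h / X * X) by (mono_r; lra). replace (h / X * X) with h in H by (field; lra). lra.
  - apply Rmult_le_reg_r with L; auto. unfold Rdiv. rewrite Rmult_assoc, Rinv_l by lra.
   assert (h / (X + h) * (X + h) <= L * (X + h)) by (mono_r; lra). replace (h / (X + h) * (X + h)) with h in H by (field; lra). lra. }
 set (K1 := h / (b - ln X)) in *.
 assert (D : Rabs ((K1 - X) * (invzeta k - Sm)) <= h * 2).
 { rewrite Rabs_mult. mono; try apply Rabs_pos; auto. rewrite Rabs_pos_eq; lra. }
 replace (Qk k X - X * invzeta k) with ((Qk k X - (S1 + S2)) + (S1 - X * Sm) + (S2 - (invzeta k - Sm) * K1) + (K1 - X) * (invzeta k - Sm)) by ring.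
 via Rabs_triang. le_trans. apply Rplus_le_compat_r, Rabs_triang. le_trans. apply Rplus_le_compat_r, Rplus_le_compat_r, Rabs_triang.
 lra.
Qed.

Lemma exp_vs_square (v : R) : 30 <= v -> 17 * v ^ 2 <= exp v.
Proof.
 intros Hv. assert (A := exp_mult_lower (v / 6) 6 ltac:(lra)). replace (INR 6 * (v / 6)) with v in A by (simpl; field).
 upto A. assert (36 <= (1 + v / 6) ^ 2) by nra.
 replace ((1 + v / 6) ^ 6) with ((1 + v / 6) ^ 2 * (1 + v / 6) ^ 2 * (1 + v / 6) ^ 2) by ring.
 assert (v ^ 2 / 36 <= (1 + v / 6) ^ 2) by nra. set (q := (1 + v / 6) ^ 2) in *. assert (1296 <= q * q) by nra. nra.
Qed.

(** The choice h = X^(1/(k+1)), with Y its integer part, balances the two errors: X^s0 Y^(-(k-1) s0)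
    is then X^(2 s0/(k+1)), up to the loss from rounding. *)
Lemma RH_bound (k : nat) (X : R) : RH -> 1 < X -> 30 <= ln (ln X) -> (2 <= k)%nat -> INR k + 1 <= ln (ln X) ->
 Rabs (Qk k X - X * invzeta k) <= exp (ln X * (/ (INR k + 1) + 5 / ln (ln X))) / (20 * (INR k + 1)).
Proof.
 intros HR HX Hv Hk Hkv. destruct (loglog_large X Hv HX) as [HlX [HX3 EX]]. set (v := ln (ln X)) in *.
 assert (k2 := two_le_INR k Hk).
 set (l := ln X) in *. set (h := exp (l / (INR k + 1))).
 assert (V2 := exp_vs_square v Hv). rewrite <- EX in V2.
 assert (lk : 1 <= l / (INR k + 1)).
 { apply Rmult_le_reg_r with (INR k + 1). lra. unfold Rdiv. rewrite Rmult_assoc, Rinv_l by lra. nra. }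
 assert (h2 : 2 <= h). { unfold h. assert (Q := exp_ineq1_le (l / (INR k + 1))). lra. }
 assert (hX : h <= X).
 { unfold h. rewrite <- (exp_ln X) by lra. fold l. apply exp_le. apply Rmult_le_reg_r with (INR k + 1). lra. unfold Rdiv. rewrite Rmult_assoc, Rinv_l by lra. nra. }
 assert (HY : exists Y : nat, INR Y <= h < INR Y + 1).
 { destruct (archimed h) as [P Q]. exists (Z.to_nat (up h - 1)). rewrite (INR_IZR_INZ (Z.to_nat _)), Z2Nat.id, minus_IZR. lra.
  apply le_IZR. rewrite minus_IZR. lra. }
 destruct HY as [Y HY].
 assert (Y1 : (1 <= Y)%nat) by (apply INR_le; simpl; lra).
 assert (R := RH_bound_raw k Y X h HR HX Hv Hk Y1 ltac:(lra) ltac:(lra)). cbv zeta in R. fold l in R. fold v in R.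
 via R. clear R. set (s0 := 1 / 2 + 6 / v). set (b := ln (X + h)).
 assert (H6 : 0 < 6 / v) by pos.
 assert (H62 : 6 / v <= 0.2) by (apply Rmult_le_reg_r with v; [lra|unfold Rdiv; rewrite Rmult_assoc, Rinv_l; lra]).
 assert (L2 : ln 2 <= 1) by (rewrite <- (ln_exp 1); apply ln_le'; [lra|]; assert (Z := exp_ineq1_le 1); lra).
 assert (Hb : b <= l + 1). { unfold b. apply Rle_trans with (ln (X * 2)). apply ln_le'; lra. rewrite (ln_mult X 2) by lra. fold l. lra. }
 assert (HlY : l / (INR k + 1) - 1 <= ln (INR Y)).
 { assert (h <= INR Y * 2) by lra. assert (Hl := ln_le' h (INR Y * 2) ltac:(lra) H). rewrite ln_mult in Hl by lra. unfold h in Hl. rewrite ln_exp in Hl. lra. }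
 set (E := l / v). assert (E0 : 0 < E) by pos.
 assert (Big : exp (- (INR k - 1) * s0 * ln (INR Y)) * exp (0.64 * l / v) * exp (b * s0) <= h * exp (INR k) * exp (4.64 * E)).
 { unfold h. rewrite <- !exp_plus. apply exp_le.
  assert (s01 : s0 <= 1) by (unfold s0; lra). assert (s00 : 0 < s0) by (unfold s0; lra).
  assert (Q1 : b * s0 <= l * s0 + 1) by nra.
  assert (Q2 : - (INR k - 1) * s0 * ln (INR Y) <= - (INR k - 1) * s0 * (l / (INR k + 1)) + (INR k - 1)).
  { assert (0 <= (INR k - 1) * s0) by nra. assert ((INR k - 1) * s0 * (l / (INR k + 1) - 1) <= (INR k - 1) * s0 * ln (INR Y)) by (mono_l; auto).
   assert ((INR k - 1) * s0 <= INR k - 1) by nra. lra. }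
  (* Twice s0/(k+1) equals 1/(k+1) + 12/((k+1) v), and k >= 2 makes the excess at most 4/v. *)
  assert (Q3 : l * s0 + - (INR k - 1) * s0 * (l / (INR k + 1)) = l / (INR k + 1) + 12 / (INR k + 1) * E).
  { unfold s0, E. field. lra. }
  assert (Q4 : 12 / (INR k + 1) * E <= 4 * E).
  { mono_r. lra. apply Rmult_le_reg_r with (INR k + 1). lra. unfold Rdiv. rewrite Rmult_assoc, Rinv_l by lra. lra. }
  replace (0.64 * l / v) with (0.64 * E) by (unfold E, Rdiv; ring). lra. }
 assert (Ev : 17 * v <= E).
 { apply Rmult_le_reg_r with v. lra. replace (E * v) with l by (unfold E; field; lra). lra. }
 assert (Main : 247 * (20 * (INR k + 1)) * ((1 + INR k) * exp (INR k) * l ^ 2) <= exp (0.36 * E)).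
 { assert (K1 := exp_ineq1_le (INR k)). assert (K2 : exp (INR k) <= exp v) by (apply exp_le; lra). rewrite <- EX in K2.
  assert (K3 : 4940 <= exp 13). { assert (Z := exp_mult_lower 1 13 ltac:(lra)). replace (INR 13 * 1) with 13 in Z by (simpl; lra). lra. }
  assert (K4 := exp_pos (INR k)).
  apply Rle_trans with (exp 13 * l ^ 5).
  - replace (247 * (20 * (INR k + 1)) * ((1 + INR k) * exp (INR k) * l ^ 2)) with (4940 * ((1 + INR k) * (1 + INR k) * exp (INR k) * l ^ 2)) by ring.
   mono; [lra| |lra|]. { assert (0 <= l ^ 2) by (apply pow_le; lra). repeat mul_pos; lra. }
   replace (l ^ 5) with (l * l * l * l ^ 2) by ring. mono_r. apply pow_le; lra. assert (1 + INR k <= l) by lra.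
   mono; [nra|lra|nra|lra].
  - rewrite EX. rewrite exp_pow_nat, <- exp_plus. apply exp_le. simpl INR. lra. }
 fold l v s0 b.
 replace (l * (/ (INR k + 1) + 5 / v)) with (l / (INR k + 1) + (4.64 * E + 0.36 * E)) by (unfold E, Rdiv; lra). rewrite !exp_plus. fold h.
 set (x1 := exp (4.64 * E)) in *. set (x2 := exp (0.36 * E)) in *.
 assert (x11 : 1 <= x1) by (unfold x1; rewrite <- exp_0; apply exp_le; lra).
 set (D := (1 + INR k) * exp (INR k) * l ^ 2) in *.
 assert (D1 : 1 <= D).
 { unfold D. assert (1 <= exp (INR k)) by (rewrite <- exp_0; apply exp_le; lra). assert (1 <= l ^ 2) by (apply pow_R1_Rle; lra).
  assert (1 <= (1 + INR k) * exp (INR k)) by nra. rewrite <- (Rmult_1_r 1). mono; lra. }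
 apply Rle_trans with (247 * (h * x1 * D)).
 - replace (247 * (h * x1 * D)) with (7 * (h * (x1 * D)) + 240 * (h * x1 * D)) by ring. apply Rplus_le_compat.
  + mono_l. lra. rewrite <- (Rmult_1_r h) at 1. mono_l. lra. nra.
  + rewrite !Rmult_assoc in Big.
   replace (120 * ((1 + INR k) * exp (- (INR k - 1) * s0 * ln (INR Y)) * exp (0.64 * l / v) * exp (b * s0)) * l ^ 2)
    with (120 * ((1 + INR k) * l ^ 2) * (exp (- (INR k - 1) * (s0 * ln (INR Y))) * (exp (0.64 * l / v) * exp (b * s0)))).
   2:{ replace (- (INR k - 1) * s0 * ln (INR Y)) with (- (INR k - 1) * (s0 * ln (INR Y))) by ring. ring. }
   apply Rle_trans with (120 * ((1 + INR k) * l ^ 2) * (h * (exp (INR k) * x1))).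
   * mono_l; auto. mul_pos. lra. mul_pos. lra. apply pow_le; lra.
   * replace (120 * ((1 + INR k) * l ^ 2) * (h * (exp (INR k) * x1))) with (120 * (h * x1 * D)) by (unfold D; ring).
    clearbody D. assert (0 <= h * x1) by (mul_pos; lra). assert (0 <= h * x1 * D) by (mul_pos; lra). lra.
 - apply Rmult_le_reg_r with (20 * (INR k + 1)). lra.
  replace (h * (x1 * x2) / (20 * (INR k + 1)) * (20 * (INR k + 1))) with (h * (x1 * x2)) by (field; lra).
  replace (247 * (h * x1 * D) * (20 * (INR k + 1))) with (h * x1 * (247 * (20 * (INR k + 1)) * D)) by ring.
  replace (h * (x1 * x2)) with (h * x1 * x2) by ring. mono_l; auto. mul_pos; lra.
Qed.

Lemma CSer_real (u : nat -> R) : CSer (fun n => RtoC (u n)) = RtoC (Series u).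
Proof.
 unfold CSer. apply C_eq; csimp.
 - apply Series_ext. intros; now csimp.
 - rewrite (Series_ext _ (fun n => 0 * 0)) by (intros; csimp; ring). rewrite Series_scal_l. ring.
Qed.

(** The Moebius series at the integer k against the real series of the statement; both are real, so
    the complex identity for zeta and 1/zeta descends. *)
Lemma invzeta_nat (k : nat) : (2 <= k)%nat -> / zeta_nat k = invzeta k.
Proof.
 intros Hk. assert (k2 := two_le_INR k Hk).
 assert (E1 : zeta_s (RtoC (INR k)) = RtoC (zeta_nat k)).
 { rewrite <- (ctends_CSer_of _ _ (zeta_s_tends (RtoC (INR k)) ltac:(simpl; lra))). unfold zeta_nat.
  rewrite <- CSer_real. apply CSer_ext. intros n. unfold xpow.
  replace (- RtoC (INR k) * RtoC (ln (INR (S n))))%C with (RtoC (- (INR k * ln (INR (S n))))) by (rewrite RtoC_opp, RtoC_mult; ring).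
  rewrite cexp_R. f_equal. rewrite exp_Ropp, <- exp_pow_nat, exp_ln. reflexivity. apply INR_S_pos. }
 assert (E2 : mus (RtoC (INR k)) = RtoC (invzeta k)).
 { unfold invzeta, mus. rewrite (CSer_ext _ (fun i => RtoC (mu (S i) * pw (INR k) i))) by (intros; apply dterm_mu_real).
  rewrite CSer_real. reflexivity. }
 assert (M := mus_zeta (RtoC (INR k)) ltac:(simpl; lra)). rewrite E1, E2, <- RtoC_mult in M. apply (f_equal Re) in M. simpl in M.
 assert (zeta_nat k <> 0) by (intros E; rewrite E in M; lra).
 apply Rmult_eq_reg_r with (zeta_nat k); auto. rewrite Rinv_l; auto.
Qed.

(** Smoothing length 1 and Y the integer part of (x + 1)^(1/k): then no d > Y contributes to the
    count, and the tail of the Moebius series times x is at most 1 + r. *)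
Lemma elementary_bound (k : nat) (x : R) : (2 <= k)%nat -> 1 <= x ->
 Rabs (Qk k x - x * invzeta k) <= 9 * exp (ln x / INR k).
Proof.
 intros Hk Hx. assert (k2 := two_le_INR k Hk).
 set (r := exp (ln (x + 1) / INR k)).
 assert (r1 : 1 < r).
 { apply Rle_lt_trans with (exp 0). rewrite exp_0; lra. apply exp_increasing. apply Rdiv_lt_0_compat. apply Rle_lt_trans with (ln 1). rewrite ln_1; lra. apply ln_increasing; lra. lra. }
 assert (L2 : ln 2 <= 1) by (rewrite <- (ln_exp 1); apply ln_le'; [lra|]; assert (Z := exp_ineq1_le 1); lra).
 assert (r2 : r <= 2 * exp (ln x / INR k)).
 { assert (ln (x + 1) <= ln 2 + ln x) by (rewrite <- ln_mult by lra; apply ln_le'; lra).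
  rewrite <- (exp_ln 2) at 1 by lra. rewrite <- exp_plus. apply exp_le.
  apply Rmult_le_reg_r with (INR k). lra. replace (ln (x + 1) / INR k * INR k) with (ln (x + 1)) by (field; lra).
  replace ((ln 2 + ln x / INR k) * INR k) with (ln 2 * INR k + ln x) by (field; lra).
  assert (0 <= ln 2) by (apply ln_nonneg; lra).  assert (0 <= ln 2 * (INR k - 1)) by (mul_pos; lra). lra. }
 assert (HY : exists Y : nat, INR Y <= r < INR Y + 1).
 { destruct (archimed r) as [P Q]. exists (Z.to_nat (up r - 1)). rewrite (INR_IZR_INZ (Z.to_nat _)), Z2Nat.id, minus_IZR. lra.
  apply le_IZR. rewrite minus_IZR. lra. }
 destruct HY as [Y HY].
 destruct (INR_above (x + 1 + r)) as [M HM].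
 assert (HYM : (Y <= M)%nat) by (apply INR_le; lra).
 assert (A := Qk_smooth k M x 1 ltac:(lia) ltac:(lra) ltac:(lra) ltac:(lra)).
 assert (B := small_part k Y M x 1 Hk ltac:(lra) ltac:(lra) ltac:(lra)).
 assert (lr : forall i, ln (x + 1) <= INR k * ln (INR (S (Y + i)))).
 { intros i. assert (r <= INR (S (Y + i))). { rewrite S_INR, plus_INR. assert (0 <= INR i) by apply pos_INR. lra. }
  apply ln_le' in H; [|lra]. unfold r in H. rewrite ln_exp in H.
  apply Rmult_le_compat_l with (r := INR k) in H; [|lra]. replace (INR k * (ln (x + 1) / INR k)) with (ln (x + 1)) in H by (field; lra). exact H. }
 rewrite (rsum_shrink _ Y M HYM) in A.
 2:{ intros i Hi. replace (Rd k M (ln x) (ln (x + 1)) i) with 0. ring. unfold Rd. rewrite (rsum_ext _ (fun _ => 0)). rewrite rsum_const. ring.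
   intros j _. apply ramp_0. apply ln_increasing; lra. assert (0 <= ln (INR (S j))) by apply ln_nonneg, INR_S_ge_1.
   assert (Z := lr (i - Y)%nat). replace (Y + (i - Y))%nat with i in Z by lia. lra. }
 set (S1 := rsum (fun i => mu (S i) * Rd k M (ln x) (ln (x + 1)) i) Y) in *.
 set (Sm := rsum (fun i => mu (S i) * pw (INR k) i) Y) in *.
 assert (T : Rabs (invzeta k - Sm) <= / (x + 1) + r / (x + 1)).
 { unfold Sm. rewrite <- Ptail_at_1 by auto. via re_le_Cmod. unfold Ptail. rewrite Cmult_1_r, muz_mus by (simpl; lra).
  assert (Hser := ex_series_pw (INR k) ltac:(lra)).
  apply CSer_uniform with (pw (INR k)); auto. intros n. apply (dterm_mu_bound (RtoC (INR k))). apply (proj1 Hser).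
  assert (P0 : pw (INR k) Y <= / (x + 1)).
  { assert (Z := lr O). rewrite Nat.add_0_r in Z. unfold pw. rewrite <- (exp_ln (/ (x + 1))) by pos.
   rewrite ln_Rinv by lra. apply exp_le. lra. }
  assert (P1 : exp ((1 - INR k) * ln (INR (S Y))) / (INR k - 1) <= r / (x + 1)).
  { assert (Z := lr O). rewrite Nat.add_0_r in Z.
   assert (P2 : exp ((1 - INR k) * ln (INR (S Y))) <= r / (x + 1)).
   { replace (r / (x + 1)) with (exp (ln (x + 1) / INR k - ln (x + 1))).
    2:{ unfold Rminus. rewrite exp_plus, exp_Ropp, exp_ln by lra. reflexivity. }
    apply exp_le. apply Rmult_le_reg_r with (INR k). lra.
    replace ((ln (x + 1) / INR k - ln (x + 1)) * INR k) with ((1 - INR k) * ln (x + 1)) by (field; lra). nra. }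
   apply Rle_trans with (exp ((1 - INR k) * ln (INR (S Y))) / 1). 2: lra.
   unfold Rdiv. mono_l. pos. apply Rinv_le_contravar; lra. }
  assert (P3 : 0 <= / (x + 1) + r / (x + 1)).
  { assert (0 < / (x + 1)) by pos. unfold Rdiv. nra. }
  intros K. destruct K as [|K]. exact P3.
  replace (S K) with (1 + K)%nat by lia. rewrite rsum_app. apply Rplus_le_compat.
  - simpl rsum. rewrite Nat.add_0_r. lra.
  - upto P1. le_trans. 2: apply (rsum_pow_tail (INR k) Y K); lra. apply Req_le, rsum_ext.
   intros i _. unfold pw. do 4 f_equal. lia. }
 assert (D : Rabs (x * (invzeta k - Sm)) <= 1 + r).
 { rewrite Rabs_mult, (Rabs_pos_eq x) by lra. apply Rle_trans with ((x + 1) * (/ (x + 1) + r / (x + 1))).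
  mono; try lra. apply Rabs_pos. right. field. lra. }
 replace (Qk k x - x * invzeta k) with ((Qk k x - S1) + (S1 - x * Sm) + - (x * (invzeta k - Sm))) by ring.
 via Rabs_triang. le_trans. apply Rplus_le_compat_r, Rabs_triang. rewrite Rabs_Ropp.
 assert (1 <= exp (ln x / INR k)).
 { rewrite <- exp_0. apply exp_le. mul_pos. apply ln_nonneg; lra. pos. }
 lra.
Qed.

(** * A zero of zeta near 1/2 + 14.13 i *)

(** One integration from 0. Repeated, it gives Taylor and Euler-Maclaurin remainders with their
    factorials. *)
Lemma rder_power_bound (F F' : R -> C) (p : R) (n : nat) (tau : R) : 0 <= p -> 0 <= tau -> F 0 = 0%C ->
 (forall t, 0 <= t <= tau -> rder F t (F' t)) -> (forall t, 0 <= t <= tau -> contC F' t) ->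
 (forall t, 0 <= t <= tau -> Cmod (F' t) <= p * t ^ n) -> Cmod (F tau) <= p / INR (S n) * tau ^ S n.
Proof.
 intros Hp Ht F0 HF HC HB.
 replace (F tau) with (F tau - F 0)%C by (rewrite F0; ring).
 rewrite <- (CInt_FTC F F' 0 tau Ht HF HC).
 replace (p / INR (S n) * tau ^ S n) with (p / INR (S n) * tau ^ S n - p / INR (S n) * 0 ^ S n) by (simpl; ring).
 apply (CInt_bound_derive F' (fun t => p / INR (S n) * t ^ S n) (fun t => p * t ^ n)); auto.
 - intros t _. replace (p * t ^ n) with (p / INR (S n) * (INR (S n) * t ^ n)) by (field; apply not_0_INR; lia).
  apply is_derive_scal. replace (INR (S n) * t ^ n) with (INR (S n) * 1 * t ^ pred (S n)) by (simpl pred; ring).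
  apply (is_derive_pow (fun t => t)). apply (is_derive_id (K := R_AbsRing)).
 - intros t _. apply continuous_of_derive. auto_derive. auto.
Qed.

Definition Texp (m : nat) (w : C) : C := csum (fun j => (w ^ j / RtoC (INR (fact j)))%C) (S m).

Lemma rder_contC (F : R -> C) (t : R) (l : C) : rder F t l -> contC F t.
Proof. intros [A B]. split; apply continuous_of_derive; eexists; eauto. Qed.

(** Induction on the order along t -> t w: the derivative of each remainder is w times the previous
    one. *)
Lemma cexp_Taylor (m : nat) (w : C) : Cmod (cexp w - Texp m w) <= Cmod w ^ S m / INR (fact (S m)) * exp (Cmod w).
Proof.
 assert (H : forall m t, 0 <= t <= 1 -> Cmod (cexp (RtoC t * w) - Texp m (RtoC t * w)) <= exp (Cmod w) * Cmod w ^ S m / INR (fact (S m)) * t ^ S m).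
 { clear m. 
  assert (D0 : forall t, rder (fun s => cexp (RtoC s * w)) t (w * cexp (RtoC t * w))%C) by (intros; apply rder_cexp_line).
  assert (Pw : forall (r : R) n, ((RtoC r * w) ^ n)%C = (RtoC (r ^ n) * w ^ n)%C).
  { intros r n. induction n as [|n IH]. simpl. ring. simpl. rewrite IH, RtoC_mult. ring. }
  assert (fn : forall n, RtoC (INR (fact n)) <> RtoC 0).
  { intros n E. apply (f_equal Re) in E. simpl in E. now apply INR_fact_neq_0 in E. }
  assert (Dp : forall n t, rder (fun s => (RtoC s * w) ^ S n / RtoC (INR (fact (S n))))%C t (w * ((RtoC t * w) ^ n / RtoC (INR (fact n))))%C).
  { intros n t. apply rder_ext with (F := fun s => (RtoC (s ^ S n) * (w ^ S n / RtoC (INR (fact (S n)))))%C)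
    (a := (RtoC (INR (S n) * t ^ n) * (w ^ S n / RtoC (INR (fact (S n)))) + RtoC (t ^ S n) * 0)%C).
   - intros u. rewrite Pw. unfold Cdiv. ring.
   - rewrite Pw. rewrite fact_simpl, mult_INR, !RtoC_mult. change (w ^ S n)%C with (w * w ^ n)%C. field. split. apply fn.
    intros E. apply (f_equal Re) in E. now apply (not_0_INR (S n)) in E.
   - apply (rder_mult (fun s => RtoC (s ^ S n)) (fun _ => (w ^ S n / RtoC (INR (fact (S n))))%C)). apply rder_RtoC.
    replace (INR (S n) * t ^ n) with (INR (S n) * 1 * t ^ pred (S n)) by (simpl pred; ring).
    apply (is_derive_pow (fun t => t)). apply (is_derive_id (K := R_AbsRing)). apply rder_const. }
  assert (Dt : forall m t, rder (fun s => Texp (S m) (RtoC s * w)) t (w * Texp m (RtoC t * w))%C).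
  { intros m t. induction m as [|m IH].
   - apply rder_ext with (F := fun s => (1 + (RtoC s * w) ^ 1 / RtoC (INR (fact 1)))%C) (a := (0 + w * ((RtoC t * w) ^ 0 / RtoC (INR (fact 0))))%C).
    intros u. unfold Texp. simpl. field. unfold Texp. simpl. field. apply rder_plus. apply rder_const. apply Dp.
   - apply rder_ext with (F := fun s => (Texp (S m) (RtoC s * w) + (RtoC s * w) ^ S (S m) / RtoC (INR (fact (S (S m)))))%C)
     (a := (w * Texp m (RtoC t * w) + w * ((RtoC t * w) ^ S m / RtoC (INR (fact (S m)))))%C).
    reflexivity. change (Texp (S m) (RtoC t * w)) with (Texp m (RtoC t * w) + (RtoC t * w) ^ S m / RtoC (INR (fact (S m))))%C. ring.
    apply rder_plus. exact IH. apply Dp. }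
  assert (T0 : forall m, Texp m (RtoC 0 * w) = 1%C).
  { intros m. replace (RtoC 0 * w)%C with (RtoC 0) by ring. induction m as [|m IH]. unfold Texp; simpl; field.
   change (Texp (S m) 0) with (Texp m 0 + 0 ^ S m / RtoC (INR (fact (S m))))%C. rewrite IH. change (RtoC 0 ^ S m)%C with (RtoC 0 * RtoC 0 ^ m)%C. unfold Cdiv. ring. }
  assert (F0 : forall m, (cexp (RtoC 0 * w) - Texp m (RtoC 0 * w))%C = 0%C).
  { intros m. rewrite T0. replace (RtoC 0 * w)%C with (RtoC 0) by ring. rewrite cexp_0. ring. }
  assert (wp : 0 <= Cmod w) by pos. assert (ep := exp_pos (Cmod w)).
  induction m as [|m IH]; intros t Ht.
  - replace (exp (Cmod w) * Cmod w ^ 1 / INR (fact 1) * t ^ 1) with (Cmod w * exp (Cmod w) / INR 1 * t ^ 1) by (simpl; field).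
   apply (rder_power_bound (fun s => cexp (RtoC s * w) - Texp 0 (RtoC s * w))%C (fun s => w * cexp (RtoC s * w))%C); auto; try lra.
   + nra.
   + intros u _. apply rder_ext with (F := fun s => (cexp (RtoC s * w) + - (1))%C) (a := (w * cexp (RtoC u * w) + 0)%C).
    intros y. unfold Texp. simpl. field. ring. apply rder_plus. apply D0. apply rder_const.
   + intros u _. eapply rder_contC. apply (rder_mult (fun _ => w) (fun s => cexp (RtoC s * w))). apply rder_const. apply D0.
   + intros u Hu. rewrite Cmod_mult, Cmod_cexp, Rmult_1_r. mono_l; auto. apply exp_le.
    via Re_le_mod. rewrite Cmod_mult, Cmod_R, Rabs_pos_eq by lra. nra.
  - replace (exp (Cmod w) * Cmod w ^ S (S m) / INR (fact (S (S m))) * t ^ S (S m))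
    with (Cmod w * (exp (Cmod w) * Cmod w ^ S m / INR (fact (S m))) / INR (S (S m)) * t ^ S (S m)).
   2:{ rewrite (fact_simpl (S m)), mult_INR. change (Cmod w ^ S (S m)) with (Cmod w * Cmod w ^ S m). field.
     split. apply INR_fact_neq_0. apply not_0_INR; lia. }
   assert (dd : forall u, rder (fun s => cexp (RtoC s * w) - Texp (S m) (RtoC s * w))%C u (w * (cexp (RtoC u * w) - Texp m (RtoC u * w)))%C).
   { intros u. apply rder_ext with (F := fun s => (cexp (RtoC s * w) + - (1) * Texp (S m) (RtoC s * w))%C)
     (a := (w * cexp (RtoC u * w) + (0 * Texp (S m) (RtoC u * w) + - (1) * (w * Texp m (RtoC u * w))))%C).
    intros y. ring. ring. apply rder_plus. apply D0. apply (rder_mult (fun _ => (- (1))%C)). apply rder_const. apply Dt. }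
   apply (rder_power_bound (fun s => cexp (RtoC s * w) - Texp (S m) (RtoC s * w))%C (fun s => w * (cexp (RtoC s * w) - Texp m (RtoC s * w)))%C); auto; try lra.
   + mul_pos; auto. mul_pos. mul_pos. lra. now apply pow_le. left. apply Rinv_0_lt_compat, INR_fact_lt_0.
   + intros u _. assert (C1 : forall n, contC (fun s => Texp n (RtoC s * w)) u).
    { intros n. destruct n. apply rder_contC with (l := RtoC 0). apply rder_ext with (F := fun _ => RtoC 1) (a := RtoC 0). intros y; unfold Texp; simpl; field. ring. apply rder_const.
     eapply rder_contC. apply Dt. }
    destruct (C1 m) as [X1 X2]. destruct (rder_contC _ _ _ (D0 u)) as [Y1 Y2].
    split.
    * apply continuous_ext with (fun s => Re w * (1 * Re (cexp (RtoC s * w)) + (-1) * Re (Texp m (RtoC s * w))) + - Im w * (1 * Im (cexp (RtoC s * w)) + (-1) * Im (Texp m (RtoC s * w)))).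
     intros; rewrite Re_mult, Re_minus, Im_minus; toR; ring. apply continuous_lin2; apply continuous_lin2; auto.
    * apply continuous_ext with (fun s => Re w * (1 * Im (cexp (RtoC s * w)) + (-1) * Im (Texp m (RtoC s * w))) + Im w * (1 * Re (cexp (RtoC s * w)) + (-1) * Re (Texp m (RtoC s * w)))).
     intros; rewrite Im_mult, Re_minus, Im_minus; toR; ring. apply continuous_lin2; apply continuous_lin2; auto.
   + intros u Hu. rewrite Cmod_mult, (Rmult_assoc (Cmod w)). mono_l; auto. apply IH; lra. }
 specialize (H m 1 ltac:(lra)). rewrite pow1, Rmult_1_r in H. replace (RtoC 1 * w)%C with w in H by ring.
 via H. right. unfold Rdiv. ring.
Qed.

(* The error of the trapezoidal rule corrected by [tau^2/12] times the increment of the derivative: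
  its third derivative in [tau] is [tau^2/12] times the fourth derivative of the integrand. *)
Definition em0 (s : C) (x tau : R) : C :=
 (xpow (x + tau) (s - 1) - xpow x (s - 1) + (s - 1) / 2 * (RtoC tau * (xpow x s + xpow (x + tau) s))
  + (s - 1) * s / 12 * (RtoC (tau * tau) * (xpow (x + tau) (s + 1) - xpow x (s + 1))))%C.
Definition em1 (s : C) (x tau : R) : C :=
 ((s - 1) / 2 * (xpow x s - xpow (x + tau) s) - (s - 1) * s / 2 * (RtoC tau * xpow (x + tau) (s + 1))
  + (s - 1) * s / 6 * (RtoC tau * (xpow (x + tau) (s + 1) - xpow x (s + 1)))
  - (s - 1) * s * (s + 1) / 12 * (RtoC (tau * tau) * xpow (x + tau) (s + 2)))%C.
Definition em2 (s : C) (x tau : R) : C :=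
 ((s - 1) * s / 6 * (xpow (x + tau) (s + 1) - xpow x (s + 1)) + (s - 1) * s * (s + 1) / 6 * (RtoC tau * xpow (x + tau) (s + 2))
  + (s - 1) * s * (s + 1) * (s + 2) / 12 * (RtoC (tau * tau) * xpow (x + tau) (s + 3)))%C.
Definition em3 (s : C) (x tau : R) : C :=
 (- ((s - 1) * s * (s + 1) * (s + 2) * (s + 3) / 12 * (RtoC (tau * tau) * xpow (x + tau) (s + 4))))%C.

Lemma rder_shift (x tau : R) (s : C) : 0 < x -> 0 <= tau -> rder (fun t => xpow (x + t) s) tau (- s * xpow (x + tau) (s + 1))%C.
Proof.
 intros Hx Ht. apply rder_ext with (F := fun t => xpow (x + t) s) (a := (RtoC 1 * (- s * xpow (x + tau) (s + 1)))%C). auto. ring.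
 apply (rder_comp (fun y => xpow y s) (fun t => x + t)). auto_derive; auto; toR; ring. apply rder_xpow. lra.
Qed.

Lemma em_chain (s : C) (x tau : R) : 0 < x -> 0 <= tau ->
 rder (em0 s x) tau (em1 s x tau) /\ rder (em1 s x) tau (em2 s x tau) /\ rder (em2 s x) tau (em3 s x tau).
Proof.
 intros Hx Ht.
 assert (Dm : rder (fun t => xpow (x + t) (s - 1)) tau (- (s - 1) * xpow (x + tau) s)%C).
 { assert (H := rder_shift x tau (s - 1) Hx Ht). replace (s - 1 + 1)%C with s in H by ring. exact H. }
 assert (D0 := rder_shift x tau s Hx Ht).
 assert (D1 : rder (fun t => xpow (x + t) (s + 1)) tau (- (s + 1) * xpow (x + tau) (s + 2))%C).
 { assert (H := rder_shift x tau (s + 1) Hx Ht). replace (s + 1 + 1)%C with (s + 2)%C in H by (apply C_eq; csimp; simpl; ring). exact H. }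
 assert (D2 : rder (fun t => xpow (x + t) (s + 2)) tau (- (s + 2) * xpow (x + tau) (s + 3))%C).
 { assert (H := rder_shift x tau (s + 2) Hx Ht). replace (s + 2 + 1)%C with (s + 3)%C in H by (apply C_eq; csimp; simpl; ring). exact H. }
 assert (D3 : rder (fun t => xpow (x + t) (s + 3)) tau (- (s + 3) * xpow (x + tau) (s + 4))%C).
 { assert (H := rder_shift x tau (s + 3) Hx Ht). replace (s + 3 + 1)%C with (s + 4)%C in H by (apply C_eq; csimp; simpl; ring). exact H. }
 assert (R1 : rder (fun t => RtoC t) tau (RtoC 1)) by (apply rder_RtoC; auto_derive; auto; toR; ring).
 assert (R2 : rder (fun t => RtoC (t * t)) tau (RtoC (2 * tau))) by (apply rder_RtoC; auto_derive; auto; toR; ring).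
 assert (K : forall c : C, rder (fun _ => c) tau 0%C) by (intros; apply rder_const).
 assert (sc : forall c F l, rder F tau l -> rder (fun t => c * F t)%C tau (c * l)%C).
 { intros c F l H. apply rder_ext with (F := fun t => (c * F t)%C) (a := (0 * F tau + c * l)%C). auto. ring. apply (rder_mult (fun _ => c) F); auto. }
 split; [|split].
 - eapply rder_ext. 3: refine (rder_plus _ _ _ _ _ (rder_plus _ _ _ _ _ (rder_plus _ _ _ _ _ Dm (K (- xpow x (s - 1))%C))
   (sc ((s - 1) / 2)%C _ _ (rder_mult _ _ _ _ _ R1 (rder_plus _ _ _ _ _ (K (xpow x s)) D0))))
   (sc ((s - 1) * s / 12)%C _ _ (rder_mult _ _ _ _ _ R2 (rder_plus _ _ _ _ _ D1 (K (- xpow x (s + 1))%C))))).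
  + intros t. unfold em0. ring.
  + unfold em1. rewrite !RtoC_mult. field.
 - eapply rder_ext. 3: refine (rder_plus _ _ _ _ _ (rder_plus _ _ _ _ _ (rder_plus _ _ _ _ _
   (sc ((s - 1) / 2)%C _ _ (rder_plus _ _ _ _ _ (K (xpow x s)) (sc (- (1))%C _ _ D0)))
   (sc (- ((s - 1) * s / 2))%C _ _ (rder_mult _ _ _ _ _ R1 D1)))
   (sc ((s - 1) * s / 6)%C _ _ (rder_mult _ _ _ _ _ R1 (rder_plus _ _ _ _ _ D1 (K (- xpow x (s + 1))%C)))))
   (sc (- ((s - 1) * s * (s + 1) / 12))%C _ _ (rder_mult _ _ _ _ _ R2 D2))).
  + intros t. unfold em1. ring.
  + unfold em2. rewrite !RtoC_mult. field.
 - eapply rder_ext. 3: refine (rder_plus _ _ _ _ _ (rder_plus _ _ _ _ _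
   (sc ((s - 1) * s / 6)%C _ _ (rder_plus _ _ _ _ _ D1 (K (- xpow x (s + 1))%C)))
   (sc ((s - 1) * s * (s + 1) / 6)%C _ _ (rder_mult _ _ _ _ _ R1 D2)))
   (sc ((s - 1) * s * (s + 1) * (s + 2) / 12)%C _ _ (rder_mult _ _ _ _ _ R2 D3))).
  + intros t. unfold em2. ring.
  + unfold em3. rewrite !RtoC_mult. field.
Qed.

(** Three integrations of the bound t^2 / 12 for the third derivative give t^5 / 720, since the
    error and its first two derivatives vanish at 0. *)
Lemma em_bound (s : C) (x : R) : 0 < x -> 0 <= Re s + 4 ->
 Cmod (em0 s x 1) <= Cmod ((s - 1) * s * (s + 1) * (s + 2) * (s + 3)) / 720 * exp (- (Re s + 4) * ln x).
Proof.
 intros Hx Hs. set (Q := ((s - 1) * s * (s + 1) * (s + 2) * (s + 3))%C). set (X := exp (- (Re s + 4) * ln x)).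
 assert (X0 : 0 < X) by pos. assert (Q0 := Cmod_ge_0 Q).
 assert (B3 : forall t, 0 <= t -> Cmod (em3 s x t) <= Cmod Q * X / 12 * t ^ 2).
 { intros t Ht. unfold em3. fold Q. unfold Cdiv. rewrite Cmod_opp, !Cmod_mult, Cmod_R, Cmod_xpow.
  rewrite (Rabs_pos_eq (t * t)) by nra. rewrite Cmod_inv by (intros E; apply (f_equal Re) in E; simpl in E; lra).
  rewrite Cmod_R, Rabs_pos_eq by lra. rewrite Re_plus, Re_RtoC.
  replace (Cmod Q * X / 12 * t ^ 2) with (Cmod Q * / 12 * (t * t * X)) by field.
  mono_l. mul_pos; lra. mono_l. nra. apply exp_le.
  assert (ln x <= ln (x + t)) by (apply ln_le'; lra). nra. }
 assert (z0 : em0 s x 0 = 0%C /\ em1 s x 0 = 0%C /\ em2 s x 0 = 0%C).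
 { unfold em0, em1, em2. rewrite Rplus_0_r, Rmult_0_r. repeat split; ring. }
 destruct z0 as [z0 [z1 z2]].
 assert (c3 : forall t, 0 <= t -> contC (em3 s x) t).
 { intros t Ht. eapply rder_contC. unfold em3.
  apply rder_ext with (F := fun t => (- (Q / 12) * (RtoC (t * t) * xpow (x + t) (s + 4)))%C) (2 := eq_refl).
  intros u. unfold Q. unfold Cdiv. ring.
  apply (rder_mult (fun _ => (- (Q / 12))%C)). apply rder_const. apply rder_mult. apply rder_RtoC. auto_derive; auto; toR; ring.
  apply rder_shift; auto. }
 assert (B2 : forall t, 0 <= t -> Cmod (em2 s x t) <= Cmod Q * X / 36 * t ^ 3).
 { intros t Ht. replace (Cmod Q * X / 36) with (Cmod Q * X / 12 / INR 3) by (simpl; field).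
  apply (rder_power_bound (em2 s x) (em3 s x)); auto. mul_pos; nra. intros u Hu. exact (proj2 (proj2 (em_chain s x u Hx (proj1 Hu)))). intros u Hu. apply c3; lra. intros u Hu. apply B3; lra. }
 assert (B1 : forall t, 0 <= t -> Cmod (em1 s x t) <= Cmod Q * X / 144 * t ^ 4).
 { intros t Ht. replace (Cmod Q * X / 144) with (Cmod Q * X / 36 / INR 4) by (simpl; field).
  apply (rder_power_bound (em1 s x) (em2 s x)); auto. mul_pos; nra. intros u Hu. exact (proj1 (proj2 (em_chain s x u Hx (proj1 Hu)))).
  intros u Hu. exact (rder_contC _ _ _ (proj2 (proj2 (em_chain s x u Hx (proj1 Hu))))). intros u Hu. apply B2; lra. }
 assert (B0 : Cmod (em0 s x 1) <= Cmod Q * X / 144 / INR 5 * 1 ^ 5).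
 { apply (rder_power_bound (em0 s x) (em1 s x)); auto; try lra. mul_pos; nra. intros u Hu. exact (proj1 (em_chain s x u Hx (proj1 Hu))).
  intros u Hu. exact (rder_contC _ _ _ (proj1 (proj2 (em_chain s x u Hx (proj1 Hu))))). intros u Hu. apply B1; lra. }
 via B0. right. simpl. field.
Qed.

(** [fN] with the next Euler-Maclaurin correction, which raises the decay of the step error to
    N^(-Re s - 4). *)
Definition gN (N : nat) (s : C) : C := (fN N s + (s - 1) * s / 12 * xpow (INR N) (s + 1))%C.

Lemma gN_step (N : nat) (s : C) : gN (S N) s = (gN N s + em0 s (INR N) 1)%C.
Proof.
 unfold gN, fN, em0. change (csum (fun n => xpow (INR (S n)) s) (S N)) with (csum (fun n => xpow (INR (S n)) s) N + xpow (INR (S N)) s)%C.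
 rewrite S_INR. replace (1 * 1) with 1 by ring. field.
Qed.

Lemma fz_gN (N : nat) (s : C) : -1 < Re s -> (1 <= N)%nat ->
 Cmod (fz s - gN N s) <= Cmod ((s - 1) * s * (s + 1) * (s + 2) * (s + 3)) / 720 *
  (exp (- (Re s + 4) * ln (INR N)) + exp (- (Re s + 3) * ln (INR N)) / (Re s + 3)).
Proof.
 intros Hs HN. set (Q := Cmod ((s - 1) * s * (s + 1) * (s + 2) * (s + 3)) / 720).
 assert (Q0 : 0 <= Q) by (mul_pos; [apply Cmod_ge_0|lra]).
 apply (ctends_bound (fun K => gN (N + K) s + - gN N s)%C _ _ 0).
 2:{ apply ctends_plus. 2: apply ctends_const. apply (ctends_sub (fun N => gN N s) _ (fun K => (N + K)%nat)). intros; lia.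
   unfold gN. replace (fz s) with (fz s + (s - 1) * s / 12 * 0)%C by ring. apply ctends_plus. now apply fN_tends.
   apply ctends_scal. apply xpow_tends_0. csimp. simpl. lra. }
 intros K _. destruct N as [|N]. lia.
 assert (S1 : Cmod (gN (S N + K) s + - gN (S N) s) <= Q * rsum (fun i => exp (- (Re s + 4) * ln (INR (S N + i)))) K).
 { induction K as [|K IH]. rewrite Nat.add_0_r. replace (gN (S N) s + - gN (S N) s)%C with (RtoC 0) by ring. rewrite Cmod_0. simpl. lra.
  replace (S N + S K)%nat with (S (S N + K)) by lia. rewrite gN_step.
  replace (gN (S N + K) s + em0 s (INR (S N + K)) 1 + - gN (S N) s)%C with ((gN (S N + K) s + - gN (S N) s) + em0 s (INR (S N + K)) 1)%C by ring.
  via Cmod_triangle.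
  change (rsum (fun i => exp (- (Re s + 4) * ln (INR (S N + i)))) (S K)) with (rsum (fun i => exp (- (Re s + 4) * ln (INR (S N + i)))) K + exp (- (Re s + 4) * ln (INR (S N + K)))).
  rewrite Rmult_plus_distr_l. apply Rplus_le_compat; auto. apply em_bound. apply lt_0_INR; lia. lra. }
 via S1. mono_l; auto.
 assert (P : 0 <= exp (- (Re s + 4) * ln (INR (S N))) + exp (- (Re s + 3) * ln (INR (S N))) / (Re s + 3)).
 { assert (X := exp_pos (- (Re s + 4) * ln (INR (S N)))). assert (Y := exp_pos (- (Re s + 3) * ln (INR (S N)))).
  assert (0 < / (Re s + 3)) by pos. unfold Rdiv. nra. }
 destruct K as [|K]. exact P. replace (S K) with (1 + K)%nat by lia. rewrite rsum_app. apply Rplus_le_compat.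
 - simpl rsum. rewrite Nat.add_0_r, Rplus_0_l. apply Rle_refl.
 - assert (T := rsum_pow_tail (Re s + 4) N K ltac:(lra)). replace (1 - (Re s + 4)) with (- (Re s + 3)) in T by ring.
  replace (Re s + 4 - 1) with (Re s + 3) in T by ring. upto T. apply Req_le, rsum_ext. intros i _.
  replace (S N + (1 + i))%nat with (S (S (N + i))) by lia. reflexivity.
Qed.

(** The maximum principle for 1/f on a square. *)
Lemma min_modulus (V : C -> Prop) (f : C -> C) (x0 y0 r m : R) : hol 2 V f -> 0 < r -> 0 < m ->
 (forall x y, x0 - r <= x <= x0 + r -> y0 - r <= y <= y0 + r -> V (x, y) /\ f (x, y) <> RtoC 0) ->
 (forall x y, x0 - r <= x <= x0 + r -> y0 - r <= y <= y0 + r -> Rabs (x - x0) = r \/ Rabs (y - y0) = r -> m <= Cmod (f (x, y))) ->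
 m <= Cmod (f (x0, y0)).
Proof.
 intros Hf Hr Hm Hin Hb. assert (H0 : 0 < Cmod (f (x0, y0))) by (apply Cmod_gt_0, Hin; lra).
 apply Rmult_le_reg_l with (/ m). pos. rewrite Rinv_l by lra.
 apply Rmult_le_reg_r with (/ Cmod (f (x0, y0))). pos. rewrite Rmult_assoc, Rinv_r, Rmult_1_l, Rmult_1_r by lra.
 rewrite <- Cmod_inv by (apply Hin; lra).
 apply (rectangle_principle (fun z => V z /\ f z <> RtoC 0) (fun z => (/ f z)%C) (x0 - r) (x0 + r) (y0 - r) (y0 + r)); auto; try lra.
 - apply hol_inv. intros z [_ Hz]; exact Hz. apply hol_sub with (2 := Hf). intros z [Hz _]; exact Hz.
 - left. pos.
 - intros x y Hx Hy He. rewrite Cmod_inv by now apply Hin. apply Rinv_le_contravar; auto. apply Hb; auto.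
  destruct He as [-> |[-> |[-> | ->]]]; [left; rewrite Rabs_left|left; rewrite Rabs_pos_eq|right; rewrite Rabs_left|right; rewrite Rabs_pos_eq]; lra.
Qed.

(* Fixed-point complex arithmetic: [near z (a, b, e)] says that [10^9 z] is within [e] of [a + b i] in the l1 norm. *)
Definition fpS : Z := 1000000000.
Definition near (z : C) (q : Z * Z * Z) : Prop :=
 let '(a, b, e) := q in Rabs (IZR fpS * Re z - IZR a) + Rabs (IZR fpS * Im z - IZR b) <= IZR e.

Definition addq (q q' : Z * Z * Z) : Z * Z * Z :=
 let '(a, b, e) := q in let '(a', b', e') := q' in (a + a', b + b', e + e')%Z.
(** The 3 units cover the rounding down of both coordinates and of the propagated error itself. *)
Definition mulq (q q' : Z * Z * Z) : Z * Z * Z :=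
 let '(a, b, e) := q in let '(a', b', e') := q' in
 ((a * a' - b * b') / fpS, (a * b' + b * a') / fpS,
  ((Z.abs a + Z.abs b) * e' + (Z.abs a' + Z.abs b') * e + e * e') / fpS + 3)%Z.
Definition divq (k : Z) (q : Z * Z * Z) : Z * Z * Z :=
 let '(a, b, e) := q in (a / k, b / k, e / k + 3)%Z.
Definition scalq (k : Z) (q : Z * Z * Z) : Z * Z * Z := let '(a, b, e) := q in (k * a, k * b, Z.abs k * e)%Z.

Lemma div_floor (a k : Z) : (0 < k)%Z -> 0 <= IZR a / IZR k - IZR (a / k) <= 1.
Proof.
 intros Hk. assert (K : 0 < IZR k) by (now apply (IZR_lt 0)).
 assert (E := Z.div_mod a k ltac:(lia)). assert (M := Z.mod_pos_bound a k Hk).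
 assert (IZR a = IZR k * IZR (a / k) + IZR (a mod k)) by (rewrite <- mult_IZR, <- plus_IZR; now rewrite <- E).
 assert (0 <= IZR (a mod k) <= IZR k) by (split; apply IZR_le; lia).
 replace (IZR a / IZR k - IZR (a / k)) with (IZR (a mod k) / IZR k) by (rewrite H; field; lra).
 split. mul_pos. lra. pos.
 apply Rmult_le_reg_r with (IZR k); auto. unfold Rdiv. rewrite Rmult_assoc, Rinv_l by lra. lra.
Qed.

Lemma near_add (z z' : C) (q q' : Z * Z * Z) : near z q -> near z' q' -> near (z + z') (addq q q').
Proof.
 destruct q as [[a b] e]. destruct q' as [[a' b'] e']. unfold near, addq. intros H H'. rewrite !plus_IZR, Re_plus, Im_plus.
 replace (IZR fpS * (Re z + Re z') - (IZR a + IZR a')) with ((IZR fpS * Re z - IZR a) + (IZR fpS * Re z' - IZR a')) by ring.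
 replace (IZR fpS * (Im z + Im z') - (IZR b + IZR b')) with ((IZR fpS * Im z - IZR b) + (IZR fpS * Im z' - IZR b')) by ring.
 assert (T1 := Rabs_triang (IZR fpS * Re z - IZR a) (IZR fpS * Re z' - IZR a')).
 assert (T2 := Rabs_triang (IZR fpS * Im z - IZR b) (IZR fpS * Im z' - IZR b')). lra.
Qed.

Arguments near_add {z z' q q'}.

Lemma near_scal (z : C) (k : Z) (q : Z * Z * Z) : near z q -> near ((IZR k) * z) (scalq k q).
Proof.
 destruct q as [[a b] e]. unfold near, scalq. intros H. rewrite !mult_IZR, abs_IZR. rewrite Re_mult, Im_mult, Re_RtoC, Im_RtoC.
 replace (IZR fpS * (IZR k * Re z - 0 * Im z) - IZR k * IZR a) with (IZR k * (IZR fpS * Re z - IZR a)) by ring.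
 replace (IZR fpS * (IZR k * Im z + 0 * Re z) - IZR k * IZR b) with (IZR k * (IZR fpS * Im z - IZR b)) by ring.
 rewrite !Rabs_mult. rewrite <- Rmult_plus_distr_l. mono_l; auto. apply Rabs_pos.
Qed.

Lemma near_div (z : C) (k : Z) (q : Z * Z * Z) : (0 < k)%Z -> near z q -> near (z / (IZR k)) (divq k q).
Proof.
 intros Hk. destruct q as [[a b] e]. unfold near, divq. intros H. assert (K : 0 < IZR k) by (now apply (IZR_lt 0)).
 assert (Da := div_floor a k Hk). assert (Db := div_floor b k Hk). assert (De := div_floor e k Hk).
 replace (z / RtoC (IZR k))%C with (RtoC (/ IZR k) * z)%C by (rewrite RtoC_inv by lra; unfold Cdiv; ring).
 rewrite Re_mult, Im_mult, Re_RtoC, Im_RtoC, plus_IZR.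
 replace (IZR fpS * (/ IZR k * Re z - 0 * Im z) - IZR (a / k)) with (/ IZR k * (IZR fpS * Re z - IZR a) + (IZR a / IZR k - IZR (a / k))) by (unfold Rdiv; ring).
 replace (IZR fpS * (/ IZR k * Im z + 0 * Re z) - IZR (b / k)) with (/ IZR k * (IZR fpS * Im z - IZR b) + (IZR b / IZR k - IZR (b / k))) by (unfold Rdiv; ring).
 le_trans. apply Rplus_le_compat; apply Rabs_triang. rewrite !Rabs_mult.
 assert (I : 0 < / IZR k) by pos.
 rewrite (Rabs_pos_eq (/ IZR k)) by lra. rewrite (Rabs_pos_eq (IZR a / IZR k - _)), (Rabs_pos_eq (IZR b / IZR k - _)) by lra.
 assert (/ IZR k * (Rabs (IZR fpS * Re z - IZR a) + Rabs (IZR fpS * Im z - IZR b)) <= / IZR k * IZR e) by (mono_l; lra).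
 unfold Rdiv in *. lra.
Qed.

Lemma near_mul (z z' : C) (q q' : Z * Z * Z) : near z q -> near z' q' -> near (z * z') (mulq q q').
Proof.
 destruct q as [[a b] e]. destruct q' as [[a' b'] e']. unfold near, mulq. intros H H'.
 assert (D1 := div_floor (a * a' - b * b') fpS eq_refl). assert (D2 := div_floor (a * b' + b * a') fpS eq_refl).
 set (ee := ((Z.abs a + Z.abs b) * e' + (Z.abs a' + Z.abs b') * e + e * e')%Z).
 assert (D3 := div_floor ee fpS eq_refl). rewrite plus_IZR, Re_mult, Im_mult.
 set (x := IZR fpS * Re z - IZR a) in *. set (y := IZR fpS * Im z - IZR b) in *.
 set (x' := IZR fpS * Re z' - IZR a') in *. set (y' := IZR fpS * Im z' - IZR b') in *.
 assert (S0 : 0 < IZR fpS) by (apply (IZR_lt 0); reflexivity).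
 assert (Ez : Re z = (IZR a + x) / IZR fpS) by (unfold x; field; lra). assert (Ey : Im z = (IZR b + y) / IZR fpS) by (unfold y; field; lra).
 assert (Ez' : Re z' = (IZR a' + x') / IZR fpS) by (unfold x'; field; lra). assert (Ey' : Im z' = (IZR b' + y') / IZR fpS) by (unfold y'; field; lra).
 set (d1 := IZR (a * a' - b * b') / IZR fpS - IZR ((a * a' - b * b') / fpS)) in *.
 set (d2 := IZR (a * b' + b * a') / IZR fpS - IZR ((a * b' + b * a') / fpS)) in *.
 replace (IZR fpS * (Re z * Re z' - Im z * Im z') - IZR ((a * a' - b * b') / fpS))
  with ((IZR a * x' - IZR b * y' + x * IZR a' - y * IZR b' + (x * x' - y * y')) / IZR fpS + d1).
 2:{ unfold d1. rewrite Ez, Ey, Ez', Ey', minus_IZR, !mult_IZR. field. lra. }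
 replace (IZR fpS * (Re z * Im z' + Im z * Re z') - IZR ((a * b' + b * a') / fpS))
  with ((IZR a * y' + IZR b * x' + x * IZR b' + y * IZR a' + (x * y' + y * x')) / IZR fpS + d2).
 2:{ unfold d2. rewrite Ez, Ey, Ez', Ey', plus_IZR, !mult_IZR. field. lra. }
 assert (Eee : IZR ee = (Rabs (IZR a) + Rabs (IZR b)) * IZR e' + (Rabs (IZR a') + Rabs (IZR b')) * IZR e + IZR e * IZR e').
 { unfold ee. rewrite !plus_IZR, !mult_IZR, !plus_IZR, !abs_IZR. ring. }
 assert (P : Rabs (IZR a * x' - IZR b * y' + x * IZR a' - y * IZR b' + (x * x' - y * y')) + Rabs (IZR a * y' + IZR b * x' + x * IZR b' + y * IZR a' + (x * y' + y * x')) <= IZR ee).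
 { rewrite Eee. assert (X := Rabs_pos x). assert (Y := Rabs_pos y). assert (X' := Rabs_pos x'). assert (Y' := Rabs_pos y').
  assert (HA := Rabs_pos (IZR a)). assert (HB := Rabs_pos (IZR b)). assert (HA' := Rabs_pos (IZR a')). assert (HB' := Rabs_pos (IZR b')).
  assert (T : forall u v, Rabs (u - v) <= Rabs u + Rabs v) by (intros; unfold Rminus; rewrite <- (Rabs_Ropp v); apply Rabs_triang).
  apply Rle_trans with ((Rabs (IZR a) + Rabs (IZR b)) * (Rabs x' + Rabs y') + (Rabs (IZR a') + Rabs (IZR b')) * (Rabs x + Rabs y) + (Rabs x + Rabs y) * (Rabs x' + Rabs y')).
  - via Rplus_le_compat.
   + via Rabs_triang. via Rplus_le_compat. via T. apply Rplus_le_compat_r. via Rabs_triang. apply Rplus_le_compat_r. apply T. apply T. apply Rle_refl.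
   + via Rabs_triang. via Rplus_le_compat. via Rabs_triang. apply Rplus_le_compat_r. via Rabs_triang. apply Rplus_le_compat_r. apply Rabs_triang. apply Rabs_triang. apply Rle_refl.
   + rewrite !Rabs_mult. right. ring.
  - apply Rplus_le_compat. apply Rplus_le_compat. mono_l; lra. mono_l; lra. mono; lra. }
 le_trans. apply Rplus_le_compat; apply Rabs_triang. rewrite (Rabs_pos_eq d1), (Rabs_pos_eq d2) by lra.
 unfold Rdiv. rewrite !Rabs_mult, (Rabs_pos_eq (/ IZR fpS)) by pos.
 assert (I : 0 < / IZR fpS) by pos.
 assert (Q := Rmult_le_compat_r (/ IZR fpS) _ _ (Rlt_le _ _ I) P). unfold Rdiv in D3. lra.
Qed.

(* Fifth-order Taylor polynomial of exp, then eight squarings; the Taylor error is below 13 units for |w| <= 1/8. *)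
Arguments near_mul {z z' q q'}.

Definition exp8q (q : Z * Z * Z) : Z * Z * Z :=
 let one := (fpS, 0, 0)%Z in
 let '(a, b, e) := addq one (mulq q (addq one (divq 2 (mulq q (addq one (divq 3 (mulq q (addq one (divq 4 (mulq q (addq one (divq 5 q)))))))))))) in
 Nat.iter 8 (fun p => mulq p p) (a, b, e + 13)%Z.

Definition smallq (q : Z * Z * Z) : bool := let '(a, b, e) := q in (8 * (Z.abs a + Z.abs b + e) <=? fpS)%Z.

Lemma near_one : near 1 (fpS, 0, 0)%Z.
Proof. unfold near. csimp. rewrite Rmult_1_r, Rmult_0_r, !Rminus_diag, Rabs_R0. lra. Qed.

Lemma near_weaken (z z' : C) (a b e k : Z) : near z (a, b, e) -> IZR fpS * (2 * Cmod (z' - z)) <= IZR k -> near z' (a, b, e + k)%Z.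
Proof.
 unfold near. intros H Hk. rewrite plus_IZR. assert (S0 : 0 < IZR fpS) by (apply (IZR_lt 0); reflexivity).
 replace (IZR fpS * Re z' - IZR a) with ((IZR fpS * Re z - IZR a) + IZR fpS * Re (z' - z)%C) by (rewrite Re_minus; ring).
 replace (IZR fpS * Im z' - IZR b) with ((IZR fpS * Im z - IZR b) + IZR fpS * Im (z' - z)%C) by (rewrite Im_minus; ring).
 le_trans. apply Rplus_le_compat; apply Rabs_triang. rewrite !Rabs_mult, (Rabs_pos_eq (IZR fpS)) by lra.
 assert (A := re_le_Cmod (z' - z)). assert (B := Im_le_Cmod (z' - z)). nra.
Qed.

Lemma near_exp8 (w : C) (q : Z * Z * Z) : near w q -> smallq q = true -> near (cexp (RtoC 256 * w)) (exp8q q).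
Proof.
 intros H Hs.
 assert (Hw : Cmod w <= 1 / 8).
 { destruct q as [[a b] e]. unfold smallq in Hs. apply Z.leb_le, IZR_le in Hs. rewrite mult_IZR, !plus_IZR, !abs_IZR in Hs. unfold near in H.
  via Cmod_le_abs. assert (S0 : 0 < IZR fpS) by (apply (IZR_lt 0); reflexivity).
  assert (A := Rabs_triang (IZR fpS * Re w - IZR a) (IZR a)). assert (B := Rabs_triang (IZR fpS * Im w - IZR b) (IZR b)).
  replace (IZR fpS * Re w - IZR a + IZR a) with (IZR fpS * Re w) in A by ring. replace (IZR fpS * Im w - IZR b + IZR b) with (IZR fpS * Im w) in B by ring.
  rewrite Rabs_mult, Rabs_pos_eq in A, B by lra. apply Rmult_le_reg_l with (IZR fpS); auto. lra. }
 unfold exp8q.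
 set (h := addq (fpS, 0%Z, 0%Z) (mulq q (addq (fpS, 0%Z, 0%Z) (divq 2 (mulq q (addq (fpS, 0%Z, 0%Z) (divq 3 (mulq q (addq (fpS, 0%Z, 0%Z) (divq 4 (mulq q (addq (fpS, 0%Z, 0%Z) (divq 5 q))))))))))))).
 assert (HT : near (1 + w * (1 + (w * (1 + (w * (1 + (w * (1 + w / 5)) / 4)) / 3)) / 2)) h).
 { unfold h. repeat first [apply near_add; [exact near_one|] | apply near_mul; [exact H|] | apply near_div; [reflexivity|]]. exact H. }
 set (t := (1 + w * (1 + (w * (1 + (w * (1 + (w * (1 + w / 5)) / 4)) / 3)) / 2))%C) in *.
 assert (Et : t = Texp 5 w).
 { unfold t, Texp, csum.
  replace (INR (fact 0)) with 1 by reflexivity. replace (INR (fact 1)) with 1 by reflexivity. replace (INR (fact 2)) with 2 by (simpl; lra).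
  replace (INR (fact 3)) with (2 * 3) by (simpl; lra). replace (INR (fact 4)) with (2 * 3 * 4) by (simpl; lra).
  replace (INR (fact 5)) with (2 * 3 * 4 * 5) by (simpl; lra). rewrite !RtoC_mult. cbn [Cpow].
  field. }
 destruct h as [[a b] e].
 assert (H0 : near (cexp w) (a, b, e + 13)%Z).
 { apply near_weaken with t; auto. rewrite Et. assert (B := cexp_Taylor 5 w).
  assert (E8 : exp (Cmod w) <= 8 / 7).
  { via exp_le. exact Hw. via exp_small_ub. lra. lra. }
  assert (P6 : Cmod w ^ 6 <= (1 / 8) ^ 6) by (apply pow_incr; split; [apply Cmod_ge_0|exact Hw]).
  replace (INR (fact 6)) with 720 in B by (simpl; lra).
  assert (Cmod w ^ 6 / 720 * exp (Cmod w) <= (1 / 8) ^ 6 / 720 * (8 / 7)).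
  { mono; try lra. mul_pos. apply pow_le, Cmod_ge_0. lra. pos. }
  unfold fpS. lra. }
 assert (It : forall n z q, near z q -> near (Nat.iter n (fun x => (x * x)%C) z) (Nat.iter n (fun p => mulq p p) q)).
 { intros n z q0 Hz. induction n as [|n IH]. exact Hz. simpl. now apply near_mul. }
 replace (cexp (RtoC 256 * w)) with (Nat.iter 8 (fun x => (x * x)%C) (cexp w)). now apply It.
 simpl Nat.iter. rewrite <- !cexp_plus. f_equal. apply C_eq; csimp; simpl; ring.
Qed.

(** The beginning of the series of 2 artanh y, with the remaining terms bounded by y^5. *)
Lemma ln_ratio_bounds (y : R) : 0 <= y <= 1 / 10 ->
 2 * (y + y ^ 3 / 3) <= ln ((1 + y) / (1 - y)) <= 2 * (y + y ^ 3 / 3) + y ^ 5.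
Proof.
 intros Hy. rewrite ln_div by lra.
 assert (D : forall t, 0 <= t <= y -> is_derive (fun t => ln (1 + t) - ln (1 - t) - 2 * (t + t ^ 3 / 3)) t (2 * t ^ 4 / (1 - t ^ 2))).
 { intros t Ht. auto_derive. lra. field. nra. }
 assert (P : forall t, 0 <= t <= y -> 0 <= 2 * t ^ 4 / (1 - t ^ 2) <= 5 * t ^ 4).
 { intros t Ht. assert (0 <= t ^ 4) by (apply pow_le; lra). assert (t ^ 2 <= 1 / 100) by nra. split.
  - mul_pos. lra. pos.
  - apply Rmult_le_reg_r with (1 - t ^ 2). lra. unfold Rdiv. rewrite Rmult_assoc, Rinv_l by lra. nra. }
 assert (L := monotone_from_derivative _ _ 0 y ltac:(lra) D (fun t Ht => proj1 (P t Ht))). cbv beta in L.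
 assert (U := monotone_from_derivative (fun t => t ^ 5 - (ln (1 + t) - ln (1 - t) - 2 * (t + t ^ 3 / 3))) (fun t => 5 * t ^ 4 - 2 * t ^ 4 / (1 - t ^ 2)) 0 y ltac:(lra)).
 cbv beta in U. rewrite Rplus_0_r, Rminus_0_r, ln_1 in L, U.
 specialize (U ltac:(intros t Ht; apply is_derive_Rminus; [auto_derive; auto; toR; ring|now apply D])).
 specialize (U ltac:(intros t Ht; assert (Q := P t Ht); lra)). lra.
Qed.

Lemma near_real (x : R) (a e : Z) : Rabs (IZR fpS * x - IZR a) <= IZR e -> near (RtoC x) (a, 0, e)%Z.
Proof. intros H. unfold near. csimp. rewrite Rmult_0_r, Rminus_diag, Rabs_R0. lra. Qed.

Lemma near_ln (u y : R) (a e : Z) : 0 <= y <= 1 / 10 -> u = (1 + y) / (1 - y) ->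
 IZR a - IZR e <= IZR fpS * (2 * (y + y ^ 3 / 3)) -> IZR fpS * (2 * (y + y ^ 3 / 3) + y ^ 5) <= IZR a + IZR e -> near (RtoC (ln u)) (a, 0, e)%Z.
Proof.
 intros Hy -> H1 H2. apply near_real. assert (B := ln_ratio_bounds y Hy). assert (S0 : 0 < IZR fpS) by (apply (IZR_lt 0); reflexivity).
 apply Rabs_le. split; nra.
Qed.

(** The logarithms of 16/15, 25/24, 81/80 and 50/49 in units of 10^(-9). These quotients are close
    to 1, so two terms of the series suffice, and integer combinations of their logarithms recover
    those of 2, 3, 5 and 7. *)
Definition lq16 : Z * Z * Z := (64538521, 0, 40)%Z.
Definition lq25 : Z * Z * Z := (40821994, 0, 10)%Z.
Definition lq81 : Z * Z * Z := (12422520, 0, 3)%Z.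
Definition lq50 : Z * Z * Z := (20202707, 0, 3)%Z.

Definition lq2 := addq (scalq 7 lq16) (addq (scalq 5 lq25) (scalq 3 lq81)).
Definition lq3 := addq (scalq 11 lq16) (addq (scalq 8 lq25) (scalq 5 lq81)).
Definition lq5 := addq (scalq 16 lq16) (addq (scalq 12 lq25) (scalq 7 lq81)).
Definition lq7 := divq 2 (addq lq2 (addq (scalq 2 lq5) (scalq (-1) lq50))).

Lemma near_lq16 : near (RtoC (ln (16 / 15))) lq16.
Proof. apply near_ln with (1 / 31); unfold fpS; lra. Qed.
Lemma near_lq25 : near (RtoC (ln (25 / 24))) lq25.
Proof. apply near_ln with (1 / 49); unfold fpS; lra. Qed.
Lemma near_lq81 : near (RtoC (ln (81 / 80))) lq81.
Proof. apply near_ln with (1 / 161); unfold fpS; lra. Qed.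
Lemma near_lq50 : near (RtoC (ln (50 / 49))) lq50.
Proof. apply near_ln with (1 / 99); unfold fpS; lra. Qed.

Lemma near_eq (z z' : C) (q : Z * Z * Z) : z = z' -> near z q -> near z' q.
Proof. now intros ->. Qed.

Lemma ln_combo (n : R) (i j k : nat) : 0 < n -> n = (16 / 15) ^ i * ((25 / 24) ^ j * (81 / 80) ^ k) ->
 RtoC (ln n) = ((INR i) * (ln (16 / 15)) + ((INR j) * (ln (25 / 24)) + (INR k) * (ln (81 / 80))))%C.
Proof.
 intros Hn ->. rewrite !ln_mult, !ln_pow by (try lra; repeat apply Rmult_lt_0_compat; try apply pow_lt; lra).
 now rewrite !RtoC_plus, !RtoC_mult.
Qed.

Lemma near_lq2 : near (RtoC (ln 2)) lq2.
Proof.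
 apply near_eq with ((IZR 7) * (ln (16 / 15)) + ((IZR 5) * (ln (25 / 24)) + (IZR 3) * (ln (81 / 80))))%C.
 - rewrite (ln_combo 2 7 5 3) by lra. rewrite !INR_IZR_INZ. reflexivity.
 - repeat apply near_add; apply near_scal; auto using near_lq16, near_lq25, near_lq81.
Qed.
Lemma near_lq3 : near (RtoC (ln 3)) lq3.
Proof.
 apply near_eq with ((IZR 11) * (ln (16 / 15)) + ((IZR 8) * (ln (25 / 24)) + (IZR 5) * (ln (81 / 80))))%C.
 - rewrite (ln_combo 3 11 8 5) by lra. rewrite !INR_IZR_INZ. reflexivity.
 - repeat apply near_add; apply near_scal; auto using near_lq16, near_lq25, near_lq81.
Qed.
Lemma near_lq5 : near (RtoC (ln 5)) lq5.
Proof.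
 apply near_eq with ((IZR 16) * (ln (16 / 15)) + ((IZR 12) * (ln (25 / 24)) + (IZR 7) * (ln (81 / 80))))%C.
 - rewrite (ln_combo 5 16 12 7) by lra. rewrite !INR_IZR_INZ. reflexivity.
 - repeat apply near_add; apply near_scal; auto using near_lq16, near_lq25, near_lq81.
Qed.
Lemma near_lq7 : near (RtoC (ln 7)) lq7.
Proof.
 apply near_eq with ((RtoC (ln 2) + ((IZR 2) * (ln 5) + (IZR (-1)) * (ln (50 / 49)))) / (IZR 2))%C.
 - replace (50 / 49) with (2 * (5 * 5) / (7 * 7)) by lra. rewrite ln_div, !ln_mult by lra.
  rewrite RtoC_minus, !RtoC_plus. change (RtoC (-1)) with (RtoC (- (1))). rewrite RtoC_opp. field.
 - apply near_div. reflexivity. repeat apply near_add. apply near_lq2. apply near_scal, near_lq5. apply near_scal, near_lq50.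
Qed.

(** A point at which the truncated Euler-Maclaurin sum [S10] nearly vanishes. It is adapted to that
    sum rather than to zeta, so its real part differs from 1/2. *)
Definition s0 : C := (0.5017, 14.1346).
Definition ms0q : Z * Z * Z := (-501700000, -14134600000, 0)%Z.

Lemma near_ms0 : near (- s0) ms0q.
Proof.
 unfold near, ms0q, s0, fpS. csimp. match goal with |- Rabs ?a + Rabs ?b <= _ => replace a with 0 by lra; replace b with 0 by lra end.
 rewrite Rabs_R0. lra.
Qed.

(** Division by 256 brings the exponent within the range of the Taylor polynomial, and eight
    squarings undo it. *)
Definition zq (l : Z * Z * Z) : Z * Z * Z := exp8q (divq 256 (mulq ms0q l)).

Lemma near_zq (x : R) (l : Z * Z * Z) : near (RtoC (ln x)) l -> smallq (divq 256 (mulq ms0q l)) = true -> near (xpow x s0) (zq l).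
Proof.
 intros H Hs. apply near_eq with (cexp (RtoC 256 * ((- s0 * (ln x)) / (IZR 256)))).
 - unfold xpow. f_equal. field.
 - apply near_exp8; auto. apply near_div. reflexivity. apply near_mul. apply near_ms0. exact H.
Qed.

Definition B0q : Z * Z * Z := (479270221, -588817233, 10)%Z.
(** The coefficient of 10^(-s) in [S10] at s0: the halved last term, the integral term and the first
    Bernoulli correction. *)
Definition B0 : C := (1 / 2 + 10 / (s0 - 1) + s0 / 120)%C.

Lemma B0_eq : B0 = (1 / 2 - 4.983 / 200.03522005 + 0.5017 / 120, 14.1346 / 120 - 141.346 / 200.03522005).
Proof.
 unfold B0, s0. replace (10 / ((0.5017, 14.1346) - 1))%C with (- (4.983 / 200.03522005), - (141.346 / 200.03522005)) .
 apply C_eq; csimp; simpl; lra.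
 apply C_eq; unfold Cdiv, Cinv; csimp; simpl; lra.
Qed.

Lemma near_B0 : near B0 B0q.
Proof.
 rewrite B0_eq. unfold near, B0q, fpS. csimp.
 apply Rle_trans with (4 + 4). apply Rplus_le_compat; apply Rabs_le; lra. lra.
Qed.

Definition zn (n : nat) : C := xpow (INR n) s0.
Definition z2q := zq lq2. Definition z3q := zq lq3. Definition z5q := zq lq5. Definition z7q := zq lq7.

Lemma zn_mul (m n : nat) : (0 < m)%nat -> (0 < n)%nat -> zn (m * n) = (zn m * zn n)%C.
Proof. intros Hm Hn. unfold zn. rewrite mult_INR. apply xpow_mult; now apply lt_0_INR. Qed.

Lemma ln_mul_nat (m n : nat) : (0 < m)%nat -> (0 < n)%nat -> RtoC (ln (INR (m * n))) = (RtoC (ln (INR m)) + (ln (INR n)))%C.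
Proof. intros Hm Hn. rewrite mult_INR, ln_mult by (now apply lt_0_INR). apply RtoC_plus. Qed.

Definition term (n : nat) (z l : Z * Z * Z) : Prop := near (zn n) z /\ near (RtoC (ln (INR n))) l.

(** Only the primes up to 7 need an exponential; the other terms up to 10 follow by
    multiplicativity. *)
Lemma term_mul (m n : nat) (z l z' l' : Z * Z * Z) : (0 < m)%nat -> (0 < n)%nat -> term m z l -> term n z' l' ->
 term (m * n) (mulq z z') (addq l l').
Proof.
 intros Hm Hn [H1 H2] [K1 K2]. split. rewrite zn_mul by auto. now apply near_mul. rewrite ln_mul_nat by auto. now apply near_add.
Qed.

Lemma term_prime (n : nat) (x : R) (l : Z * Z * Z) : INR n = x -> near (RtoC (ln x)) l -> smallq (divq 256 (mulq ms0q l)) = true -> term n (zq l) l.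
Proof. intros E H Hs. unfold term, zn. rewrite E. split; auto. now apply near_zq. Qed.

Lemma term_2 : term 2 z2q lq2. Proof. apply term_prime with 2. simpl; lra. apply near_lq2. vm_compute; reflexivity. Qed.
Lemma term_3 : term 3 z3q lq3. Proof. apply term_prime with 3. simpl; lra. apply near_lq3. vm_compute; reflexivity. Qed.
Lemma term_5 : term 5 z5q lq5. Proof. apply term_prime with 5. simpl; lra. apply near_lq5. vm_compute; reflexivity. Qed.
Lemma term_7 : term 7 z7q lq7. Proof. apply term_prime with 7. simpl; lra. apply near_lq7. vm_compute; reflexivity. Qed.
Lemma term_4 : term 4 (mulq z2q z2q) (addq lq2 lq2). Proof. apply (term_mul 2 2); try lia; apply term_2. Qed.
Lemma term_6 : term 6 (mulq z2q z3q) (addq lq2 lq3). Proof. apply (term_mul 2 3); try lia. apply term_2. apply term_3. Qed.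
Lemma term_8 : term 8 (mulq z2q (mulq z2q z2q)) (addq lq2 (addq lq2 lq2)). Proof. apply (term_mul 2 4); try lia. apply term_2. apply term_4. Qed.
Lemma term_9 : term 9 (mulq z3q z3q) (addq lq3 lq3). Proof. apply (term_mul 3 3); try lia; apply term_3. Qed.
Lemma term_10 : term 10 (mulq z2q z5q) (addq lq2 lq5). Proof. apply (term_mul 2 5); try lia. apply term_2. apply term_5. Qed.

Definition jet0 : C := (csum (fun i => zn (S i)) 9 + zn 10 * B0)%C.
(** The derivative of [S10] at s0 with the coefficient of 10^(-s) held fixed; the variation of that
    coefficient is charged to the error term in [S10_expand]. *)
Definition jet1 : C := (- (csum (fun i => RtoC (ln (INR (S i))) * zn (S i)) 9 + (ln (INR 10)) * (zn 10 * B0)))%C.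

Definition jet0q : Z * Z * Z :=
 addq (addq (addq (addq (addq (addq (addq (addq (addq (fpS, 0, 0)%Z z2q) z3q) (mulq z2q z2q)) z5q) (mulq z2q z3q)) z7q)
  (mulq z2q (mulq z2q z2q))) (mulq z3q z3q)) (mulq (mulq z2q z5q) B0q).
Definition jet1q : Z * Z * Z :=
 addq (addq (addq (addq (addq (addq (addq (addq (mulq lq2 z2q) (mulq lq3 z3q)) (mulq (addq lq2 lq2) (mulq z2q z2q))) (mulq lq5 z5q))
  (mulq (addq lq2 lq3) (mulq z2q z3q))) (mulq lq7 z7q))
  (mulq (addq lq2 (addq lq2 lq2)) (mulq z2q (mulq z2q z2q)))) (mulq (addq lq3 lq3) (mulq z3q z3q)))
  (mulq (addq lq2 lq5) (mulq (mulq z2q z5q) B0q)).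

Lemma near_jet0 : near jet0 jet0q.
Proof.
 apply near_eq with (1 + zn 2 + zn 3 + zn 4 + zn 5 + zn 6 + zn 7 + zn 8 + zn 9 + zn 10 * B0)%C.
 { unfold jet0. cbn [csum]. assert (E : zn 1 = 1%C) by (unfold zn; simpl; apply xpow_x1). rewrite E. ring. }
 exact (near_add (near_add (near_add (near_add (near_add (near_add (near_add (near_add (near_add
  near_one (proj1 term_2)) (proj1 term_3)) (proj1 term_4)) (proj1 term_5)) (proj1 term_6)) (proj1 term_7)) (proj1 term_8)) (proj1 term_9))
  (near_mul (proj1 term_10) near_B0)).
Qed.

Lemma near_jet1 : near (- jet1) jet1q.
Proof.
 apply near_eq with ((ln (INR 2)) * zn 2 + (ln (INR 3)) * zn 3 + (ln (INR 4)) * zn 4 + (ln (INR 5)) * zn 5 + (ln (INR 6)) * zn 6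
  + (ln (INR 7)) * zn 7 + (ln (INR 8)) * zn 8 + (ln (INR 9)) * zn 9 + (ln (INR 10)) * (zn 10 * B0))%C.
 { unfold jet1. cbn [csum]. replace (RtoC (ln (INR 1))) with (RtoC 0) by (simpl; now rewrite ln_1). ring. }
 assert (M : forall n z l, term n z l -> near ((ln (INR n)) * zn n) (mulq l z)) by (intros n z l [H1 H2]; now apply near_mul).
 exact (near_add (near_add (near_add (near_add (near_add (near_add (near_add (near_add
  (M _ _ _ term_2) (M _ _ _ term_3)) (M _ _ _ term_4)) (M _ _ _ term_5)) (M _ _ _ term_6)) (M _ _ _ term_7)) (M _ _ _ term_8)) (M _ _ _ term_9))
  (near_mul (proj2 term_10) (near_mul (proj1 term_10) near_B0))).
Qed.

Lemma jet0_small : Cmod jet0 <= 0.0006.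
Proof.
 assert (H := near_jet0). assert (E : jet0q = (33240, -11908, 498400)%Z) by (vm_compute; reflexivity). rewrite E in H. unfold near, fpS in H.
 via Cmod_le_abs.
 assert (B1 := Rabs_triang (1000000000 * Re jet0 - 33240) 33240). assert (B2 := Rabs_triang (1000000000 * Im jet0 - -11908) (-11908)).
 replace (1000000000 * Re jet0 - 33240 + 33240) with (1000000000 * Re jet0) in B1 by ring.
 replace (1000000000 * Im jet0 - -11908 + -11908) with (1000000000 * Im jet0) in B2 by ring.
 rewrite Rabs_mult, (Rabs_pos_eq 1000000000) in B1, B2 by lra. rewrite (Rabs_pos_eq 33240) in B1 by lra. rewrite (Rabs_left (-11908)) in B2 by lra. lra.
Qed.

Lemma jet1_large : 0.777 <= Re jet1.
Proof.
 assert (H := near_jet1). assert (E : jet1q = (-778378984, -142012061, 885327)%Z) by (vm_compute; reflexivity). rewrite E in H. unfold near, fpS in H.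
 rewrite Re_opp in H. assert (P := Rabs_pos (1000000000 * Im (- jet1) - -142012061)). assert (Q := Rle_abs (1000000000 * - Re jet1 - -778378984)). lra.
Qed.

Definition S10 (s : C) : C := (csum (fun i => xpow (INR (S i)) s) 9 + xpow (INR 10) s * (1 / 2 + 10 / (s - 1) + s / 120))%C.

Lemma gN_S10 (s : C) : s <> 1%C -> gN 10 s = ((s - 1) * S10 s)%C.
Proof.
 intros Hs. assert (Hn : (s - 1)%C <> 0%C) by (intros E; apply Hs; replace s with ((s - 1) + 1)%C by ring; rewrite E; ring).
 unfold gN, fN, S10. change (csum (fun n => xpow (INR (S n)) s) 10) with (csum (fun i => xpow (INR (S i)) s) 9 + xpow (INR 10) s)%C.
 assert (E1 : xpow (INR 10) (s - 1) = (10 * xpow (INR 10) s)%C).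
 { replace (s - 1)%C with (s + - (1))%C by ring. rewrite xpow_plus, xpow_m1 by (apply lt_0_INR; lia). replace (INR 10) with 10 at 2 by (simpl; lra). ring. }
 assert (E2 : xpow (INR 10) (s + 1) = (xpow (INR 10) s / 10)%C).
 { rewrite xpow_plus, xpow_1 by (apply lt_0_INR; lia). replace (INR 10) with 10 at 2 by (simpl; lra). rewrite RtoC_inv by lra. reflexivity. }
 rewrite E1, E2. replace (RtoC 120) with (RtoC 12 * RtoC 10)%C by (rewrite <- RtoC_mult; f_equal; lra). field. exact Hn.
Qed.

Lemma near_ln_bounds (x : R) (a e : Z) : near (RtoC (ln x)) (a, 0, e)%Z -> IZR a - IZR e <= IZR fpS * ln x <= IZR a + IZR e.
Proof. unfold near. csimp. rewrite Rmult_0_r, Rminus_diag, Rabs_R0. intros H. assert (X := Rabs_le_between (IZR fpS * ln x - IZR a) (IZR e)). lra. Qed.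

Lemma ln_10_bounds : 2.3025 <= ln 10 <= 2.3026.
Proof.
 assert (H := proj2 term_10). replace (INR 10) with 10 in H by (simpl; lra).
 assert (E : addq lq2 lq5 = (2302585081, 0, 1120)%Z) by (vm_compute; reflexivity). rewrite E in H. apply near_ln_bounds in H. unfold fpS in H. lra.
Qed.

Lemma inv_sqrt_bound (n c : R) : 0 < n -> 0 < c -> 1 <= c * c * n -> exp (- (1 / 2) * ln n) <= c.
Proof.
 intros Hn Hc H. rewrite <- (exp_ln c) by auto. apply exp_le. assert (L := ln_nonneg _ H). rewrite !ln_mult in L by nra. lra.
Qed.

(** The second-order Taylor weights n^(-1/2) (log n)^2 / 2 for n <= 9, each square root replaced by
    a decimal upper bound. *)
Lemma second_order_weight : rsum (fun i => exp (- (1 / 2) * ln (INR (S i))) * (ln (INR (S i)) ^ 2 / 2)) 9 <= 4.53.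
Proof.
 assert (W : forall n c l L, 0 < c -> 1 <= c * c * INR n -> term n L l -> forall a e, l = (a, 0%Z, e) -> 0 <= IZR a - IZR e ->
   exp (- (1 / 2) * ln (INR n)) * (ln (INR n) ^ 2 / 2) <= c * (((IZR a + IZR e) / 1000000000) ^ 2 / 2)).
 { intros n c l L Hc H [_ T] a e -> Ha. apply near_ln_bounds in T. unfold fpS in T.
  assert (0 < INR n) by (assert (0 <= INR n) by apply pos_INR; nra).
  mono. pos. assert (0 <= ln (INR n) ^ 2) by apply pow2_ge_0; lra. apply inv_sqrt_bound; auto.
  assert (ln (INR n) ^ 2 <= ((IZR a + IZR e) / 1000000000) ^ 2) by (apply pow_incr; lra). lra. }
 let w n c T := pose proof (W n c _ _ ltac:(lra) ltac:(simpl; lra) T _ _ ltac:(vm_compute; reflexivity) ltac:(lra)) in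
  w 2%nat 0.7072 term_2; w 3%nat 0.5774 term_3; w 4%nat 0.5 term_4; w 5%nat 0.4473 term_5; w 6%nat 0.4083 term_6; w 7%nat 0.3780 term_7; w 8%nat 0.3536 term_8; w 9%nat 0.3334 term_9.
 assert (w1 : exp (- (1 / 2) * ln (INR 1)) * (ln (INR 1) ^ 2 / 2) = 0) by (simpl; rewrite ln_1; field).
 cbn [rsum]. rewrite w1. lra.
Qed.

(** 0.0708 is just above 0.05 sqrt 2, the half diagonal of the square used below, and 1.195 bounds
    exp (0.0708 log 10). *)
Lemma xpow_expand (n : nat) (h : C) : (1 <= n <= 10)%nat -> Cmod h <= 0.0708 -> 
 Cmod (xpow (INR n) (s0 + h) - zn n + h * ((ln (INR n)) * zn n)) <= 1.195 * (exp (- (1 / 2) * ln (INR n)) * (ln (INR n) ^ 2 / 2)) * Cmod h ^ 2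
 /\ Cmod (xpow (INR n) h) <= 1.195.
Proof.
 intros Hn Hh. assert (B := ln_10_bounds). assert (n1 : 1 <= INR n <= 10).
 { destruct Hn as [H1 H2]. apply le_INR in H1. apply le_INR in H2. simpl in H1. replace (INR 10) with 10 in H2 by (simpl; lra). lra. }
 set (l := ln (INR n)). assert (l0 : 0 <= l) by (apply ln_nonneg; lra). assert (l1 : l <= 2.3026) by (assert (l <= ln 10) by (apply ln_le'; lra); lra).
 assert (h0 := Cmod_ge_0 h). set (w := (- h * RtoC l)%C).
 assert (Ew : Cmod w = Cmod h * l) by (unfold w; rewrite Cmod_mult, Cmod_opp, Cmod_R, Rabs_pos_eq; lra).
 assert (w1 : Cmod w <= 0.1631) by (rewrite Ew; nra).
 assert (ew : exp (Cmod w) <= 1.195).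
 { le_trans. apply exp_le, w1. via exp_small_ub. lra. lra. }
 split.
 - rewrite xpow_plus. change (xpow (INR n) h) with (cexp w). fold (zn n).
  replace (zn n * cexp w - zn n + h * (RtoC l * zn n))%C with (zn n * (cexp w - Texp 1 w))%C.
  2:{ unfold Texp. simpl. unfold w. field. }
  rewrite Cmod_mult. assert (T := cexp_Taylor 1 w). replace (INR (fact 2)) with 2 in T by (simpl; lra). rewrite Ew in T.
  assert (Z : Cmod (zn n) <= exp (- (1 / 2) * l)).
  { unfold zn. rewrite Cmod_xpow. apply exp_le. fold l. unfold s0. rewrite Re_pair. nra. }
  replace (1.195 * (exp (- (1 / 2) * l) * (l ^ 2 / 2)) * Cmod h ^ 2) with (exp (- (1 / 2) * l) * ((Cmod h * l) ^ 2 / 2 * 1.195)) by (simpl; lra).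
  mono; try apply Cmod_ge_0; auto. via T. rewrite <- Ew. mono_l; auto.
  assert (0 <= Cmod w ^ 2) by apply pow2_ge_0. lra.
 - rewrite Cmod_xpow. fold l. upto ew. apply exp_le. rewrite Ew. assert (A := re_le_Cmod h). apply Rabs_le_between in A. nra.
Qed.

(** The quadratic term collects the second-order weights of all ten powers; the linear error 0.0229
    is the variation of the coefficient of 10^(-s). *)
Lemma S10_expand (h : C) : Cmod h <= 0.0708 -> Cmod (S10 (s0 + h) - jet0 - h * jet1) <= 6.19 * Cmod h ^ 2 + 0.0229 * Cmod h.
Proof.
 intros Hh. assert (h0 := Cmod_ge_0 h). assert (B := ln_10_bounds).
 set (c := (s0 - 1)%C). assert (ic : 14.1346 <= Cmod c).
 { upto Im_le_Cmod. unfold c, s0. csimp. rewrite Rabs_pos_eq; lra. }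
 assert (ich : 14 <= Cmod (c + h)) by (assert (T := Cmod_triangle_inv c h); lra).
 assert (cn : c <> 0%C) by (intros E; rewrite E, Cmod_0 in ic; lra). assert (chn : (c + h)%C <> 0%C) by (intros E; rewrite E, Cmod_0 in ich; lra).
 set (bh := (1 / 2 + 10 / (c + h) + (s0 + h) / 120)%C).
 assert (Ebh : Cmod (bh - B0) <= 0.06 * Cmod h).
 { replace (bh - B0)%C with (h * (1 / 120 - 10 / (c * (c + h))))%C.
  2:{ unfold bh, B0. fold c. field. split; auto. }
  rewrite Cmod_mult, Rmult_comm. mono_r; auto. via Cmod_triangle_minus.
  unfold Cdiv. rewrite !Cmod_mult, !Cmod_inv, !Cmod_mult by (try (apply Cmult_neq_0; auto); apply C_neq_of_Re; simpl; lra). rewrite !Cmod_R, !Rabs_pos_eq by lra.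
  assert (/ (Cmod c * Cmod (c + h)) <= / (14.1346 * 14)) by (apply Rinv_le_contravar; nra). lra. }
 assert (B0b : Cmod B0 <= 0.7593).
 { assert (Q := Cmod_sq B0). rewrite B0_eq in *. rewrite Re_pair, Im_pair in Q. assert (Cmod_ge := Cmod_ge_0 (1 / 2 - 4.983 / 200.03522005 + 0.5017 / 120, 14.1346 / 120 - 141.346 / 200.03522005)). nra. }
 destruct (xpow_expand 10 h ltac:(lia) Hh) as [X1 X2].
 set (u := fun i => (xpow (INR (S i)) (s0 + h) - zn (S i) + h * (RtoC (ln (INR (S i))) * zn (S i)))%C).
 set (u10 := (xpow (INR 10) (s0 + h) - zn 10 + h * ((ln (INR 10)) * zn 10))%C) in *.
 replace (S10 (s0 + h) - jet0 - h * jet1)%C with (csum u 9 + (u10 * B0 + xpow (INR 10) (s0 + h) * (bh - B0)))%C.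
 2:{ unfold S10, jet0, jet1, u. replace (s0 + h - 1)%C with (c + h)%C by (unfold c; ring). fold bh. cbn [csum]. unfold u10. ring. }
 assert (z10 : exp (- (1 / 2) * ln (INR 10)) <= 0.3163) by (apply inv_sqrt_bound; simpl; lra).
 assert (T1 : Cmod (csum u 9) <= 1.195 * Cmod h ^ 2 * 4.53).
 { via csum_Cmod. via (rsum_le _ (fun i => (1.195 * Cmod h ^ 2) * (exp (- (1 / 2) * ln (INR (S i))) * (ln (INR (S i)) ^ 2 / 2)))).
  - intros n Hn. destruct (xpow_expand (S n) h ltac:(lia) Hh) as [Y _]. unfold u. lra.
  - rewrite rsum_scal. mono_l. assert (0 <= Cmod h ^ 2) by apply pow2_ge_0. lra. apply second_order_weight. }
 assert (T2 : Cmod (u10 * B0) <= 1.195 * (0.3163 * 2.6512) * Cmod h ^ 2 * 0.7593).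
 { rewrite Cmod_mult. mono; try apply Cmod_ge_0; auto. via X1.
  mono_r. apply pow2_ge_0. mono_l. lra. replace (INR 10) with 10 in * by (simpl; lra).
  mono; auto. pos. assert (0 <= ln 10 ^ 2) by apply pow2_ge_0; lra. nra. }
 assert (T3 : Cmod (xpow (INR 10) (s0 + h) * (bh - B0)) <= 0.3163 * 1.195 * (0.06 * Cmod h)).
 { rewrite Cmod_mult. mono; try apply Cmod_ge_0; auto. rewrite xpow_plus, Cmod_mult. mono; try apply Cmod_ge_0; auto.
  rewrite Cmod_xpow. upto z10. apply exp_le. unfold s0. rewrite Re_pair. replace (INR 10) with 10 by (simpl; lra). lra. }
 via Cmod_triangle. via (Rplus_le_compat_l _ _ _ (Cmod_triangle _ _)).
 assert (0 <= Cmod h ^ 2) by apply pow2_ge_0. lra.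
Qed.

Lemma Cmod_le_sq (z : C) (B : R) : 0 <= B -> Re z ^ 2 + Im z ^ 2 <= B ^ 2 -> Cmod z <= B.
Proof. intros HB H. rewrite <- Cmod_sq in H. pose proof (Cmod_ge_0 z). apply Rnot_lt_le. intros K. nra. Qed.

Lemma fz_remainder (x y : R) : 0.4517 <= x <= 0.5517 -> 14.0846 <= y <= 14.1846 -> Cmod (fz (x, y) - gN 10 (x, y)) <= 0.118.
Proof.
 intros Hx Hy. set (s := (x, y) : C). via fz_gN. simpl; lra. lia.
 replace (INR 10) with 10 by (simpl; lra). change (Re s) with x.
 assert (M : forall c B, 0 <= B -> 0 <= x + c -> (0.5517 + c) ^ 2 + 14.1846 ^ 2 <= B ^ 2 -> Cmod (s + RtoC c) <= B).
 { intros c B HB Hc H. apply Cmod_le_sq; auto. unfold s. csimp. assert ((x + c) ^ 2 <= (0.5517 + c) ^ 2) by (apply pow_incr; lra).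
  assert ((y + 0) ^ 2 <= 14.1846 ^ 2) by (apply pow_incr; lra). lra. }
 assert (m1 : Cmod (s - 1) <= 14.1953).
 { apply Cmod_le_sq. lra. unfold s. csimp. assert ((y - 0) ^ 2 <= 14.1846 ^ 2) by (apply pow_incr; lra). nra. }
 assert (m0 : Cmod s <= 14.1954) by (replace s with (s + RtoC 0)%C by ring; apply M; lra).
 assert (p1 := M 1 14.2693 ltac:(lra) ltac:(lra) ltac:(lra)). assert (p2 := M 2 14.4124 ltac:(lra) ltac:(lra) ltac:(lra)).
 assert (p3 := M 3 14.6226 ltac:(lra) ltac:(lra) ltac:(lra)).
 rewrite !Cmod_mult.
 assert (P : Cmod (s - 1) * Cmod s * Cmod (s + 1) * Cmod (s + 2) * Cmod (s + 3) <= 14.1953 * 14.1954 * 14.2693 * 14.4124 * 14.6226).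
 { repeat (mono; try apply Cmod_ge_0; auto; repeat (apply Rmult_le_pos || apply Cmod_ge_0)). }
 assert (L := ln_10_bounds).
 assert (E45 : exp (- 0.45 * ln 10) <= 1 / 2.8).
 { rewrite <- (exp_ln (1 / 2.8)) by lra. apply exp_le. unfold Rdiv. rewrite Rmult_1_l, ln_Rinv by lra.
  assert (H : ln (2.8 ^ 20) <= ln (10 ^ 9)) by (apply ln_le'; lra). rewrite !ln_pow in H by lra. replace (INR 20) with 20 in H by (simpl; lra). replace (INR 9) with 9 in H by (simpl; lra). lra. }
 assert (E3 : exp (- (x + 3) * ln 10) <= / 1000 * (1 / 2.8)).
 { apply Rle_trans with (exp (- 3 * ln 10 + - 0.45 * ln 10)). apply exp_le. nra. rewrite exp_plus. mono; try (left; apply exp_pos); auto.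
  replace (-3 * ln 10) with (- (INR 3 * ln 10)) by (simpl; lra). rewrite exp_Ropp, <- exp_pow_nat, exp_ln by lra. apply Rinv_le_contravar; lra. }
 assert (E4 : exp (- (x + 4) * ln 10) <= / 10000 * (1 / 2.8)).
 { apply Rle_trans with (exp (- 4 * ln 10 + - 0.45 * ln 10)). apply exp_le. nra. rewrite exp_plus. mono; try (left; apply exp_pos); auto.
  replace (-4 * ln 10) with (- (INR 4 * ln 10)) by (simpl; lra). rewrite exp_Ropp, <- exp_pow_nat, exp_ln by lra. apply Rinv_le_contravar; lra. }
 assert (E5 : exp (- (x + 3) * ln 10) / (x + 3) <= / 1000 * (1 / 2.8) * / 3.45).
 { mono; auto. pos. pos. apply Rinv_le_contravar; lra. }
 apply Rle_trans with (14.1953 * 14.1954 * 14.2693 * 14.4124 * 14.6226 / 720 * (/ 10000 * (1 / 2.8) + / 1000 * (1 / 2.8) * / 3.45)). 2: lra.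
 mono.
 - mul_pos. repeat (apply Rmult_le_pos || apply Cmod_ge_0). lra.
 - apply Rplus_le_le_0_compat. pos. mul_pos. pos. pos.
 - lra.
 - lra.
Qed.

(** If fz had no zero in the square of half side 0.05 about s0, its minimum modulus would be
    attained on the boundary. There it is at least 14.08 times 0.0216 minus 0.118, above 0.18, while
    at the centre it is at most 0.118 + 0.009. *)
Lemma zeta_zero_exists : exists sigma t : R, 0 < sigma < 1 /\ 0 < t /\ zeta sigma t = RtoC 0.
Proof.
 apply NNPP. intros HN.
 assert (Fn : forall x y, 0.4517 <= x <= 0.5517 -> 14.0846 <= y <= 14.1846 -> fz (x, y) <> RtoC 0).
 { intros x y Hx Hy E. apply HN. exists x, y. repeat split; try lra. apply (proj2 (zeta_zero_iff (x, y) ltac:(simpl; lra))). exact E. }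
 assert (G : forall x y, 0.4517 <= x <= 0.5517 -> 14.0846 <= y <= 14.1846 -> gN 10 (x, y) = (((x, y) - 1) * S10 (s0 + ((x - 0.5017)%R, (y - 14.1346)%R)))%C).
 { intros x y Hx Hy. rewrite gN_S10. 2:{ intros E. apply (f_equal Im) in E. simpl in E. lra. }
  do 2 f_equal. unfold s0. apply C_eq; csimp; ring. }
 assert (M : 0.18 <= Cmod (fz (0.5017, 14.1346))).
 { apply (min_modulus (fun s => -1 < Re s) fz 0.5017 14.1346 0.05 0.18 (fz_hol 2)); try lra.
  - intros x y Hx Hy. split. simpl; lra. apply Fn; lra.
  - intros x y Hx Hy Hb. assert (R := fz_remainder x y ltac:(lra) ltac:(lra)). rewrite G in R by lra.
   set (h := ((x - 0.5017)%R, (y - 14.1346)%R) : C) in *.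
   assert (h1 : Cmod h <= 0.0708). { apply Cmod_le_sq. lra. unfold h. csimp. nra. }
   assert (h2 : 0.05 <= Cmod h).
   { destruct Hb as [Hb|Hb]; rewrite <- Hb. apply (re_le_Cmod h). apply (Im_le_Cmod h). }
   assert (E := S10_expand h h1). assert (J0 := jet0_small). assert (J1 := jet1_large). assert (J2 := Re_le_mod jet1).
   (* The lower bound 0.777 q - 0.0006 - 6.19 q^2 - 0.0229 q is concave in q = |h|, so it suffices
      to look at both ends of the range 0.05 to 0.0708. *)
   assert (E2 : 0.0216 <= Cmod (S10 (s0 + h))).
   { replace (S10 (s0 + h)) with (h * jet1 + (jet0 + (S10 (s0 + h) - jet0 - h * jet1)))%C by ring.
    assert (T := Cmod_triangle_inv (h * jet1) (jet0 + (S10 (s0 + h) - jet0 - h * jet1))). rewrite Cmod_mult in T.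
    assert (T2 := Cmod_triangle jet0 (S10 (s0 + h) - jet0 - h * jet1)).
    assert (0.777 * Cmod h <= Cmod h * Cmod jet1) by nra. set (q := Cmod h) in *.
    assert (0 <= (q - 0.05) * (0.0708 - q)) by nra. nra. }
   assert (E3 : 14.08 <= Cmod ((x, y) - 1)). { upto Im_le_Cmod. csimp. rewrite Rabs_pos_eq; lra. }
   assert (T := Cmod_triangle_inv (((x, y) - 1) * S10 (s0 + h)) (fz (x, y) - ((x, y) - 1) * S10 (s0 + h))).
   replace (((x, y) - 1) * S10 (s0 + h) + (fz (x, y) - ((x, y) - 1) * S10 (s0 + h)))%C with (fz (x, y)) in T by ring.
   rewrite Cmod_mult in T. assert (14.08 * 0.0216 <= Cmod ((x, y) - 1) * Cmod (S10 (s0 + h))) by (mono; lra). lra. }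
 assert (R := fz_remainder 0.5017 14.1346 ltac:(lra) ltac:(lra)). rewrite G in R by lra.
 replace ((0.5017 - 0.5017)%R, (14.1346 - 14.1346)%R) with (RtoC 0) in R by (apply C_eq; csimp; lra).
 assert (E := S10_expand 0 ltac:(rewrite Cmod_0; lra)). rewrite Cmod_0 in E. set (q := S10 (s0 + 0)) in *.
 assert (J0 := jet0_small). assert (Q : Cmod q <= 0.0006).
 { replace q with (jet0 + (q - jet0 - 0 * jet1))%C by ring. via Cmod_triangle. lra. }
 assert (E3 : Cmod ((0.5017, 14.1346) - 1) <= 15) by (apply Cmod_le_sq; csimp; lra).
 replace (fz (0.5017, 14.1346)) with ((fz (0.5017, 14.1346) - ((0.5017, 14.1346) - 1) * q) + ((0.5017, 14.1346) - 1) * q)%C in M by ring.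
 assert (T := Cmod_triangle (fz (0.5017, 14.1346) - ((0.5017, 14.1346) - 1) * q) (((0.5017, 14.1346) - 1) * q)).
 rewrite Cmod_mult in T. assert (Cmod ((0.5017, 14.1346) - 1) * Cmod q <= 15 * 0.0006) by (mono; try apply Cmod_ge_0; lra). lra.
Qed.

Lemma Omega_bound (s : C) : 1 / 2 <= Re s -> Cmod (Omega s) <= 5 / 3.
Proof.
 intros Hs. unfold Omega. via (IL_bound Ltrap (s + 2) (5 / 2) Ltrap_local). csimp. simpl. lra. lra.
Qed.

(** On the critical line s (s - 1) = -(1/4 + t^2) is real, and with |Omega| <= 5/3 the second factor
    of fz is 1 plus a number of modulus below 1. *)
Lemma fz_low_line (t : R) : 0 <= t <= 1.4 -> fz (1 / 2, t) <> RtoC 0.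
Proof.
 intros Ht E. set (s := ((1 / 2)%R, t) : C) in *.
 assert (E2 : fz s = ((s + 1) / 2 * (1 + s * (s - 1) * Omega s / 4))%C) by (unfold fz, xi_c; field).
 assert (Sm : (s * (s - 1))%C = RtoC (- (1 / 4 + t ^ 2))).
 { unfold s. apply C_eq; csimp; simpl; field. }
 rewrite E2, Sm in E. destruct (classic ((1 + RtoC (- (1 / 4 + t ^ 2)) * Omega s / 4)%C = RtoC 0)) as [E'|E'].
 2:{ revert E. apply Cmult_neq_0; auto. intros E. apply (f_equal Re) in E. unfold s in E. simpl in E. lra. }
 clear E. rename E' into E.
 - assert (O := Omega_bound s ltac:(unfold s; simpl; lra)).
  assert (A : Cmod (RtoC (- (1 / 4 + t ^ 2)) * Omega s / 4) = 1).
  { replace (RtoC (- (1 / 4 + t ^ 2)) * Omega s / 4)%C with (- (1))%C. rewrite Cmod_opp, Cmod_1. reflexivity.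
   replace (RtoC (- (1 / 4 + t ^ 2)) * Omega s / 4)%C with ((1 + RtoC (- (1 / 4 + t ^ 2)) * Omega s / 4) - 1)%C by ring. rewrite E. ring. }
  unfold Cdiv in A. rewrite !Cmod_mult, Cmod_R, Rabs_Ropp, Rabs_pos_eq, Cmod_inv, Cmod_R, Rabs_pos_eq in A by (try nra; intros EE; apply (f_equal Re) in EE; simpl in EE; lra).
  assert (t ^ 2 <= 1.96) by nra. assert (0 <= Cmod (Omega s)) by pos. nra.
Qed.

(** [real] sends an infinite bound to 0, so a lower bound on the infimum needs a zero to exist;
    under RH all zeros are on the critical line, where low heights are excluded. *)
Lemma gamma1_lower : RH -> 1.4 <= gamma1.
Proof.
 intros HR. unfold gamma1. set (E := fun t => 0 < t /\ exists sigma, 0 < sigma < 1 /\ zeta sigma t = RtoC 0).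
 assert (G := Glb_Rbar_correct E). destruct G as [G1 G2].
 assert (L : Rbar_le 1.4 (Glb_Rbar E)).
 { apply G2. intros t [Ht [sigma [Hs Hz]]]. simpl. apply Rnot_lt_le. intros Hlt.
  assert (F : fz (sigma, t) = RtoC 0) by (apply (zeta_zero_iff (sigma, t)); [simpl; lra|exact Hz]).
  assert (R := RH_fz (sigma, t) HR ltac:(simpl; lra) F). simpl in R. subst sigma. apply (fz_low_line t); auto. lra. }
 destruct zeta_zero_exists as [sigma [t [Hs [Ht Hz]]]].
 assert (U : Rbar_le (Glb_Rbar E) t) by (apply G1; split; eauto).
 destruct (Glb_Rbar E); simpl in *; try tauto; lra.
Qed.

(** * The explicit constants *)

Lemma PI_upper : PI <= 10 / 3.
Proof. assert (H := Machin_2_3). assert (A := atan_le_id (/ 2) ltac:(lra)). assert (B := atan_le_id (/ 3) ltac:(lra)). lra. Qed.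

Lemma ln_450 : 6.1 <= ln 450.
Proof.
 assert (H : near (RtoC (ln 450)) (addq lq2 (addq (scalq 2 lq3) (scalq 2 lq5)))).
 { apply near_eq with (RtoC (ln 2) + ((IZR 2) * (ln 3) + (IZR 2) * (ln 5)))%C.
  - replace 450 with (2 * (3 * 3 * (5 * 5))) by lra. rewrite !ln_mult, !RtoC_plus by lra. ring.
  - repeat apply near_add. apply near_lq2. apply near_scal, near_lq3. apply near_scal, near_lq5. }
 assert (E : addq lq2 (addq (scalq 2 lq3) (scalq 2 lq5)) = (6109247551, 0, 2971)%Z) by (vm_compute; reflexivity).
 rewrite E in H. apply near_ln_bounds in H. unfold fpS in H. lra.
Qed.

Lemma Rdiv_le_of_le (a b c : R) : 0 < b -> 0 < c -> a <= c * b -> a / b <= c.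
Proof. intros Hb Hc H. apply Rmult_le_reg_r with b; auto. unfold Rdiv. rewrite Rmult_assoc, Rinv_l by lra. lra. Qed.

Lemma phi1_nonneg (u : R) : 0 < u -> 0 <= phi1 u.
Proof.
 intros Hu. unfold phi1. destruct Rlt_dec. lra.
 assert (P : 0 <= 20.1911 / (u * exp (0.285 * u))) by (mul_pos; [lra|left; apply Rinv_0_lt_compat, Rmult_lt_0_compat; [lra|pos]]).
 cut (M1 (10 ^ 2465) <= 1.719282). lra. unfold M1, MM, Rpower. rewrite ln_pow by lra.
 replace (INR 2465) with 2465 by (rewrite INR_IZR_INZ; reflexivity). assert (B := ln_10_bounds).
 assert (L : 8 <= ln (2465 * ln 10)).
 { apply Rle_trans with (ln (450 * 10)). rewrite ln_mult by lra. assert (X := ln_450). lra. apply ln_le'; lra. }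
 set (l := ln (2465 * ln 10)) in *. assert (X := exp_ineq1_le (0.285 * l)).
 assert (20.1911 / (exp (0.285 * l) * l) <= 0.9). { apply Rdiv_le_of_le; nra. } lra.
Qed.

(** In the second branch the term depending on u is dropped, and M2(10^208) <= 2.61 leaves more than
    0.53. *)
Lemma phi2_lower (u : R) : 0 < u -> 0.53 <= phi2 u.
Proof.
 intros Hu. unfold phi2. destruct Rlt_dec. lra.
 assert (P : 0 <= 60.12 / (u * exp (0.2705 * u))) by (mul_pos; [lra|left; apply Rinv_0_lt_compat, Rmult_lt_0_compat; [lra|pos]]).
 cut (M2 (10 ^ 208) <= 2.61). lra. unfold M2, MM, Rpower. rewrite ln_pow by lra.
 replace (INR 208) with 208 by (rewrite INR_IZR_INZ; reflexivity). assert (B := ln_10_bounds).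
 assert (L : 6.1 <= ln (208 * ln 10)).
 { apply Rle_trans with (ln 450). apply ln_450. apply ln_le'; lra. }
 set (l := ln (208 * ln 10)) in *.
 assert (X : 5.06 <= exp (0.2705 * l)).
 { apply Rle_trans with (exp 1.65). 2: apply exp_le; lra.
  assert (Y := exp_mult_lower 0.033 50 ltac:(lra)). replace (INR 50 * 0.033) with 1.65 in Y by (simpl; lra). lra. }
 assert (60.12 / (exp (0.2705 * l) * l) <= 1.957). { apply Rdiv_le_of_le; try nra. } lra.
Qed.

Lemma e_bounds : 2 <= e <= 3.
Proof. unfold e. split. assert (X := exp_ineq1_le 1). lra. apply exp_le_3. Qed.

Lemma delta_ge_1 (t0 : R) : 0 < t0 -> 1 <= delta t0.
Proof. intros H. unfold delta. assert (0 < 1 / t0) by pos. nra. Qed.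

Lemma a1_lower (t0 : R) : 0 < t0 -> 40 <= a1 t0.
Proof.
 intros H. unfold a1. assert (D := delta_ge_1 t0 H). set (d := delta t0) in *. assert (B := e_bounds).
 assert (E1 : 0 <= t0 / exp (exp 2)) by (mul_pos; [lra|left; apply Rinv_0_lt_compat, exp_pos]).
 assert (E2 : 2 <= (3 + e) / e).
 { apply Rmult_le_reg_r with e. lra. unfold Rdiv. rewrite Rmult_assoc, Rinv_l by lra. lra. }
 set (q := t0 / exp (exp 2) + (3 + e) / e) in *. assert (2 <= q) by (unfold q; lra). nra.
Qed.

Lemma lambda_pos (t0 : R) : 2.8 <= t0 -> 0 < lambda t0.
Proof.
 intros H. unfold lambda. apply Rmult_lt_0_compat. lra. rewrite <- ln_1. apply ln_increasing. lra.
 rewrite <- (ln_exp 1). apply ln_increasing. pos. assert (X := exp_le_3). lra.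
Qed.

(** 21.2 is 40 times 0.53, from the first term alone; the others are nonnegative, the second because
    [gamma1] is positive. *)
Lemma omega_lower (t0 u : R) : RH -> 2.8 <= t0 -> 0 < u -> 21.2 / (lambda t0 * u) <= omega t0 u.
Proof.
 intros HR Ht Hu. assert (G := gamma1_lower HR). assert (L := lambda_pos t0 Ht). assert (D := delta_ge_1 t0 ltac:(lra)).
 assert (A := a1_lower t0 ltac:(lra)). assert (P1 := phi1_nonneg u Hu). assert (P2 := phi2_lower u Hu). assert (B := e_bounds).
 assert (Eu := exp_pos u). unfold omega. set (l := lambda t0) in *. set (d := delta t0) in *.
 assert (pos : forall a b, 0 <= a -> 0 < b -> 0 <= a / b) by (intros; mul_pos; [lra|pos]).
 assert (lu : 0 < l * u) by now apply Rmult_lt_0_compat.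
 assert (T1 : 21.2 / (l * u) <= a1 t0 * phi2 u / (l * u)).
 { mono_r. pos. nra. }
 assert (T2 : 0 <= a2 t0 * u / (l * exp u)).
 { apply pos. 2: now apply Rmult_lt_0_compat. mul_pos; [|lra]. unfold a2. fold d. mul_pos. lra.
  assert (0 <= t0 / (2 * gamma1)) by (apply pos; lra). assert (0 <= 1 / e) by (apply pos; lra). lra. }
 assert (T3 : 0 <= 15.83 / exp u) by (apply pos; lra).
 assert (T4 : 0 <= 12 * l / (u * exp (exp u)) * (3 * phi1 u / (2 * u) + 3 / (100 * exp (u + exp u)))).
 { mul_pos. apply pos. lra. apply Rmult_lt_0_compat; [lra|pos].
  apply Rplus_le_le_0_compat; apply pos; try lra. apply Rmult_lt_0_compat; [lra|pos]. }
 assert (T5 : 0 <= a4 t0 * phi2 u / (u ^ 2 * exp u)).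
 { apply pos. 2: apply Rmult_lt_0_compat; [nra|lra]. mul_pos; [|lra]. unfold a4. fold d. mul_pos. apply pos; nra. lra. }
 lra.
Qed.

Lemma omega_pos (t0 u : R) : RH -> 2.8 <= t0 -> 0 < u -> 0 <= omega t0 u.
Proof.
 intros HR Ht Hu. le_trans. 2: now apply omega_lower. assert (L := lambda_pos t0 Ht).
 mul_pos. lra. left; apply Rinv_0_lt_compat. now apply Rmult_lt_0_compat.
Qed.

(* AM-GM between the two terms in [lambda / u] and [1 / (lambda u)]. *)
Lemma omega2_lower (t0 u : R) : RH -> 2.8 <= t0 -> 0 < u -> 5 / u <= omega2 t0 u.
Proof.
 intros HR Ht Hu. unfold omega2. assert (O := omega_lower t0 u HR Ht Hu). assert (L := lambda_pos t0 Ht). set (l := lambda t0) in *. clearbody l.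
 assert (P := PI_upper). assert (P0 := PI_RGT_0).
 le_trans. 2: apply Rplus_le_compat_l, O. assert (Pl : 0 < PI * l) by pos. apply Rmult_le_reg_r with (PI * l * u). now apply Rmult_lt_0_compat.
 replace (5 / u * (PI * l * u)) with (5 * PI * l) by (field; lra).
 replace ((l / (PI * u) + 21.2 / (l * u)) * (PI * l * u)) with (l ^ 2 + 21.2 * PI) by (unfold Rdiv; field; lra).
 assert (0 <= (l - 5 / 2 * PI) ^ 2) by apply pow2_ge_0. nra.
Qed.

Lemma omega1_nonneg (sigma t0 u : R) : RH -> 1 / 2 < sigma -> 2.8 <= t0 -> 0 < u -> 0 <= omega1 sigma t0 u.
Proof.
 intros HR Hs Ht Hu. unfold omega1. assert (O := omega_pos t0 u HR Ht Hu). assert (L := lambda_pos t0 Ht). assert (P1 := phi1_nonneg u Hu).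
 assert (pos : forall a b, 0 <= a -> 0 < b -> 0 <= a / b) by (intros; mul_pos; [lra|pos]).
 apply Rplus_le_le_0_compat; auto. mul_pos. mul_pos. lra. apply Rplus_le_le_0_compat; apply pos; try lra.
 apply Rmult_lt_0_compat; [lra|pos]. apply ln_nonneg. assert (0 <= 2 * lambda t0 / ((sigma - 1 / 2) * u)) by (apply pos; [lra|pos]). lra.
Qed.

Lemma x0_facts (x0 : R) : 4 * exp (2 * exp 1 ^ 2) <= x0 ->
 8 <= ln x0 /\ 10 <= x0 /\ 0 < ln (ln (3 * e * sqrt x0 / 2)) /\ 0 < ln (ln (3 * e * x0 / 2)).
Proof.
 intros H. assert (X := exp_ineq1_le 1). assert (Q : 8 <= 2 * exp 1 ^ 2) by nra. set (q := 2 * exp 1 ^ 2) in *.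
 assert (Y := exp_ineq1_le q). assert (B := e_bounds).
 assert (L : q <= ln x0).
 { rewrite <- (ln_exp q). apply ln_le'. pos. lra. }
 assert (s1 : ln (sqrt x0) = 1 / 2 * ln x0) by (rewrite sqrt_exp_ln by lra; apply ln_exp).
 assert (sp : 0 < sqrt x0) by (apply sqrt_lt_R0; lra).
 assert (K : forall y, 0 < y -> 2 <= ln y -> 0 < ln (ln (3 * e * y / 2))).
 { intros y Hy Hl. rewrite <- ln_1. apply ln_increasing. lra. apply Rlt_le_trans with (ln y). lra. apply ln_le'; nra. }
 split. lra. split. lra. split; apply K; lra.
Qed.

Lemma Rpower_ge_1 (a b : R) : 1 <= a -> 0 <= b -> 1 <= Rpower a b.
Proof. intros Ha Hb. unfold Rpower. rewrite <- exp_0. apply exp_le. mul_pos; auto. now apply ln_nonneg. Qed.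

Lemma N1_lower (sigma0 t0 x0 : R) : RH -> 1 / 2 < sigma0 < 1 -> 2.8 <= t0 -> 4 * exp (2 * exp 1 ^ 2) <= x0 -> / (2 * PI) <= N1 sigma0 t0 x0.
Proof.
 intros HR Hs Ht Hx. destruct (x0_facts x0 Hx) as [Lx [X10 [U1 U2]]]. assert (B := e_bounds). assert (P0 := PI_RGT_0).
 assert (W := omega1_nonneg sigma0 t0 _ HR (proj1 Hs) Ht U1). fold (omega01 sigma0 t0 x0) in W. unfold N1. set (w := omega01 sigma0 t0 x0) in *.
 assert (pos : forall a b, 0 <= a -> 0 < b -> 0 <= a / b) by (intros; mul_pos; [lra|pos]).
 assert (rp : forall a b, 0 < Rpower a b) by (intros; pos).
 assert (T1 : 1 <= Rpower (3 * e / 2) w) by (apply Rpower_ge_1; lra).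
 assert (T2 : 0 <= 1 / ln x0 + (1.1 - sigma0) / (Rpower x0 (sigma0 - 1 / 2) * ln x0)).
 { apply Rplus_le_le_0_compat; apply pos; try lra. apply Rmult_lt_0_compat; [apply rp|lra]. }
 assert (T3 : 0 <= 1 / Rpower x0 (1 / 2 * w) * (8 * exp (exp 2) / (PI * sigma0 * (sigma0 - 1 / 2) * ln x0) + 23.6 / Rpower x0 (sigma0 - 1 / 2))).
 { mul_pos. apply pos; [lra|apply rp]. apply Rplus_le_le_0_compat; apply pos; try lra; try apply rp.
  assert (Z := exp_pos (exp 2)). lra. assert (0 < PI * sigma0) by pos. assert (0 < PI * sigma0 * (sigma0 - 1 / 2)) by pos. pos. }
 replace (/ (2 * PI)) with (1 / PI * 1 * (1 / 2)) by (field; lra).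
 apply Rle_trans with (1 / PI * Rpower (3 * e / 2) w * (1 / 2 + 1 / ln x0 + (1.1 - sigma0) / (Rpower x0 (sigma0 - 1 / 2) * ln x0))). 2: lra.
 assert (0 < 1 / PI) by pos. mono; try lra. mono_l; lra.
Qed.

(** Only the leading product is kept: N1 >= 1/(2 pi) and Phi >= 2 give 1/(pi^2 (k + 1)), and pi^2 <=
    20. *)
Lemma N2_lower (k : nat) (sigma0 t1 t2 x0 : R) : RH -> (2 <= k)%nat -> 1 / 2 < sigma0 < 1 -> 2.8 <= t1 -> 2.8 <= t2 ->
 4 * exp (2 * exp 1 ^ 2) <= x0 -> alpha sigma0 t1 x0 < 1 -> 1 / 2 <= alpha sigma0 t1 x0 /\ / (20 * (INR k + 1)) <= N2 k sigma0 t1 t2 x0.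
Proof.
 intros HR Hk Hs Ht1 Ht2 Hx Ha. assert (k2 := two_le_INR k Hk).
 destruct (x0_facts x0 Hx) as [Lx [X10 [U1 U2]]]. assert (B := e_bounds). assert (P0 := PI_RGT_0). assert (P1 := PI_upper).
 assert (W1 := omega1_nonneg sigma0 t1 _ HR (proj1 Hs) Ht1 U1). fold (omega01 sigma0 t1 x0) in W1.
 assert (W2 := omega2_lower t2 _ HR Ht2 U2). fold (omega02 t2 x0) in W2.
 assert (w0 : 0 <= omega02 t2 x0) by (le_trans; [|exact W2]; pos).
 assert (al : 1 / 2 <= alpha sigma0 t1 x0) by (unfold alpha; lra). split; auto.
 assert (n1 := N1_lower sigma0 t1 x0 HR Hs Ht1 Hx). unfold N2. set (n := N1 sigma0 t1 x0) in *. set (w := omega02 t2 x0) in *. set (a := alpha sigma0 t1 x0) in *.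
 assert (pos : forall a b, 0 <= a -> 0 < b -> 0 <= a / b) by (intros; mul_pos; [lra|pos]).
 assert (rp : forall a b, 0 < Rpower a b) by (intros; pos).
 assert (ip : 0 < / (2 * PI)) by pos.
 assert (F : 2 <= Phi (INR k / 2) a x0).
 { unfold Phi. set (s := INR k / 2). assert (1 <= s) by (unfold s; lra). assert (0 < s - a) by lra.
  assert (1 <= s / (s - a)) by (apply Rmult_le_reg_r with (s - a); [lra|unfold Rdiv; rewrite Rmult_assoc, Rinv_l by lra; lra]).
  assert (0 <= 1 / ((s - a) * ln x0)) by (apply pos; [lra|pos]). nra. }
 set (ph := Phi (INR k / 2) a x0) in *. cbv zeta.
 assert (T1 : 1 <= Rpower (3 * e / 2) w) by (apply Rpower_ge_1; lra).
 assert (T2 : 0 <= 1 / ln x0 + 0.57 / (sqrt x0 * ln x0 ^ 2)).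
 { apply Rplus_le_le_0_compat; apply pos; try lra. apply Rmult_lt_0_compat; [apply sqrt_lt_R0; lra|nra]. }
 assert (T3 : 0 <= 1 / (Rpower x0 w * ln x0) * (n / (INR k + 1) * (56 * exp (exp 2) * ph / PI + 1 / (2 * Rpower x0 (1 / (2 * (INR k + 1))))) + 27.7 / Rpower x0 ((a - 1 / 2) / (INR k + 1)))).
 { mul_pos. apply pos. lra. apply Rmult_lt_0_compat; [apply rp|lra].
  apply Rplus_le_le_0_compat. 2: apply pos; [lra|apply rp]. mul_pos. apply pos; lra.
  apply Rplus_le_le_0_compat; apply pos; try lra. assert (Z := exp_pos (exp 2)). mul_pos; lra. apply Rmult_lt_0_compat; [lra|apply rp]. }
 apply Rle_trans with (n * ph / (PI * (INR k + 1)) * Rpower (3 * e / 2) w * (1 + 1 / ln x0 + 0.57 / (sqrt x0 * ln x0 ^ 2))). 2: lra.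
 assert (M : / (20 * (INR k + 1)) <= n * ph / (PI * (INR k + 1))).
 { apply Rle_trans with (/ (2 * PI) * 2 / (PI * (INR k + 1))).
  - replace (/ (2 * PI) * 2 / (PI * (INR k + 1))) with (/ (PI * PI * (INR k + 1))) by (field; lra). apply Rinv_le_contravar.
   assert (0 < PI * PI) by pos. pos. mono_r; nra.
  - mono_r. left; apply Rinv_0_lt_compat, Rmult_lt_0_compat; lra. mono; lra. }
 assert (0 < / (20 * (INR k + 1))) by pos.
 rewrite <- (Rmult_1_r (/ (20 * (INR k + 1)))). mono; try lra. rewrite <- (Rmult_1_r (/ (20 * (INR k + 1)))). mono; lra.
Qed.

Theorem theorem6 :
 RH ->
 forall (k : nat) (sigma0 t1 t2 x0 x : R),
  (2 <= k)%nat ->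
  1 / 2 < sigma0 < 1 ->
  2 * gamma1 <= t1 <= 50 ->
  2 * gamma1 <= t2 <= 50 ->
  4 * exp (2 * exp 1 ^ 2) <= x0 ->
  x0 ^ (k + 1) <= x ->
  alpha sigma0 t1 x0 < 1 ->
  Rabs (Qk k x - x / zeta_nat k) <=
   N2 k sigma0 t1 t2 x0
    * Rpower x ((1 / 2 + alpha sigma0 t1 x0) / (INR k + 1) + omega02 t2 x0)
    * (ln x) ^ 2.
Proof.
 intros HR k sigma0 t1 t2 x0 x Hk Hs Ht1 Ht2 Hx0 Hx Ha.
 assert (G := gamma1_lower HR). assert (k2 := two_le_INR k Hk).
 destruct (x0_facts x0 Hx0) as [Lx [X10 [U1 U2]]]. assert (B := e_bounds).
 destruct (N2_lower k sigma0 t1 t2 x0 HR Hk Hs ltac:(lra) ltac:(lra) Hx0 Ha) as [al n2].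
 assert (W2 := omega2_lower t2 _ HR ltac:(lra) U2). fold (omega02 t2 x0) in W2.
 set (u := ln (ln (3 * e * x0 / 2))) in *. set (w := omega02 t2 x0) in *. set (a := alpha sigma0 t1 x0) in *. set (n := N2 k sigma0 t1 t2 x0) in *.
 set (K := INR k + 1) in *. assert (HK : 3 <= K) by (unfold K; lra).
 (* 4.5 bounds 3e/2 from above, so the argument of log log in u is at most x. *)
 assert (x1 : 4.5 * x0 <= x).
 { upto Hx. replace (k + 1)%nat with (S (S (k - 1))) by lia. simpl.
  assert (1 <= x0 ^ (k - 1)) by (apply pow_R1_Rle; lra). set (p := x0 ^ (k - 1)) in *. assert (x0 <= x0 * p) by nra. nra. }
 assert (lx : 8 * K <= ln x).
 { apply Rle_trans with (ln (x0 ^ (k + 1))). rewrite ln_pow, plus_INR by lra. fold K. change (INR k + INR 1) with K. nra. apply ln_le'. apply pow_lt; lra. exact Hx. }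
 assert (wl : (1 / 2 + a) / K >= / K).
 { apply Rle_ge. unfold Rdiv. rewrite <- (Rmult_1_l (/ K)) at 1. mono_r. pos. lra. }
 assert (iK : 0 < / (20 * K)) by pos.
 assert (l2 : 64 * K ^ 2 <= ln x ^ 2) by nra.
 replace (x / zeta_nat k) with (x * invzeta k) by (rewrite <- invzeta_nat by auto; reflexivity).
 unfold Rpower. set (ex := exp (((1 / 2 + a) / K + w) * ln x)). assert (ex0 : 0 < ex) by pos.
 (* As 1/K + 1/(kK) = 1/k, this threshold is where the claimed exponent reaches that of the
    elementary bound. *)
 destruct (Rle_dec (/ (INR k * K)) w) as [Hw|Hw].
 - le_trans. apply elementary_bound; auto. lra.
  assert (E : exp (ln x / INR k) <= ex).
  { apply exp_le. replace (ln x / INR k) with ((/ K + / (INR k * K)) * ln x) by (unfold K; field; lra). mono_r; lra. }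
  (* The lower bounds log x >= 8K and N2 >= 1/(20K) give (64/20) K >= 9.6. *)
  assert (C9 : 9 <= n * ln x ^ 2).
  { apply Rle_trans with (/ (20 * K) * (64 * K ^ 2)). replace (/ (20 * K) * (64 * K ^ 2)) with (64 / 20 * K) by (field; lra). lra.
   mono; try lra. nra. }
  replace (n * ex * ln x ^ 2) with ((n * ln x ^ 2) * ex) by ring. mono; try lra. pos.
 (* A small w forces u to be large because w >= 5/u; since k(k + 1) >= 6 this yields u >= 30 and k +
    1 <= u, the hypotheses of [RH_bound]. *)
 - assert (ku : 5 * (INR k * K) <= u).
  { assert (H5 : 5 / u <= / (INR k * K)) by lra. assert (0 < INR k * K) by pos.
   apply Rmult_le_compat_r with (r := u * (INR k * K)) in H5; [|apply Rlt_le, Rmult_lt_0_compat; lra].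
   replace (5 / u * (u * (INR k * K))) with (5 * (INR k * K)) in H5 by (field; lra).
   replace (/ (INR k * K) * (u * (INR k * K))) with u in H5 by (field; unfold K; lra). exact H5. }
  assert (kK : 6 <= INR k * K) by nra.
  assert (L0 : 0 < ln (3 * e * x0 / 2)). { rewrite <- ln_1. apply ln_increasing; nra. }
  assert (uv : u <= ln (ln x)). { apply ln_le'; auto. apply ln_le'; nra. }
  le_trans. apply RH_bound; auto. lra. lra. fold K. nra. fold K.
  assert (E : exp (ln x * (/ K + 5 / ln (ln x))) <= ex).
  { apply exp_le. rewrite Rmult_comm. mono_r. lra. assert (5 / ln (ln x) <= 5 / u) by (mono_l; [lra|apply Rinv_le_contravar; lra]). lra. }
  assert (N : / (20 * K) <= n * ln x ^ 2).
  { rewrite <- (Rmult_1_r (/ (20 * K))). mono; try lra. nra. }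
  replace (n * ex * ln x ^ 2) with (ex * (n * ln x ^ 2)) by ring. unfold Rdiv. mono; try lra. pos.
Qed.
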